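(* There is an absolute constant $c>0$ such that the following holds. Let $G$ be a planar graph and let $S$ be a collinear set of $G$. Then every straight-line drawing of $G$ (possibly with crossings) can be untangled while keeping at least $c\sqrt{|S|}$ vertices fixed; that is, there is a plane straight-line drawing of $G$ in which at least $c\sqrt{|S|}$ vertices are placed at the same points as in the given drawing.
   Context: A straight-line drawing of a graph maps vertices to distinct points in the plane and edges to straight-line segments between their endpoints; it is plane if no two edges intersect except at a common endpoint. A set $S\subseteq V(G)$ of a planar graph $G$ is a collinear set if $G$ has a plane straight-line drawing in which all vertices of $S$ lie on a single line. The paper states the bound as $\Omega(\sqrt{|S|})$. *)

(* Defs.v *)
From mathcomp Require Import all_boot.
From Stdlib Require Import Reals.

Set Implicit Arguments.
Unset Strict Implicit.
Unset Printing Implicit Defensive.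

Open Scope R_scope.

Definition point := (R * R)%type.

Definition simple_graph (T : finType) (e : rel T) : Prop :=
  (forall x y, e x y = e y x) /\ (forall x, e x x = false).

Definition on_segment (p q x : point) : Prop :=
  exists t : R, 0 <= t <= 1 /\
    x = ((1 - t) * fst p + t * fst q, (1 - t) * snd p + t * snd q).

(* A straight-line drawing maps vertices to distinct points; edges are the
   segments between the images of their endpoints. *)
Definition straight_line_drawing (T : finType) (D : T -> point) : Prop :=
  injective D.

Definition plane_drawing (T : finType) (e : rel T) (D : T -> point) : Prop :=
  straight_line_drawing D /\
  forall a b c d : T, e a b -> e c d ->
    ~ ((a = c /\ b = d) \/ (a = d /\ b = c)) ->
    forall x : point, on_segment (D a) (D b) x -> on_segment (D c) (D d) x ->
      exists v : T, (v = a \/ v = b) /\ (v = c \/ v = d) /\ x = D v.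

(* Planar: admits a plane straight-line drawing (equivalent by Fary). *)
Definition planar (T : finType) (e : rel T) : Prop :=
  exists D : T -> point, plane_drawing e D.

Definition collinear_set (T : finType) (e : rel T) (S : {set T}) : Prop :=
  exists D : T -> point, plane_drawing e D /\
    exists a b c : R, (a <> 0 \/ b <> 0) /\
      forall v, v \in S -> a * fst (D v) + b * snd (D v) = c.

(* Main.v *)
Require Import Defs.
From mathcomp Require Import all_boot all_order all_algebra boolp.
From mathcomp Require Import ring lra zify.
From mathcomp Require Rstruct.

(* Take the line through [S] to be the vertical axis and extend the drawing to a maximal plane
   graph inside a triangle.  The vertices on the axis are free: for every increasing
   reparametrization of the axis and all horizontal offsets there is a plane drawing that moves
   them to the prescribed heights, with the offsets scaled by some small positive factor.  A linear
   map turns the offsets into arbitrary ones and the axis into a direction separating the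
   points of [D]; by Erdos-Szekeres the heights of some [A] with [#|S| <= #|A| ^ 2] in that
   direction are monotone along the axis, so all of [A] can be placed where [D] has it.

   Freedom of the axis.  In a triangulation of a triangle it suffices that no line through the image
   of an inner vertex has its neighbours on one side only: counting the sign changes of a linear
   functional around the vertices shows that all faces keep their orientation.  The vertices
   incident with edges crossing the axis are placed at [(1 / X, Y / X)], where crossing the axis at
   height [c] becomes the linear condition that [Y - c * X] agrees at the two ends, and the
   condition on the neighbours becomes a system of inequalities, solved by linear programming
   duality; the remaining vertices are placed by harmonic interpolation. *)

Set Implicit Arguments.
Unset Strict Implicit.
Unset Printing Implicit Defensive.

Import Order.TTheory GRing.Theory Num.Theory.
Local Open Scope ring_scope.

(* [lra] and [lia] are slow on large contexts: these variants first discard hypotheses that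
   they could not use. *)
Ltac drop_nonlinear := repeat match goal with
  | x := _ |- _ => clearbody x
  | H : ?T |- _ => lazymatch T with
    | forall _, _ => clear H
    | exists _, _ => clear H
    | ~ _ => clear H
    | @eq (_ * _) _ _ => clear H
    | @eq nat _ _ => clear H
    | @eq bool _ _ => clear H
    | is_true (leq _ _) => clear H
    | is_true (~~ _) => clear H
    | is_true (?e _ _) => is_var e; clear H
    end end.
Ltac drop_nonnat := repeat match goal with
  | H : ?T |- _ => lazymatch type of T with Prop => lazymatch T with
    | is_true (leq _ _) => fail
    | is_true (~~ _) => fail
    | is_true (_ && _) => fail
    | is_true (_ || _) => fail
    | is_true (_ == _) => fail
    | @eq nat _ _ => fail
    | @eq bool _ _ => fail
    | ~ _ => fail
    | _ /\ _ => fail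
    | _ \/ _ => fail
    | _ => clear H
    end end end.
Tactic Notation "slra" := first [solve [drop_nonlinear; lra] | lra].
Tactic Notation "slia" := first [solve [drop_nonnat; lia] | lia].

(** The obstacle is the edges that cross the axis: such an edge ties together a vertex of each half
    plane, so the two halves cannot be redrawn independently. Fixing the height at which it crosses,
    as the image of its old height, makes the tie one linear equation between its ends. That the
    resulting linear program is feasible is seen from the dual side. An infeasibility certificate
    gives a slope to every gap between consecutive crossing edges. If the largest slope were
    positive, a run of gaps attaining it would be bounded, seen from either half plane, by two edges
    with the same end there; these would share both ends and be the same edge. If it is not
    positive, all multipliers of strict inequalities vanish. The sign change count needs no Euler
    formula: the number of faces having a given vertex as middle corner, summed over the vertices,
    is the number of faces for every linear order, and the order given by a linear functional of the
    original drawing supplies the matching bound. All this takes place over an arbitrary ordered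
    field; limits occur only as statements valid for all small positive parameters. *)

Lemma fin_argmin (F : realFieldType) (T : finType) (P : T -> Prop) (k : T -> F) :
  (exists x, P x) -> exists x, P x /\ forall y, P y -> k x <= k y.
Proof.
move=> [x0 Px0].
have p0 : `[< P x0 >] by apply/asboolP.
case: (@arg_minP _ F T x0 (fun i => `[< P i >]) k p0) => x /asboolP Px h.
by exists x; split=> // y Py; apply: h; apply/asboolP.
Qed.

(** * Affine geometry of segments: convex combinations, orientation, leaving a cone *)

Section Segments.
Variable F : realFieldType.
Implicit Types (p q a b c d z : F * F) (s t : F).

Definition mix s p q : F * F := ((1 - s) * p.1 + s * q.1, (1 - s) * p.2 + s * q.2).
Definition cseg p q z := exists t, (0 <= t <= 1) /\ z = mix t p q.
Definition oseg p q z := exists t, (0 < t < 1) /\ z = mix t p q.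
Definition orient a b c := (b.1 - a.1) * (c.2 - a.2) - (b.2 - a.2) * (c.1 - a.1).

Lemma mix_orient a b s p q :
  orient a b (mix s p q) = (1 - s) * orient a b p + s * orient a b q.
Proof. rewrite /orient /mix /=; ring. Qed.

Lemma orient_rot a b c : orient a b c = orient b c a.
Proof. rewrite /orient; ring. Qed.

Lemma orient_swap a b c : orient a b c = - orient b a c.
Proof. rewrite /orient; ring. Qed.

Lemma oseg_cseg p q z : oseg p q z -> cseg p q z.
Proof. by move=> [t [h ->]]; exists t; split=> //; slra. Qed.

Lemma cseg_sym p q z : cseg p q z -> cseg q p z.
Proof.
move=> [t [h ->]]; exists (1 - t); split; first slra.
by congr pair; ring.
Qed.

Lemma oseg_sym p q z : oseg p q z -> oseg q p z.
Proof.
move=> [t [h ->]]; exists (1 - t); split; first slra.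
by congr pair; ring.
Qed.

Lemma cseg_oseg p q z : cseg p q z -> [\/ z = p, z = q | oseg p q z].
Proof.
move=> [t [h ->]].
have [->|t0] := eqVneq t 0; first by constructor 1; case: p => ? ?; rewrite /mix /=; congr pair; ring.
have [->|t1] := eqVneq t 1; first by constructor 2; case: q => ? ?; rewrite /mix /=; congr pair; ring.
constructor 3; exists t; split=> //.
by case/andP: h; rewrite !le_eqVlt eq_sym (negPf t0) (negPf t1) /= => -> ->.
Qed.

Lemma pairP p q : p.1 = q.1 -> p.2 = q.2 -> p = q.
Proof. by case: p; case: q => ? ? ? ? /= -> ->. Qed.

Lemma oseg_neq p q z : p <> q -> oseg p q z -> z <> p /\ z <> q.
Proof.
move=> pq [t [h ->]]; split => e; apply: pq; move: (f_equal fst e) (f_equal snd e);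
  rewrite /mix /= => e1 e2; apply: pairP.
- have : t * (q.1 - p.1) = 0 by slra.
  by move/eqP; rewrite mulf_eq0 => /orP[/eqP?|/eqP ?]; slra.
- have : t * (q.2 - p.2) = 0 by slra.
  by move/eqP; rewrite mulf_eq0 => /orP[/eqP?|/eqP ?]; slra.
- have : (1 - t) * (q.1 - p.1) = 0 by slra.
  by move/eqP; rewrite mulf_eq0 => /orP[/eqP?|/eqP ?]; slra.
- have : (1 - t) * (q.2 - p.2) = 0 by slra.
  by move/eqP; rewrite mulf_eq0 => /orP[/eqP?|/eqP ?]; slra.
Qed.

(* Leaving a cone: a segment on which two affine functions start positive and end with
   one of them nonpositive meets the boundary of the cone. *)
Lemma exit2 (a0 b0 a1 b1 : F) : 0 < a0 -> 0 < b0 -> (a1 <= 0) \/ (b1 <= 0) ->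
  exists m, [/\ 0 < m <= 1, 0 <= (1 - m) * a0 + m * a1, 0 <= (1 - m) * b0 + m * b1 &
    ((1 - m) * a0 + m * a1 == 0) || ((1 - m) * b0 + m * b1 == 0)].
Proof.
move=> ha hb h.
pose ra := a0 / (a0 - a1); pose rb := b0 / (b0 - b1).
have Ra : a1 <= 0 -> ra * (a0 - a1) = a0 by move=> ?; rewrite /ra divfK //; slra.
have Rb : b1 <= 0 -> rb * (b0 - b1) = b0 by move=> ?; rewrite /rb divfK //; slra.
have Ia : a1 <= 0 -> 0 < ra <= 1.
  by move=> ?; rewrite /ra divr_gt0 ?ler_pdivrMr /=; slra.
have Ib : b1 <= 0 -> 0 < rb <= 1.
  by move=> ?; rewrite /rb divr_gt0 ?ler_pdivrMr /=; slra.
have Na : ~~ (a1 <= 0) -> 0 < a1 by rewrite -ltNge.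
have Nb : ~~ (b1 <= 0) -> 0 < b1 by rewrite -ltNge.
have [a1p|/Na a1p] := boolP (a1 <= 0); have [b1p|/Nb b1p] := boolP (b1 <= 0); last by slra.
- have /Ra Ea := a1p; have /Rb Eb := b1p; have /Ia Ja := a1p; have /Ib Jb := b1p.
  have [l|l] := leP ra rb.
  + exists ra; split=> //; first (by slra); last by apply/orP; left; apply/eqP; slra.
    have : 0 <= (rb - ra) * (b0 - b1) by apply: mulr_ge0; slra.
    slra.
  + exists rb; split=> //; last (by apply/orP; right; apply/eqP; slra); last by slra.
    have : 0 <= (ra - rb) * (a0 - a1) by apply: mulr_ge0; slra.
    slra.
- have /Ra Ea := a1p; have /Ia Ja := a1p.
  exists ra; split=> //; [slra| | by apply/orP; left; apply/eqP; slra].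
  have : 0 <= ra * b1 by apply: mulr_ge0; slra.
  have : 0 <= (1 - ra) * b0 by apply: mulr_ge0; slra.
  slra.
- have /Rb Eb := b1p; have /Ib Jb := b1p.
  exists rb; split=> //; [| slra | by apply/orP; right; apply/eqP; slra].
  have : 0 <= rb * a1 by apply: mulr_ge0; slra.
  have : 0 <= (1 - rb) * a0 by apply: mulr_ge0; slra.
  slra.
Qed.

End Segments.

(** * Visibility in a maximal plane graph: a blocked line of sight still yields a neighbour *)

Section MaximalPlane.
Variables (F : realFieldType) (V : finType) (g : V -> F * F) (E : rel V).
Implicit Types (a b c d u v x y : V) (z : F * F).

(** Stronger than a plane drawing in one respect: the fourth clause keeps isolated vertices off the
    edges as well. *)
Definition plane_edges : Prop :=
  [/\ injective g,
      (forall a b, E a b = E b a),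
      (forall a, E a a = false),
      (forall a b v, E a b -> cseg (g a) (g b) (g v) -> v = a \/ v = b) &
      (forall a b c d z, E a b -> E c d -> oseg (g a) (g b) z -> cseg (g c) (g d) z ->
         (a = c /\ b = d) \/ (a = d /\ b = c))].

(** Maximality under adding edges, in the local form that lets adjacency be proved by checking
    visibility. *)
Definition saturated : Prop :=
  forall a b, a <> b -> (forall v, ~ oseg (g a) (g b) (g v)) ->
  (forall c d z, E c d -> oseg (g a) (g b) z -> cseg (g c) (g d) z -> False) -> E a b.

Section PlaneEdges.
Hypothesis HP : plane_edges.

Lemma plane_inj : injective g. Proof. by case: HP. Qed.
Lemma plane_sym a b : E a b = E b a. Proof. by case: HP. Qed.
Lemma plane_irr a : E a a = false. Proof. by case: HP. Qed.
Lemma plane_vtx a b v : E a b -> cseg (g a) (g b) (g v) -> v = a \/ v = b.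
Proof. by case: HP => ? ? ? h ?; apply: h. Qed.
Lemma plane_cross a b c d z : E a b -> E c d -> oseg (g a) (g b) z -> cseg (g c) (g d) z ->
  (a = c /\ b = d) \/ (a = d /\ b = c).
Proof. by case: HP => ? ? ? ? h; apply: h. Qed.

End PlaneEdges.

Hypothesis HP : plane_edges.
Hypothesis Hsat : saturated.

Local Notation g_inj := (plane_inj HP).
Local Notation E_sym := (plane_sym HP).
Local Notation E_irr := (plane_irr HP).
Local Notation E_vtx := (plane_vtx HP).
Local Notation E_pl := (plane_cross HP).

Lemma edge_neq a b : E a b -> a <> b.
Proof. by move=> h e; rewrite e E_irr in h. Qed.

Lemma edge_gneq a b : E a b -> g a <> g b.
Proof. by move=> h /g_inj; apply: edge_neq. Qed.

(** Affine coordinates with origin [a] and basis [z - a], [x - a], kept abstract through the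
    identities they satisfy, so that the arguments below are linear algebra in [al] and [be]. *)
Definition corner_coords (a x z : F * F) (al be : F * F -> F) :=
  [/\ (forall s p q, al (mix s p q) = (1 - s) * al p + s * al q),
      (forall s p q, be (mix s p q) = (1 - s) * be p + s * be q),
      al a = 0 /\ be a = 0, al x = 0 /\ be x = 1 & al z = 1 /\ be z = 0] /\
  forall p q, al p = al q -> be p = be q -> p = q.

Section Corner.
Variables (a x d p : V) (z : F * F) (al be : F * F -> F).
Hypothesis co : corner_coords (g a) (g x) z al be.

Definition in_corner v := [/\ 0 <= al (g v), 0 < be (g v) & al (g v) + be (g v) <= 1].

(** Among the vertices of the triangle off the line [az], [p] has the direction from [a] closest to
    [z], that is, the largest ratio [al / be], and is nearest to [a] in that direction. The ratios
    are cross-multiplied. *)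
Definition extreme := in_corner p /\ forall v, in_corner v ->
  al (g v) * be (g p) <= al (g p) * be (g v) /\
  (al (g v) * be (g p) = al (g p) * be (g v) -> be (g p) <= be (g v)).

Hypothesis ex : extreme.

Lemma extreme_visible v : ~ oseg (g a) (g p) (g v).
Proof.
have [[ap bp sp] m] := ex; have [[alM beM [ala bea] _ _] _] := co.
move=> [t [ht ev]].
have ev1 : al (g v) = t * al (g p) by rewrite ev alM ala; ring.
have ev2 : be (g v) = t * be (g p) by rewrite ev beM bea; ring.
have : 0 < (1 - t) * be (g p) by apply: mulr_gt0; slra.
have Cv : in_corner v.
  rewrite /in_corner ev1 ev2; split.
  - by apply: mulr_ge0 => //; slra.
  - by apply: mulr_gt0 => //; slra.
  - have : 0 <= (1 - t) * (al (g p) + be (g p)) by apply: mulr_ge0; slra.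
    slra.
by have [_] := m v Cv; rewrite ev1 ev2 => /(_ (ltac:(ring))); slra.
Qed.

Lemma coords_on_ray (t : F) (y : F * F) : 0 < t < 1 -> y = mix t (g a) (g p) ->
  [/\ 0 <= al y, 0 < be y, al y + be y < 1, be y = t * be (g p) & al y * be (g p) = be y * al (g p)].
Proof.
have [[ap bp sp] _] := ex; have [[alM beM [ala bea] _ _] _] := co.
move=> ht ey; have y1 : al y = t * al (g p) by rewrite ey alM ala; ring.
have y2 : be y = t * be (g p) by rewrite ey beM bea; ring.
have : 0 < (1 - t) * (al (g p) + be (g p)) by apply: mulr_gt0; slra.
move=> h; rewrite y1 y2; split=> //; [by apply: mulr_ge0; slra|by apply: mulr_gt0; slra|slra|ring].
Qed.

Lemma far_end : oseg (g x) (g d) z -> al (g d) + be (g d) = 1.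
Proof.
have [[alM beM _ [alx bex] [alz bez]] _] := co; case=> s [hs ez].
have e1 : 1 = (1 - s) * 0 + s * al (g d) by rewrite -{1}alz ez alM alx.
have e2 : 0 = (1 - s) * 1 + s * be (g d) by rewrite -{1}bez ez beM bex.
have : s * (al (g d) + be (g d) - 1) = 0 by slra.
by move/eqP; rewrite mulf_eq0 => /orP[/eqP?|/eqP ?]; slra.
Qed.

Lemma not_base c d1 (y : F * F) : oseg (g x) (g d) z -> cseg (g c) (g d1) y -> al y + be y < 1 ->
  ~ ((x = c /\ d = d1) \/ (x = d1 /\ d = c)).
Proof.
move=> zxd; have sd := far_end zxd; have [[alM beM _ [alx bex] _] _] := co.
have sx : al (g x) + be (g x) = 1 by rewrite alx bex; ring.
case=> s [hs ->]; rewrite alM beM => sy; case=> [[e1 e2]|[e1 e2]]; subst c d1; move: sy;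
    [have -> : (1 - s) * al (g x) + s * al (g d) + ((1 - s) * be (g x) + s * be (g d)) =
       (1 - s) * (al (g x) + be (g x)) + s * (al (g d) + be (g d)) by ring
    | have -> : (1 - s) * al (g d) + s * al (g x) + ((1 - s) * be (g d) + s * be (g x)) =
       (1 - s) * (al (g d) + be (g d)) + s * (al (g x) + be (g x)) by ring];
    rewrite sx sd; slra.
Qed.

(** A vertex on the [z] side of the ray [ap] has a larger ratio [al / be] than [p], so extremality
    expels it from the triangle. *)
Lemma outside_corner c : 0 < al (g c) * be (g p) - be (g c) * al (g p) ->
  be (g c) <= 0 \/ 1 - (al (g c) + be (g c)) <= 0.
Proof.
have [[ap bp sp] m] := ex; move=> Rc.
have [bc|bc] := ltP 0 (be (g c)); last by left.
have [sc|sc] := leP (al (g c) + be (g c)) 1; last by right; slra.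
exfalso.
have ac : 0 <= al (g c).
  have : 0 < al (g c) * be (g p).
    have : 0 <= be (g c) * al (g p) by apply: mulr_ge0; slra.
    by slra.
  by rewrite pmulr_lgt0 // => /ltW.
by have [h _] := m c (And3 ac bc sc); slra.
Qed.

(** The point [q] would lie on the edge [xd], where planarity admits no other edge, or on the open
    segment [az], which no edge meets. *)
Lemma no_edge_on_boundary c d2 (q : F * F) : E x d -> oseg (g x) (g d) z ->
  (forall c c' w, E c c' -> oseg (g a) z w -> ~ cseg (g c) (g c') w) ->
  E c d2 -> cseg (g c) (g d2) q -> ~ ((x = c /\ d = d2) \/ (x = d2 /\ d = c)) ->
  0 < al q * be (g p) - be q * al (g p) -> 0 <= be q -> 0 <= 1 - (al q + be q) ->
  (be q == 0) || (1 - (al q + be q) == 0) -> False.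
Proof.
have [[ap bp sp] _] := ex; have [[alM beM [ala bea] [alx bex] [alz bez]] coord] := co.
move=> Exd zxd ne Ec qe nxd Rq m1 m2 m3.
have aq : 0 < al q.
  have : 0 < al q * be (g p).
    have : 0 <= be q * al (g p) by apply: mulr_ge0; slra.
    by slra.
  by rewrite pmulr_lgt0.
have [sq1|sq1] := eqVneq (al q + be q) 1.
  apply: nxd; apply: (E_pl (z := q) Exd Ec) => //; have sd := far_end zxd; case: zxd => s [hs ez].
  have e1 : s * al (g d) = 1 by rewrite -alz ez alM alx; ring.
  exists (al q * s); split.
    apply/andP; split; first by apply: mulr_gt0; slra.
    have : 0 <= (1 - al q) * s by apply: mulr_ge0; slra.
    slra.
  apply: coord; rewrite ?alM ?beM ?alx ?bex; first by rewrite mulr0 add0r -mulrA e1 mulr1.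
  have -> : be (g d) = 1 - al (g d) by slra.
  rewrite (_ : _ + _ = 1 - al q * (s * al (g d))); last ring.
  by rewrite e1; slra.
have b0 : be q = 0 by case/orP: m3 => /eqP // e; move/eqP: sq1; slra.
apply: (ne c d2 q Ec _ qe); exists (al q); split; first slra.
by apply: coord; rewrite ?alM ?beM ?ala ?bea ?alz ?bez ?b0; ring.
Qed.

(* An edge with an endpoint on the [z] side of the line [ap] leaves the triangle [axz] through
   one of the sides [az] and [xz]. *)
Lemma no_crossing_edge c d2 (t : F) (y : F * F) : E x d -> oseg (g x) (g d) z ->
  (forall c c' w, E c c' -> oseg (g a) z w -> ~ cseg (g c) (g c') w) ->
  0 < t < 1 -> y = mix t (g a) (g p) -> E c d2 -> cseg (g c) (g d2) y ->
  0 < al (g c) * be (g p) - be (g c) * al (g p) -> False.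
Proof.
have [[ap bp sp] _] := ex; have [[alM beM [ala bea] [alx bex] [alz bez]] coord] := co.
move=> Exd zxd ne ht ey Ec yc Rc; have [ay0 by0 sy _ Ry] := coords_on_ray ht ey.
have nxd := not_base zxd yc sy.
have ext m : 0 <= m <= 1 -> cseg (g c) (g d2) (mix m y (g c)).
  case: yc => s [hs ->] hm; exists ((1 - m) * s); split.
    apply/andP; split; first by apply: mulr_ge0; slra.
    have : 0 <= m * s by apply: mulr_ge0; slra.
    slra.
  by apply: pairP; rewrite /mix /=; ring.
have sy' : 0 < 1 - (al y + be y) by slra.
have [m [hm m1 m2 m3]] := exit2 by0 sy' (outside_corner Rc).
set q := mix m y (g c).
have bq : be q = (1 - m) * be y + m * be (g c) by rewrite /q beM.
have sq : 1 - (al q + be q) = (1 - m) * (1 - (al y + be y)) + m * (1 - (al (g c) + be (g c))).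
  by rewrite /q beM alM; ring.
have qe : cseg (g c) (g d2) q by apply: ext; slra.
have Rq : 0 < al q * be (g p) - be q * al (g p).
  rewrite (_ : _ - _ = m * (al (g c) * be (g p) - be (g c) * al (g p)) + (1 - m) * (al y * be (g p) - be y * al (g p))).
    by rewrite Ry subrr mulr0 addr0; apply: mulr_gt0; slra.
  by rewrite /q alM beM; ring.
move: m1 m2 m3; rewrite -bq -sq => m1 m2 m3.
exact: (no_edge_on_boundary Exd zxd ne Ec qe nxd Rq m1 m2 m3).
Qed.

(** An edge lying along the ray has no end strictly between [a] and [p], so it covers both and,
    having no vertex in its interior, is [ap] itself. *)
Lemma edge_on_ray v w (t : F) (y : F * F) : 0 < t < 1 -> y = mix t (g a) (g p) -> E v w ->
  al (g v) * be (g p) = be (g v) * al (g p) -> al (g w) * be (g p) = be (g w) * al (g p) ->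
  oseg (g v) (g w) y -> be (g v) <= be (g w) -> E a p.
Proof.
have [[ap bp sp] _] := ex; have [[alM beM [ala bea] _ _] coord] := co.
move=> ht ey Evw Rv Rw [s1 [hs1 ey1]] le.
have [_ by0 _ y2 _] := coords_on_ray ht ey; rewrite y2 in by0.
have bp0 := lt0r_neq0 bp.
have par u : al (g u) * be (g p) = be (g u) * al (g p) -> g u = mix (be (g u) / be (g p)) (g a) (g p).
  move=> Ru; apply: coord; rewrite ?alM ?beM ?ala ?bea mulr0 add0r; last by rewrite divfK.
  by apply: (mulIf bp0); rewrite Ru mulrAC divfK.
have bvw : be (g v) <> be (g w).
  by move=> bb; apply: (edge_gneq Evw); rewrite (par v) // (par w) // bb.
have yb : t * be (g p) = (1 - s1) * be (g v) + s1 * be (g w) by rewrite -y2 ey1 beM.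
have d0 : 0 < be (g w) - be (g v) by rewrite subr_gt0 lt_neqAle le andbT; apply/eqP.
have hv : be (g v) <= 0.
  rewrite leNgt; apply/negP => b0; apply: (extreme_visible (v := v)).
  exists (be (g v) / be (g p)); split; last exact: par.
  rewrite divr_gt0 //= ltr_pdivrMr // mul1r.
  have : 0 < s1 * (be (g w) - be (g v)) by apply: mulr_gt0; slra.
  have : 0 < (1 - t) * be (g p) by apply: mulr_gt0; slra.
  slra.
have hw : be (g p) <= be (g w).
  rewrite leNgt; apply/negP => b0; apply: (extreme_visible (v := w)).
  exists (be (g w) / be (g p)); split; last exact: par.
  rewrite ltr_pdivrMr // mul1r b0 andbT divr_gt0 //.
  have : 0 < (1 - s1) * (be (g w) - be (g v)) by apply: mulr_gt0; slra.
  slra.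
have on (tau : F) : be (g v) <= tau * be (g p) <= be (g w) -> cseg (g v) (g w) (mix tau (g a) (g p)).
  move=> ht'; exists ((tau * be (g p) - be (g v)) / (be (g w) - be (g v))); split.
    rewrite divr_ge0 /=; [|slra|slra].
    by rewrite ler_pdivrMr //; slra.
  have e0 : be (mix tau (g a) (g p)) = be (mix ((tau * be (g p) - be (g v)) / (be (g w) - be (g v))) (g v) (g w)).
    by rewrite !beM bea; field; exact: lt0r_neq0.
  apply: coord => //; apply: (mulIf bp0); move: e0; rewrite !beM !alM ala bea => e0.
  rewrite [RHS]mulrDl -!mulrA Rv Rw !mulrA -mulrDl -e0; ring.
have va : cseg (g v) (g w) (g a).
  have -> : g a = mix 0 (g a) (g p) by rewrite /mix; apply: pairP => /=; ring.
  by apply: on; slra.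
have vp : cseg (g v) (g w) (g p).
  have -> : g p = mix 1 (g a) (g p) by rewrite /mix; apply: pairP => /=; ring.
  by apply: on; slra.
have nap : a <> p by move=> e1; move: bp; rewrite -e1 bea ltxx.
by case: (E_vtx Evw va) => ?; case: (E_vtx Evw vp) => ?; subst => //; rewrite E_sym.
Qed.

Lemma extreme_edge : E x d -> oseg (g x) (g d) z ->
  (forall c c' w, E c c' -> oseg (g a) z w -> ~ cseg (g c) (g c') w) -> E a p.
Proof.
move=> Exd zxd ne; have [//|/negP nE] := boolP (E a p); exfalso.
have [[ap bp sp] _] := ex; have [[alM beM [ala bea] _ _] coord] := co.
apply: (nE); apply: Hsat; [by move=> e; move: bp; rewrite -e bea ltxx|exact: extreme_visible|].
move=> c1 d1 y Ecd [t [ht ey]] ycd; have [_ _ sy _ Ry] := coords_on_ray ht ey.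
have nxd := not_base zxd ycd sy.
have ycd' : oseg (g c1) (g d1) y.
  case: (cseg_oseg ycd) => // e; [case: (@extreme_visible c1)|case: (@extreme_visible d1)];
    by exists t; split=> //; rewrite -e ey.
pose R v := al (g v) * be (g p) - be (g v) * al (g p).
have [s [hs e]] : exists s, (0 < s < 1) /\ (1 - s) * R c1 + s * R d1 = 0.
  case: ycd' => s [hs e]; exists s; split=> //; have : al y * be (g p) - be y * al (g p) = 0 by rewrite Ry subrr.
  by rewrite e alM beM => <-; rewrite /R; ring.
case: (ltgtP (R c1) 0) => Rc1.
- have h : 0 < (1 - s) * - R c1 by apply: mulr_gt0; slra.
  have : 0 < s * R d1 by slra.
  rewrite pmulr_rgt0 => [h'|]; last slra.
  by apply: (no_crossing_edge Exd zxd ne ht ey (c := d1) (d2 := c1)) => //; [rewrite E_sym|exact: cseg_sym].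
- exact: (no_crossing_edge Exd zxd ne ht ey Ecd ycd).
have Rd1 : R d1 = 0.
  by move: e; rewrite Rc1 mulr0 add0r => /eqP; rewrite mulf_eq0 => /orP[/eqP|/eqP]; slra.
move/eqP: Rc1; move/eqP: Rd1; rewrite !subr_eq0 => /eqP Rd1 /eqP Rc1.
case/orP: (le_total (be (g c1)) (be (g d1))) => l; apply: nE.
  exact: (edge_on_ray ht ey Ecd).
by apply: (edge_on_ray ht ey (v := d1) (w := c1)) => //; [rewrite E_sym|exact: oseg_sym].
Qed.

End Corner.

(** [z] is the point where the edge [xd] first blocks the view from [a]. The position of the
    neighbour is given by coefficients, so that a functional larger at [z] and [x] than at [a] is
    seen to be larger at [w] too. *)
Lemma visible a z x d :
  E x d -> oseg (g x) (g d) z -> orient (g a) z (g x) != 0 ->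
  (forall c c' w, E c c' -> oseg (g a) z w -> ~ cseg (g c) (g c') w) ->
  exists (w : V) al be, [/\ E a w, 0 <= al, 0 < be &
    g w = ((g a).1 + al * (z.1 - (g a).1) + be * ((g x).1 - (g a).1),
           (g a).2 + al * (z.2 - (g a).2) + be * ((g x).2 - (g a).2))].
Proof.
move=> Exd zxd D0 ne.
pose D := orient (g a) z (g x).
pose al (p : F * F) := orient (g a) p (g x) / D.
pose be (p : F * F) := orient (g a) z p / D.
have gE (p : F * F) : p = ((g a).1 + al p * (z.1 - (g a).1) + be p * ((g x).1 - (g a).1),
           (g a).2 + al p * (z.2 - (g a).2) + be p * ((g x).2 - (g a).2)).
  apply: pairP => /=; rewrite /al /be; move: D0; rewrite -/D /D /orient => D0; field; exact: D0.
have co : corner_coords (g a) (g x) z al be.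
  split; last by move=> p q e1 e2; rewrite (gE p) (gE q) e1 e2.
  split; last by rewrite /al /be divff // /orient; split=> //; field.
  - by move=> s p q; rewrite /al /orient /mix /=; field.
  - by move=> s p q; rewrite /be /orient /mix /=; field.
  - by rewrite /al /be /orient; split; field.
  - by rewrite /al /be divff // /orient; split=> //; field.
clearbody al be; pose C v := in_corner al be v.
have Cx : C x by case: co => -[_ _ _ [alx bex] _] _; rewrite /C /in_corner alx bex; split; slra.
have [p0 [Cp0 m0]] := @fin_argmin F V C (fun p => - (al (g p) / be (g p))) (ex_intro _ x Cx).
pose r := al (g p0) / be (g p0).
have [p [[Cp rp] mp]] := @fin_argmin F V (fun p => C p /\ al (g p) / be (g p) = r)
   (fun p => be (g p)) (ex_intro _ p0 (conj Cp0 erefl)).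
have ex : extreme p al be.
  split=> // v Cv; case: (Cv) (Cp) => _ bv _ [_ bp _]; split.
    by have := m0 v Cv; rewrite -/r -rp => h; rewrite -ler_pdivlMr // mulrAC -ler_pdivrMr //; slra.
  move=> h; apply: mp; split=> //; rewrite -rp.
  by apply/eqP; rewrite eqr_div ?(lt0r_neq0 bv) ?(lt0r_neq0 bp) //; apply/eqP.
exists p, (al (g p)), (be (g p)); have [ap bp sp] := Cp; split=> //.
exact: (extreme_edge co ex Exd zxd ne).
Qed.
End MaximalPlane.

(** * Neighbours in every open half plane that contains a vertex *)

Section Triangles.
Variables (F : realFieldType) (V : finType) (g : V -> F * F) (E : rel V).
Implicit Types (a b c d u v x y : V) (z : F * F).
Hypothesis HP : plane_edges g E.
Hypothesis Hsat : saturated g E.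

Local Notation E_sym := (plane_sym HP).
Local Notation E_vtx := (plane_vtx HP).

Lemma collinear_mix (k1 k2 : F) (c d p : F * F) :
  let f (q : F * F) := k1 * q.1 + k2 * q.2 in
  orient c d p = 0 -> f c != f d -> p = mix ((f c - f p) / (f c - f d)) c d.
Proof.
move=> f o n.
have n' : f c - f d != 0 by rewrite subr_eq0.
apply: pairP; apply: (mulIf n'); rewrite /mix /=.
  have -> : ((1 - (f c - f p) / (f c - f d)) * c.1 + (f c - f p) / (f c - f d) * d.1) * (f c - f d) =
    (f c - f d) * c.1 + (f c - f p) * (d.1 - c.1) by field.
  have : k2 * orient c d p = 0 by rewrite o mulr0.
  by rewrite /orient /f; slra.
have -> : ((1 - (f c - f p) / (f c - f d)) * c.2 + (f c - f p) / (f c - f d) * d.2) * (f c - f d) =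
    (f c - f d) * c.2 + (f c - f p) * (d.2 - c.2) by field.
have : k1 * orient c d p = 0 by rewrite o mulr0.
by rewrite /orient /f; slra.
Qed.

Lemma collinear_trans (k1 k2 : F) (a v x d : F * F) :
  let f (q : F * F) := k1 * q.1 + k2 * q.2 in
  f a != f v -> orient a v x = 0 -> orient a v d = 0 ->
  orient x d a = 0 /\ orient x d v = 0.
Proof.
move=> f n hx hd.
have ex := collinear_mix (k1 := k1) (k2 := k2) hx n.
have ed := collinear_mix (k1 := k1) (k2 := k2) hd n.
by rewrite ex ed /orient /mix /=; split; ring.
Qed.

Section NearestAbove.
Variables (k1 k2 : F) (a v0 : V).
Local Notation f := (fun q : F * F => k1 * q.1 + k2 * q.2).

Definition nearest_above := f (g a) < f (g v0) /\ forall u, f (g a) < f (g u) -> f (g v0) <= f (g u).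

(** An edge blocking the segment from [a] to [v0], directed so that its first end lies above [a];
    one of the ends always does, since the blocking point is above [a]. *)
Definition upward (e : V * V) := [/\ E e.1 e.2, f (g a) < f (g e.1) &
  exists t, 0 < t < 1 /\ cseg (g e.1) (g e.2) (mix t (g a) (g v0))].

Hypothesis near : nearest_above.

Let fM s (p q : F * F) : f (mix s p q) = (1 - s) * f p + s * f q.
Proof. by rewrite /mix /=; ring. Qed.

Lemma nearest_visible u : ~ oseg (g a) (g v0) (g u).
Proof.
have [hv0 minv] := near; move=> [t [ht e]].
have fu : f (g u) = (1 - t) * f (g a) + t * f (g v0) by rewrite e fM.
have h1 : 0 < t * (f (g v0) - f (g a)) by apply: mulr_gt0; slra.
have h2 : 0 < (1 - t) * (f (g v0) - f (g a)) by apply: mulr_gt0; slra.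
have : f (g v0) <= f (g u) by apply: minv; slra.
slra.
Qed.

Lemma upwardP c d t : E c d -> 0 < t < 1 -> cseg (g c) (g d) (mix t (g a) (g v0)) ->
  upward (c, d) \/ upward (d, c).
Proof.
have [hv0 _] := near; move=> Ecd ht cs.
have [fc|fc] := ltP (f (g a)) (f (g c)); first by left; split=> //; exists t.
right; split=> /=; [by rewrite E_sym| |by exists t; split=> //; apply: cseg_sym].
case: cs => s [hs e]; have := fM t (g a) (g v0); rewrite e fM => fe.
have h1 : 0 < t * (f (g v0) - f (g a)) by apply: mulr_gt0; slra.
have h2 : 0 <= (1 - s) * (f (g a) - f (g c)) by apply: mulr_ge0; slra.
have h3 : 0 < s * (f (g d) - f (g a)) by slra.
have s0 : 0 < s by rewrite lt_def; case/andP: hs => -> _; rewrite andbT; apply/eqP => s0; move: h3; rewrite s0 mul0r ltxx.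
by rewrite pmulr_rgt0 // subr_gt0 in h3.
Qed.

(** A blocking edge collinear with [a] and [v0] has one end no higher than [a] and the other no
    lower than [v0]; it would contain both and be the edge [a v0]. *)
Lemma upward_transversal e : ~ E a v0 -> upward e ->
  orient (g e.1) (g e.2) (g a) <> orient (g e.1) (g e.2) (g v0).
Proof.
have [hv0 minv] := near; case: e => c d nE [/= Ecd fc [t [ht cs]]] oe.
have o0 : orient (g c) (g d) (g a) = 0.
  have : orient (g c) (g d) (mix t (g a) (g v0)) = 0.
    by case: cs => s [_ ->]; rewrite mix_orient /orient; ring.
  by rewrite mix_orient -oe; slra.
rewrite o0 in oe; symmetry in oe.
have fcv := minv c fc.
case: cs => s [hs e]; have := fM t (g a) (g v0); rewrite e fM => fe.
have h2 : 0 < (1 - t) * (f (g v0) - f (g a)) by apply: mulr_gt0; slra.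
have fd : f (g d) <= f (g a).
  rewrite leNgt; apply/negP => /minv fd.
  have h1 : 0 <= (1 - s) * (f (g c) - f (g v0)) by apply: mulr_ge0; slra.
  have h3 : 0 <= s * (f (g d) - f (g v0)) by apply: mulr_ge0; slra.
  slra.
have dcd : 0 < f (g c) - f (g d) by slra.
have ncd : f (g c) != f (g d) by rewrite gt_eqF // -subr_gt0.
have on p : orient (g c) (g d) p = 0 -> f (g d) <= f p <= f (g c) -> cseg (g c) (g d) p.
  move=> op hp; exists ((f (g c) - f p) / (f (g c) - f (g d))).
  split; last exact: collinear_mix.
  by rewrite divr_ge0 ?ler_pdivrMr //=; slra.
have ca := E_vtx Ecd (on _ o0 (ltac:(by rewrite fd ltW))).
have cv := E_vtx Ecd (on _ oe (ltac:(by rewrite fcv (le_trans fd) // ltW))).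
have ead : a = d by case: ca => // e1; move: fc; rewrite e1 ltxx.
have evc : v0 = c by case: cv => // e1; exfalso; move: hv0; rewrite e1 ltNge fd.
by apply: nE; rewrite ead evc E_sym.
Qed.

End NearestAbove.

(** If the lowest vertex above [a] is not a neighbour, the segment to it is blocked. At the first
    blocking edge, whose end [x] is above [a], visibility gives a neighbour in the cone spanned by
    [z - a] and [x - a], which points upwards throughout. *)
Lemma nbr_above (k1 k2 : F) a v :
  let f (q : F * F) := k1 * q.1 + k2 * q.2 in
  f (g a) < f (g v) -> exists w, E a w /\ f (g a) < f (g w).
Proof.
move=> f fav.
have [v0 [hv0 minv]] := @fin_argmin F V (fun u => f (g a) < f (g u)) (fun u => f (g u)) (ex_intro _ v fav).
have near : nearest_above k1 k2 a v0 by split.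
have fM s (p q : F * F) : f (mix s p q) = (1 - s) * f p + s * f q by rewrite /f /mix /=; ring.
have nv := nearest_visible near.
have [|/negP nE] := boolP (E a v0); first by exists v0.
pose B := upward k1 k2 a v0; have Bor := upwardP near.
(* The parameter at which the line of [e] meets the segment from [a] to [v0]. *)
pose k (e : V * V) := orient (g e.1) (g e.2) (g a) /
  (orient (g e.1) (g e.2) (g a) - orient (g e.1) (g e.2) (g v0)).
have Bex : exists e, B e.
  apply: contrapT => nB; apply: nE; apply: Hsat => //; first by move=> e; move: hv0; rewrite e ltxx.
  by move=> c d w Ecd [t [ht ->]] cs; case: (Bor c d t Ecd ht cs) => h; apply: nB; eexists; exact: h.
have noncol e := upward_transversal (e := e) near nE.
have kB e t : B e -> cseg (g e.1) (g e.2) (mix t (g a) (g v0)) -> k e = t.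
  move=> Be [s [_ es]]; have /eqP n := noncol e Be.
  have : orient (g e.1) (g e.2) (mix t (g a) (g v0)) = 0 by rewrite es mix_orient /orient; ring.
  rewrite mix_orient /k => h.
  have n' : orient (g e.1) (g e.2) (g a) - orient (g e.1) (g e.2) (g v0) != 0 by rewrite subr_eq0.
  by apply: (mulIf n'); rewrite divfK //; slra.
have [[x d] [Be mine]] := @fin_argmin F (prod V V : finType) B k Bex.
have [/= Exd fx' [t0 [ht0 cs]]] := Be; have fx : f (g a) < f (g x) by exact: fx'.
have kt0 := kB _ _ Be cs.
set z := mix t0 (g a) (g v0) in cs.
have sub t' : mix t' (g a) z = mix (t' * t0) (g a) (g v0).
  by rewrite /z /mix /=; congr pair; ring.
have nvz u : ~ oseg (g a) z (g u).
  move=> [t' [ht' e]]; apply: (nv u); exists (t' * t0); split; last by rewrite e sub.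
  apply/andP; split; first by apply: mulr_gt0; slra.
  have : 0 < t' * (1 - t0) by apply: mulr_gt0; slra.
  slra.
have nez c c' w : E c c' -> oseg (g a) z w -> ~ cseg (g c) (g c') w.
  move=> Ec [t' [ht' ->]]; rewrite sub => cs'.
  have lt1 : 0 < (1 - t') * t0 by apply: mulr_gt0; slra.
  have lt2 : 0 < t' * t0 by apply: mulr_gt0; slra.
  have hh : 0 < t' * t0 < 1 by slra.
  case: (Bor _ _ _ Ec hh cs') => B'; have := mine _ B'; rewrite kt0.
    by rewrite (kB _ _ B' cs'); slra.
  by rewrite (kB _ _ B' (cseg_sym cs')); slra.
have zi u : g u <> z.
  by move=> e; apply: (nv u); exists t0; split.
have oxd : oseg (g x) (g d) z.
  by case: (cseg_oseg cs) => // e; [case: (zi x)|case: (zi d)].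
have D0 : orient (g a) z (g x) != 0.
  apply/eqP => o.
  have ox : orient (g a) (g v0) (g x) = 0.
    have : t0 * orient (g a) (g v0) (g x) = 0 by rewrite -[RHS]o /z /orient /mix /=; ring.
    by move/eqP; rewrite mulf_eq0 => /orP[/eqP|/eqP //]; slra.
  have od : orient (g a) (g v0) (g d) = 0.
    case: oxd => s [hs es].
    have : orient (g a) (g v0) z = 0 by rewrite /z /orient /mix /=; ring.
    rewrite es mix_orient ox mulr0 add0r => /eqP; rewrite mulf_eq0 => /orP[/eqP|/eqP //]; slra.
  have fne : f (g a) != f (g v0) by rewrite lt_eqF.
  have [o1 o2] := collinear_trans (k1 := k1) (k2 := k2) fne ox od.
  by apply: (noncol _ Be); rewrite o1 o2.
have [w [al [be [Ew hal hbe ew]]]] := visible HP Hsat Exd oxd D0 nez.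
exists w; split=> //.
have fz : f z = (1 - t0) * f (g a) + t0 * f (g v0) by rewrite fM.
have -> : f (g w) = f (g a) + al * (f z - f (g a)) + be * (f (g x) - f (g a)).
  by rewrite ew /f /=; ring.
have h1 : 0 <= al * (f z - f (g a)).
  apply: mulr_ge0 => //; rewrite fz.
  have : 0 < t0 * (f (g v0) - f (g a)) by apply: mulr_gt0; slra.
  slra.
have h2 : 0 < be * (f (g x) - f (g a)) by apply: mulr_gt0; slra.
slra.
Qed.

End Triangles.

(** The first exit is at the smallest of the individual zeros [f0 i / (f0 i - f1 i)]. *)
Lemma exitn (F : realFieldType) (I : finType) (f0 f1 : I -> F) :
  (forall i, 0 < f0 i) -> (exists i, f1 i <= 0) ->
  exists m, [/\ 0 < m <= 1, forall i, 0 <= (1 - m) * f0 i + m * f1 i &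
    exists i, (1 - m) * f0 i + m * f1 i = 0].
Proof.
move=> h0 ex.
have [i [hi mi]] := @fin_argmin F I (fun i => f1 i <= 0) (fun i => f0 i / (f0 i - f1 i)) ex.
have d j : f1 j <= 0 -> 0 < f0 j - f1 j by move=> ?; have := h0 j; slra.
set m := f0 i / (f0 i - f1 i) in mi *.
have E : m * (f0 i - f1 i) = f0 i by rewrite /m divfK // gt_eqF ?d.
have hm : 0 < m <= 1 by rewrite /m divr_gt0 ?ler_pdivrMr ?d ?h0 //=; slra.
exists m; split=> //; last by exists i; slra.
move=> j; have := h0 j => hj; have [lj|lj] := leP (f1 j) 0.
  have := mi j lj; rewrite ler_pdivlMr ?d //; slra.
have : 0 <= m * f1 j by apply: mulr_ge0; slra.
have : 0 <= (1 - m) * f0 j by apply: mulr_ge0; slra.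
slra.
Qed.

Lemma small_mix (F : realFieldType) (x y : F) : 0 < x ->
  exists e, 0 < e /\ forall t, 0 < t <= e -> 0 < (1 - t) * x + t * y.
Proof.
move=> hx; have [hy|hy] := leP 0 y.
  exists (1 / 2); split; first slra.
  move=> t ht; have : 0 <= t * y by apply: mulr_ge0; slra.
  have : 0 < (1 - t) * x by apply: mulr_gt0; slra.
  slra.
exists (x / (2 * (x - y))); split; first by apply: divr_gt0; slra.
move=> t; rewrite ler_pdivlMr; slra.
Qed.

(** * Triangular faces: no edge enters one, and an edge has at most one on each side *)

Section Tri.
Variables (F : realFieldType) (V : finType) (g : V -> F * F) (E : rel V).
Implicit Types (a b c d u v w x y : V) (z : F * F).
Hypothesis HP : plane_edges g E.

Local Notation E_sym := (plane_sym HP).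
Local Notation E_vtx := (plane_vtx HP).
Local Notation E_pl := (plane_cross HP).

Local Notation ori a b p := (orient (g a) (g b) p).

(** A face listed counterclockwise. Emptiness is required of vertices only; planarity then keeps the
    edges out as well. *)
Definition tri a b c : bool :=
  [&& E a b, E b c, E c a, 0 < ori a b (g c) &
   [forall v, [&& 0 <= ori a b (g v), 0 <= ori b c (g v) & 0 <= ori c a (g v)] ==>
              [|| v == a, v == b | v == c]]].

Lemma triP a b c : tri a b c ->
  [/\ E a b, E b c, E c a, 0 < ori a b (g c) &
   forall v, 0 <= ori a b (g v) -> 0 <= ori b c (g v) -> 0 <= ori c a (g v) ->
     [\/ v = a, v = b | v = c]].
Proof.
case/and5P=> h1 h2 h3 h4 /forallP h5; split=> // v v1 v2 v3.
by have := h5 v; rewrite v1 v2 v3 /= => /or3P[] /eqP; [constructor 1|constructor 2|constructor 3].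
Qed.

Lemma tri_rot a b c : tri a b c -> tri b c a.
Proof.
case/and5P=> h1 h2 h3 h4 /forallP h5; apply/and5P; split=> //; first by rewrite -orient_rot.
apply/forallP=> v; apply/implyP=> /and3P[v1 v2 v3].
have := h5 v; rewrite v1 v2 v3 /= => /or3P[] -> //; rewrite ?orbT //.
Qed.

Lemma orient_sum (a b c p : F * F) : orient a b p + orient b c p + orient c a p = orient a b c.
Proof. by rewrite /orient; ring. Qed.

Lemma on_side (a b c p : F * F) : 0 < orient a b c -> orient a b p = 0 ->
  0 <= orient b c p -> 0 <= orient c a p -> cseg a b p.
Proof.
move=> h e h2 h3; have s := orient_sum a b c p.
exists (orient c a p / orient a b c); split.
  apply/andP; split; first by apply: divr_ge0 => //; exact: ltW.
  by rewrite ler_pdivrMr //; slra.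
have n : orient a b c != 0 by rewrite gt_eqF.
apply: pairP; rewrite /mix /=; apply: (mulIf n).
  have -> : ((1 - orient c a p / orient a b c) * a.1 + orient c a p / orient a b c * b.1) * orient a b c =
     (orient a b c - orient c a p) * a.1 + orient c a p * b.1 by field.
  rewrite -s e; move: e; rewrite /orient => e.
  have : (b.1 - a.1) * ((b.1 - a.1) * (p.2 - a.2) - (b.2 - a.2) * (p.1 - a.1)) = 0 by rewrite e mulr0.
  have : (c.1 - a.1) * ((b.1 - a.1) * (p.2 - a.2) - (b.2 - a.2) * (p.1 - a.1)) = 0 by rewrite e mulr0.
  have : (p.1 - a.1) * ((b.1 - a.1) * (p.2 - a.2) - (b.2 - a.2) * (p.1 - a.1)) = 0 by rewrite e mulr0.
  slra.
have -> : ((1 - orient c a p / orient a b c) * a.2 + orient c a p / orient a b c * b.2) * orient a b c =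
     (orient a b c - orient c a p) * a.2 + orient c a p * b.2 by field.
rewrite -s e; move: e; rewrite /orient => e.
have : (b.2 - a.2) * ((b.1 - a.1) * (p.2 - a.2) - (b.2 - a.2) * (p.1 - a.1)) = 0 by rewrite e mulr0.
have : (c.2 - a.2) * ((b.1 - a.1) * (p.2 - a.2) - (b.2 - a.2) * (p.1 - a.1)) = 0 by rewrite e mulr0.
have : (p.2 - a.2) * ((b.1 - a.1) * (p.2 - a.2) - (b.2 - a.2) * (p.1 - a.1)) = 0 by rewrite e mulr0.
slra.
Qed.

(** Moving from [z] towards an end outside the triangle, the edge would leave through a side and, by
    planarity, be that side. With no end outside, both ends are corners and the edge lies on a
    side. *)
Lemma tri_interior a b c u v z : tri a b c -> E u v -> oseg (g u) (g v) z ->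
  0 < ori a b z -> 0 < ori b c z -> 0 < ori c a z -> False.
Proof.
move=> T Euv.
have [Eab Ebc Eca D emp] := triP T.
have D2 : 0 < ori b c (g a) by rewrite -orient_rot.
have D3 : 0 < ori c a (g b) by rewrite orient_rot.
pose f (i : 'I_3) (p : F * F) := if i == 0 :> nat then ori a b p else if i == 1%N :> nat then ori b c p else ori c a p.
have fM i s (p q : F * F) : f i (mix s p q) = (1 - s) * f i p + s * f i q.
  by rewrite /f; case: ifP => _; [|case: ifP => _]; rewrite mix_orient.
have out u' v' : E u' v' -> oseg (g u') (g v') z -> 0 < ori a b z -> 0 < ori b c z -> 0 < ori c a z ->
    (exists i, f i (g u') < 0) -> False.
  move=> Euv' [s [hs ez]] z1 z2 z3 [i0 hi0].
  have fz i : 0 < f i z by rewrite /f; case: ifP => _; [|case: ifP => _].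
  have [m [hm m1 [i mi]]] := exitn fz (ex_intro (fun i => f i (g u') <= 0) i0 (ltW hi0)).
  have m1' : m < 1.
    rewrite lt_neqAle; apply/andP; split; last by slra.
    by apply/eqP=> e; have := m1 i0; rewrite e; slra.
  set q := mix m z (g u').
  have oq : oseg (g u') (g v') q.
    exists ((1 - m) * s); split.
      have : 0 < (1 - m) * s by apply: mulr_gt0; slra.
      have : 0 <= m * s by apply: mulr_ge0; slra.
      slra.
    by rewrite /q ez /mix /=; congr pair; ring.
  have fq j : 0 <= f j q by rewrite fM.
  have q1 : 0 <= ori a b q := fq (Ordinal (isT : (0 < 3)%N)).
  have q2 : 0 <= ori b c q := fq (Ordinal (isT : (1 < 3)%N)).
  have q3 : 0 <= ori c a q := fq (Ordinal (isT : (2 < 3)%N)).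
  have fq0 : f i q = 0 by rewrite fM.
  have zon (x y : V) : 0 < ori x y z -> E x y -> cseg (g x) (g y) q -> False.
    move=> oz Exy cq; case: (E_pl Euv' Exy oq cq) => [[e1 e2]|[e1 e2]]; move: oz;
      by rewrite ez e1 e2 mix_orient /orient; slra.
  move: fq0; rewrite /f; case: ifP => _; [|case: ifP => _] => e.
  - by apply: (zon a b) => //; exact: (on_side D).
  - by apply: (zon b c) => //; exact: (on_side D2).
  - by apply: (zon c a) => //; exact: (on_side D3).
move=> oz z1 z2 z3.
have [[i hi]|nu] := pselect (exists i, f i (g u) < 0); first by apply: (out u v) => //; exists i.
have [[i hi]|nv] := pselect (exists i, f i (g v) < 0).
  by apply: (out v u) => //; [rewrite E_sym|exact: oseg_sym|exists i].
have fge w i : ~ (exists i, f i (g w) < 0) -> 0 <= f i (g w).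
  by move=> h; rewrite leNgt; apply/negP => h'; apply: h; exists i.
have cor w : ~ (exists i, f i (g w) < 0) -> [\/ w = a, w = b | w = c].
  move=> h; apply: emp.
  - exact: (fge w (Ordinal (isT : (0 < 3)%N)) h).
  - exact: (fge w (Ordinal (isT : (1 < 3)%N)) h).
  - exact: (fge w (Ordinal (isT : (2 < 3)%N)) h).
case: oz => s [hs ez]; move: z1 z2 z3; rewrite ez !mix_orient.
by case: (cor u nu) => ->; case: (cor v nv) => ->; rewrite /orient; slra.
Qed.

(** Near [a] such an edge would run inside the face. *)
Lemma tri_sector a b c d : tri a b c -> E a d -> 0 < ori a b (g d) -> 0 < ori a d (g c) -> False.
Proof.
move=> T Ead h1 h2; have [Eab Ebc Eca D _] := triP T.
have [e [he small]] := @small_mix F (ori b c (g a)) (ori b c (g d)) (ltac:(rewrite -orient_rot; exact: D)).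
pose t := Num.min e (1 / 2).
have ht : 0 < t <= e /\ t <= 1 / 2.
  by rewrite /t; case: (leP e (1/2)) => ?; slra.
apply: (tri_interior (z := mix t (g a) (g d)) T Ead); first by exists t; split=> //; slra.
- rewrite mix_orient; have -> : ori a b (g a) = 0 by rewrite /orient; ring.
  by rewrite mulr0 add0r; apply: mulr_gt0; slra.
- by rewrite mix_orient; apply: small; slra.
- rewrite mix_orient; have -> : ori c a (g a) = 0 by rewrite /orient; ring.
  by rewrite mulr0 add0r orient_rot; apply: mulr_gt0; slra.
Qed.

Lemma same_ray a c d (h : F) (k1 k2 : F) : E a c -> E a d ->
  let f (q : F * F) := k1 * q.1 + k2 * q.2 in
  f (g a) < f (g c) -> f (g a) < f (g d) -> ori a c (g d) = 0 -> c = d.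
Proof.
move=> Eac Ead f fc fd o.
have n : f (g a) != f (g c) by rewrite lt_eqF.
have e := collinear_mix (k1 := k1) (k2 := k2) o n; rewrite -!/(f _) in e.
set t := (f (g a) - f (g d)) / (f (g a) - f (g c)) in e.
have tE : t * (f (g c) - f (g a)) = f (g d) - f (g a).
  by rewrite /t; field; rewrite subr_eq0.
have t0 : 0 < t.
  have : 0 < t * (f (g c) - f (g a)) by slra.
  by rewrite pmulr_lgt0 //; slra.
have [t1|t1] := leP t 1.
  have : cseg (g a) (g c) (g d) by exists t; split; [slra|].
  by move=> /(E_vtx Eac) [ed|//]; move: fd; rewrite ed ltxx.
have : cseg (g a) (g d) (g c).
  exists t^-1; split; first by rewrite invr_ge0 invf_le1 // !ltW.
  rewrite e; apply: pairP; rewrite /mix /=; field; exact: lt0r_neq0.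
by move=> /(E_vtx Ead) [ed|//]; move: fc; rewrite ed ltxx.
Qed.

(** If [c] and [d] lie in different directions from [a], one of the edges [ac], [ad] enters the face
    of the other; on a common ray they coincide. *)
Lemma tri_uniq a b c d : tri a b c -> tri a b d -> c = d.
Proof.
move=> T1 T2; have [Eab Ebc Eca D1 _] := triP T1; have [_ Ebd Eda D2 _] := triP T2.
case: (ltgtP (ori a c (g d)) 0) => o.
- case: (tri_sector T1 (d := d)) => //; first by rewrite E_sym.
  by move: o; rewrite /orient; slra.
- by case: (tri_sector T2 (d := c)) => //; first by rewrite E_sym.
apply: (@same_ray a c d 0 (- ((g b).2 - (g a).2)) ((g b).1 - (g a).1)) => //; rewrite 1?E_sym //;
  by move: D1 D2; rewrite /orient; slra.
Qed.

End Tri.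

(** * Existence of a face beside an edge *)

Section TriExists.
Variables (F : realFieldType) (V : finType) (g : V -> F * F) (E : rel V).
Implicit Types (a b c d u v w x y : V) (z : F * F).
Hypothesis HP : plane_edges g E.
Hypothesis Hsat : saturated g E.

Local Notation g_inj := (plane_inj HP).
Local Notation E_sym := (plane_sym HP).
Local Notation E_vtx := (plane_vtx HP).
Local Notation E_pl := (plane_cross HP).

Local Notation ori a b p := (orient (g a) (g b) p).

Lemma edge_along a w p z : (forall v, ~ oseg (g a) (g p) (g v)) ->
  E a w -> oseg (g a) (g p) z -> cseg (g a) (g w) z -> E a p.
Proof.
move=> nv Eaw [t [ht ey]] [s [hs ey']].
have nap : a <> p.
  by move=> e; apply: (nv a); rewrite -e; exists t; split=> //; rewrite /mix; apply: pairP => /=; ring.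
have n : t != 0 by apply/eqP; slra.
have e1 : t * ((g p).1 - (g a).1) = s * ((g w).1 - (g a).1).
  by have := congr1 fst (etrans (esym ey) ey'); rewrite /mix /=; slra.
have e2 : t * ((g p).2 - (g a).2) = s * ((g w).2 - (g a).2).
  by have := congr1 snd (etrans (esym ey) ey'); rewrite /mix /=; slra.
have [s0|s0] := eqVneq s 0.
  case: nap; apply: g_inj; apply: pairP; apply: (mulfI n); move: e1 e2; rewrite s0; slra.
have {}s0 : 0 < s by case/andP: hs => h _; rewrite lt_def s0.
have [st|st] := leP s t.
  have : cseg (g a) (g w) (g p).
    exists (s / t); split.
      by rewrite divr_ge0 ?ler_pdivrMr /=; slra.
    apply: pairP; rewrite /mix /=; apply: (mulfI n).
      by rewrite (_ : t * (_ + _) = t * (g a).1 + s * ((g w).1 - (g a).1)); [slra|field].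
    by rewrite (_ : t * (_ + _) = t * (g a).2 + s * ((g w).2 - (g a).2)); [slra|field].
  by move=> /(E_vtx Eaw) [e|-> //]; case: nap.
case: (nv w); exists (t / s); split.
  by rewrite divr_gt0 ?ltr_pdivrMr /=; slra.
have ns := lt0r_neq0 s0.
apply: pairP; rewrite /mix /=; apply: (mulfI ns).
  by rewrite (_ : s * (_ + _) = s * (g a).1 + t * ((g p).1 - (g a).1)); [slra|field].
by rewrite (_ : s * (_ + _) = s * (g a).2 + t * ((g p).2 - (g a).2)); [slra|field].
Qed.

Lemma angular_min a b v : E a b -> 0 < ori a b (g v) ->
  exists c, [/\ E a c, 0 < ori a b (g c) &
    forall d, E a d -> 0 < ori a b (g d) -> 0 <= ori a c (g d)].
Proof.
move=> Eab hv.
have [w [Ew hw]] := @nbr_above F V g E HP Hsat (- ((g b).2 - (g a).2)) ((g b).1 - (g a).1) a v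
  (ltac:(move: hv; rewrite /orient /=; slra)).
pose P c := E a c /\ 0 < ori a b (g c).
pose dot c := ((g c).1 - (g a).1) * ((g b).1 - (g a).1) + ((g c).2 - (g a).2) * ((g b).2 - (g a).2).
have Pw : P w by split=> //; move: hw; rewrite /orient /=; slra.
have [c [[Ec hc] mc]] := @fin_argmin F V P (fun c => - (dot c / ori a b (g c))) (ex_intro _ w Pw).
exists c; split=> // d Ed hd.
have := mc d (conj Ed hd); rewrite lerN2 ler_pdivrMr // mulrAC ler_pdivlMr // => h.
pose N := ((g b).1 - (g a).1) ^+ 2 + ((g b).2 - (g a).2) ^+ 2.
have Npos : 0 < N.
  have h1 : 0 <= ((g b).1 - (g a).1) ^+ 2 by exact: sqr_ge0.
  have h2 : 0 <= ((g b).2 - (g a).2) ^+ 2 by exact: sqr_ge0.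
  rewrite /N lt_def addr_ge0 // andbT paddr_eq0 // !sqrf_eq0; apply/negP => /andP[/eqP e1 /eqP e2].
  by move: hc; rewrite /orient e1 e2 !mul0r subrr ltxx.
have : 0 <= N * ori a c (g d).
  rewrite (_ : N * _ = dot c * ori a b (g d) - dot d * ori a b (g c)); first by slra.
  by rewrite /N /dot /orient; ring.
by rewrite pmulr_rge0.
Qed.

(* [f1], [f2], [f3] are the orientations relative to [ab], [bc], [ca], where [c] follows [b] in the
   counterclockwise order around [a]. *)
Definition wedge a b c (f1 f2 f3 : F * F -> F) :=
  [/\ (forall s p q, f1 (mix s p q) = (1 - s) * f1 p + s * f1 q),
      (forall s p q, f2 (mix s p q) = (1 - s) * f2 p + s * f2 q),
      (forall s p q, f3 (mix s p q) = (1 - s) * f3 p + s * f3 q) &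
      (forall p, f1 p + f2 p + f3 p = f1 (g c)) /\ 0 < f1 (g c)] /\
  [/\ f1 (g a) = 0 /\ f1 (g b) = 0, f2 (g b) = 0 /\ f2 (g c) = 0,
      f3 (g c) = 0 /\ f3 (g a) = 0 & f3 (g b) = f1 (g c)] /\
  [/\ (forall q, f1 q = 0 -> 0 <= f2 q -> 0 <= f3 q -> cseg (g a) (g b) q),
      (forall q, f3 q = 0 -> 0 <= f1 q -> 0 <= f2 q -> cseg (g c) (g a) q),
      (forall v, E a v -> 0 < f1 (g v) -> 0 < f3 (g v) -> False) & E a b /\ E c a].

Section Wedge.
Variables (a b c : V) (f1 f2 f3 : F * F -> F).
Hypothesis W : wedge a b c f1 f2 f3.

Definition in_wedge p := [/\ 0 < f1 p, 0 < f3 p & 0 <= f2 p].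

(** [f2] vanishes on [bc] and grows towards [a]. Following the edge towards an end where [f2] is no
    smaller, one stays on the side of [a], so the cone is left through [ab] or [ac]. Planarity
    allows this only at the ends of these sides, and at [b] or [c] only if [z] is already on the
    line [bc]. *)
Lemma walk c1 d1 z : E c1 d1 -> cseg (g c1) (g d1) z -> 0 < f1 z -> 0 < f3 z ->
    0 <= f2 z -> f2 z <= f2 (g c1) ->
  [\/ in_wedge (g c1), cseg (g c1) (g d1) (g a), f2 z = 0 /\ cseg (g c1) (g d1) (g b)
    | f2 z = 0 /\ cseg (g c1) (g d1) (g c)].
Proof.
have [[M1 M2 M3 _] [[[f1a f1b] [f2b f2c] [f3c f3a] _] [side1 side3 _ [Eab Eca]]]] := W.
move=> Ec zc z1 z3 z2 z2'.
have [[h1 h3]|h13] := pselect (0 < f1 (g c1) /\ 0 < f3 (g c1)).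
  by constructor 1; split=> //; slra.
have dis : f1 (g c1) <= 0 \/ f3 (g c1) <= 0.
  by have [|h1] := leP (f1 (g c1)) 0; [left|right; rewrite leNgt; apply/negP => h3; apply: h13].
have [m [hm m1 m3 m0]] := exit2 z1 z3 dis.
set q := mix m z (g c1).
have qe : cseg (g c1) (g d1) q.
  case: zc => s [hs ez]; exists ((1 - m) * s); split.
    have : 0 <= (1 - m) * s by apply: mulr_ge0; slra.
    have : 0 <= m * s by apply: mulr_ge0; slra.
    slra.
  by rewrite /q ez /mix /=; congr pair; ring.
move: m1 m3 m0; rewrite -M1 -M3 -/q => q1 q3 q0.
have q2 : f2 z <= f2 q.
  have : 0 <= m * (f2 (g c1) - f2 z) by apply: mulr_ge0; slra.
  by rewrite /q M2; slra.
have dz : 0 <= f2 q by slra.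
case/orP: q0 => /eqP q0.
  case: (cseg_oseg (side1 q q0 dz q3)) => [e|e|oq].
  - by constructor 2; rewrite -e.
  - by constructor 3; rewrite -e; split=> //; rewrite e f2b in q2; slra.
  - case: zc => s [_ ez].
    by case: (E_pl Eab Ec oq qe) => [[e1 e2]|[e1 e2]]; move: z1; rewrite ez M1 -e1 -e2 f1a f1b; slra.
case: (cseg_oseg (side3 q q0 q1 dz)) => [e|e|oq].
- by constructor 4; rewrite -e; split=> //; rewrite e f2c in q2; slra.
- by constructor 2; rewrite -e.
- case: zc => s [_ ez].
  by case: (E_pl Eca Ec oq qe) => [[e1 e2]|[e1 e2]]; move: z3; rewrite ez M3 -e1 -e2 f3a f3c; slra.
Qed.

Lemma higher_end c1 d1 z : cseg (g c1) (g d1) z -> f2 z <= f2 (g c1) \/ f2 z <= f2 (g d1).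
Proof.
have [[_ M2 _ _] _] := W.
case=> s [hs ->]; rewrite M2; case/orP: (le_total (f2 (g d1)) (f2 (g c1))) => h; [left|right].
  have : 0 <= s * (f2 (g c1) - f2 (g d1)) by apply: mulr_ge0; slra.
  slra.
have : 0 <= (1 - s) * (f2 (g d1) - f2 (g c1)) by apply: mulr_ge0; slra.
slra.
Qed.

Lemma edge_through c1 d1 z p x : (forall v, ~ oseg (g x) (g p) (g v)) -> E c1 d1 ->
  cseg (g c1) (g d1) z -> oseg (g x) (g p) z -> cseg (g c1) (g d1) (g x) -> E x p.
Proof.
move=> nv Ec zc zo xc; case: (E_vtx Ec xc) => e; subst x.
  exact: (edge_along nv Ec zo zc).
by apply: (edge_along nv _ zo (cseg_sym zc)); rewrite E_sym.
Qed.

Lemma wedge_ray p t : in_wedge (g p) -> 0 < t < 1 ->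
  [/\ 0 < f1 (mix t (g a) (g p)), 0 < f3 (mix t (g a) (g p)) & f2 (g p) < f2 (mix t (g a) (g p))].
Proof.
have [[M1 _ M3 [S _]] [[[f1a _] _ [_ f3a] _] _]] := W.
move=> [p1 p3 p2] ht; have := S (g p); have := S (mix t (g a) (g p)).
rewrite M1 M3 f1a f3a.
have : 0 < (1 - t) * f1 (g p) by apply: mulr_gt0; slra.
have : 0 < (1 - t) * f3 (g p) by apply: mulr_gt0; slra.
have : 0 < t * f1 (g p) by apply: mulr_gt0; slra.
have : 0 < t * f3 (g p) by apply: mulr_gt0; slra.
by split; slra.
Qed.

(** A vertex of the wedge with largest [f2] would be visible from [a], since a blocking edge would
    have an end in the wedge with larger [f2]. But [a] has no neighbour strictly between [b] and
    [c]. *)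
Lemma wedge_empty v : ~ in_wedge (g v).
Proof.
have [[_ _ _ [S Dc]] [[[f1a _] _ _ _] [_ _ neg3 _]]] := W.
move=> Cv.
have [p [Cp maxp]] := @fin_argmin F V (fun p => in_wedge (g p)) (fun p => - f2 (g p)) (ex_intro _ v Cv).
have [p1 p3 p2] := Cp.
have nv u : ~ oseg (g a) (g p) (g u).
  move=> [t [ht e]]; have [u1 u3 u2] := wedge_ray Cp ht; rewrite -e in u1 u3 u2.
  have : - f2 (g p) <= - f2 (g u) by apply: maxp; split=> //; slra.
  slra.
apply: (neg3 p) => //; apply: contrapT => nE; apply: nE; apply: Hsat => //.
  by move=> e; move: p1; rewrite -e f1a ltxx.
move=> c1 d1 z Ec oz zc.
have [z1 z3 z2] : [/\ 0 < f1 z, 0 < f3 z & f2 (g p) < f2 z].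
  by case: oz => t [ht ->]; apply: wedge_ray.
have z2' : 0 <= f2 z by slra.
have fin c2 d2 : E c2 d2 -> cseg (g c2) (g d2) z -> f2 z <= f2 (g c2) -> False.
  move=> Ec2 zc2 l; case: (walk Ec2 zc2 z1 z3 z2' l) => [Cc|ca|[e _]|[e _]].
  - by have := maxp c2 Cc; slra.
  - by apply: (neg3 p) => //; apply: (edge_through nv Ec2 zc2 oz ca).
  - slra.
  - slra.
by case: (higher_end zc) => l; [apply: (fin c1 d1)|apply: (fin d1 c1) => //; [rewrite E_sym|exact: cseg_sym]].
Qed.

Lemma wedge_no_edge x z : E a x -> cseg (g a) (g x) z -> 0 < f1 z -> 0 < f3 z -> False.
Proof.
have [[M1 _ M3 _] [[[f1a _] _ [_ f3a] _] [_ _ neg3 _]]] := W.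
move=> Eax [s [hs ->]]; rewrite M1 M3 f1a f3a !mulr0 !add0r => h1 h3.
have hs' : 0 <= s by slra.
by apply: (neg3 x) => //; rewrite ltNge; apply/negP => h'; have := mulr_ge0_le0 hs' h'; slra.
Qed.

(** With no vertex in the wedge, an edge blocking [bc] comes from [a] through the cone, which the
    choice of [c] excludes, or passes through [b] or [c] along [bc], which makes [bc] an edge. *)
Lemma wedge_closes : E b c.
Proof.
have [[M1 M2 M3 [S Dc]] [[[f1a f1b] [f2b f2c] [f3c f3a] f3b] [_ _ neg3 _]]] := W.
have base t z : 0 < t < 1 -> z = mix t (g b) (g c) -> [/\ 0 < f1 z, 0 < f3 z & f2 z = 0].
  move=> ht ->; rewrite M1 M2 M3 f1b f2b f2c f3c f3b !mulr0 !add0r addr0.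
  by split=> //; apply: mulr_gt0 => //; slra.
have nvbc u : ~ oseg (g b) (g c) (g u).
  move=> [t [ht e]]; have [h1 h3 h2] := base _ _ ht e.
  by apply: (wedge_empty (v := u)); split=> //; rewrite h2.
apply: contrapT => nE; apply: (nE); apply: Hsat => //.
  by move=> e; move: Dc; rewrite -e f1b ltxx.
move=> c1 d1 z Ec oz zc; have [t [ht ez]] := oz; have [z1 z3 z2] := base _ _ ht ez.
have z2' : 0 <= f2 z by rewrite z2.
have fin c2 d2 : E c2 d2 -> cseg (g c2) (g d2) z -> f2 z <= f2 (g c2) -> E b c.
  move=> Ec2 zc2 l; case: (walk Ec2 zc2 z1 z3 z2' l) => [Cc|ca|[_ cb]|[_ cc]].
  - by case: (wedge_empty Cc).
  - exfalso; case: (E_vtx Ec2 ca) => e.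
      by rewrite -e in Ec2 zc2; apply: (wedge_no_edge Ec2 zc2).
    by rewrite -e in Ec2 zc2; apply: (wedge_no_edge (x := c2) _ (cseg_sym zc2)) => //; rewrite E_sym.
  - exact: (edge_through nvbc Ec2 zc2 oz cb).
  - rewrite E_sym; apply: (@edge_through c2 d2 z b c) => //.
      by move=> u /oseg_sym; exact: nvbc.
    exact: oseg_sym.
by apply: nE; case: (higher_end zc) => l; [apply: (fin c1 d1)|apply: (fin d1 c1) => //; [rewrite E_sym|exact: cseg_sym]].
Qed.

Lemma wedge_triangle u : 0 <= f1 (g u) -> 0 <= f2 (g u) -> 0 <= f3 (g u) -> [|| u == a, u == b | u == c].
Proof.
have [_ [_ [side1 side3 _ [Eab Eca]]]] := W; move=> u1 u2 u3.
have [e|n1] : f1 (g u) = 0 \/ 0 < f1 (g u) by case: (ltgtP 0 (f1 (g u))) u1 => // h _; [right|left].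
  by case: (E_vtx Eab (side1 _ e u2 u3)) => ->; rewrite eqxx ?orbT.
have [e|n3] : f3 (g u) = 0 \/ 0 < f3 (g u) by case: (ltgtP 0 (f3 (g u))) u3 => // h _; [right|left].
  by case: (E_vtx Eca (side3 _ e u1 u2)) => ->; rewrite eqxx ?orbT.
by case: (@wedge_empty u).
Qed.

End Wedge.

Lemma tri_exists a b v : E a b -> 0 < ori a b (g v) -> exists c, tri g E a b c.
Proof.
move=> Eab hv; have [c [Eac D minc]] := angular_min Eab hv.
have Eca : E c a by rewrite E_sym.
have D3 : 0 < ori c a (g b) by rewrite orient_rot.
have W : wedge a b c (orient (g a) (g b)) (orient (g b) (g c)) (orient (g c) (g a)).
  do ![split] => //; try by [move=> *; exact: mix_orient|rewrite /orient; ring].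
  - by move=> p; exact: orient_sum.
  - by move=> q; exact: on_side D.
  - by move=> q; exact: on_side D3.
  - by move=> v' Ev h1; have := minc v' Ev h1; rewrite (orient_swap (g c)); slra.
exists c; apply/and5P; split=> //; first exact: wedge_closes W.
by apply/forallP => u; apply/implyP => /and3P[u1 u2 u3]; apply: wedge_triangle W _ u1 u2 u3.
Qed.

End TriExists.

(** * Statements that hold for all small positive parameters *)

Section Eventually.
Variable F : realFieldType.
Implicit Types (P Q : F -> Prop) (A B C s : F).

(** Stands for the limit at zero from above, so that perturbation arguments work over any ordered
    field; closed under finite conjunctions. *)
Definition ev P := exists e, 0 < e /\ forall s, 0 < s <= e -> P s.

Lemma ev_and P Q : ev P -> ev Q -> ev (fun s => P s /\ Q s).
Proof.
move=> [e [he hP]] [d [hd hQ]]; exists (Num.min e d); split; first by rewrite lt_min he.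
by move=> s; rewrite le_min => /and3P[s0 s1 s2]; split; [apply: hP|apply: hQ]; rewrite s0.
Qed.

Lemma ev_imp P Q : (forall s, 0 < s -> P s -> Q s) -> ev P -> ev Q.
Proof. by move=> h [e [he hP]]; exists e; split=> // s hs; apply: h; [slra|apply: hP]. Qed.

Lemma ev_true P : (forall s, 0 < s -> P s) -> ev P.
Proof. by move=> h; exists 1; split; [slra|move=> s hs; apply: h; slra]. Qed.

Lemma ev_seq (I : eqType) (r : seq I) (P : I -> F -> Prop) :
  (forall i, i \in r -> ev (P i)) -> ev (fun s => forall i, i \in r -> P i s).
Proof.
elim: r => [|x r IH] h; first by apply: ev_true.
have h1 : ev (P x) by apply: h; rewrite mem_head.
have h2 : ev (fun s => forall i, i \in r -> P i s).
  by apply: IH => i ir; apply: h; rewrite inE ir orbT.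
apply: ev_imp (ev_and h1 h2) => s _ [p1 p2] i; rewrite inE => /orP[/eqP ->//|]; exact: p2.
Qed.

Lemma ev_all (I : finType) (P : I -> F -> Prop) :
  (forall i, ev (P i)) -> ev (fun s => forall i, P i s).
Proof.
move=> h; have := @ev_seq I (enum I) P (fun i _ => h i).
by apply: ev_imp => s _ p i; apply: p; rewrite mem_enum.
Qed.

Lemma ev_if (X : Prop) P : (X -> ev P) -> ev (fun s => X -> P s).
Proof.
have [x|nx] := pselect X; first by move=> /(_ x); apply: ev_imp => s _ p _.
by move=> _; apply: ev_true.
Qed.

Lemma ev_ex P : ev P -> exists s, 0 < s /\ P s.
Proof. by move=> [e [he h]]; exists e; split=> //; apply: h; rewrite he lexx. Qed.

Lemma ev_pos A B C : 0 < A -> ev (fun s => 0 < A + s * B + s * s * C).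
Proof.
move=> hA; pose M := `|B| + `|C| + 1.
have Mp : 0 < M by rewrite /M; have := normr_ge0 B; have := normr_ge0 C; slra.
exists (Num.min 1 (A / (2 * M))); split.
  by rewrite lt_min ltr01 divr_gt0 //; slra.
move=> s; rewrite le_min => /and3P[s0 s1]; rewrite ler_pdivlMr; last by slra.
have hB := ler_norm (- B); have hC := ler_norm (- C); rewrite !normrN in hB hC.
have h1 : 0 <= s * (`|B| + B) by apply: mulr_ge0; slra.
have h2 : 0 <= s * (s * (`|C| + C)) by apply: mulr_ge0; [slra|apply: mulr_ge0; slra].
have h3 : 0 <= s * ((1 - s) * `|C|).
  by apply: mulr_ge0; [slra|apply: mulr_ge0; [slra|exact: normr_ge0]].
rewrite /M; nra.
Qed.

Lemma ev_pos_f (f : F -> F) A B C : (forall s, f s = A + s * B + s * s * C) -> 0 < A ->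
  ev (fun s => 0 < f s).
Proof. by move=> h /(@ev_pos A B C); apply: ev_imp => s _; rewrite h. Qed.

Lemma ev_neq A B : (A != 0) || (B != 0) -> ev (fun s => A + s * B != 0).
Proof.
have [->|A0] /= := eqVneq A 0.
  by move=> B0; apply: ev_true => s s0; rewrite add0r mulf_neq0 // gt_eqF.
move=> _; have : 0 < A \/ 0 < - A by case: (ltgtP A 0) A0 => // ? _; [right; slra|left].
case=> /(@ev_pos _); [move=> /(_ B 0)|move=> /(_ (- B) 0)]; apply: ev_imp => s _ h; apply/eqP; slra.
Qed.

End Eventually.

(** * Linear functionals in general position *)

Section Functional.
Variables (F : realFieldType).
Implicit Types (k p : F * F).

Definition fn k p : F := k.1 * p.1 + k.2 * p.2.

Lemma fn_mix k s p p' : fn k (mix s p p') = (1 - s) * fn k p + s * fn k p'.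
Proof. by rewrite /fn /mix /=; ring. Qed.

Lemma sq_pos k : k <> (0, 0) -> 0 < k.1 * k.1 + k.2 * k.2.
Proof.
move=> k0; rewrite -!expr2 lt_def addr_ge0 ?sqr_ge0 // andbT paddr_eq0 ?sqr_ge0 // !sqrf_eq0.
by apply/negP => /andP[/eqP e1 /eqP e2]; apply: k0; apply: pairP.
Qed.

(** Turning [k] slightly towards its perpendicular keeps the finitely many strict inequalities and
    separates every pair, because [k] and its perpendicular do not both vanish on a nonzero
    difference. *)
Lemma generic_fn (V : finType) (g : V -> F * F) k : injective g -> k <> (0, 0) ->
  exists k', (forall u v, fn k (g u) < fn k (g v) -> fn k' (g u) < fn k' (g v)) /\
    injective (fun v => fn k' (g v)).
Proof.
move=> gi k0.
pose kk s : F * F := (k.1 - s * k.2, k.2 + s * k.1).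
have h1 (u v : V) : ev (fun s => fn k (g u) < fn k (g v) -> fn (kk s) (g u) < fn (kk s) (g v)).
  apply: ev_if => h; pose f s := fn (kk s) (g v) - fn (kk s) (g u).
  apply: (@ev_imp F (fun s => 0 < f s)); first by move=> s _; rewrite /f; slra.
  apply: (@ev_pos_f F f (fn k (g v) - fn k (g u))
     (- k.2 * ((g v).1 - (g u).1) + k.1 * ((g v).2 - (g u).2)) 0); last by slra.
  by move=> s; rewrite /f /kk /fn /=; ring.
have h2 (u v : V) : ev (fun s => u != v -> fn (kk s) (g u) != fn (kk s) (g v)).
  apply: ev_if => uv.
  apply: ev_imp (@ev_neq F (fn k (g u) - fn k (g v))
     (- k.2 * ((g u).1 - (g v).1) + k.1 * ((g u).2 - (g v).2)) _).
    by move=> s _ /eqP h; apply/eqP => e; apply: h; move: e; rewrite /fn /kk /=; slra.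
  apply/negPn; rewrite negb_or !negbK; apply/negP => /andP[/eqP e1 /eqP e2].
  pose d1 := (g u).1 - (g v).1; pose d2 := (g u).2 - (g v).2.
  have N := sq_pos k0.
  have e1' : k.1 * d1 + k.2 * d2 = 0 by move: e1; rewrite /fn /d1 /d2; slra.
  have a1 : (k.1 * k.1 + k.2 * k.2) * d1 = 0.
    rewrite (_ : _ * d1 = k.1 * (k.1 * d1 + k.2 * d2) - k.2 * (- k.2 * d1 + k.1 * d2)); last by ring.
    by rewrite e1' e2; ring.
  have a2 : (k.1 * k.1 + k.2 * k.2) * d2 = 0.
    rewrite (_ : _ * d2 = k.2 * (k.1 * d1 + k.2 * d2) + k.1 * (- k.2 * d1 + k.1 * d2)); last by ring.
    by rewrite e1' e2; ring.
  case/eqP: uv; apply: gi; apply: pairP; apply/eqP; rewrite -subr_eq0; apply/eqP.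
    by move/eqP: a1; rewrite mulf_eq0 (gt_eqF N) => /eqP.
  by move/eqP: a2; rewrite mulf_eq0 (gt_eqF N) => /eqP.
have [s [_ [p1 p2]]] := ev_ex (ev_and (ev_all (fun u => ev_all (h1 u))) (ev_all (fun u => ev_all (h2 u)))).
exists (kk s); split; first exact: p1.
move=> u v e; apply/eqP; apply/negPn/negP => n; have := p2 u v n; by rewrite e eqxx.
Qed.

(* The slopes [perp / f] of a finite set in an open half plane cannot increase forever. *)
Lemma half_plane (V : finType) (g : V -> F * F) a (A : V -> Prop) k (sg : F) :
  (forall v, A v -> fn k (g a) < fn k (g v)) ->
  (forall b, A b -> exists c, A c /\ 0 < sg * orient (g a) (g b) (g c)) -> forall v, ~ A v.
Proof.
move=> hf hn v Av.
pose f v := fn k (g v) - fn k (g a).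
pose pp v := k.1 * ((g v).2 - (g a).2) - k.2 * ((g v).1 - (g a).1).
have [b [Ab mb]] := @fin_argmin F V A (fun v => - (sg * pp v / f v)) (ex_intro _ v Av).
have [c [Ac hc]] := hn b Ab.
have fb : 0 < f b by rewrite subr_gt0; apply: hf.
have fc : 0 < f c by rewrite subr_gt0; apply: hf.
have := mb c Ac; rewrite lerN2 ler_pdivrMr // mulrAC ler_pdivlMr // => h.
have N : 0 <= k.1 * k.1 + k.2 * k.2 by rewrite -!expr2 addr_ge0 ?sqr_ge0.
have : sg * pp c * f b - sg * pp b * f c = (k.1 * k.1 + k.2 * k.2) * (sg * orient (g a) (g b) (g c)).
  by rewrite /pp /f /fn /orient; ring.
have [N0|N0] := eqVneq (k.1 * k.1 + k.2 * k.2) 0.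
  move=> _; have : 0 = f b; last by slra.
  move/eqP: N0; rewrite paddr_eq0 -?expr2 ?sqr_ge0 // !sqrf_eq0 => /andP[/eqP e1 /eqP e2].
  by rewrite /f /fn e1 e2; ring.
have : 0 < (k.1 * k.1 + k.2 * k.2) * (sg * orient (g a) (g b) (g c)).
  by apply: mulr_gt0 => //; rewrite lt_def N0.
slra.
Qed.

End Functional.

(** * The cyclic order of the neighbours of an inner vertex *)

Section Rotation.
Variables (F : realFieldType) (V : finType) (g : V -> F * F) (E : rel V).
Implicit Types (a b c d u v w x y o p r : V) (z k : F * F) (A U : V -> Prop).
Hypothesis HP : plane_edges g E.
Hypothesis Hsat : saturated g E.

Local Notation g_inj := (plane_inj HP).
Local Notation E_sym := (plane_sym HP).
Local Notation E_irr := (plane_irr HP).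

Local Notation ori a b p := (orient (g a) (g b) p).
Local Notation T := (tri g E).

Definition inner o p r v := [&& v != o, v != p & v != r].

Definition frame o p r : Prop :=
  [/\ 0 < ori o p (g r), E o p /\ E p r, E r o &
   forall v, inner o p r v -> [/\ 0 < ori o p (g v), 0 < ori p r (g v) & 0 < ori r o (g v)]].

Lemma inner_rot o p r v : inner o p r v = inner p r o v.
Proof. by rewrite /inner; case: (v != o) (v != p) (v != r) => [] [] []. Qed.

Lemma frame_rot o p r : frame o p r -> frame p r o.
Proof.
move=> [h1 [h2 h3] h4 h5]; split=> //; first by rewrite -orient_rot.
by move=> v; rewrite -inner_rot => /h5 [? ? ?]; split.
Qed.

(** [a] is a combination of [o], [p], [r] with positive weights, so with the same weights the
    orientations of these three relative to the line [ab] sum to zero. *)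
Lemma inner_sides o p r a b (sg : F) : frame o p r -> inner o p r a -> a <> b -> sg != 0 ->
  exists v, 0 < sg * ori a b (g v).
Proof.
move=> [D _ _ fr] /fr [h1 h2 h3] ab s0.
apply: contrapT => nx.
have le v : sg * ori a b (g v) <= 0 by rewrite leNgt; apply/negP => h; apply: nx; exists v.
have S : ori p r (g a) * (sg * ori a b (g o)) + ori r o (g a) * (sg * ori a b (g p))
   + ori o p (g a) * (sg * ori a b (g r)) = 0 by rewrite /orient; ring.
have l1 : 0 <= ori p r (g a) * - (sg * ori a b (g o)).
  by apply: mulr_ge0; [slra|have := le o; slra].
have l2 : 0 <= ori r o (g a) * - (sg * ori a b (g p)).
  by apply: mulr_ge0; [slra|have := le p; slra].
have l3 : 0 <= ori o p (g a) * - (sg * ori a b (g r)).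
  by apply: mulr_ge0; [slra|have := le r; slra].
have e1 : ori p r (g a) * (sg * ori a b (g o)) = 0 by slra.
have e2 : ori r o (g a) * (sg * ori a b (g p)) = 0 by slra.
move: e1 e2 => /eqP; rewrite !mulf_eq0 (negPf s0) (gt_eqF h2) /= => /eqP e1 /eqP.
rewrite !mulf_eq0 (negPf s0) (gt_eqF h3) /= => /eqP e2.
have x1 : ori o p (g a) * ((g b).1 - (g a).1) = 0.
  rewrite (_ : _ * _ = ((g o).1 - (g a).1) * ori a b (g p) - ((g p).1 - (g a).1) * ori a b (g o)).
    by rewrite e1 e2; ring.
  by rewrite /orient; ring.
have x2 : ori o p (g a) * ((g b).2 - (g a).2) = 0.
  rewrite (_ : _ * _ = ((g o).2 - (g a).2) * ori a b (g p) - ((g p).2 - (g a).2) * ori a b (g o)).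
    by rewrite e1 e2; ring.
  by rewrite /orient; ring.
apply: ab; apply: g_inj; apply: pairP; apply/eqP; rewrite eq_sym -subr_eq0.
  by move/eqP: x1; rewrite mulf_eq0 (gt_eqF h1).
by move/eqP: x2; rewrite mulf_eq0 (gt_eqF h1).
Qed.

Lemma next_ex o p r a b : frame o p r -> inner o p r a -> E a b -> exists c, T a b c.
Proof.
move=> fr ia ab; have nab : a <> b by move=> e; rewrite e E_irr in ab.
have [v hv] := inner_sides fr ia nab (oner_neq0 F).
by apply: (tri_exists HP Hsat ab (v := v)); slra.
Qed.

Lemma prev_ex o p r a c : frame o p r -> inner o p r a -> E a c -> exists b, T a b c.
Proof.
move=> fr ia ac; have nab : a <> c by move=> e; rewrite e E_irr in ac.
have [v hv] := inner_sides (sg := -1) fr ia nab (ltac:(by rewrite oppr_eq0 oner_neq0)).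
have Eca : E c a by rewrite E_sym.
have [b Tb] : exists b, T c a b.
  by apply: (tri_exists HP Hsat Eca (v := v)); move: hv; rewrite (orient_swap (g c)); slra.
by exists b; apply: tri_rot.
Qed.

Definition up_step k a b c := T a b c /\ fn k (g b) < fn k (g a) < fn k (g c).

(** Without an up-step, the part of [A] below [a] is closed under successors, or the part above
    under predecessors. Turning in one sense within an open half plane must stop, so that part is
    empty; then all of [A] lies in the other half plane, where the same argument applies. *)
Lemma up_step_in k a A : injective (fun v => fn k (g v)) ->
  (forall b, A b -> E a b) -> (exists b, A b) ->
  (forall b, A b -> exists c, A c /\ T a b c) \/ (forall c, A c -> exists b, A b /\ T a b c) ->
  exists b c, [/\ A b, A c & up_step k a b c].
Proof.
move=> ki AE [b0 A0] cl; apply: contrapT => nx.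
have tie v : A v -> (fn k (g v) < fn k (g a)) \/ (fn k (g a) < fn k (g v)).
  move=> Av; case: (ltgtP (fn k (g v)) (fn k (g a))) => h; [by left|by right|].
  by have := AE v Av; rewrite (ki _ _ h) E_irr.
have pos x y : T a x y -> 0 < ori a x (g y) by case/triP.
have nB x y : A x -> A y -> T a x y -> fn k (g x) < fn k (g a) -> fn k (g y) < fn k (g a).
  move=> Ax Ay Txy lx; case: (tie y Ay) => // ly; case: nx; exists x, y; split=> //.
  by split=> //; apply/andP.
have fnN u v : fn (- k.1, - k.2) (g u) < fn (- k.1, - k.2) (g v) <-> fn k (g v) < fn k (g u).
  by rewrite /fn /= !mulNr -!opprD ltrN2.
case: cl => cl.
  have nob v : ~ (A v /\ fn k (g v) < fn k (g a)).
    apply: (@half_plane F V g a (fun v => A v /\ fn k (g v) < fn k (g a)) (- k.1, - k.2) 1).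
      by move=> u [_ h]; apply/fnN.
    move=> b [Ab lb]; have [c [Ac Tc]] := cl b Ab; exists c; split; last by rewrite mul1r; apply: pos.
    by split=> //; apply: nB Tc lb.
  apply: (@half_plane F V g a A k 1 _ _ b0 A0).
    by move=> v Av; case: (tie v Av) => // h; case: (nob v).
  by move=> b Ab; have [c [Ac Tc]] := cl b Ab; exists c; split=> //; rewrite mul1r; apply: pos.
have nob v : ~ (A v /\ fn k (g a) < fn k (g v)).
  apply: (@half_plane F V g a (fun v => A v /\ fn k (g a) < fn k (g v)) k (-1)); first by move=> u [].
  move=> c [Ac lc]; have [b [Ab Tb]] := cl c Ac; exists b; split.
    by split=> //; case: (tie b Ab) => // h; have := nB _ _ Ab Ac Tb h; slra.
  by have := pos _ _ Tb; rewrite /orient; slra.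
apply: (@half_plane F V g a A (- k.1, - k.2) (-1) _ _ b0 A0).
  by move=> v Av; apply/fnN; case: (tie v Av) => // h; case: (nob v).
move=> c Ac; have [b [Ab Tb]] := cl c Ac; exists b; split=> //.
by have := pos _ _ Tb; rewrite /orient; slra.
Qed.

Lemma up_aux (x1 y1 x2 y2 x3 y3 h1 h2 h3 : F) k :
  k.1 * x1 + k.2 * y1 < 0 -> k.1 * x2 + k.2 * y2 < 0 -> 0 < k.1 * x3 + k.2 * y3 ->
  0 < x2 * y3 - y2 * x3 -> 0 < x2 * y1 - y2 * x1 -> 0 < x1 * y3 - y1 * x3.
Proof.
move=> l1 l2 l3 D23 D21.
have : 0 < (- (k.1 * x2 + k.2 * y2)) * (x1 * y3 - y1 * x3).
  rewrite (_ : _ * _ = (- (k.1 * x1 + k.2 * y1)) * (x2 * y3 - y2 * x3) +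
     (k.1 * x3 + k.2 * y3) * (x2 * y1 - y2 * x1)); last by ring.
  by apply: addr_gt0; apply: mulr_gt0; slra.
by rewrite pmulr_rgt0 //; slra.
Qed.

(** The face of an up-step contains the beginning of a fixed one of the two rays from [a] on its
    level line, and faces do not overlap. *)
Lemma up_step_uniq k a b c b' c' : up_step k a b c -> up_step k a b' c' -> b = b' /\ c = c'.
Proof.
move=> [T1 /andP[l1 u1]] [T2 /andP[l2 u2]].
suff e : b = b' by subst b'; split=> //; apply: (tri_uniq HP T1 T2).
have [Eab _ Eca D1 _] := triP T1; have [Eab' _ Eca' D2 _] := triP T2.
have aux x y (z : V) : fn k (g x) < fn k (g a) -> fn k (g y) < fn k (g a) -> fn k (g a) < fn k (g z) ->
   0 < ori a y (g z) -> 0 < ori a y (g x) -> 0 < ori a x (g z).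
  rewrite /fn => lx ly lz h1 h2; apply: (up_aux (k := k) 0 0 0 _ _ _ h1 h2); slra.
case: (ltgtP (ori a b (g b')) 0) => h.
- case: (tri_sector HP T2 Eab); first by move: h; rewrite /orient; slra.
  by apply: (aux b b' c') => //; move: h; rewrite /orient; slra.
- by case: (tri_sector HP T1 Eab' h); apply: (aux b' b c).
- apply: (@same_ray F V g E HP a b b' 0 (- k.1) (- k.2)) => //; move: l1 l2; rewrite /fn; slra.
Qed.

(** Says that the rotation around [a] is a single cycle. A proper set of neighbours closed under
    successors and its complement, closed under predecessors, would each contain an up-step of the
    same functional, but there is only one. *)
Lemma rot_connected o p r a U : frame o p r -> inner o p r a ->
  (exists b, E a b /\ U b) -> (exists b, E a b /\ ~ U b) ->
  exists b c, [/\ T a b c, U b & ~ U c].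
Proof.
move=> fr ia [b0 [Eb0 Ub0]] [c0 [Ec0 Uc0]]; apply: contrapT => nx.
have H b c : T a b c -> U b -> U c by move=> Tb Ub; apply: contrapT => Uc; case: nx; exists b, c.
have [k [_ ki]] := @generic_fn F V g (1, 0) g_inj (ltac:(by case; apply/eqP; exact: oner_neq0)).
have [x1 [y1 [[_ U1] _ s1]]] : exists b c, [/\ E a b /\ U b, E a c /\ U c & up_step k a b c].
  apply: up_step_in => //; [by move=> b []|by exists b0|left=> b [Eb Ub]].
  have [c Tc] := next_ex fr ia Eb; exists c; split=> //; split; last exact: H Tc Ub.
  by case/triP: Tc => _ _; rewrite E_sym.
have [x2 [y2 [[_ U2] _ s2]]] : exists b c, [/\ E a b /\ ~ U b, E a c /\ ~ U c & up_step k a b c].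
  apply: up_step_in => //; [by move=> b []|by exists c0|right=> c [Ec Uc]].
  have [b Tb] := prev_ex fr ia Ec; exists b; split=> //; split; last by move=> /(H _ _ Tb).
  by case/triP: Tb.
by have [e _] := up_step_uniq s1 s2; rewrite -e in U2.
Qed.

(** The inner vertex of [A] farthest from the side [pr] has a neighbour farther still. That
    neighbour is not in [A], hence not inner, and among the corners only [o] is off that side. *)
Lemma climb o p r A a : frame o p r -> inner o p r a -> A a ->
  (forall u v, inner o p r u -> inner o p r v -> A u -> E u v -> A v) ->
  exists2 u, inner o p r u & A u /\ E u o.
Proof.
move=> fr ia Aa cl; apply: contrapT => nx.
pose k : F * F := (- ((g r).2 - (g p).2), (g r).1 - (g p).1).
have [K kE] : exists K, forall v, fn k (g v) = ori p r (g v) + K.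
  by exists (fn k (g p)) => v; rewrite /fn /k /orient /=; ring.
have [m [[im Am] mm]] := @fin_argmin F V (fun v => inner o p r v /\ A v) (fun v => - fn k (g v))
   (ex_intro _ a (conj ia Aa)).
have [D [Eop Epr] Ero inn] := fr.
have gr v : inner o p r v -> fn k (g v) < fn k (g o).
  move=> iv; rewrite !kE; have [h1 h2 h3] := inn v iv; have := orient_sum (g o) (g p) (g r) (g v).
  by move: D; rewrite (orient_rot (g o) (g p) (g r)) => D; rewrite -(orient_rot (g o) (g p) (g r)); slra.
have [w [Emw lw]] := @nbr_above F V g E HP Hsat k.1 k.2 m o (gr m im).
rewrite -!/(fn k _) in lw.
have zp : ori p r (g p) = 0 by rewrite /orient; ring.
have zr : ori p r (g r) = 0 by rewrite /orient; ring.
have [h1 h2 h3] := inn m im.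
have [iw|] := boolP (inner o p r w).
  by have := mm w (conj iw (cl m w im iw Am Emw)); slra.
rewrite /inner !negb_and !negbK => /or3P[/eqP e|/eqP e|/eqP e]; subst w.
- by apply: nx; exists m.
- by move: lw; rewrite !kE zp; slra.
- by move: lw; rewrite !kE zr; slra.
Qed.

End Rotation.

(** * Counting the middle corners of faces for a linear order *)

Section Counting.
Variables (F : realFieldType) (V : finType) (g : V -> F * F) (E : rel V).
Implicit Types (a b c d u v w x y o p r : V) (k : F * F) (A U : V -> Prop) (lt : rel V).
Hypothesis HP : plane_edges g E.
Hypothesis Hsat : saturated g E.

Local Notation g_inj := (plane_inj HP).
Local Notation E_sym := (plane_sym HP).
Local Notation E_irr := (plane_irr HP).

Local Notation ori a b p := (orient (g a) (g b) p).
Local Notation T := (tri g E).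

(** At the corner [o] the neighbours form a fan from [p] to [r] within a half plane, and a walk from
    [p] can stop only at [r]. *)
Lemma outer_chain o p r U : frame g E o p r -> U p -> ~ U r ->
  exists b c, [/\ T o b c, U b & ~ U c].
Proof.
move=> fr Up Ur; apply: contrapT => nx.
have [D [Eop Epr] Ero inn] := fr.
have H b c : T o b c -> U b -> U c by move=> Tb Ub; apply: contrapT => Uc; case: nx; exists b, c.
have nb b : E o b -> b <> r -> 0 < ori o b (g r) /\ 0 <= ori o p (g b).
  move=> Eb br; have [ib|] := boolP (inner o p r b).
    have [h1 h2 h3] := inn b ib; rewrite (orient_rot (g o)) (orient_rot (g b)); split=> //; exact: ltW.
  rewrite /inner !negb_and !negbK => /or3P[/eqP e|/eqP e|/eqP e] //; subst b.
    by rewrite E_irr in Eb.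
  by split=> //; rewrite /orient; slra.
pose k : F * F := ((g r).2 - (g p).2, - ((g r).1 - (g p).1)).
have kE v : fn k (g v) - fn k (g o) = ori o p (g v) + ori o v (g r).
  by rewrite /fn /k /orient /=; ring.
apply: (@half_plane F V g o (fun b => E o b /\ U b) k 1 _ _ p) => //.
  move=> v [Ev Uv]; rewrite -subr_gt0 kE.
  have vr : v <> r by move=> e; subst.
  by have [h1 h2] := nb v Ev vr; slra.
move=> b [Eb Ub]; have br : b <> r by move=> e; subst.
have [h1 _] := nb b Eb br; have [c Tc] := tri_exists HP Hsat Eb h1.
exists c; rewrite mul1r; have [_ _ Eco Dc _] := triP Tc; split=> //; split; first by rewrite E_sym.
exact: H Tc Ub.
Qed.

Definition strict_order lt :=
  [/\ (forall a, lt a a = false), (forall a b c, lt a b -> lt b c -> lt a c) &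
      (forall a b, a <> b -> lt a b \/ lt b a)].

(** [up] and [dn] are the faces in which [a] is the middle corner for [lt], split by the sense in
    which the order passes [a]. *)
Definition up lt a b c := [&& T a b c, lt b a & lt a c].
Definition dn lt a b c := [&& T a b c, lt a b & lt c a].
Definition n_up lt a := #|[set x : V * V | up lt a x.1 x.2]|.
Definition n_dn lt a := #|[set x : V * V | dn lt a x.1 x.2]|.

Lemma card_pairs (P : V -> V -> bool) :
  #|[set x : V * V | P x.1 x.2]| = (\sum_b \sum_c P b c)%N.
Proof.
rewrite pair_bigA /= -sum1dep_card big_mkcond /=; apply: eq_bigr => -[x y] _ /=.
by case: (P x y).
Qed.

Lemma tri_mid lt a b c : strict_order lt ->
  (up lt a b c + dn lt a b c + (up lt b c a + dn lt b c a) + (up lt c a b + dn lt c a b) = T a b c)%N.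
Proof.
move=> [li lt_tr lt_tot].
have r1 : T b c a = T a b c.
  by apply/idP/idP => [h|h]; [do 2 apply: tri_rot|apply: tri_rot].
have r2 : T c a b = T a b c.
  by apply/idP/idP => [h|h]; [apply: tri_rot|do 2 apply: tri_rot].
rewrite /up /dn r1 r2; have [t|] := boolP (T a b c) => //=.
have [Eab Ebc Eca _ _] := triP t.
have nab : a <> b by move=> e; rewrite e E_irr in Eab.
have nbc : b <> c by move=> e; rewrite e E_irr in Ebc.
have nca : c <> a by move=> e; rewrite e E_irr in Eca.
have as_ x y : lt x y -> lt y x = false.
  by move=> h; apply/negP => h'; have := lt_tr _ _ _ h h'; rewrite li.
have tr := lt_tr.
case: (lt_tot _ _ nab) => h1; case: (lt_tot _ _ nbc) => h2; case: (lt_tot _ _ nca) => h3;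
  rewrite ?h1 ?h2 ?h3 ?(as_ _ _ h1) ?(as_ _ _ h2) ?(as_ _ _ h3) //=.
  by have := as_ _ _ (tr _ _ _ h1 h2); rewrite h3.
by have := as_ _ _ (tr _ _ _ h2 h1); rewrite h3.
Qed.

(** Every face has exactly one middle corner, so the total depends on the faces alone and not on
    [lt]. The factor 3 accounts for the three rotations of a face in the sum on the right. *)
Lemma count_mid lt : strict_order lt ->
  (3 * \sum_a (n_up lt a + n_dn lt a) = \sum_a \sum_b \sum_c T a b c)%N.
Proof.
move=> so; pose m a b c := (up lt a b c + dn lt a b c)%N.
have -> : (\sum_a (n_up lt a + n_dn lt a) = \sum_a \sum_b \sum_c m a b c)%N.
  apply: eq_bigr => a _; rewrite /n_up /n_dn !card_pairs -big_split; apply: eq_bigr => b _.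
  by rewrite -big_split.
have R (f : V -> V -> V -> nat) : (\sum_a \sum_b \sum_c f b c a = \sum_a \sum_b \sum_c f a b c)%N.
  rewrite exchange_big /=; apply: eq_bigr => b _; exact: exchange_big.
have -> : (\sum_a \sum_b \sum_c T a b c = \sum_a \sum_b \sum_c (m a b c + m b c a + m c a b))%N.
  by do 3 (apply: eq_bigr => ? _); rewrite /m -(tri_mid _ _ _ so).
have -> : (\sum_a \sum_b \sum_c (m a b c + m b c a + m c a b) =
   \sum_a \sum_b \sum_c m a b c + \sum_a \sum_b \sum_c m b c a + \sum_a \sum_b \sum_c m c a b)%N.
  rewrite -!big_split; apply: eq_bigr => a _; rewrite -!big_split; apply: eq_bigr => b _.
  by rewrite -!big_split.
have -> : (\sum_a \sum_b \sum_c m c a b = \sum_a \sum_b \sum_c m a b c)%N.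
  by rewrite (R (fun a b c => m b c a)) (R m).
by rewrite (R m) !mulSn mul0n addn0 addnA.
Qed.

Definition flanked lt a := (exists b, E a b /\ lt b a) /\ (exists b, E a b /\ lt a b).

Lemma card_set_gt0 (P : V -> V -> bool) b c : P b c -> (0 < #|[set x : V * V | P x.1 x.2]|)%N.
Proof. by move=> h; apply/card_gt0P; exists (b, c); rewrite inE. Qed.

Lemma card_set_le1 (P : V -> V -> bool) :
  (forall b c b' c', P b c -> P b' c' -> b = b' /\ c = c') ->
  (#|[set x : V * V | P x.1 x.2]| <= 1)%N.
Proof.
move=> h; apply/card_le1_eqP => -[b c] [b' c']; rewrite !inE /= => h1 h2.
by have [-> ->] := h _ _ _ _ h1 h2.
Qed.

Lemma steps_ge2 o p r lt a : strict_order lt -> frame g E o p r -> inner o p r a -> flanked lt a ->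
  (0 < n_up lt a)%N /\ (0 < n_dn lt a)%N.
Proof.
move=> [li tr tot] fr ia [[b [Eb lb]] [c [Ec lc]]].
have as_ x y : lt x y -> ~ lt y x.
  by move=> h h'; have := tr _ _ _ h h'; rewrite li.
have ne x y : T x y y = false by apply/negP => /triP[_]; rewrite E_irr.
have s x y : T a x y -> a <> x /\ a <> y.
  by case/triP => e1 _ e2 _ _; split=> e; [move: e1|move: e2]; rewrite e E_irr.
split.
  have [x [y [Txy Ux Uy]]] := @rot_connected F V g E HP Hsat o p r a (fun v => lt v a) fr ia
    (ex_intro _ b (conj Eb lb)) (ex_intro _ c (conj Ec (as_ _ _ lc))).
  apply: (@card_set_gt0 (up lt a) x y); rewrite /up Txy Ux /=.
  by case: (tot a y) => //; case: (s _ _ Txy).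
have [x [y [Txy Ux Uy]]] := @rot_connected F V g E HP Hsat o p r a (fun v => lt a v) fr ia
    (ex_intro _ c (conj Ec lc)) (ex_intro _ b (conj Eb (as_ _ _ lb))).
apply: (@card_set_gt0 (dn lt a) x y); rewrite /dn Txy Ux /=.
by case: (tot a y) => //; case: (s _ _ Txy).
Qed.

(** The middle one of the three corners has the smaller corner at one end of its fan of neighbours
    and the larger corner at the other. *)
Lemma outer_mid o p r lt : strict_order lt -> frame g E o p r ->
  exists m, ~~ inner o p r m /\ (0 < n_up lt m + n_dn lt m)%N.
Proof.
move=> so fr; have [li tr tot] := so.
have as_ x y : lt x y -> ~ lt y x.
  by move=> h h'; have := tr _ _ _ h h'; rewrite li.
have s x y z : T z x y -> z <> x /\ z <> y.
  by case/triP => e1 _ e2 _ _; split=> e; [move: e1|move: e2]; rewrite e E_irr.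
have M o1 p1 r1 : frame g E o1 p1 r1 -> (lt p1 o1 /\ lt o1 r1) \/ (lt o1 p1 /\ lt r1 o1) ->
    (0 < n_up lt o1 + n_dn lt o1)%N.
  move=> fr1 [[h1 h2]|[h1 h2]]; rewrite addn_gt0; apply/orP; [left|right].
    have [x [y [Txy Ux Uy]]] := outer_chain (U := fun v => lt v o1) fr1 h1 (as_ _ _ h2).
    apply: (@card_set_gt0 (up lt o1) x y); rewrite /up Txy Ux /=.
    by case: (tot o1 y) => //; case: (s _ _ _ Txy).
  have [x [y [Txy Ux Uy]]] := outer_chain (U := fun v => lt o1 v) fr1 h1 (as_ _ _ h2).
  apply: (@card_set_gt0 (dn lt o1) x y); rewrite /dn Txy Ux /=.
  by case: (tot o1 y) => //; case: (s _ _ _ Txy).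
have [D [Eop Epr] Ero inn] := fr.
have n1 : o <> p by move=> e; rewrite e E_irr in Eop.
have n2 : p <> r by move=> e; rewrite e E_irr in Epr.
have n3 : r <> o by move=> e; rewrite e E_irr in Ero.
have fr2 := frame_rot fr; have fr3 := frame_rot fr2.
have io : ~~ inner o p r o by rewrite /inner eqxx.
have ip : ~~ inner o p r p by rewrite /inner eqxx andbF.
have ir : ~~ inner o p r r by rewrite /inner eqxx !andbF.
case: (tot _ _ n1) => h1; case: (tot _ _ n2) => h2; case: (tot _ _ n3) => h3.
- by case: (as_ _ _ (tr _ _ _ h1 h2)).
- by exists p; split=> //; apply: (M _ _ _ fr2); right.
- by exists o; split=> //; apply: (M _ _ _ fr); right.
- by exists r; split=> //; apply: (M _ _ _ fr3); left.
- by exists r; split=> //; apply: (M _ _ _ fr3); right.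
- by exists o; split=> //; apply: (M _ _ _ fr); left.
- by exists p; split=> //; apply: (M _ _ _ fr2); left.
- by case: (as_ _ _ (tr _ _ _ h2 h1)).
Qed.

(** Takes the place of Euler's formula as an upper bound on the number of faces. For the order by a
    functional of the drawing [g] itself, each vertex has at most one up-step and one down-step. *)
Lemma gamma_count o p r : frame g E o p r ->
  exists2 lt, strict_order lt &
    forall a, (n_up lt a + n_dn lt a <= 2 * inner o p r a + (a == o))%N.
Proof.
move=> fr; have [D [Eop Epr] Ero inn] := fr.
pose D0 := ori o p (g r).
(* Relative to [o] its value is the barycentric weight of [r] minus that of [p], up to the common
   factor, so [p] is lowest, [r] highest and [o] in between. *)
pose k0 : F * F := (- ((g p).2 - (g o).2) + ((g o).2 - (g r).2), (g p).1 - (g o).1 - ((g o).1 - (g r).1)).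
have kE v : fn k0 (g v) - fn k0 (g o) = ori o p (g v) - ori r o (g v).
  by rewrite /fn /k0 /orient /=; ring.
have op : ori o p (g p) = 0 by rewrite /orient; ring.
have oo : ori o p (g o) = 0 by rewrite /orient; ring.
have ro : ori r o (g o) = 0 by rewrite /orient; ring.
have rr : ori r o (g r) = 0 by rewrite /orient; ring.
have rp : ori r o (g p) = ori o p (g r) by rewrite /orient; ring.
have kp v : v <> p -> fn k0 (g p) < fn k0 (g v).
  move=> vp; have := kE v; have := kE p; rewrite op rp.
  have [iv|] := boolP (inner o p r v).
    have [h1 h2 h3] := inn v iv; have := orient_sum (g o) (g p) (g r) (g v); slra.
  rewrite /inner !negb_and !negbK => /or3P[/eqP e|/eqP e|/eqP e] //; subst v; rewrite ?oo ?ro ?rr; slra.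
have kr v : v <> r -> fn k0 (g v) < fn k0 (g r).
  move=> vr; have := kE v; have := kE r; rewrite rr.
  have [iv|] := boolP (inner o p r v).
    have [h1 h2 h3] := inn v iv; have := orient_sum (g o) (g p) (g r) (g v); slra.
  by rewrite /inner !negb_and !negbK => /or3P[/eqP e|/eqP e|/eqP e] //; subst v; rewrite ?oo ?ro ?op ?rp; slra.
have npr : p <> r by move=> e; rewrite e E_irr in Epr.
have npo : p <> o by move=> e; rewrite e E_irr in Eop.
have nro : r <> o by move=> e; rewrite e E_irr in Ero.
have k00 : k0 <> (0, 0).
  by move=> e; have := kp r (nesym npr); rewrite e /fn /=; slra.
have [k [km ki]] := @generic_fn F V g k0 g_inj k00.
exists (fun a b => fn k (g a) < fn k (g b)).
  split=> [a|a b c|a b ab]; [exact: ltxx|exact: lt_trans|].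
  case: (ltgtP (fn k (g a)) (fn k (g b))) => h; [by left|by right|by case: ab; apply: ki].
set lt := fun a b => _; move=> a.
have U1 : (n_up lt a <= 1)%N.
  apply: card_set_le1 => b c b' c' /and3P[h1 h2 h3] /and3P[h4 h5 h6].
  by apply: (@up_step_uniq F V g E HP k a); split=> //; apply/andP.
have fN u v : fn (- k.1, - k.2) (g u) < fn (- k.1, - k.2) (g v) = (fn k (g v) < fn k (g u)).
  by rewrite /fn /= !mulNr -!opprD ltrN2.
have U2 : (n_dn lt a <= 1)%N.
  apply: card_set_le1 => b c b' c' /and3P[h1 h2 h3] /and3P[h4 h5 h6].
  by apply: (@up_step_uniq F V g E HP (- k.1, - k.2) a); split=> //; rewrite !fN; apply/andP.
have [ia|] := boolP (inner o p r a); first by apply: leq_trans (leq_add U1 U2) _; rewrite muln1 leq_addr.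
have kp' v : ~~ (fn k (g v) < fn k (g p)).
  have [->|/eqP n] := eqVneq v p; first by rewrite ltxx.
  by rewrite -leNgt; apply/ltW/km/kp.
have kr' v : ~~ (fn k (g r) < fn k (g v)).
  have [->|/eqP n] := eqVneq v r; first by rewrite ltxx.
  by rewrite -leNgt; apply/ltW/km/kr.
rewrite muln0 add0n /inner !negb_and !negbK => /or3P[/eqP e|/eqP e|/eqP e]; subst a.
(* All neighbours of [o] lie in the angle [p o r], which is swept counterclockwise from low to high,
   so no down-step occurs at [o]. *)
- rewrite eqxx /=; suff -> : n_dn lt o = 0%N by rewrite addn0.
  apply/eqP; rewrite cards_eq0; apply/eqP/setP => -[b c]; rewrite !inE /=.
  apply/negP => /and3P[t]; rewrite /lt => lb lc.
  have [Eob _ Eco Dt _] := triP t.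
  have wedge v : E o v -> 0 <= ori o p (g v) /\ 0 <= ori r o (g v).
    move=> Ev; have [iv|] := boolP (inner o p r v); first by have [? ? ?] := inn v iv; split; apply: ltW.
    rewrite /inner !negb_and !negbK => /or3P[/eqP e|/eqP e|/eqP e]; subst v; rewrite ?oo ?ro ?op ?rp ?rr.
    + by rewrite E_irr in Ev.
    + by split; slra.
    + by split; slra.
  have [b1 b2] := wedge b Eob; have [c1 c2] := wedge c (ltac:(by rewrite E_sym)).
  have lp : fn k (g p) < fn k (g o) by apply/km/kp/nesym.
  have lr : fn k (g o) < fn k (g r) by apply/km/kr/nesym.
  have eb : D0 * (fn k (g b) - fn k (g o)) = ori r o (g b) * (fn k (g p) - fn k (g o)) +
     ori o p (g b) * (fn k (g r) - fn k (g o)) by rewrite /D0 /fn /orient; ring.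
  have ec : D0 * (fn k (g c) - fn k (g o)) = ori r o (g c) * (fn k (g p) - fn k (g o)) +
     ori o p (g c) * (fn k (g r) - fn k (g o)) by rewrite /D0 /fn /orient; ring.
  have et : D0 * ori o b (g c) = ori r o (g b) * ori o p (g c) - ori o p (g b) * ori r o (g c).
    by rewrite /D0 /orient; ring.
  have t1 : 0 < D0 * (fn k (g b) - fn k (g o)) by apply: mulr_gt0; [exact: D|rewrite subr_gt0].
  have t2 : 0 < D0 * (fn k (g o) - fn k (g c)) by apply: mulr_gt0; [exact: D|rewrite subr_gt0].
  have t3 : 0 < D0 * ori o b (g c) by apply: mulr_gt0.
  move: eb ec et t1 t2 t3; rewrite -/D0.
  move: (D0 * (fn k (g b) - fn k (g o))) (D0 * ori o b (g c)) => Xb Xt eb ec et t1 t2 t3.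
  move: eb et ec b1 b2 c1 c2 t2.
  rewrite (_ : D0 * (fn k (g o) - _) = - (D0 * (fn k (g c) - fn k (g o)))); last by ring.
  move: (D0 * (fn k (g c) - fn k (g o))) (ori r o (g b)) (ori o p (g b)) (ori r o (g c)) (ori o p (g c)).
  move: lp lr; rewrite -(subr_lt0 (fn k (g o))) -(subr_gt0 (fn k (g o))).
  move: (fn k (g p) - fn k (g o)) (fn k (g r) - fn k (g o)) => P R P0 R0 Xc B1 B2 C1 C2 eb et ec b1 b2 c1 c2 t2.
  have w1 : 0 <= C2 * Xb by apply: mulr_ge0 => //; exact: ltW.
  have w2 : 0 <= B2 * - Xc by apply: mulr_ge0 => //; exact: ltW.
  have w3 : 0 < Xt * - P by apply: mulr_gt0; rewrite ?oppr_gt0.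
  have : C2 * Xb + B2 * - Xc = Xt * P by rewrite eb ec et; ring.
  slra.
- have -> : (n_up lt p = 0)%N.
    apply/eqP; rewrite cards_eq0; apply/eqP/setP => -[b c]; rewrite !inE /=.
    by apply/negP => /and3P[_ h _]; move/negP: (kp' b); apply; exact: h.
  have -> // : (n_dn lt p = 0)%N.
  apply/eqP; rewrite cards_eq0; apply/eqP/setP => -[b c]; rewrite !inE /=.
  by apply/negP => /and3P[_ _ h]; move/negP: (kp' c); apply; exact: h.
- have -> : (n_up lt r = 0)%N.
    apply/eqP; rewrite cards_eq0; apply/eqP/setP => -[b c]; rewrite !inE /=.
    by apply/negP => /and3P[_ _ h]; move/negP: (kr' c); apply; exact: h.
  have -> // : (n_dn lt r = 0)%N.
  apply/eqP; rewrite cards_eq0; apply/eqP/setP => -[b c]; rewrite !inE /=.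
  by apply/negP => /and3P[_ h _]; move/negP: (kr' b); apply; exact: h.
Qed.

Lemma sum_eq_le (f h : V -> nat) : (forall a, h a <= f a)%N -> (\sum_a f a <= \sum_a h a)%N ->
  forall a, f a = h a.
Proof.
move=> hf le a; apply/eqP; rewrite eqn_leq hf andbT leqNgt; apply/negP => l.
have : (\sum_a h a < \sum_a f a)%N.
  rewrite (bigD1 a) //= [in X in (_ < X)%N](bigD1 a) //= -addSn; apply: leq_add => //.
  by apply: leq_sum => b _; apply: hf.
by rewrite ltnNge le.
Qed.

(** If every inner vertex is flanked, the total is at least two for each inner vertex plus one for
    the middle corner. This is the upper bound given by the geometric order, so equality holds at
    every vertex. *)
Lemma steps_uniq o p r lt a : strict_order lt -> frame g E o p r ->
  (forall v, inner o p r v -> flanked lt v) -> inner o p r a ->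
  n_up lt a = 1%N /\ n_dn lt a = 1%N.
Proof.
move=> so fr hf ia.
have [m [im mid]] := outer_mid so fr.
have [lt0 so0 le0] := gamma_count fr.
have S : (\sum_a (n_up lt a + n_dn lt a) = \sum_a (n_up lt0 a + n_dn lt0 a))%N.
  by apply/eqP; rewrite -(@eqn_pmul2l 3) // !count_mid.
have delta x : (\sum_a (a == x :> V) = 1)%N.
  by rewrite (bigD1 x) //= eqxx big1 // => i /negPf ->.
have := @sum_eq_le (fun a => n_up lt a + n_dn lt a)%N (fun a => 2 * inner o p r a + (a == m))%N.
move=> H; have : (n_up lt a + n_dn lt a = 2 * inner o p r a + (a == m))%N.
  apply: H => [v|].
    have [iv|niv] := boolP (inner o p r v).
      have [h1 h2] := steps_ge2 so fr iv (hf v iv).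
      have -> : (v == m) = false by apply/negP => /eqP e; move: im; rewrite -e iv.
      by rewrite addn0 muln1; apply: (leq_add h1 h2).
    by rewrite muln0 add0n; case: eqP => // ->.
  rewrite S; apply: (@leq_trans (\sum_v (2 * inner o p r v + (v == o)))%N).
    by apply: leq_sum => i _; exact: le0.
  by rewrite !big_split /= !delta.
have -> : (a == m) = false by apply/negP => /eqP e; move: im; rewrite -e ia.
rewrite ia addn0 muln1; have [] := steps_ge2 so fr ia (hf a ia).
by case: (n_up lt a) (n_dn lt a) => [|[|n]] [|[|m']] // _ _; rewrite ?addSn ?addnS.
Qed.

End Counting.

(** * A map satisfying the weak hull condition keeps the orientation of every face *)

Section Convex.
Variables (F : realFieldType) (V : finType) (g : V -> F * F) (E : rel V) (q : V -> F * F).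
Variables (o p r : V).
Implicit Types (a b c d u v w x y : V) (k f : F * F) (A U : V -> Prop).
Hypothesis HP : plane_edges g E.
Hypothesis Hsat : saturated g E.
Hypothesis fr : frame g E o p r.
Local Notation inn := (inner o p r).

Local Notation g_inj := (plane_inj HP).
Local Notation E_sym := (plane_sym HP).
Local Notation E_irr := (plane_irr HP).

Local Notation ori a b p := (orient (g a) (g b) p).
Local Notation oriq a b c := (orient (q a) (q b) (q c)).
Local Notation T := (tri g E).

(** Weak enough to hold for averages of the neighbours; level neighbourhoods are excluded
    afterwards, by the nondegeneracy of the outer triangle. *)
Definition weak_hull :=
  forall a k, inn a -> (forall b, E a b -> fn k (q b) = fn k (q a)) \/
    ((exists b, E a b /\ fn k (q b) < fn k (q a)) /\ (exists b, E a b /\ fn k (q a) < fn k (q b))).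

Hypothesis hull : weak_hull.
Hypothesis oq : 0 < oriq o p r.

(** Ties between new positions are broken by a generic functional of the original ones, so that the
    order is strict and total whatever coincidences [q] may have. *)
Definition lex k f : rel V := fun a b =>
  (fn k (q a) < fn k (q b)) || ((fn k (q a) == fn k (q b)) && (fn f (g a) < fn f (g b))).

Lemma lex_strict k f : injective (fun v => fn f (g v)) -> strict_order (lex k f).
Proof.
move=> fi; rewrite /lex; split=> [a|a b c|a b ab]; first by rewrite !ltxx andbF.
  case/orP=> [l1|/andP[/eqP e1 l1]]; case/orP=> [l2|/andP[/eqP e2 l2]]; apply/orP.
  - by left; apply: lt_trans l2.
  - by left; rewrite -e2.
  - by left; rewrite e1.
  - by right; rewrite e1 e2 eqxx (lt_trans l1 l2).
case: (ltgtP (fn k (q a)) (fn k (q b))) => h /=; [by left|by right|].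
by case: (ltgtP (fn f (g a)) (fn f (g b))) => h' /=; [by left|by right|case: ab; apply: fi].
Qed.

Lemma inner_between a f : inn a -> injective (fun v => fn f (g v)) ->
  exists v, fn f (g a) < fn f (g v).
Proof.
move=> ia fi; have [D _ _ fr'] := fr; have [h1 h2 h3] := fr' a ia.
apply: contrapT => nx.
have le v : v <> a -> 0 < fn f (g a) - fn f (g v).
  move=> va; rewrite subr_gt0; case: (ltgtP (fn f (g v)) (fn f (g a))) => // h.
    by case: nx; exists v.
  by case: va; apply: fi.
have no : o <> a by move=> e; move: ia; rewrite /inner e eqxx.
have np : p <> a by move=> e; move: ia; rewrite /inner e eqxx andbF.
have nr : r <> a by move=> e; move: ia; rewrite /inner e eqxx !andbF.
have l1 := mulr_gt0 h2 (le o no); have l2 := mulr_gt0 h3 (le p np); have l3 := mulr_gt0 h1 (le r nr).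
have : ori p r (g a) * (fn f (g a) - fn f (g o)) + ori r o (g a) * (fn f (g a) - fn f (g p)) +
   ori o p (g a) * (fn f (g a) - fn f (g r)) = 0 by rewrite /orient /fn; ring.
slra.
Qed.

Lemma fnN k (x : F * F) : fn (- k.1, - k.2) x = - fn k x.
Proof. by rewrite /fn /=; ring. Qed.

Lemma fnN_inj f : injective (fun v => fn f (g v)) -> injective (fun v => fn (- f.1, - f.2) (g v)).
Proof. by move=> fi u v; rewrite !fnN => /oppr_inj; exact: fi. Qed.

(** A vertex level with all its neighbours is flanked through the tie-breaker, since in the maximal
    plane graph it has neighbours on both sides. *)
Lemma lex_flanked k f a : injective (fun v => fn f (g v)) -> inn a -> flanked E (lex k f) a.
Proof.
move=> fi ia; case: (hull k ia) => [fl|[[b [Eb lb]] [c [Ec lc]]]]; last first.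
  by split; [exists b|exists c]; rewrite /lex ?lb ?lc.
have [v lv] := inner_between ia fi.
have [w lw] := inner_between ia (fnN_inj fi).
have [b [Eb lb]] := @nbr_above F V g E HP Hsat f.1 f.2 a v lv.
have [c [Ec lc]] := @nbr_above F V g E HP Hsat (- f.1) (- f.2) a w lw.
move: lc; rewrite -!/(fn (- f.1, - f.2) _) !fnN ltrN2 => lc.
by split; [exists c|exists b]; rewrite /lex fl // eqxx /= ?lc ?lb orbT.
Qed.

Lemma up_lex k f a b c b' c' : injective (fun v => fn f (g v)) -> inn a ->
  up g E (lex k f) a b c -> up g E (lex k f) a b' c' -> b = b' /\ c = c'.
Proof.
move=> fi ia h h'.
have [] := @steps_uniq F V g E HP Hsat o p r (lex k f) a (lex_strict k fi) fr (fun v => lex_flanked k fi) ia.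
move=> /eqP/cards1P[x ex] _.
have : (b, c) \in [set x] by rewrite -ex inE.
have : (b', c') \in [set x] by rewrite -ex inE.
by rewrite !inE => /eqP <- /eqP [].
Qed.

Lemma dn_lex k f a b c b' c' : injective (fun v => fn f (g v)) -> inn a ->
  dn g E (lex k f) a b c -> dn g E (lex k f) a b' c' -> b = b' /\ c = c'.
Proof.
move=> fi ia h h'.
have [] := @steps_uniq F V g E HP Hsat o p r (lex k f) a (lex_strict k fi) fr (fun v => lex_flanked k fi) ia.
move=> _ /eqP/cards1P[x ex].
have : (b, c) \in [set x] by rewrite -ex inE.
have : (b', c') \in [set x] by rewrite -ex inE.
by rewrite !inE => /eqP <- /eqP [].
Qed.

Lemma gfunctional k0 b a : fn k0 (g b) < fn k0 (g a) ->
  exists f, [/\ injective (fun v => fn f (g v)) &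
    forall u v, fn k0 (g u) < fn k0 (g v) -> fn f (g u) < fn f (g v)].
Proof.
move=> l; have [|f [fm fi]] := @generic_fn F V g k0 g_inj; last by exists f.
by move=> e; move: l; rewrite e /fn /=; slra.
Qed.

Definition nx a b := odflt b [pick c | T a b c].

Lemma nxE a b c : T a b c -> nx a b = c.
Proof.
rewrite /nx; case: pickP => [d Td Tc|/(_ c) -> //] /=; exact: (tri_uniq HP Td Tc).
Qed.

Lemma tri_nbr a b c : T a b c -> E a b /\ E a c.
Proof. by case/triP => ? _; rewrite E_sym. Qed.

(** The iteration starts right after [x], so taking the least [n] ensures that it has not come round
    to [x] before reaching [z]. *)
Lemma walk_to a x y z : inn a -> T a x y -> E a z ->
  exists n, z = iter n (nx a) y /\ forall m, (m < n)%N -> iter m (nx a) y <> x.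
Proof.
move=> ia Txy Ez; have [_ Ey] := tri_nbr Txy.
have [n0 e0] : exists n, z = iter n (nx a) y.
  apply: contrapT => nz.
  have [b [c [Tbc [n en] Uc]]] := @rot_connected F V g E HP Hsat o p r a
    (fun v => exists n, v = iter n (nx a) y) fr ia (ex_intro _ y (conj Ey (ex_intro _ 0%N erefl)))
    (ex_intro _ z (conj Ez nz)).
  by case: Uc; exists n.+1; rewrite /= -en (nxE Tbc).
have ex : exists n, z == iter n (nx a) y by exists n0; apply/eqP.
exists (ex_minn ex); case: ex_minnP => n /eqP en mn; split=> // m lt e.
have := mn (n - m.+1)%N; rewrite leqNgt => /(_ (ltac:(apply/eqP; rewrite en -{1}(subnK lt) iterD /= e (nxE Txy) //))).
by rewrite ltn_subrL (leq_ltn_trans _ lt).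
Qed.

(* If [a], [x], [y] are level then breaking the ties one way makes [(x, y)] the unique up-step
   at [a], and the other way the unique down-step; so the vertices strictly above [a] both
   precede and follow those strictly below. *)
Lemma level_flat k a x y : inn a -> T a x y -> fn k (q x) = fn k (q a) -> fn k (q y) = fn k (q a) ->
  forall b, E a b -> fn k (q b) = fn k (q a).
Proof.
move=> ia Txy ex ey; case: (hull k ia) => // -[[em [Em lm]] [ep [Ep lp]]].
have [_ _ _ D _] := triP Txy.
pose k0 : F * F := (- ((g x).2 - (g a).2) + ((g a).2 - (g y).2), (g x).1 - (g a).1 - ((g a).1 - (g y).1)).
have kE v : fn k0 (g v) - fn k0 (g a) = ori a x (g v) - ori y a (g v).
  by rewrite /fn /k0 /orient /=; ring.
have lx0 : fn k0 (g x) < fn k0 (g a).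
  have := kE x; have -> : ori a x (g x) = 0 by rewrite /orient; ring.
  by have -> : ori y a (g x) = ori a x (g y) by [rewrite /orient; ring]; slra.
have ly0 : fn k0 (g a) < fn k0 (g y).
  have := kE y; have -> : ori y a (g y) = 0 by rewrite /orient; ring.
  slra.
have [f [fi fm]] := gfunctional lx0; have lx := fm _ _ lx0; have ly := fm _ _ ly0.
have fi' := fnN_inj fi; set f' := (- f.1, - f.2) in fi'.
have u1 : up g E (lex k f) a x y by rewrite /up Txy /lex ex ey eqxx lx ly !orbT.
have d2 : dn g E (lex k f') a x y.
  by rewrite /dn Txy /lex ex ey eqxx /f' !fnN !ltrN2 lx ly !orbT.
have [nm [im hm]] := walk_to ia Txy Em; have [np [ip hp]] := walk_to ia Txy Ep.
have [_ Ey] := tri_nbr Txy.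
have itE n : E a (iter n (nx a) y).
  elim: n => //= n IH; have [c Tc] := next_ex HP Hsat fr ia IH.
  by rewrite (nxE Tc); case: (tri_nbr Tc).
have stp n : T a (iter n (nx a) y) (iter n.+1 (nx a) y).
  by have [c Tc] := next_ex HP Hsat fr ia (itE n); rewrite /= (nxE Tc).
have tot (f0 : F * F) (fi0 : injective (fun v => fn f0 (g v))) v : E a v -> lex k f0 v a \/ lex k f0 a v.
  have [_ _ tt] := lex_strict k fi0; move=> Ev; apply: tt => e; by rewrite e E_irr in Ev.
exfalso; have [le|lt] := leqP nm np.
  have : lex k f (iter np (nx a) y) a.
    rewrite -(subnKC le); have : (np - nm <= np - nm)%N by [].
    elim: {1 3}(np - nm)%N => [|n IH] hn; first by rewrite addn0 -im /lex lm.
    have {}IH := IH (ltnW hn); rewrite addnS.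
    case: (tot f fi _ (itE (nm + n).+1)) => // l.
    have us : up g E (lex k f) a (iter (nm + n) (nx a) y) (iter (nm + n).+1 (nx a) y).
      by rewrite /up stp IH l.
    have [e _] := up_lex fi ia u1 us.
    by case: (hp (nm + n)%N) => //; rewrite -ltn_subRL.
  by rewrite -ip /lex; move: lp; case: ltgtP.
have : lex k f' a (iter nm (nx a) y).
  have le := ltnW lt; rewrite -(subnKC le); have : (nm - np <= nm - np)%N by [].
  elim: {1 3}(nm - np)%N => [|n IH] hn; first by rewrite addn0 -ip /lex lp.
  have {}IH := IH (ltnW hn); rewrite addnS.
  case: (tot f' fi' _ (itE (np + n).+1)) => // l.
  have us : dn g E (lex k f') a (iter (np + n) (nx a) y) (iter (np + n).+1 (nx a) y).
    by rewrite /dn stp IH l.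
  have [e _] := dn_lex fi' ia d2 us.
  by case: (hm (np + n)%N) => //; rewrite -ltn_subRL.
by rewrite -im /lex; move: lm; case: ltgtP.
Qed.

(** Flatness spreads: an inner neighbour of a flat vertex has a face whose three corners are level,
    hence is flat too. It reaches the corners [o], [p], [r], which would then be collinear in
    [q]. *)
Lemma no_flat k a : inn a -> k <> (0, 0) -> ~ (forall b, E a b -> fn k (q b) = fn k (q a)).
Proof.
move=> ia k0 fl.
pose A v := (forall b, E v b -> fn k (q b) = fn k (q v)) /\ fn k (q v) = fn k (q a).
have Aa : A a by [].
have cl u v : inn u -> inn v -> A u -> E u v -> A v.
  move=> iu iv [fu eu] Euv; have [c Tc] := next_ex HP Hsat fr iu Euv.
  have [_ Euc] := tri_nbr Tc.
  split; last by rewrite fu.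
  by apply: (level_flat iv (tri_rot Tc)); rewrite (fu v) // fu.
have top x : (exists2 u, inn u & A u /\ E u x) -> fn k (q x) = fn k (q a).
  by case=> u _ [[fu <-] Eux]; apply: fu.
have fr2 := frame_rot fr; have fr3 := frame_rot fr2.
have e1 : fn k (q o) = fn k (q a) by apply/top/(climb HP Hsat fr ia Aa).
have i2 v : inner p r o v = inn v by rewrite (inner_rot o p r).
have i3 v : inner r o p v = inn v by rewrite -(inner_rot p r o) i2.
have e2 : fn k (q p) = fn k (q a).
  apply/top; have [||u iu Au] := climb HP Hsat fr2 (a := a) (A := A) _ Aa.
  - by rewrite i2.
  - by move=> u v; rewrite !i2; apply: cl.
  by exists u => //; rewrite -i2.
have e3 : fn k (q r) = fn k (q a).
  apply/top; have [||u iu Au] := climb HP Hsat fr3 (a := a) (A := A) _ Aa.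
  - by rewrite i3.
  - by move=> u v; rewrite !i3; apply: cl.
  by exists u => //; rewrite -i3.
have N := sq_pos k0; have := mulr_gt0 N oq.
have -> : (k.1 * k.1 + k.2 * k.2) * oriq o p r =
  (fn k (q r) - fn k (q o)) * (k.1 * ((q p).2 - (q o).2) - k.2 * ((q p).1 - (q o).1)) * -1 +
  (fn k (q p) - fn k (q o)) * (k.1 * ((q r).2 - (q o).2) - k.2 * ((q r).1 - (q o).1)).
  by rewrite /orient /fn; ring.
by rewrite e1 e2 e3 !subrr !mul0r addr0 ltxx.
Qed.

(** A degenerate face is level for some nonzero functional, which makes [a] flat. *)
Lemma tri_nondeg a x y : inn a -> T a x y -> oriq a x y <> 0.
Proof.
move=> ia Txy e.
have [k [k0 e1 e2]] : exists k, [/\ k <> (0, 0), fn k (q x) = fn k (q a) & fn k (q y) = fn k (q a)].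
  have [ex|nx] := pselect (q x = q a); last first.
    exists (- ((q x).2 - (q a).2), (q x).1 - (q a).1); split.
    - by move=> [e1 e2]; apply: nx; apply: pairP; slra.
    - by rewrite /fn /=; ring.
    - by move: e; rewrite /orient /fn /=; slra.
  have [ey|ny] := pselect (q y = q a); last first.
    exists (- ((q y).2 - (q a).2), (q y).1 - (q a).1); split.
    - by move=> [e1 e2]; apply: ny; apply: pairP; slra.
    - by rewrite ex.
    - by rewrite /fn /=; ring.
  exists (1, 0); split; rewrite ?ex ?ey //.
  by case; apply/eqP; exact: oner_neq0.
exact: (no_flat ia k0 (level_flat ia Txy e1 e2)).
Qed.

(** If the faces beside [ab] were folded onto each other, [c] and [d] would lie on one side of the
    line [ab] in [q]. With the tie broken so that [b] is below [a], there is an up-step from [b] and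
    a down-step into [b]; a neighbour strictly below then forces a second down-step. *)
Lemma tri_opposite a b c d : inn a -> T a b c -> T a d b -> 0 < oriq a b c -> 0 < oriq a d b.
Proof.
move=> ia Tbc Tdb hc; rewrite ltNge; apply/negP => hd.
have {}hd : 0 < oriq a b d.
  have := tri_nondeg ia Tdb; have e : oriq a b d = - oriq a d b by rewrite /orient; ring.
  by rewrite e oppr_gt0 lt_neqAle hd andbT => /eqP.
pose k : F * F := (- ((q b).2 - (q a).2), (q b).1 - (q a).1).
have kE v : fn k (q v) = fn k (q a) + oriq a b v by rewrite /fn /k /orient /=; ring.
have eb : fn k (q b) = fn k (q a) by rewrite (kE b) /orient; ring.
have lc : fn k (q a) < fn k (q c) by rewrite (kE c); slra.
have ld : fn k (q a) < fn k (q d) by rewrite (kE d); slra.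
have [e [Ee le]] : exists e, E a e /\ fn k (q e) < fn k (q a).
  case: (hull k ia) => [fl|[] //]; move: lc; rewrite fl ?ltxx //; by case: (tri_nbr Tbc).
have [Eab _] := tri_nbr Tbc.
have gab : g b <> g a by move=> /g_inj e'; rewrite e' E_irr in Eab.
pose k0 : F * F := ((g a).1 - (g b).1, (g a).2 - (g b).2).
have k00 : k0 <> (0, 0) by move=> [e1 e2]; apply: gab; apply: pairP; slra.
have l0 : fn k0 (g b) < fn k0 (g a).
  by have := sq_pos k00; rewrite /fn /k0 /=; slra.
have [f [fi fm]] := gfunctional l0; have lb := fm _ _ l0.
have up1 : up g E (lex k f) a b c by rewrite /up Tbc /lex eb eqxx lb orbT lc.
have dn1 : dn g E (lex k f) a d b by rewrite /dn Tdb /lex eb eqxx lb orbT ld.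
have [li tr tt] := lex_strict k fi.
have eb' : e <> b by move=> e'; move: le; rewrite e' eb ltxx.
pose U v := ~ (lex k f v a /\ v <> b).
have Ub : U b by case.
have Ue : ~ U e by apply; split=> //; rewrite /lex le.
have [b1 [c1 [T1 nU1 U1]]] := @rot_connected F V g E HP Hsat o p r a U fr ia
   (ex_intro _ b (conj Eab Ub)) (ex_intro _ e (conj Ee Ue)).
have [V1 n1] := contrapT U1.
have [E1 _] := tri_nbr T1.
have [e1|n] := pselect (b1 = b).
  subst b1; have ec := tri_uniq HP T1 Tbc; subst c1.
  by move: V1; rewrite /lex; move: lc; case: ltgtP.
have l1 : lex k f a b1.
  have [] := tt a b1 => //; first by move=> e'; rewrite e' E_irr in E1.
  by move=> h; case: nU1.
have [_ e2] := dn_lex fi ia dn1 (ltac:(by rewrite /dn T1 l1 V1) : dn g E (lex k f) a b1 c1).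
by case: n1.
Qed.

Lemma same_sign a b c b' c' : inn a -> T a b c -> T a b' c' -> 0 < oriq a b c -> 0 < oriq a b' c'.
Proof.
move=> ia Tb Tb' h; apply: contrapT => h'.
pose U v := exists w, T a v w /\ 0 < oriq a v w.
have Ub : U b by exists c.
have Ub' : ~ U b' by move=> [w [Tw hw]]; apply: h'; rewrite (tri_uniq HP Tb' Tw).
have [b1 [c1 [T1 U1 nU1]]] := @rot_connected F V g E HP Hsat o p r a (fun v => ~ U v) fr ia
   (ex_intro _ b' (conj (tri_nbr Tb').1 Ub')) (ex_intro _ b (conj (tri_nbr Tb).1 (fun n => n Ub))).
have [w [Tw hw]] := contrapT nU1.
by apply: U1; exists c1; split=> //; apply: (tri_opposite ia Tw T1).
Qed.

(** A vertex extremal beyond the side [op] would be inner, and the weak hull condition would make it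
    flat. *)
Lemma outer_side v : 0 <= oriq o p v.
Proof.
pose k : F * F := (- ((q p).2 - (q o).2), (q p).1 - (q o).1).
have kE u : fn k (q u) = fn k (q o) + oriq o p u by rewrite /fn /k /orient /=; ring.
have [m [_ mm]] := @fin_argmin F V (fun v => True) (fun v => oriq o p v) (ex_intro _ v I).
apply: le_trans (mm v I); rewrite leNgt; apply/negP => neg.
have k0 : k <> (0, 0).
  by move=> [e1 e2]; move: oq; rewrite /orient; rewrite e2 mul0r -mulNr e1 mul0r addr0 ltxx.
have im : inn m.
  apply/and3P; split; apply/eqP => e; subst m.
  - by move: neg; rewrite /orient; slra.
  - by move: neg; rewrite /orient; slra.
  - by move: neg oq; slra.
apply: (no_flat im k0); case: (hull k im) => // -[[b [_ lb]] _].
by move: lb; rewrite (kE b) (kE m); have := mm b I; slra.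
Qed.

(** All faces at an inner vertex have one sign, so a wrong face spoils every adjacent inner vertex
    and, by climbing, a neighbour of [o]. Turning around [o] towards [p] the faces stay wrong; the
    turn cannot go on forever, and at [p] a wrong face contradicts [outer_side]. *)
Lemma inner_tri_pos a b c : inn a -> T a b c -> 0 < oriq a b c.
Proof.
pose bad u := exists x y, T u x y /\ oriq u x y <= 0.
move=> ia Tabc; rewrite ltNge; apply/negP => hb.
have bada : bad a by exists b, c.
have allb u x y : inn u -> bad u -> T u x y -> oriq u x y <= 0.
  move=> iu [x' [y' [T' h']]] Txy; rewrite leNgt; apply/negP => h.
  by have := same_sign iu Txy T' h; rewrite ltNge h'.
have cl u v : inn u -> inn v -> bad u -> E u v -> bad v.
  move=> iu iv bu Euv; have [c' Tc'] := next_ex HP Hsat fr iu Euv.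
  exists c', u; split; first exact: tri_rot.
  by rewrite -orient_rot; apply: allb Tc'.
have [u iu [bu Euo]] := climb HP Hsat fr ia bada cl.
have [D [Eop Epr] Ero ins] := fr.
have [w Tw] := prev_ex HP Hsat fr iu Euo.
have Tou : T o u w by do 2 apply: tri_rot.
have bouw : oriq o u w <= 0 by rewrite orient_rot; apply: allb Tw.
have no : o <> p by move=> e; rewrite e E_irr in Eop.
have nop x y : T o x y -> oriq o x y <= 0 -> x <> p.
  move=> Txy h e; subst x.
  have [Eo1 Epy Eyo Dt emp] := triP Txy.
  have [iy|] := boolP (inn y).
    have Ty : T y o p by do 2 apply: tri_rot.
    have := tri_nondeg iy Ty; have := outer_side y; rewrite (orient_rot (q y)) => h1 h2.
    by apply: h2; apply/eqP; rewrite eq_le h1 h.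
  rewrite /inner !negb_and !negbK => /or3P[/eqP e|/eqP e|/eqP e]; subst y.
  - by rewrite E_irr in Eyo.
  - by rewrite E_irr in Epy.
  - have [h1 h2 h3] := ins u iu.
    by case: (emp u (ltW h1) (ltW h2) (ltW h3)) => e; move: iu; rewrite e /inner eqxx ?andbF.
pose k : F * F := ((g r).2 - (g p).2, - ((g r).1 - (g p).1)).
have kE v : fn k (g v) = fn k (g o) + (ori o p (g v) + ori r o (g v)).
  by rewrite /fn /k /orient /=; ring.
pose A v := inn v /\ exists y, T o v y /\ oriq o v y <= 0.
apply: (@half_plane F V g o A k (-1) _ _ u).
- by move=> v [iv _]; rewrite (kE v); have [? ? ?] := ins v iv; slra.
- move=> v [iv [y [Tvy hvy]]].
  have Evo : E v o by rewrite E_sym; case: (tri_nbr Tvy).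
  have [_ h2 h3] := ins v iv.
  have nvp : v <> p := nop _ _ Tvy hvy.
  have [h1 _ _] := ins v iv.
  have [d Td] : exists d, T v o d.
    by apply: (tri_exists HP Hsat Evo (v := p)); rewrite orient_rot.
  have Tod : T o d v by apply: tri_rot.
  have bv : bad v.
    by exists y, o; split; [apply: tri_rot|rewrite -orient_rot].
  have hd : oriq o d v <= 0 by rewrite -orient_rot; apply: allb Td.
  have ndp := nop _ _ Tod hd.
  have [Eod Edv _ Dd _] := triP Tod.
  exists d; split; last by move: Dd; rewrite /orient; slra.
  split; last by exists v.
  apply/and3P; split; apply/eqP => e; subst d => //.
    by rewrite E_irr in Eod.
  by move: Dd; rewrite /orient; move: h3; rewrite /orient; slra.
- by split=> //; exists w.
Qed.

Lemma tri_pos a b c : T a b c -> 0 < oriq a b c.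
Proof.
move=> Tabc; have [ia|na] := boolP (inn a); first exact: inner_tri_pos.
have [ib|nb] := boolP (inn b); first by rewrite orient_rot; apply: inner_tri_pos => //; apply: tri_rot.
have [ic|nc] := boolP (inn c).
  by rewrite -orient_rot; apply: inner_tri_pos => //; do 2 apply: tri_rot.
have [D [Eop Epr] Ero ins] := fr.
have [Eab Ebc Eca Dt _] := triP Tabc.
have oq2 : 0 < oriq p r o by rewrite -orient_rot.
have oq3 : 0 < oriq r o p by rewrite orient_rot.
have N : ori o r (g p) < 0 by move: D; rewrite /orient; slra.
have N2 : ori r p (g o) < 0 by move: D; rewrite /orient; slra.
have N3 : ori p o (g r) < 0 by move: D; rewrite /orient; slra.
move: na nb nc; rewrite /inner !negb_and !negbK.
case/or3P=> /eqP ea; case/or3P=> /eqP eb; case/or3P=> /eqP ec; move: Eab Ebc Eca Dt; rewrite ea eb ec ?E_irr // => _ _ _ Dt; slra.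
Qed.

End Convex.

(** * Crossings of a ray with the boundary of a triangle, and generic directions *)

Section Crossing.
Variable F : realFieldType.
Implicit Types (a b c z : F * F).

(* Signed crossing number of the directed edge [ab] with a horizontal ray ending at [z]. *)
Definition chi z a b : F :=
  [&& a.2 < z.2, z.2 < b.2 & 0 < orient a b z]%:R - [&& b.2 < z.2, z.2 < a.2 & 0 < orient b a z]%:R.

Lemma chi_anti z a b : chi z a b = - chi z b a.
Proof. by rewrite /chi opprB. Qed.

Definition inside a b c z := [/\ 0 < orient a b z, 0 < orient b c z & 0 < orient c a z].

Lemma chi_up z a b c : 0 < orient a b c -> a.2 < z.2 -> z.2 < b.2 -> z.2 < c.2 ->
  let s := chi z a b + chi z b c + chi z c a in (0 <= s <= 1) /\ (inside a b c z -> s = 1).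
Proof.
move=> D ha hb hc s.
have e1 : orient a b z * (c.2 - a.2) = orient a c z * (b.2 - a.2) + orient a b c * (z.2 - a.2).
  by rewrite /orient; ring.
have imp : 0 < orient a c z -> 0 < orient a b z.
  move=> h; have h1 := mulr_gt0 h (ltac:(slra) : 0 < b.2 - a.2).
  have h2 := mulr_gt0 D (ltac:(slra) : 0 < z.2 - a.2).
  have := addr_gt0 h1 h2; rewrite -e1 pmulr_lgt0 //; slra.
have -> : s = ((0 < orient a b z)%R)%:R - ((0 < orient a c z)%R)%:R.
  rewrite /s /chi ha hb hc (lt_gtF ha) (lt_gtF hb) (lt_gtF hc) /= ?andbF /=; ring.
split.
  by case: (0 < orient a c z) imp => [->//|_] /=; case: (0 < orient a b z) => /=; slra.
move=> [h1 h2 h3]; have -> : (0 < orient a c z) = false by apply: lt_gtF; move: h3; rewrite /orient; slra.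
by rewrite h1 /=; ring.
Qed.

Lemma chi_dn z a b c : 0 < orient a b c -> a.2 < z.2 -> b.2 < z.2 -> z.2 < c.2 ->
  let s := chi z a b + chi z b c + chi z c a in (0 <= s <= 1) /\ (inside a b c z -> s = 1).
Proof.
move=> D ha hb hc s.
have e1 : orient b c z * (c.2 - a.2) = orient a c z * (c.2 - b.2) + orient a b c * (c.2 - z.2).
  by rewrite /orient; ring.
have imp : 0 < orient a c z -> 0 < orient b c z.
  move=> h; have h1 := mulr_gt0 h (ltac:(slra) : 0 < c.2 - b.2).
  have h2 := mulr_gt0 D (ltac:(slra) : 0 < c.2 - z.2).
  have := addr_gt0 h1 h2; rewrite -e1 pmulr_lgt0 //; slra.
have -> : s = ((0 < orient b c z)%R)%:R - ((0 < orient a c z)%R)%:R.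
  rewrite /s /chi ha hb hc (lt_gtF ha) (lt_gtF hb) (lt_gtF hc) /= ?andbF /=; ring.
split.
  by case: (0 < orient a c z) imp => [->//|_] /=; case: (0 < orient b c z) => /=; slra.
move=> [h1 h2 h3]; have -> : (0 < orient a c z) = false by apply: lt_gtF; move: h3; rewrite /orient; slra.
by rewrite h2 /=; ring.
Qed.

(** The sum measures how often the boundary winds around [z]. Corners level with [z] are excluded so
    that the ray meets no corner. *)
Lemma chi_tri z a b c : 0 < orient a b c -> a.2 != z.2 -> b.2 != z.2 -> c.2 != z.2 ->
  let s := chi z a b + chi z b c + chi z c a in (0 <= s <= 1) /\ (inside a b c z -> s = 1).
Proof.
move=> D na nb nc s.
have D2 : 0 < orient b c a by rewrite -orient_rot.
have D3 : 0 < orient c a b by rewrite orient_rot.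
have s2 : s = chi z b c + chi z c a + chi z a b by rewrite /s; ring.
have s3 : s = chi z c a + chi z a b + chi z b c by rewrite /s; ring.
have r2 : inside a b c z -> inside b c a z by case.
have r3 : inside a b c z -> inside c a b z by case.
have far : (0 < a.2 - z.2 /\ 0 < b.2 - z.2 /\ 0 < c.2 - z.2) \/ (0 < - (a.2 - z.2) /\ 0 < - (b.2 - z.2) /\ 0 < - (c.2 - z.2)) ->
    s = 0 -> (0 <= s <= 1) /\ (inside a b c z -> s = 1).
  move=> hf ->; split; first slra.
  move=> [h1 h2 h3]; exfalso.
  have e : orient b c z * (a.2 - z.2) + orient c a z * (b.2 - z.2) + orient a b z * (c.2 - z.2) = 0.
    by rewrite /orient; ring.
  case: hf => -[f1 [f2 f3]]; have := mulr_gt0 h2 f1; have := mulr_gt0 h3 f2; have := mulr_gt0 h1 f3; slra.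
case: (ltgtP a.2 z.2) na => // ha _; case: (ltgtP b.2 z.2) nb => // hb _;
  case: (ltgtP c.2 z.2) nc => // hc _.
- apply: far; first by right; slra.
  by rewrite /s /chi (lt_gtF ha) (lt_gtF hb) (lt_gtF hc) /= ?andbF; ring.
- by apply: chi_dn.
- by rewrite s3; have [h1 h2] := chi_dn D3 hc ha hb; split=> // /r3.
- by apply: chi_up.
- by rewrite s2; have [h1 h2] := chi_dn D2 hb hc ha; split=> // /r2.
- by rewrite s2; have [h1 h2] := chi_up D2 hb hc ha; split=> // /r2.
- by rewrite s3; have [h1 h2] := chi_up D3 hc ha hb; split=> // /r3.
- apply: far; first by left; slra.
  by rewrite /s /chi (lt_gtF ha) (lt_gtF hb) (lt_gtF hc) /= ?andbF; ring.
Qed.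

Definition cross a b : F := a.1 * b.2 - a.2 * b.1.
Definition dir a b : F * F := (b.1 - a.1, b.2 - a.2).
Definition shift z (s : F) w : F * F := (z.1 + s * w.1, z.2 + s * w.2).

(** The same small turn as for functionals: it keeps the strict signs and avoids the finitely many
    directions in [d]. *)
Lemma generic_dir (u : seq (F * F)) (d : seq (F * F)) (w0 : F * F) : w0 <> (0, 0) ->
  (forall x, x \in u -> 0 < cross x w0) -> (forall x, x \in d -> x <> (0, 0)) ->
  exists w, (forall x, x \in u -> 0 < cross x w) /\ (forall x, x \in d -> cross x w != 0).
Proof.
move=> w00 hu hd; pose W s : F * F := (w0.1 - s * w0.2, w0.2 + s * w0.1).
have e1 : ev (fun s => forall x, x \in u -> 0 < cross x (W s)).
  apply: ev_seq => x /hu h; apply: (@ev_pos_f F _ (cross x w0) (x.1 * w0.1 + x.2 * w0.2) 0) => // s.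
  by rewrite /cross /W /=; ring.
have e2 : ev (fun s => forall x, x \in d -> cross x (W s) != 0).
  apply: ev_seq => x /hd h.
  apply: ev_imp (@ev_neq F (cross x w0) (x.1 * w0.1 + x.2 * w0.2) _).
    by move=> s _; rewrite (_ : _ + _ = cross x (W s)) // /cross /W /=; ring.
  apply/negPn; rewrite negb_or !negbK; apply/negP => /andP[/eqP c1 /eqP c2].
  have N := sq_pos w00.
  have n1 : x.1 * (w0.1 * w0.1 + w0.2 * w0.2) = w0.2 * cross x w0 + w0.1 * (x.1 * w0.1 + x.2 * w0.2).
    by rewrite /cross; ring.
  have n2 : x.2 * (w0.1 * w0.1 + w0.2 * w0.2) = w0.2 * (x.1 * w0.1 + x.2 * w0.2) - w0.1 * cross x w0.
    by rewrite /cross; ring.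
  by apply: h; apply: pairP; apply: (mulIf (lt0r_neq0 N)); rewrite ?n1 ?n2 c1 c2 /=; ring.
by have [s [_ [h1 h2]]] := ev_ex (ev_and e1 e2); exists (W s).
Qed.

End Crossing.

(** * The images of the faces do not overlap, so the new positions give a plane drawing *)

Section Cover.
Variables (F : realFieldType) (V : finType) (g : V -> F * F) (E : rel V) (q : V -> F * F).
Variables (o p r : V).
Implicit Types (a b c d u v : V) (k f : F * F) (z w : F * F).
Hypothesis HP : plane_edges g E.
Hypothesis Hsat : saturated g E.
Hypothesis fr : frame g E o p r.
Hypothesis hull : weak_hull E q o p r.
Hypothesis oq : 0 < orient (q o) (q p) (q r).
Local Notation inn := (inner o p r).
Local Notation E_sym := (plane_sym HP).
Local Notation E_irr := (plane_irr HP).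
Local Notation ori a b p := (orient (g a) (g b) p).
Local Notation oriq a b c := (orient (q a) (q b) (q c)).
Local Notation T := (tri g E).

Let tpos a b c : T a b c -> 0 < oriq a b c.
Proof. exact: (tri_pos HP Hsat fr hull oq). Qed.

Let Trot a b c : T b c a = T a b c.
Proof. by apply/idP/idP => h; [do 2 apply: tri_rot|apply: tri_rot]. Qed.

Definition chiq z a b := chi z (q a) (q b).

(** The second summand recognizes the sides of the outer triangle taken clockwise; every other
    directed edge has a vertex, hence a face, on its left. *)
Lemma outer_edges a b : E a b ->
  ([exists c, T a b c] + (((a == p) && (b == o)) + ((a == r) && (b == p)) + ((a == o) && (b == r))) = 1)%N.
Proof.
move=> Eab; have [D [Eop Epr] Ero ins] := fr.
have nop : (o == p) = false by apply/eqP => e; rewrite e E_irr in Eop.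
have npr : (p == r) = false by apply/eqP => e; rewrite e E_irr in Epr.
have nro : (r == o) = false by apply/eqP => e; rewrite e E_irr in Ero.
have nab : a <> b by move=> e; rewrite e E_irr in Eab.
have ex v : 0 < ori a b (g v) -> [exists c, T a b c].
  by move=> h; apply/existsP; apply: (tri_exists HP Hsat Eab h).
have all_in c : [/\ 0 <= ori o p (g c), 0 <= ori p r (g c) & 0 <= ori r o (g c)].
  have [ic|] := boolP (inn c); first by have [? ? ?] := ins c ic; split; apply: ltW.
  by rewrite /inner !negb_and !negbK => /or3P[/eqP e|/eqP e|/eqP e]; subst c; split;
    move: D; rewrite /orient; slra.
have noex x y : (forall c, 0 <= ori y x (g c)) -> [exists c, T x y c] = false.
  move=> h; apply/existsP => -[c /triP[_ _ _ h' _]]; have := h c; move: h'; rewrite /orient; slra.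
have [ia|na] := boolP (inn a).
  have [v hv] := inner_sides HP fr ia nab (oner_neq0 F).
  rewrite (ex v) ?addn0; last by slra.
  by move: ia; rewrite /inner => /and3P[/negPf -> /negPf -> /negPf ->].
have [ib|nb] := boolP (inn b).
  have [v hv] := inner_sides (sg := -1) HP fr ib (nesym nab) (ltac:(by rewrite oppr_eq0 oner_neq0)).
  rewrite (ex v) ?addn0; last by move: hv; rewrite (orient_swap (g a)); slra.
  by move: ib; rewrite /inner => /and3P[/negPf -> /negPf -> /negPf ->]; rewrite !andbF.
move: na nb; rewrite /inner !negb_and !negbK.
case/or3P=> /eqP ea; case/or3P=> /eqP eb; subst a b => //;
  rewrite ?eqxx ?nop ?npr ?nro ?(eq_sym p o) ?(eq_sym r p) ?(eq_sym o r) ?nop ?npr ?nro /=.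
- by rewrite (ex r).
- by rewrite noex // => c; case: (all_in c).
- by rewrite noex // => c; case: (all_in c).
- by rewrite (ex o) // -orient_rot.
- by rewrite (ex p) // orient_rot.
- by rewrite noex // => c; case: (all_in c).
Qed.

Lemma sum_delta (f : V -> V -> F) x y : \sum_a \sum_b ((a == x) && (b == y))%:R * f a b = f x y.
Proof.
rewrite (bigD1 x) //= [X in _ + X]big1 ?addr0; last first.
  by move=> i /negPf n; rewrite big1 // => j _; rewrite n mul0r.
rewrite (bigD1 y) //= [X in _ + X]big1 ?addr0; first by rewrite !eqxx mul1r.
by move=> i /negPf n; rewrite n andbF mul0r.
Qed.

(** Edges bordered by faces on both sides cancel, being traversed once in each direction. What
    remains is the boundary of the outer triangle, tripled because each face is summed in its three
    rotations. *)
Lemma chi_sum z :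
  \sum_a \sum_b \sum_c (T a b c)%:R * (chiq z a b + chiq z b c + chiq z c a) =
  (chiq z o p + chiq z p r + chiq z r o) *+ 3.
Proof.
have R (f : V -> V -> V -> F) : \sum_a \sum_b \sum_c f b c a = \sum_a \sum_b \sum_c f a b c.
  by rewrite exchange_big /=; apply: eq_bigr => b _; exact: exchange_big.
pose m a b c := (T a b c)%:R * chiq z a b.
have -> : \sum_a \sum_b \sum_c (T a b c)%:R * (chiq z a b + chiq z b c + chiq z c a) =
    \sum_a \sum_b \sum_c m a b c + \sum_a \sum_b \sum_c m b c a + \sum_a \sum_b \sum_c m c a b.
  rewrite -!big_split; apply: eq_bigr => a _; rewrite -!big_split; apply: eq_bigr => b _.
  rewrite -!big_split; apply: eq_bigr => c _; rewrite /m /= (Trot a) (Trot c a b).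
  by rewrite !mulrDr.
have -> : \sum_a \sum_b \sum_c m c a b = \sum_a \sum_b \sum_c m a b c.
  by rewrite (R (fun a b c => m b c a)) (R m).
rewrite (R m); set M := \sum_a \sum_b \sum_c m a b c.
suff -> : M = chiq z o p + chiq z p r + chiq z r o by rewrite !mulrS mulr0n addr0 addrA.
pose Z a b := (((a == p) && (b == o)) + ((a == r) && (b == p)) + ((a == o) && (b == r)))%N.
have ZE a b : Z a b != 0%N -> E a b.
  have [D [Eop Epr] Ero ins] := fr.
  rewrite /Z; case: andP => [[/eqP -> /eqP ->] _|_]; first by rewrite E_sym.
  case: andP => [[/eqP -> /eqP ->] _|_]; first by rewrite E_sym.
  by case: andP => [[/eqP -> /eqP ->] _|_] //; rewrite E_sym.
have e1 : M = \sum_a \sum_b ((E a b)%:R * chiq z a b - (Z a b)%:R * chiq z a b).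
  apply: eq_bigr => a _; apply: eq_bigr => b _.
  rewrite -mulrBl -mulr_suml; congr (_ * _).
  have -> : \sum_c (T a b c)%:R = ([exists c, T a b c])%:R :> F.
    case: existsP => [[c Tc]|n].
      rewrite (bigD1 c) //= Tc big1 ?addr0 // => i /negPf ne.
      by case Ti : (T a b i) => //; move: ne; rewrite (tri_uniq HP Ti Tc) eqxx.
    by rewrite big1 // => i _; case Ti : (T a b i) => //; case: n; exists i.
  case Eab : (E a b).
    have -> : true%:R = 1%N%:R :> F by [].
    by rewrite -(outer_edges Eab) -/(Z a b) natrD addrK.
  have -> : Z a b = 0%N by apply/eqP; apply/negPn/negP => /ZE; rewrite Eab.
  by rewrite subr0; case: existsP => // -[c /triP[]]; rewrite Eab.
have e2 : \sum_a \sum_b (E a b)%:R * chiq z a b = 0.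
  set S := \sum_a _; suff : S = - S by slra.
  rewrite {1}/S exchange_big /= -sumrN; apply: eq_bigr => a _; rewrite -sumrN; apply: eq_bigr => b _.
  by rewrite E_sym /chiq chi_anti mulrN.
have e3 : \sum_a \sum_b (Z a b)%:R * chiq z a b = chiq z p o + chiq z r p + chiq z o r.
  rewrite -!(sum_delta (chiq z)) -!big_split; apply: eq_bigr => a _; rewrite -!big_split.
  by apply: eq_bigr => b _ /=; rewrite /Z !natrD !mulrDl.
have -> : M = \sum_a \sum_b (E a b)%:R * chiq z a b - \sum_a \sum_b (Z a b)%:R * chiq z a b.
  by rewrite e1 -sumrB; apply: eq_bigr => a _; rewrite -sumrB.
by rewrite e2 e3 /chiq (chi_anti _ (q o)) (chi_anti _ (q p)) (chi_anti _ (q r)); ring.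
Qed.

Definition in_tri a b c z := inside (q a) (q b) (q c) z.

(** If two different faces covered [z], the sum over ordered triples would be at least 4, from three
    rotations of one face and a triple of the other, while the outer triangle allows at most 3. *)
Lemma disjoint_generic a b c a' b' c' z : (forall v, (q v).2 != z.2) ->
  T a b c -> T a' b' c' -> in_tri a b c z -> in_tri a' b' c' z ->
  (a', b', c') \in [:: (a, b, c); (b, c, a); (c, a, b)].
Proof.
move=> gen Tb Tb' hz hz'; apply/negPn/negP => no.
have tp a1 b1 c1 : T a1 b1 c1 ->
    (0 <= chiq z a1 b1 + chiq z b1 c1 + chiq z c1 a1) /\
    (in_tri a1 b1 c1 z -> chiq z a1 b1 + chiq z b1 c1 + chiq z c1 a1 = 1).
  by move=> /tpos D; have [/andP[h1 h2] h3] := chi_tri D (gen a1) (gen b1) (gen c1).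
have [/andP[_ le1] _] := chi_tri oq (gen o) (gen p) (gen r).
have S := chi_sum z.
pose fT (x : V * V * V) : F := (T x.1.1 x.1.2 x.2)%:R *
   (chiq z x.1.1 x.1.2 + chiq z x.1.2 x.2 + chiq z x.2 x.1.1).
have S' : \sum_x fT x = (chiq z o p + chiq z p r + chiq z r o) *+ 3.
  by rewrite -S !pair_bigA; apply: eq_bigr => -[[x y] t].
have f0 (x : V * V * V) : 0 <= fT x.
  rewrite /fT; case Tx : (T _ _ _); last by rewrite mul0r.
  by rewrite mul1r; case: (tp _ _ _ Tx).
pose l := [:: (a, b, c); (b, c, a); (c, a, b); (a', b', c')].
have f1 (x : V * V * V) : x \in l -> fT x = 1.
  have Tb2 := tri_rot Tb; have Tb3 := tri_rot Tb2; have [z1 z2 z3] := hz.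
  rewrite !inE => /or4P[] /eqP -> ; rewrite /fT /= ?Tb ?Tb2 ?Tb3 ?Tb' mul1r.
  - by case: (tp _ _ _ Tb) => _; apply.
  - by case: (tp _ _ _ Tb2) => _; apply.
  - by case: (tp _ _ _ Tb3) => _; apply.
  - by case: (tp _ _ _ Tb') => _; apply.
have [Eab Ebc Eca _ _] := triP Tb.
have nab : (a == b) = false by apply/eqP => e; rewrite e E_irr in Eab.
have nbc : (b == c) = false by apply/eqP => e; rewrite e E_irr in Ebc.
have nca : (c == a) = false by apply/eqP => e; rewrite e E_irr in Eca.
have ul : uniq l.
  rewrite /= !inE !xpair_eqE nab nbc (eq_sym a c) nca /= andbT.
  by move: no; rewrite !inE !xpair_eqE !negb_or (eq_sym a') (eq_sym b') (eq_sym c') ![c' == _]eq_sym ![b' == _]eq_sym ![a' == _]eq_sym; case/and3P=> -> -> ->.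
have : \sum_(x in l) fT x = 4%:R.
  by rewrite -big_uniq //= big_seq (eq_bigr (fun=> 1)) -?big_seq ?f1 // !big_cons big_nil; ring.
have : \sum_(x in l) fT x <= \sum_x fT x.
  by rewrite [X in _ <= X](bigID (mem l)) /= lerDl sumr_ge0.
rewrite S' -mulr_natr /chiq => h1 h2; move: le1 h1; rewrite h2; slra.
Qed.

Lemma shift_ori (x y z w : F * F) s : orient x y (shift z s w) = orient x y z + s * cross (dir x y) w.
Proof. by rewrite /orient /shift /cross /dir /=; ring. Qed.

(** A small vertical shift keeps [z] inside both open triangles and avoids the heights of all
    vertices. *)
Lemma disjoint_tris a b c a' b' c' z : T a b c -> T a' b' c' -> in_tri a b c z -> in_tri a' b' c' z ->
  (a', b', c') \in [:: (a, b, c); (b, c, a); (c, a, b)].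
Proof.
move=> Tb Tb' hz hz'.
have st a1 b1 c1 : in_tri a1 b1 c1 z -> ev (fun s => in_tri a1 b1 c1 (shift z s (0, 1))).
  move=> [h1 h2 h3]; have P (x y : F * F) : 0 < orient x y z -> ev (fun s => 0 < orient x y (shift z s (0, 1))).
    move=> h; apply: (@ev_pos_f F _ (orient x y z) (cross (dir x y) (0, 1)) 0) => // s.
    by rewrite shift_ori; ring.
  by apply: ev_imp (ev_and (P _ _ h1) (ev_and (P _ _ h2) (P _ _ h3))) => s _ [? [? ?]].
have gen : ev (fun s => forall v, (q v).2 != (shift z s (0, 1)).2).
  apply: ev_all => v; apply: ev_imp (@ev_neq F (z.2 - (q v).2) 1 _).
    by move=> s _; apply: contra => /eqP ->; apply/eqP; rewrite /shift /=; ring.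
  by rewrite oner_neq0 orbT.
have [s [_ [h1 [h2 h3]]]] := ev_ex (ev_and gen (ev_and (st _ _ _ hz) (st _ _ _ hz'))).
exact: (disjoint_generic h1 Tb Tb' h2 h3).
Qed.

Lemma nbr_neq a b : inn a -> E a b -> q a <> q b.
Proof.
move=> ia Eab e; have [c Tc] := next_ex HP Hsat fr ia Eab.
by have := tpos Tc; rewrite e /orient; slra.
Qed.

(** The hull condition puts neighbours on both sides of the line through [q v] in direction [w]; at
    the step of the rotation where the side changes, the face contains the beginning of the ray. *)
Lemma star v w : inn v -> w <> (0, 0) -> (forall b, E v b -> cross (dir (q v) (q b)) w != 0) ->
  exists b c, T v b c /\ ev (fun s => in_tri v b c (shift (q v) s w)).
Proof.
move=> iv w0 gen; pose k : F * F := (w.2, - w.1).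
have kE b : cross (dir (q v) (q b)) w = fn k (q b) - fn k (q v).
  by rewrite /cross /dir /fn /=; ring.
have k0 : k <> (0, 0) by move=> [e1 e2]; apply: w0; apply: pairP => /=; slra.
have [[b0 [Eb0 lb0]] [c0 [Ec0 lc0]]] : (exists b, E v b /\ fn k (q b) < fn k (q v)) /\ (exists b, E v b /\ fn k (q v) < fn k (q b)).
  by case: (hull k iv) => // /(no_flat HP Hsat fr hull oq iv k0).
have hb : ~ 0 < cross (dir (q v) (q b0)) w by rewrite (kE b0); slra.
have hc : 0 < cross (dir (q v) (q c0)) w by rewrite (kE c0); slra.
have [b [c [Tb hb' hc']]] := @rot_connected F V g E HP Hsat o p r v
   (fun b => is_true (0 < cross (dir (q v) (q b)) w)) fr iv
   (ex_intro _ c0 (conj Ec0 hc)) (ex_intro _ b0 (conj Eb0 hb)).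
have {}hc' : cross (dir (q v) (q c)) w < 0.
  have [_ Evc] := tri_nbr HP Tb.
  by rewrite lt_neqAle gen //= leNgt; apply/negP.
exists b, c; split=> //.
have D : 0 < orient (q b) (q c) (q v) by rewrite -orient_rot; apply: tpos.
have e1 := @ev_pos_f F (fun s => orient (q b) (q c) (shift (q v) s w)) _ (cross (dir (q b) (q c)) w) 0 _ D.
apply: ev_imp (e1 _); last by move=> s; rewrite shift_ori; ring.
move=> s s0 h; split=> //; rewrite shift_ori.
  by rewrite (_ : orient _ _ _ = 0) ?add0r ?mulr_gt0 // /orient; ring.
rewrite (_ : orient _ _ _ = 0) ?add0r; last by rewrite /orient; ring.
rewrite (_ : cross _ _ = - cross (dir (q v) (q c)) w) ?mulr_gt0 ?oppr_gt0 //.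
by rewrite /cross /dir /=; ring.
Qed.

Lemma edge_side a b c z w : T a b c -> oseg (q a) (q b) z -> 0 < cross (dir (q a) (q b)) w ->
  ev (fun s => in_tri a b c (shift z s w)).
Proof.
move=> Tb [t [ht ez]] hw; have D := tpos Tb.
have z1 : orient (q a) (q b) z = 0 by rewrite ez mix_orient /orient; ring.
have z2 : 0 < orient (q b) (q c) z.
  rewrite ez mix_orient (_ : orient (q b) (q c) (q b) = 0); last by rewrite /orient; ring.
  by rewrite mulr0 addr0 -orient_rot mulr_gt0 //; slra.
have z3 : 0 < orient (q c) (q a) z.
  rewrite ez mix_orient (_ : orient (q c) (q a) (q a) = 0) ?mulr0 ?add0r; last by rewrite /orient; ring.
  by rewrite orient_rot mulr_gt0 //; slra.
have P (x y : F * F) : 0 < orient x y z -> ev (fun s => 0 < orient x y (shift z s w)).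
  move=> h; apply: (@ev_pos_f F _ (orient x y z) (cross (dir x y) w) 0) => // s.
  by rewrite shift_ori; ring.
apply: ev_imp (ev_and (P _ _ z2) (P _ _ z3)) => s s0 [h2 h3]; split=> //.
by rewrite shift_ori z1 add0r mulr_gt0.
Qed.

Lemma dir_neq (x y : F * F) : x <> y -> dir x y <> (0, 0).
Proof. by move=> n [e1 e2]; apply: n; apply: pairP; slra. Qed.

Let one_neq : ((0, 1) : F * F) <> (0, 0).
Proof. by case; apply/eqP; exact: oner_neq0. Qed.

Let dirs u := [seq dir (q u) (q b) | b <- enum V & E u b].

Let dirsP u x : inn u -> x \in dirs u -> x <> (0, 0).
Proof.
move=> iu /mapP[b]; rewrite mem_filter => /andP[Eb _] ->; apply: dir_neq; exact: nbr_neq.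
Qed.

Let dirs_gen u w : (forall x, x \in dirs u -> cross x w != 0) ->
  forall b, E u b -> cross (dir (q u) (q b)) w != 0.
Proof. by move=> h b Eb; apply: h; apply/mapP; exists b => //; rewrite mem_filter Eb mem_enum. Qed.

Let tri_mem a b c x y t : (x, y, t) \in [:: (a, b, c); (b, c, a); (c, a, b)] -> [\/ x = a, x = b | x = c].
Proof.
by rewrite !inE => /or3P[] /eqP [-> _ _]; [constructor 1|constructor 2|constructor 3].
Qed.

Let nz_of (x w : F * F) : cross x w != 0 -> w <> (0, 0).
Proof. by move=> h e; move: h; rewrite e /cross /= !mulr0 subrr eqxx. Qed.

(** A common position, shifted in a generic direction, lies in a face at [u] and in one at [v].
    These are the same face, so [u] and [v] are equal or adjacent, and adjacent vertices are
    apart. *)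
Lemma q_inj u v : inn u -> inn v -> q u = q v -> u = v.
Proof.
move=> iu iv e.
have [w [_ gw]] := @generic_dir F [::] ((1, 0) :: dirs u ++ dirs v) (0, 1) one_neq (fun _ h => match notF h with end)
  (ltac:(move=> x; rewrite inE mem_cat => /or3P[/eqP ->|/(dirsP iu)|/(dirsP iv)] //; case; apply/eqP; exact: oner_neq0)).
have w0 : w <> (0, 0) by apply: (nz_of (gw (1, 0) (mem_head _ _))).
have gu x : x \in dirs u -> cross x w != 0 by move=> h; apply: gw; rewrite inE mem_cat h orbT.
have gv x : x \in dirs v -> cross x w != 0 by move=> h; apply: gw; rewrite inE mem_cat h !orbT.
have [b [c [Tb hb]]] := star iu w0 (dirs_gen gu).
have [b' [c' [Tb' hb']]] := star iv w0 (dirs_gen gv).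
have [s [_ [h1 h2]]] := ev_ex (ev_and hb hb'); rewrite -e in h2.
have [E1 E2] := tri_nbr HP Tb.
case: (tri_mem (disjoint_tris Tb Tb' h1 h2)) => // e'; subst v.
  by case: (nbr_neq iu E1).
by case: (nbr_neq iu E2).
Qed.

(** As for injectivity, with a face at [v] compared to the face beside the edge on which [v] would
    lie. *)
Lemma q_vtx a b v : inn a -> inn v -> E a b -> ~ oseg (q a) (q b) (q v).
Proof.
move=> ia iv Eab oz.
have nab := nbr_neq ia Eab.
have [w [_ gw]] := @generic_dir F [::] (dir (q a) (q b) :: dirs v) (0, 1) one_neq (fun _ h => match notF h with end)
  (ltac:(by move=> x; rewrite inE => /orP[/eqP ->|/(dirsP iv)] //; apply: dir_neq)).
have g1 := gw _ (mem_head _ _).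
have w0 := nz_of g1.
have gv x : x \in dirs v -> cross x w != 0 by move=> h; apply: gw; rewrite inE h orbT.
have [b' [c' [Tb' hb']]] := star iv w0 (dirs_gen gv).
have [nza nzb] := oseg_neq nab oz.
have fin x y c : T x y c -> oseg (q x) (q y) (q v) -> ev (fun s => in_tri x y c (shift (q v) s w)) ->
    v <> x -> v <> y -> False.
  move=> Tx oxy hx nx ny; have [s [_ [h1 h2]]] := ev_ex (ev_and hx hb').
  case: (tri_mem (disjoint_tris Tx Tb' h1 h2)) => // e; subst v.
  have := tpos Tx; case: oxy => t [_ ->]; rewrite mix_orient /orient; slra.
have va : v <> a by move=> e; apply: nza; rewrite e.
have vb : v <> b by move=> e; apply: nzb; rewrite e.
case: (ltgtP (cross (dir (q a) (q b)) w) 0) => h; last by rewrite h eqxx in g1.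
  have [d Td] := prev_ex HP Hsat fr ia Eab.
  have Td' : T b a d by do 2 apply: tri_rot.
  have ozs := oseg_sym oz.
  apply: (fin b a d) => //; apply: edge_side => //.
  by move: h; rewrite /cross /dir /=; slra.
have [c Tc] := next_ex HP Hsat fr ia Eab.
by apply: (fin a b c) => //; apply: edge_side.
Qed.

(** The edges are directed so as not to point in opposite directions; then some direction is to the
    left of both and leads from the common point into both left faces, which must agree. *)
Lemma q_plane a b c d z : inn a -> inn b -> inn c -> inn d -> E a b -> E c d ->
  oseg (q a) (q b) z -> oseg (q c) (q d) z -> (a = c /\ b = d) \/ (a = d /\ b = c).
Proof.
move=> ia ib ic id Eab Ecd oab ocd.
wlog dot : c d ic id Ecd ocd / 0 <= ((q b).1 - (q a).1) * ((q d).1 - (q c).1) + ((q b).2 - (q a).2) * ((q d).2 - (q c).2).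
  move=> W; case: (leP 0 (((q b).1 - (q a).1) * ((q d).1 - (q c).1) + ((q b).2 - (q a).2) * ((q d).2 - (q c).2))) => h.
    exact: W.
  have Edc : E d c by rewrite E_sym.
  have dot : 0 <= ((q b).1 - (q a).1) * ((q c).1 - (q d).1) + ((q b).2 - (q a).2) * ((q c).2 - (q d).2) by slra.
  by case: (W d c id ic Edc (oseg_sym ocd) dot) => -[? ?]; [right|left].
have [e Te] := next_ex HP Hsat fr ia Eab; have [f Tf] := next_ex HP Hsat fr ic Ecd.
have N1 := sq_pos (dir_neq (nbr_neq ia Eab)); have N2 := sq_pos (dir_neq (nbr_neq ic Ecd)).
(* The sum of the two left normals; [dot] makes its cross product with either edge positive. *)
pose w : F * F := (- ((q b).2 - (q a).2) - ((q d).2 - (q c).2), ((q b).1 - (q a).1) + ((q d).1 - (q c).1)).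
have h1 : 0 < cross (dir (q a) (q b)) w by move: N1 N2; rewrite /dir /cross /w /=; slra.
have h2 : 0 < cross (dir (q c) (q d)) w by move: N1 N2; rewrite /dir /cross /w /=; slra.
have [s [_ [s1 s2]]] := ev_ex (ev_and (edge_side Te oab h1) (edge_side Tf ocd h2)).
have z0 : orient (q a) (q b) z = 0 by case: oab => t [_ ->]; rewrite mix_orient /orient; ring.
have D := tpos Te; have := disjoint_tris Te Tf s1 s2; rewrite !inE => /or3P[] /eqP [e1 e2 e3]; subst c d f.
- by left.
- case: ocd => t [ht ez]; move: z0; rewrite ez mix_orient.
  have h : 0 < t * oriq a b e by apply: mulr_gt0; slra.
  by rewrite (_ : oriq a b b = 0) ?mulr0 ?add0r => [z0|]; [move: h; rewrite z0 ltxx|rewrite /orient; ring].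
- case: ocd => t [ht ez]; move: z0; rewrite ez mix_orient.
  have h : 0 < (1 - t) * oriq a b e by apply: mulr_gt0; slra.
  by rewrite (_ : oriq a b a = 0) ?mulr0 ?addr0 => [z0|]; [move: h; rewrite z0 ltxx|rewrite /orient; ring].
Qed.

End Cover.

(** * Linear programming duality over an ordered field *)

Section Farkas.
Variable F : realFieldType.

Definition dot (I : finType) (a x : I -> F) : F := \sum_i a i * x i.

Lemma dot_lin (I : finType) (a x y : I -> F) (s : F) :
  dot a (fun i => x i - s * y i) = dot a x - s * dot a y.
Proof.
rewrite /dot mulr_sumr -sumrB; apply: eq_bigr => i _; ring.
Qed.

Lemma dot_linl (I : finType) (a b x : I -> F) (s : F) :
  dot (fun i => a i - s * b i) x = dot a x - s * dot b x.
Proof. by rewrite /dot mulr_sumr -sumrB; apply: eq_bigr => i _; ring. Qed.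

(** Induction on the number of constraints. If the last one is needed, there is a point [x0] that
    satisfies the others and violates [b], hence also violates the last one. Subtracting multiples
    of the last row makes all functionals vanish at [x0] and leaves one constraint less. *)
Lemma farkas_nat (I : finType) n (A : nat -> I -> F) (b : I -> F) :
  (forall x, (forall j, (j < n)%N -> dot (A j) x <= 0) -> dot b x <= 0) ->
  exists l : nat -> F, (forall j, 0 <= l j) /\ forall i, b i = \sum_(j < n) l j * A j i.
Proof.
elim: n A b => [|n IH] A b H.
  exists (fun=> 0); split=> // i; rewrite big_ord0.
  have h : dot b b <= 0 by apply: H.
  have : \sum_i b i * b i == 0.
    by rewrite eq_le h sumr_ge0 // => j _; rewrite -expr2 sqr_ge0.
  rewrite psumr_eq0 => [/allP/(_ i)|j _]; last by rewrite -expr2 sqr_ge0.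
  by rewrite mem_index_enum mulf_eq0 orbb => /(_ isT)/implyP/(_ isT)/eqP.
have [h|h] := pselect (forall x, (forall j, (j < n)%N -> dot (A j) x <= 0) -> dot b x <= 0).
  have [l [l0 lE]] := IH A b h; exists (fun j => if (j < n)%N then l j else 0).
  split=> [j|i]; first by case: ifP.
  rewrite big_ord_recr /= ltnn mul0r addr0 lE; apply: eq_bigr => j _; by rewrite ltn_ord.
have [x0 [hx0 bx0]] : exists x0, (forall j, (j < n)%N -> dot (A j) x0 <= 0) /\ 0 < dot b x0.
  apply: contrapT => nx; apply: h => x hx; rewrite leNgt; apply/negP => hb; apply: nx; by exists x.
have an : 0 < dot (A n) x0.
  rewrite ltNge; apply/negP => an; move: bx0; rewrite ltNge H // => j; rewrite ltnS leq_eqVlt.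
  by case/orP=> [/eqP ->|/hx0].
pose u (a : I -> F) := dot a x0 / dot (A n) x0.
have [l [l0 lE]] := IH (fun j i => A j i - u (A j) * A n i) (fun i => b i - u b * A n i)
  (ltac:(move=> x hx; rewrite dot_linl;
     have e (a : I -> F) : dot a x - u a * dot (A n) x = dot a (fun i => x i - (dot (A n) x / dot (A n) x0) * x0 i);
       [by rewrite dot_lin /u; field; exact: lt0r_neq0|];
     rewrite e; apply: H => j; rewrite ltnS leq_eqVlt -e => /orP[/eqP ->|/hx];
       [by rewrite /u divff ?lt0r_neq0 // mul1r subrr|by rewrite dot_linl])).
(* The last coefficient collects what was subtracted; it is nonnegative because [u b] is and every
   [u (A k)] is nonpositive. *)
exists (fun j => if (j < n)%N then l j else u b - \sum_(k < n) l k * u (A k)); split=> [j|i].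
  case: ifP => // _; rewrite subr_ge0; apply: (@le_trans _ _ 0).
    apply: sumr_le0 => k _; apply: mulr_ge0_le0 => //; apply: mulr_le0_ge0; first exact: hx0.
    by rewrite invr_ge0 ltW.
  by rewrite divr_ge0 // ltW.
rewrite big_ord_recr /= ltnn (eq_bigr (fun k : 'I_n => l k * A k i)); last by move=> k _; rewrite ltn_ord.
have := lE i => {lE}.
have -> : \sum_(j < n) l j * (A j i - u (A j) * A n i) =
   \sum_(j < n) l j * A j i - (\sum_(j < n) l j * u (A j)) * A n i.
  by rewrite mulr_suml -sumrB; apply: eq_bigr => j _; ring.
by move=> e; rewrite -[b i](subrK (u b * A n i)) e; ring.
Qed.

Lemma farkas (I R : finType) (A : R -> I -> F) (b : I -> F) :
  (forall x, (forall j, dot (A j) x <= 0) -> dot b x <= 0) ->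
  exists l : R -> F, (forall j, 0 <= l j) /\ forall i, b i = \sum_j l j * A j i.
Proof.
move=> H; pose A' (j : nat) := if insub j is Some k then A (enum_val (k : 'I_#|R|)) else fun=> 0.
have eA r : A' (enum_rank r) = A r by rewrite /A' valK enum_rankK.
have [x hx|l [l0 lE]] := @farkas_nat I #|R| A' b.
  by apply: H => r; rewrite -eA; apply: hx.
exists (fun r => l (enum_rank r)); split=> // i; rewrite lE (reindex (@enum_rank R)) /=.
  by apply: eq_bigr => r _; rewrite eA.
exact: onW_bij (enum_rank_bij R).
Qed.

(** Motzkin's transposition theorem. The coordinate [None] is a margin [t] with [t <= B j x] for all
    [j] in [P]; strict solvability means that [t <= 0] does not follow from the constraints, and
    Farkas describes the case in which it does. *)
Lemma motzkin (I K J : finType) (A : K -> I -> F) (P : pred J) (B : J -> I -> F) :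
  (exists x, (forall k, dot (A k) x = 0) /\ (forall j, P j -> 0 < dot (B j) x)) \/
  (exists (l : K -> F) (m : J -> F), [/\ forall j, 0 <= m j, exists j, P j /\ 0 < m j, forall j, ~~ P j -> m j = 0 &
     forall i, \sum_k l k * A k i + \sum_j m j * B j i = 0]).
Proof.
pose ext (t : F) (a : I -> F) (i : option I) := if i is Some i' then a i' else t.
pose R := (J + K + K)%type.
pose M (x : R) : option I -> F := match x with
  | inl (inl j) => if P j then ext 1 (fun i => - B j i) else ext 0 (fun=> 0)
  | inl (inr k) => ext 0 (A k)
  | inr k => ext 0 (fun i => - A k i) end.
pose b := ext 1 (fun=> 0).
have dE t a x : dot (ext t a) x = t * x None + dot a (fun i => x (Some i)).
  rewrite /dot (bigD1 None) //=; congr (_ + _).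
  rewrite (reindex_omap Some id) /=; last by case.
  by apply: eq_big => // i; rewrite eqxx.
have dN (a : I -> F) x : dot (fun i => - a i) x = - dot a x.
  by rewrite /dot -sumrN; apply: eq_bigr => i _; rewrite mulNr.
have [h|h] := pselect (forall x, (forall j, dot (M j) x <= 0) -> dot b x <= 0).
  right; have [l [l0 lE]] := farkas h.
  have S (f : R -> F) : \sum_x f x = \sum_j f (inl (inl j)) + \sum_k f (inl (inr k)) + \sum_k f (inr k).
    by rewrite !big_sumType.
  exists (fun k => l (inr k) - l (inl (inr k))), (fun j => if P j then l (inl (inl j)) else 0); split.
  - by move=> j; case: ifP.
  - have := lE None; rewrite S /= => e; apply: contrapT => nx.
    have z j : P j -> l (inl (inl j)) = 0.
      move=> Pj; apply/eqP; rewrite eq_le l0 andbT leNgt; apply/negP => hj; apply: nx; exists j.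
      by rewrite Pj.
    move: e; rewrite !big1 ?addr0 => [/eqP|||].
    + by rewrite oner_eq0.
    + by move=> k _; rewrite mulr0.
    + by move=> k _; rewrite mulr0.
    + by move=> k _; case: ifP => [/z -> | _]; rewrite /= ?mul0r ?mulr0.
  - by move=> j /negPf ->.
  move=> i; have := lE (Some i); rewrite S /=.
  rewrite (eq_bigr (fun j => - ((if P j then l (inl (inl j)) else 0) * B j i))) ?sumrN; last first.
    by move=> j _; case: ifP => _ /=; rewrite ?mulrN ?mulr0 ?mul0r ?oppr0.
  rewrite [X in _ = _ + X](eq_bigr (fun k => - (l (inr k) * A k i))) ?sumrN; last by move=> j _; rewrite mulrN.
  have -> : \sum_k (l (inr k) - l (inl (inr k))) * A k i = \sum_k l (inr k) * A k i - \sum_k l (inl (inr k)) * A k i.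
    by rewrite -sumrB; apply: eq_bigr => k _; rewrite mulrBl.
  slra.
left; have [x [hx bx]] : exists x, (forall j, dot (M j) x <= 0) /\ 0 < dot b x.
  apply: contrapT => nx; apply: h => x hx; rewrite leNgt; apply/negP => hb; apply: nx; by exists x.
exists (fun i => x (Some i)).
have t0 : 0 < x None.
  move: bx; rewrite dE mul1r /dot big1 ?addr0 // => i _; by rewrite mul0r.
split=> [k|j Pj].
  have h1 : dot (M (inl (inr k))) x <= 0 by [].
  have h2 : dot (M (inr k)) x <= 0 by [].
  by move: h1 h2; rewrite /M !dE dN; slra.
have h1 : dot (M (inl (inl j))) x <= 0 by [].
by move: h1; rewrite /M Pj !dE dN; slra.
Qed.

End Farkas.

(** * Noncrossing sequences of labels and the intervals that are unions of classes *)

Section Labels.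
Local Open Scope nat_scope.
Variables (V : eqType) (M : nat) (lab : nat -> V).
Hypothesis nc : forall i j k l, i < j -> j < k -> k < l -> l < M -> lab i = lab k -> lab j = lab l -> lab i = lab j.

(** An interval that no label class leaves: quantities balanced over each class telescope to equal
    values at its two ends. *)
Definition complete a b := a <= b <= M /\
  forall i j, i < M -> j < M -> lab i = lab j -> a <= i < b -> a <= j < b.

Lemma complete_nil a : a <= M -> complete a a.
Proof. by split=> [|i j _ _ _]; slia. Qed.

Lemma complete_cat a b c : complete a b -> complete b c -> complete a c.
Proof.
move=> [h1 k1] [h2 k2]; split=> [|i j iM jM e h]; first slia.
have [l|l] := ltnP i b; first by have := k1 i j iM jM e; slia.
by have := k2 i j iM jM e; slia.
Qed.

Lemma complete_cut a b c : complete a c -> complete a b -> b <= c -> complete b c.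
Proof.
move=> [h1 k1] [h2 k2] bc; split=> [|i j iM jM e h]; first slia.
have := k1 i j iM jM e; have := k2 j i jM iM (esym e); slia.
Qed.

Lemma last_occ i : i < M -> exists k, [/\ i <= k < M, lab k = lab i & forall j, j < M -> lab j = lab i -> j <= k].
Proof.
move=> iM; have ex : exists k, (k < M) && (lab k == lab i) by exists i; rewrite iM eqxx.
have [|k /andP[kM /eqP e] mx] := @ex_maxnP (fun k => (k < M) && (lab k == lab i)) M ex.
  by move=> j /andP[]; slia.
exists k; split=> //; last by move=> j jM ej; apply: mx; rewrite jM ej eqxx.
by rewrite kM mx // iM eqxx.
Qed.

Lemma first_occ i : i < M -> exists k, [/\ k <= i, lab k = lab i & forall j, j < M -> lab j = lab i -> k <= j].
Proof.
move=> iM; have ex : exists k, (k < M) && (lab k == lab i) by exists i; rewrite iM eqxx.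
have [k /andP[kM /eqP e] mn] := ex_minnP ex.
exists k; split=> //; last by move=> j jM ej; apply: mn; rewrite jM ej eqxx.
by apply: mn; rewrite iM eqxx.
Qed.

Lemma prev_occ a i : a < i -> lab a = lab i ->
  exists j, [/\ a <= j < i, lab j = lab i & forall x, j < x < i -> lab x <> lab i].
Proof.
move=> ai e; have ex : exists k, (k < i) && (lab k == lab i) by exists a; rewrite ai e eqxx.
have [|k /andP[kM /eqP ek] mx] := @ex_maxnP (fun k => (k < i) && (lab k == lab i)) i ex.
  by move=> j /andP[]; slia.
exists k; split=> //; first by rewrite kM mx // ai e eqxx.
by move=> x h ex'; have := mx x; rewrite ex' eqxx; slia.
Qed.

Lemma next_occ i b : i < b -> lab b = lab i ->
  exists j, [/\ i < j <= b, lab j = lab i & forall x, i < x < j -> lab x <> lab i].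
Proof.
move=> ib e; have ex : exists k, (i < k) && (lab k == lab i) by exists b; rewrite ib e eqxx.
have [k /andP[kM /eqP ek] mn] := ex_minnP ex.
exists k; split=> //; first by rewrite kM mn // ib e eqxx.
by move=> x h ex'; have := mn x; rewrite ex' eqxx; slia.
Qed.

(** Between consecutive occurrences of a label, a class with members both inside and outside would
    cross the class of that label. *)
Lemma complete_between i k : i < k -> k < M -> lab i = lab k ->
  (forall x, i < x < k -> lab x <> lab k) -> complete i.+1 k.
Proof.
move=> ik kM e n; split=> [|x y xM yM exy h]; first slia.
apply: contrapT => ny.
have nx := n x h; have [yi|yi] := leqP y i.
  have [ye|ye] := eqVneq y i; first by apply: nx; rewrite exy ye.
  by apply: nx; rewrite exy -e; apply: (@nc y i x k); rewrite ?exy //; slia.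
have [ye|ye] := eqVneq y k; first by apply: nx; rewrite exy ye.
by apply: nx; rewrite -e; apply/esym; apply: (@nc i x k y) => //; slia.
Qed.

(** Cuts a complete interval after the last occurrence of its first label; inductions over complete
    intervals peel off classes in this way. *)
Lemma complete_prefix a b k : complete a b -> a < b -> k < M -> lab k = lab a ->
  (forall j, j < M -> lab j = lab a -> j <= k) -> [/\ a <= k < b, complete a k.+1 & complete k.+1 b].
Proof.
move=> C ab kM e mx; have [h1 cl] := C.
have ak : a <= k < b by apply: (cl a k) => //; slia.
have C1 : complete a k.+1.
  split=> [|i j iM jM eij h]; first slia.
  have aj : a <= j < b by apply: (cl i j) => //; slia.
  suff : j <= k by slia.
  have [ei|ni] := eqVneq (lab i) (lab a); first by apply: mx => //; rewrite -eij.
  rewrite leqNgt; apply/negP => kj.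
  have ia : i <> a by move=> z; move: ni; rewrite z eqxx.
  have ik : i <> k by move=> z; move: ni; rewrite z e eqxx.
  by move/eqP: ni; apply; apply/esym; apply: (@nc a i k j) => //; slia.
by split=> //; apply: complete_cut C C1 _; slia.
Qed.

(** Among the pairs of equal labels on the two sides of the gap [g] the closest one works: a class
    leaving either interval would cross it or contain a closer pair. Equal labels at both ends of
    the sequence guarantee that a pair exists. *)
Lemma straddle g : 0 < g < M -> lab 0 = lab M.-1 ->
  exists i k, [/\ i < g <= k, k < M, lab i = lab k, complete i.+1 g & complete g k].
Proof.
move=> gM e0.
pose P n := [exists i : 'I_M, exists k : 'I_M, [&& i < g, g <= k, lab i == lab k & k - i == n]].
have exP : exists n, P n.
  have M0 : 0 < M by slia.
  have M1 : M.-1 < M by slia.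
  exists M.-1; apply/existsP; exists (Ordinal M0); apply/existsP; exists (Ordinal M1) => /=.
  by rewrite e0 eqxx; slia.
have [n /existsP[i /existsP[k /and4P[ig gk /eqP e /eqP en]]] mn] := ex_minnP exP.
have key x y : i <= x -> x < g -> g <= y -> y <= k -> lab x = lab y -> x = i /\ y = k.
  move=> h1 h2 h3 h4 exy; have xM : x < M by slia.
  have yM : y < M by have := ltn_ord k; slia.
  have := mn (y - x) (ltac:(apply/existsP; exists (Ordinal xM); apply/existsP; exists (Ordinal yM); rewrite /= exy eqxx; slia)).
  slia.
exists i, k; split=> //; first by rewrite ig.
  split=> [|x y xM yM exy h]; first slia.
  have nx : lab x <> lab k by move=> z; have [||||? ?] := key x k _ _ _ _ z; have := ltn_ord k; slia.
  apply: contrapT => ny; have [gy|yg] := leqP g y.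
    have [yk|ky] := leqP y k; first by have [||||? ?] := key x y _ _ _ _ exy; have := ltn_ord k; slia.
    by apply: nx; rewrite -e; apply/esym; apply: (@nc i x k y) => //; slia.
  have [ye|ye] := eqVneq y i; first by apply: nx; rewrite exy ye.
  by apply: nx; rewrite exy -e; apply: (@nc y i x k); rewrite ?exy //; have := ltn_ord k; slia.
split=> [|x y xM yM exy h]; first by have := ltn_ord k; slia.
have nx : lab x <> lab i by move=> z; have [||||? ?] := key i x _ _ _ _ (esym z); have := ltn_ord k; slia.
apply: contrapT => ny; have [gy|yg] := leqP g y.
  have [ye|ye] := eqVneq y k; first by apply: nx; rewrite exy ye e.
  by apply: nx; apply/esym; apply: (@nc i x k y) => //; have := ltn_ord k; slia.
have [iy|yi] := leqP i y; first by have [||||? ?] := key y x _ _ _ _ (esym exy); have := ltn_ord k; slia.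
by apply: nx; rewrite exy; apply: (@nc y i x k); rewrite ?exy //; have := ltn_ord k; slia.
Qed.

End Labels.

(** * Infeasibility certificates on one side of the axis: gaps of extremal slope *)

Section SideDual.
Variables (F : realFieldType) (V : finType) (M : nat) (lab : nat -> V).
Variables (c ph ps eta theta : nat -> F).
Hypothesis nc : forall i j k l, (i < j)%N -> (j < k)%N -> (k < l)%N -> (l < M)%N ->
  lab i = lab k -> lab j = lab l -> lab i = lab j.
Hypothesis clt : forall i j, (i < j)%N -> (j < M)%N -> lab i = lab j -> c i < c j.
Hypothesis ps0 : forall i, 0 <= ps i.
Hypothesis th0 : forall i, 0 <= theta i.
Hypothesis thm : forall i, theta i <> 0 -> (0 < i < M)%N /\ c i.-1 = c i.
Hypothesis etm : forall i, eta i <> 0 -> [/\ (0 < i < M)%N,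
  (forall j, (j < M)%N -> lab j = lab i.-1 -> (j < i)%N) & (forall j, (j < M)%N -> lab j = lab i -> (i <= j)%N)].

(** Positions are edges in their order along the axis, and gap [i] lies just before position [i].
    [ph] and [ps] will be the multipliers of the height equation of an edge and of its strict
    inequality in [X]; [eta] and [theta] those of the equation in [X] at a sibling gap and of the
    inequality at a gap between edges of equal height. [Gs] and [Gc] are the slope and the constant
    term of the resulting flow through a gap. *)
Definition Asl i := \sum_(j < i) ph j.
Definition Act i := \sum_(j < i) (- (ph j * c j) - ps j).
Definition Gs i := Asl i + theta i.
Definition Gc i := Act i + eta i - theta i * c i.

Hypothesis bal1 : forall v, \sum_(i < M | lab i == v) (Gs i.+1 - Gs i) = 0.
Hypothesis bal2 : forall v, \sum_(i < M | lab i == v) (Gc i.+1 - Gc i) = 0.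

Local Notation complete := (complete M lab).

Lemma complete_tele (f : nat -> F) a b : (forall v, \sum_(i < M | lab i == v) (f i.+1 - f i) = 0) ->
  complete a b -> f a = f b.
Proof.
move=> bal [h cl]; apply/eqP; rewrite eq_sym -subr_eq0; apply/eqP.
rewrite -telescope_sumr; last by slia.
rewrite (@big_nat_widen _ _ _ a b M) /=; last by slia.
rewrite (@big_nat_widenl _ _ _ a 0 M) /=; last by slia.
rewrite big_mkord (partition_big (fun i : 'I_M => lab i) xpredT) //=; apply: big1 => v _.
have [[i [hi ev]]|n] := pselect (exists i : 'I_M, (a <= i < b)%N /\ lab i = v).
  rewrite -[RHS](bal v); apply: eq_bigl => j.
  have [ej|] := eqVneq (lab j) v; last by rewrite andbF.
  have := cl i j (ltn_ord i) (ltn_ord j) (etrans ev (esym ej)) hi; slia.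
apply: big1 => i /andP[h1 /eqP h2]; case: n; exists i; split=> //; slia.
Qed.

Definition val i x := Gs i * x + Gc i.

(** At height [c i] the contribution of [ph i] cancels and [ps i] can only lower the value; [theta]
    cancels because it lives on gaps between edges of equal height. *)
Lemma drop_step i : (i < M)%N -> val i.+1 (c i) <= val i (c i) - eta i + eta i.+1.
Proof.
move=> iM; rewrite /val /Gs /Gc /Asl /Act !big_ord_recr /=.
have t : theta i.+1 * (c i - c i.+1) = 0.
  have [->|/eqP n] := eqVneq (theta i.+1) 0; first by rewrite mul0r.
  by have [_ /= ->] := thm n; rewrite subrr mulr0.
have := ps0 i; lra.
Qed.

Lemma eta_next j i : (j < i)%N -> (i < M)%N -> lab j = lab i -> eta j.+1 = 0.
Proof.
move=> ji iM e; apply/eqP/negPn/negP => /eqP n.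
have [_ h _] := etm n; have := h i iM (esym e); rewrite /=; slia.
Qed.

Lemma eta_prev j i : (j < i)%N -> (i < M)%N -> lab j = lab i -> eta i = 0.
Proof.
move=> ji iM e; apply/eqP/negPn/negP => /eqP n.
have [_ _ h] := etm n; have := h j (ltn_trans ji iM) e; slia.
Qed.

Variable sg : F.
Hypothesis Gle : forall i, (i <= M)%N -> Gs i <= sg.

(** Induction over complete intervals, peeling off the first class. Between consecutive occurrences
    [j < i] of its label the flow returns to the same affine function, of slope at most [sg], so the
    deficit [R] relative to the initial function at [c i] can only grow. After the class the flow is
    the initial function again, which bounds the deficit by the growth of [eta]; zero [eta] at both
    ends forces equality throughout. *)
Lemma closure n a b : (b - a < n)%N -> complete a b -> Gs a = sg ->
  eta a <= eta b /\ (eta a = 0 -> eta b = 0 ->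
    forall g, (a <= g <= b)%N -> [/\ Gs g = sg, Gc g = Gc a & eta g = 0]).
Proof.
elim: n a b => // n IH a b; rewrite ltnS => ban C ga.
have [h cl] := C.
have [ab|ab] := leqP b a.
  have -> : b = a by slia.
  by split=> // ea _ g hg; have -> : g = a by slia.
have aM : (a < M)%N by slia.
have [k [kM ek mx]] := last_occ lab aM.
have kM' : (k < M)%N by slia.
have [ak C1 C2] := complete_prefix nc C ab kM' ek mx.
have teq x y : complete x y -> Gs x = Gs y /\ Gc x = Gc y.
  by move=> Cx; split; [apply: (complete_tele bal1)|apply: (complete_tele bal2)].
pose R i := val a (c i) - eta a + eta i - val i (c i).
pose good g := [/\ Gs g = sg, Gc g = Gc a & eta g = 0].
have Q m i : (i - a < m)%N -> (a <= i <= k)%N -> lab i = lab a ->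
    0 <= R i /\ (eta a = 0 -> R i <= 0 -> forall g, (a <= g <= i)%N -> good g).
  elim: m i => // m IHm i; rewrite ltnS => im ik ei.
  have [->|ia] := eqVneq i a.
    split=> [|e _ g hg]; first by rewrite /R; lra.
    by have -> : g = a by slia.
  have lai : (a < i)%N by slia.
  have iM : (i < M)%N by slia.
  have [j [aj ej nj]] := prev_occ lai (esym ei).
  have ji : (j < i)%N by slia.
  have Cji : complete j.+1 i by apply: complete_between; rewrite ?ej.
  have [r0 rg] := IHm j (ltac:(slia)) (ltac:(slia)) (etrans ej ei).
  have [s1 s2] := teq _ _ Cji.
  have e1 := eta_next ji iM ej; have e2 := eta_prev ji iM ej.
  have d := drop_step (ltn_trans ji iM); rewrite e1 in d.
  have cc := clt ji iM ej.
  have gi := Gle (ltnW iM).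
  have Ri : R j + (sg - Gs i) * (c i - c j) <= R i.
    by move: d; rewrite /R /val s1 s2 e2 ga; lra.
  have pos : 0 <= (sg - Gs i) * (c i - c j) by apply: mulr_ge0; lra.
  split=> [|ea Ri0 g hg]; first lra.
  have Rj0 : R j <= 0 by lra.
  have gs : Gs i = sg.
    have : (sg - Gs i) * (c i - c j) = 0 by lra.
    by move/eqP; rewrite mulf_eq0 => /orP[/eqP|/eqP]; lra.
  have gc : Gc i = Gc a.
    have : R i = 0 by lra.
    by rewrite /R /val e2 ea gs ga; lra.
  have [lg|lg] := leqP g j; first by apply: rg => //; slia.
  have [_ H] := IH j.+1 i (ltac:(slia)) Cji (etrans s1 gs).
  have [h1 h2 h3] := H e1 e2 g (ltac:(slia)).
  by split=> //; rewrite h2 s2 gc.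
have [r0 rg] := Q (k - a).+1 k (leqnn _) (ltac:(slia)) ek.
have d := drop_step kM'.
have [s1 s2] := teq _ _ C1.
have le1 : R k <= eta k.+1 - eta a.
  by move: d; rewrite /R /val -s1 -s2; lra.
have [le2 H] := IH k.+1 b (ltac:(slia)) C2 (etrans (esym s1) ga).
split=> [|ea eb g hg]; first lra.
have ek1 : eta k.+1 = 0 by lra.
have [lg|lg] := leqP g k; first by apply: rg => //; [lra|slia].
by have [h1 h2 h3] := H ek1 eb g (ltac:(slia)); split=> //; rewrite h2 -s2.
Qed.

Hypothesis ends : lab 0 = lab M.-1.

Lemma sector g : (0 < g < M)%N -> Gs g = sg ->
  exists i k, [/\ (i < g <= k)%N, (k < M)%N, lab i = lab k, complete i.+1 k &
    forall x, (i < x <= k)%N -> Gs x = sg /\ eta x = 0].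
Proof.
move=> gM gg; have [i [k [ik kM e C1 C2]]] := straddle nc gM ends.
have C := complete_cat C1 C2; exists i, k; split=> // x hx.
have lik : (i < k)%N by slia.
have e1 := eta_next lik kM e; have e2 := eta_prev lik kM e.
have s : Gs i.+1 = sg by rewrite (complete_tele bal1 C1).
have [_ H] := closure (leqnn _) C s.
by have [] := H e1 e2 x (ltac:(slia)).
Qed.

Lemma theta_eq0 x : (0 < x < M)%N -> c x.-1 < c x -> theta x = 0.
Proof. by move=> xM l; apply/eqP/negPn/negP => /eqP /thm [_ e]; move: l; rewrite e ltxx. Qed.

(** Heights increase strictly across a sector, so some gap in it separates different heights and
    carries no [theta]. *)
Lemma nonmicro g : (0 < g < M)%N -> Gs g = sg ->
  exists x, [/\ (0 < x < M)%N, c x.-1 < c x & Asl x = sg].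
Proof.
move=> gM gg; have [i [k [ik kM e C H]]] := sector gM gg.
apply: contrapT => nx.
have lik : (i < k)%N by slia.
have st x : (i < x <= k)%N -> c x <= c x.-1.
  move=> hx; rewrite leNgt; apply/negP => l; apply: nx; exists x; split=> //; first slia.
  have [g1 _] := H x hx; rewrite -g1 /Gs theta_eq0 ?addr0 //; slia.
have eqi n : (i + n <= k)%N -> c (i + n)%N <= c i.
  elim: n => [|n IHn] h; first by rewrite addn0.
  have := st (i + n.+1)%N (ltac:(slia)); rewrite addnS /= => h1; apply: le_trans h1 (IHn _); slia.
have := eqi (k - i)%N (ltac:(slia)); rewrite subnKC; last by slia.
have := clt lik kM e; lra.
Qed.

(** If the label of [i2] first occurred in the run only after [i1], the sector around that
    occurrence would stay inside the run and either contain an earlier occurrence or end before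
    [i2], splitting its class. *)
Lemma run i1 i2 : (i1 < i2)%N -> (i2 < M)%N -> Gs i1 < sg -> Gs i2.+1 < sg ->
  (forall x, (i1 < x <= i2)%N -> Asl x = sg) -> lab i1 = lab i2.
Proof.
move=> i12 i2M l1 l2 H.
have ex : exists j, (i1 <= j)%N && (lab j == lab i2) by exists i2; rewrite eqxx ltnW.
have [j /andP[ij /eqP ej] mn] := ex_minnP ex.
have ji : (j <= i2)%N by apply: mn; rewrite eqxx ltnW.
have [-> //|nj] := eqVneq i1 j.
have gj : Gs j = sg.
  have hj : (i1 < j <= i2)%N by slia.
  apply/eqP; rewrite eq_le Gle; last by slia.
  by rewrite /= /Gs (H j hj) lerDl.
have jM : (0 < j < M)%N by slia.
have [i [k [ik kM e [_ C] S]]] := sector jM gj.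
have hi : (i1 <= i)%N.
  by rewrite leqNgt; apply/negP => l; have [s _] := S i1 (ltac:(slia)); rewrite s ltxx in l1.
have hk : (k <= i2)%N.
  by rewrite leqNgt; apply/negP => l; have [s _] := S i2.+1 (ltac:(slia)); rewrite s ltxx in l2.
have [ejk|njk] := eqVneq j k.
  by have := mn i; rewrite hi e -ejk ej eqxx => /(_ isT); slia.
have := C j i2 (ltac:(slia)) i2M ej (ltac:(slia)); slia.
Qed.

End SideDual.

(** * Solutions on one side of the axis: how a class lies relative to the adjacent ones *)

Section SidePrimal.
Variables (F : realFieldType) (V : eqType) (M : nat) (lab : nat -> V).
Variables (c : nat -> F) (X Y : V -> F).
Hypothesis nc : forall i j k l, (i < j)%N -> (j < k)%N -> (k < l)%N -> (l < M)%N ->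
  lab i = lab k -> lab j = lab l -> lab i = lab j.
Hypothesis cle : forall i j, (i <= j)%N -> (j < M)%N -> c i <= c j.
Hypothesis clt : forall i j, (i < j)%N -> (j < M)%N -> lab i = lab j -> c i < c j.
Let hh (s : F) v := Y v - s * X v.
Hypothesis gapX : forall i, (0 < i < M)%N -> lab i.-1 <> lab i ->
  (forall j, (j < M)%N -> lab j = lab i.-1 -> (j < i)%N) ->
  (forall j, (j < M)%N -> lab j = lab i -> (i <= j)%N) -> X (lab i.-1) = X (lab i).
Hypothesis gapY : forall i, (0 < i < M)%N -> lab i.-1 <> lab i ->
  hh (c i.-1) (lab i) < hh (c i.-1) (lab i.-1) /\ hh (c i) (lab i) < hh (c i) (lab i.-1).

Local Notation complete := (complete M lab).

Lemma class_complete a l : (a <= l < M)%N -> lab a = lab l ->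
  (forall j, (j < M)%N -> lab j = lab a -> (a <= j <= l)%N) -> complete a l.+1.
Proof.
move=> al e h; split=> [|x y xM yM exy hx]; first slia.
have [ex|/eqP nx] := eqVneq (lab x) (lab a); first by have := h y yM (etrans (esym exy) ex); slia.
have xa : x <> a by move=> z; apply: nx; rewrite z.
have xl : x <> l by move=> z; apply: nx; rewrite z e.
have ya : y <> a by move=> z; apply: nx; rewrite exy z.
have yl : y <> l by move=> z; apply: nx; rewrite exy z e.
apply: contrapT => ny; have [lt|ge] := ltnP y a.
  by apply: nx; rewrite exy; apply: (@nc y a x l) => //; slia.
by apply: nx; apply/esym; apply: (@nc a x l y) => //; slia.
Qed.

(** The outermost classes of a complete interval follow one another across gaps where [X] is equal,
    and there the height inequality says that [Y] decreases. *)
Lemma siblings n b g : (g - b < n)%N -> complete b g -> (b < g)%N ->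
  X (lab g.-1) = X (lab b) /\ Y (lab g.-1) <= Y (lab b).
Proof.
elim: n g => // n IH g; rewrite ltnS => gn C bg; have [h cl] := C.
have gM : (g.-1 < M)%N by slia.
have [f [fg ef mn]] := first_occ lab gM.
have bf : (b <= f < g)%N by apply: (cl g.-1 f) => //; slia.
have [e|nf] := eqVneq f b; first by rewrite -ef e.
have C1 : complete b f.
  split=> [|x y xM yM exy hx]; first slia.
  have hy : (b <= y < g)%N by apply: (cl x y) => //; slia.
  apply: contrapT => ny.
  have nx : lab x <> lab g.-1 by move=> z; have := mn x xM z; slia.
  have yf : y <> f by move=> z; apply: nx; rewrite exy z ef.
  have yg : y <> g.-1 by move=> z; apply: nx; rewrite exy z.
  by apply: nx; rewrite -ef; apply: (@nc x f y g.-1) => //; slia.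
have [_ cl1] := C1.
have nl : lab f.-1 <> lab f.
  move=> z; have := mn f.-1 (ltac:(slia)) (etrans z ef); slia.
have e1 : X (lab f.-1) = X (lab f).
  apply: gapX => //; first slia.
    by move=> j jM ej; have := cl1 f.-1 j (ltac:(slia)) jM (esym ej) (ltac:(slia)); slia.
  by move=> j jM ej; apply: mn => //; rewrite ej.
have [_ y1] := gapY (ltac:(slia) : (0 < f < M)%N) nl.
have [e2 y2] := IH f (ltac:(slia)) C1 (ltac:(slia)).
rewrite -ef -e1 e2; split=> //; move: y1; rewrite /hh e1 => y1; lra.
Qed.

(** The height inequalities at the two ends of the interval between two occurrences of the enclosing
    label add up to a positive product of a height difference and [X (lab i) - X u]. So [X]
    decreases with the depth of nesting. *)
Lemma parent u a l i k : (a <= l)%N -> (l < k < M)%N -> (i < a)%N -> lab a = u -> lab l = u ->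
  (forall j, (j < M)%N -> lab j = u -> (a <= j <= l)%N) -> lab i = lab k ->
  complete i.+1 a -> complete i.+1 k -> X u < X (lab i).
Proof.
move=> al lk ia ea el cls eik C1 C2; have [h cl] := C2.
have C3 : complete i.+1 l.+1.
  by apply: (complete_cat C1); apply: class_complete; rewrite ?ea ?el //; slia.
have [x1 _] := siblings (leqnn _) C3 (ltac:(slia)); rewrite /= el in x1.
have [x2 y2] := siblings (leqnn _) C2 (ltac:(slia)).
have n1 : lab i.+1.-1 <> lab i.+1.
  by move=> z; have := cl i.+1 i (ltac:(slia)) (ltac:(slia)) (esym z); slia.
have n2 : lab k.-1 <> lab k.
  by move=> z; have := cl k.-1 k (ltac:(slia)) (ltac:(slia)) z; slia.
have [_ g1] := gapY (ltac:(slia) : (0 < i.+1 < M)%N) n1.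
have [g2 _] := gapY (ltac:(slia) : (0 < k < M)%N) n2.
have cc : c i.+1 <= c k.-1 by apply: cle; slia.
move: g1 g2; rewrite /hh /= -eik x2 x1 => g1 g2.
have : 0 < (c k.-1 - c i.+1) * (X (lab i) - X (lab i.+1)) by lra.
by move=> hp; rewrite -subr_gt0 -(pmulr_rgt0 (x := c k.-1 - c i.+1)) // lt_def; apply/andP; split;
  [apply/eqP => z; move: hp; rewrite z mul0r ltxx|lra].
Qed.

Hypothesis ends : lab 0 = lab M.-1.

(** Collects for each class what the hull condition needs. The labels just before and just after the
    class are siblings, with equal [X], or the enclosing class, with larger [X]; both are larger
    only if they are the same. *)
Lemma side_nbrs i0 : (i0 < M)%N -> lab i0 <> lab 0 -> let u := lab i0 in
  exists a l, [/\ (0 < a <= l)%N, (l.+1 < M)%N, lab a = u, lab l = u &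
  [/\ lab a.-1 <> u, lab l.+1 <> u, a = l \/ c a < c l,
    hh (c a) u < hh (c a) (lab a.-1) /\ hh (c l) (lab l.+1) < hh (c l) u &
    [/\ X u <= X (lab a.-1), X u <= X (lab l.+1), X u < X (lab a.-1) -> X u < X (lab l.+1) -> lab a.-1 = lab l.+1 &
     exists k, (k < M)%N /\ X u < X (lab k)]]].
Proof.
move=> iM n0 u.
have [a [ai ea amn]] := first_occ lab iM; have [l [li el lmx]] := last_occ lab iM.
have a0 : (0 < a)%N.
  by rewrite lt0n; apply/eqP => z; apply: n0; rewrite -ea z.
have lM : (l.+1 < M)%N.
  rewrite ltnNge; apply/negP => z; apply: n0; rewrite -el ends; congr lab; slia.
have cls j : (j < M)%N -> lab j = u -> (a <= j <= l)%N.
  by move=> jM ej; rewrite amn // lmx.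
have C : complete a l.+1.
  by apply: class_complete; rewrite ?ea ?el //; slia.
have [_ cl] := C.
have np : lab a.-1 <> u by move=> z; have := cls a.-1 (ltac:(slia)) z; slia.
have nq : lab l.+1 <> u by move=> z; have := cls l.+1 lM z; slia.
have nga : lab a.-1 <> lab a by rewrite ea.
have ngl : lab l.+1.-1 <> lab l.+1 by rewrite /= el; apply/nesym.
have [_ ga] := gapY (ltac:(slia) : (0 < a < M)%N) nga.
have [gl _] := gapY (ltac:(slia) : (0 < l.+1 < M)%N) ngl.
have Pp : X u = X (lab a.-1) \/ (X u < X (lab a.-1) /\ exists k, [/\ (l < k < M)%N & lab k = lab a.-1]).
  have [[k [kM ek ak]]|nx] := pselect (exists k, [/\ (k < M)%N, lab k = lab a.-1 & (a <= k)%N]).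
    right; have [k' [k1 ek' nk]] := next_occ (ltac:(slia) : (a.-1 < k)%N) ek.
    have lk' : (l < k')%N.
      rewrite ltnNge; apply/negP => z.
      by have := cl k' a.-1 (ltac:(slia)) (ltac:(slia)) ek' (ltac:(slia)); slia.
    split; last by exists k'; split=> //; slia.
    have aa : a.-1.+1 = a by slia.
    apply: (@parent u a l a.-1 k') => //; try slia; first by rewrite aa; apply: complete_nil; slia.
    apply: complete_between => //; try slia.
    by move=> x hx; rewrite ek'; apply: nk.
  left; apply/esym; rewrite [u](esym ea); apply: gapX => //; first slia.
    by move=> j jM ej; rewrite ltnNge; apply/negP => z; apply: nx; exists j.
  by move=> j jM ej; have := cls j jM (etrans ej ea); slia.
have Pq : X u = X (lab l.+1) \/ (X u < X (lab l.+1) /\ exists k, [/\ (k < a)%N & lab k = lab l.+1]).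
  have [[k [kM ek kl]]|nx] := pselect (exists k, [/\ (k < M)%N, lab k = lab l.+1 & (k <= l)%N]).
    right; have [k' [k1 ek' nk]] := prev_occ (ltac:(slia) : (k < l.+1)%N) ek.
    have k'a : (k' < a)%N.
      rewrite ltnNge; apply/negP => z.
      by have := cl k' l.+1 (ltac:(slia)) lM ek' (ltac:(slia)); slia.
    split; last by exists k'.
    have C2 : complete k'.+1 l.+1 by apply: complete_between => //; slia.
    have C1 : complete k'.+1 a.
      have [hC2 clC2] := C2; split=> [|x y xM yM exy hx]; first slia.
      have := clC2 x y xM yM exy; have := cl y x yM xM (esym exy); slia.
    by rewrite -ek'; apply: (@parent u a l k' l.+1) => //; slia.
  have h1 : (0 < l.+1 < M)%N by slia.
  left; rewrite [u](esym el); apply: (gapX h1 ngl) => j jM ej.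
    by have := cls j jM (etrans ej el); slia.
  by rewrite leqNgt; apply/negP => z; apply: nx; exists j; split=> //; slia.
exists a, l; split=> //; first slia.
split=> //.
- have [->|nal] := eqVneq a l; [by left|right; apply: clt; rewrite ?ea ?el //; slia].
- by split; [move: ga; rewrite ea|move: gl; rewrite /= el].
split.
- by case: Pp => [<-|[/ltW]].
- by case: Pq => [<-|[/ltW]].
- move=> hp hq; case: Pp => [e|[_ [k [kM ek]]]]; first by rewrite e ltxx in hp.
  case: Pq => [e|[_ [k' [kM' ek']]]]; first by rewrite e ltxx in hq.
  have [e1|n1] := eqVneq k' a.-1; first by rewrite -ek' e1.
  have [e2|n2] := eqVneq k l.+1; first by rewrite -ek e2.
  by rewrite -ek'; apply/esym; apply: (@nc k' a.-1 l.+1 k) => //; slia.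
have [i [k [ik kM e C1 C2]]] := straddle nc (ltac:(slia) : (0 < a < M)%N) ends.
exists i; split; first slia.
have lk : (l < k)%N.
  rewrite ltnNge; apply/negP => z.
  by have := cl k i kM (ltac:(slia)) (esym e) (ltac:(slia)); slia.
have C3 := complete_cat C1 C2.
by apply: (@parent u a l i k) => //; slia.
Qed.

End SidePrimal.

(** * The edges that meet a vertical line just left of the axis *)

Section Line.
Variables (F : realFieldType) (V : finType) (g : V -> F * F) (E : rel V) (o p r : V) (t : F).
Implicit Types (u v w y : V) (e f : V * V) (z : F * F) (s : F).
Hypothesis HP : plane_edges g E.
Hypothesis Hsat : saturated g E.
Hypothesis fr : frame g E o p r.
Local Notation xc v := (g v).1.
Hypothesis t0 : t < 0.
Definition left_gap := forall v, xc v < 0 -> xc v < t.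
Definition no_vertex_at := forall v, xc v != t.
Hypothesis left_t : left_gap.

Local Notation E_sym := (plane_sym HP).
Local Notation E_irr := (plane_irr HP).
Local Notation E_vtx := (plane_vtx HP).
Local Notation E_pl := (plane_cross HP).

Definition ht e s := (g e.1).2 + (s - xc e.1) / (xc e.2 - xc e.1) * ((g e.2).2 - (g e.1).2).
(** Edges ending on the axis are included. They are sorted on the line at [t] instead of the axis,
    because there edges with a common end on the axis still have distinct heights. *)
Definition crosses e := [&& E e.1 e.2, xc e.1 < 0 & 0 <= xc e.2].

Lemma crossesP e : crosses e -> [/\ E e.1 e.2, xc e.1 < t, xc e.1 < 0, 0 <= xc e.2 & t < xc e.2].
Proof.
by case/and3P=> h1 h2 h3; split=> //; [apply: left_t|apply: lt_le_trans h3].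
Qed.

Lemma on_edge e s : xc e.1 < xc e.2 -> xc e.1 <= s <= xc e.2 -> cseg (g e.1) (g e.2) (s, ht e s).
Proof.
move=> l hs; have d : xc e.2 - xc e.1 != 0 by apply/eqP; slra.
exists ((s - xc e.1) / (xc e.2 - xc e.1)); split.
  by rewrite divr_ge0 ?ler_pdivrMr /=; slra.
by apply: pairP; rewrite /mix /ht /=; field.
Qed.

Lemma on_edge_open e s : xc e.1 < xc e.2 -> xc e.1 < s < xc e.2 -> oseg (g e.1) (g e.2) (s, ht e s).
Proof.
move=> l hs; have d : xc e.2 - xc e.1 != 0 by apply/eqP; slra.
exists ((s - xc e.1) / (xc e.2 - xc e.1)); split.
  by rewrite divr_gt0 ?ltr_pdivrMr /=; slra.
by apply: pairP; rewrite /mix /ht /=; field.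
Qed.

Lemma same_edge e f z : E e.1 e.2 -> E f.1 f.2 -> xc e.1 < xc e.2 -> xc f.1 < xc f.2 ->
  oseg (g e.1) (g e.2) z -> cseg (g f.1) (g f.2) z -> e = f.
Proof.
move=> Ee Ef le lf oz cz; case: (E_pl Ee Ef oz cz) => -[e1 e2].
  by case: e f e1 e2 {Ee Ef le lf oz cz} => ? ? [? ?] /= -> ->.
by exfalso; move: le lf; rewrite e1 e2; slra.
Qed.

Lemma ht1 e : ht e (xc e.1) = (g e.1).2.
Proof. by rewrite /ht subrr mul0r mul0r addr0. Qed.

Lemma ht2 e : xc e.1 < xc e.2 -> ht e (xc e.2) = (g e.2).2.
Proof. by move=> l; rewrite /ht divff ?mul1r; [slra|apply/eqP; slra]. Qed.

Lemma ht_aff e s s' m : ht e ((1 - m) * s + m * s') = (1 - m) * ht e s + m * ht e s'.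
Proof. by rewrite /ht; ring. Qed.

(** If the order were reversed, the edges would meet at the intermediate abscissa where the
    interpolated height difference vanishes. *)
Lemma ht_ord e f s s' : E e.1 e.2 -> E f.1 f.2 -> xc e.1 < xc e.2 -> xc f.1 < xc f.2 ->
  xc e.1 <= s <= xc e.2 -> xc f.1 <= s <= xc f.2 -> xc e.1 <= s' <= xc e.2 -> xc f.1 <= s' <= xc f.2 ->
  ht e s < ht f s -> ht e s' <= ht f s'.
Proof.
move=> Ee Ef le lf es fs es' fs' lt; rewrite leNgt; apply/negP => gt.
pose A := ht f s - ht e s; pose B := ht e s' - ht f s'.
have AB : 0 < A + B by rewrite /A /B; slra.
pose m := A / (A + B); have m1 : m * (A + B) = A by rewrite divfK // gt_eqF.
have m0 : 0 < m by rewrite divr_gt0 // /A; slra.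
have mB : 0 < (1 - m) * (A + B) by move: m1; rewrite /B; slra.
have m2 : m < 1 by rewrite -subr_gt0 -(pmulr_lgt0 _ AB).
pose x := (1 - m) * s + m * s'.
have eqx : ht e x = ht f x by rewrite /x !ht_aff; move: m1; rewrite /A /B; slra.
have ss : s != s' by apply/eqP => z; move: lt gt; rewrite z; slra.
have bt a b : a <= s <= b -> a <= s' <= b -> a < x < b.
  move=> h1 h2; case: (ltgtP s s') ss => // h _; rewrite /x.
    have p1 : 0 < (1 - m) * (s' - s) by apply: mulr_gt0; slra.
    have p2 : 0 < m * (s' - s) by apply: mulr_gt0; slra.
    slra.
  have p1 : 0 < (1 - m) * (s - s') by apply: mulr_gt0; slra.
  have p2 : 0 < m * (s - s') by apply: mulr_gt0; slra.
  slra.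
have oe := on_edge_open le (bt _ _ es es').
have of_ := oseg_cseg (on_edge_open lf (bt _ _ fs fs')); rewrite -eqx in of_.
by move: lt; rewrite (same_edge Ee Ef le lf oe of_) ltxx.
Qed.

Lemma ht_inj e f : crosses e -> crosses f -> ht e t = ht f t -> e = f.
Proof.
move=> /crossesP[Ee e1 _ _ e2] /crossesP[Ef f1 _ _ f2] h.
have le := lt_trans e1 e2; have lf := lt_trans f1 f2.
have oe := on_edge_open le (ltac:(by rewrite e1 e2) : xc e.1 < t < xc e.2).
have of_ := oseg_cseg (on_edge_open lf (ltac:(by rewrite f1 f2) : xc f.1 < t < xc f.2)).
by rewrite -h in of_; apply: same_edge oe of_.
Qed.

Definition leht e f := ht e t <= ht f t.
Definition items : seq (V * V) := sort leht (enum crosses).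

Lemma mem_items e : (e \in items) = crosses e.
Proof. by rewrite mem_sort mem_enum. Qed.

Lemma uniq_items : uniq items.
Proof. by rewrite sort_uniq enum_uniq. Qed.

Definition it i := nth (o, o) items i.
Local Notation M := (size items).
Definition lab i := (it i).1.
Definition rgt i := (it i).2.

Lemma it_crosses i : (i < M)%N -> crosses (it i).
Proof. by move=> iM; rewrite -mem_items mem_nth. Qed.

Lemma it_inj i j : (i < M)%N -> (j < M)%N -> it i = it j -> i = j.
Proof. by move=> iM jM /eqP; rewrite nth_uniq ?uniq_items // => /eqP. Qed.

Lemma it_le i j : (i <= j)%N -> (j < M)%N -> ht (it i) t <= ht (it j) t.
Proof.
move=> ij jM; have tr : transitive leht by move=> x y z; apply: le_trans.
have tot : total leht by move=> x y; apply: le_total.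
apply: (sorted_leq_nth tr (fun x => lexx _) (o, o) (sort_sorted tot _)) => //.
exact: leq_ltn_trans ij jM.
Qed.

Lemma it_lt i j : (i < j)%N -> (j < M)%N -> ht (it i) t < ht (it j) t.
Proof.
move=> ij jM; have iM := ltn_trans ij jM.
rewrite lt_neqAle it_le // 1?ltnW // andbT; apply/eqP => /ht_inj e.
have := it_inj iM jM (e (it_crosses iM) (it_crosses jM)); slia.
Qed.

Lemma it_index e : crosses e -> exists2 i, (i < M)%N & it i = e.
Proof. by rewrite -mem_items => h; exists (index e items); rewrite ?index_mem // /it nth_index. Qed.

Lemma lt_it i e : (i < M)%N -> crosses e -> ht (it i) t < ht e t -> (i.+1 < M)%N /\ ht (it i.+1) t <= ht e t.
Proof.
move=> iM /it_index [j jM <-] l.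
have ij : (i < j)%N by rewrite ltnNge; apply/negP => h; have := it_le h iM; slra.
by split; [slia|apply: it_le].
Qed.

(** The edge [y] is squeezed between two edges leaving the vertex [lab x] and still extends over its
    abscissa, so it passes through that vertex. *)
Lemma lab_between (x y z : nat) : (x < y)%N -> (y < z)%N -> (z < M)%N -> lab x = lab z ->
  xc (lab y) <= xc (lab x) -> lab x = lab y.
Proof.
move=> xy yz zM exz le.
have yM := ltn_trans yz zM; have xM := ltn_trans xy yM.
have [Ex x1 x1' x2' x2] := crossesP (it_crosses xM).
have [Ey y1 y1' y2' y2] := crossesP (it_crosses yM).
have [Ez z1 z1' z2' z2] := crossesP (it_crosses zM).
have dx := lt_trans x1 x2; have dy := lt_trans y1 y2; have dz := lt_trans z1 z2.
have lxz : xc (it x).1 = xc (it z).1 by rewrite -[(it x).1]/(lab x) exz.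
rewrite /lab in le.
have in_x : xc (it x).1 <= xc (lab x) <= xc (it x).2 by rewrite /lab lexx ltW.
have in_y : xc (it y).1 <= xc (lab x) <= xc (it y).2 by rewrite le (ltW (lt_trans x1 y2)).
have in_z : xc (it z).1 <= xc (lab x) <= xc (it z).2 by rewrite /lab lxz lexx ltW.
have t_x : xc (it x).1 <= t <= xc (it x).2 by rewrite !ltW.
have t_y : xc (it y).1 <= t <= xc (it y).2 by rewrite !ltW.
have t_z : xc (it z).1 <= t <= xc (it z).2 by rewrite !ltW.
have o1 : ht (it x) (xc (lab x)) <= ht (it y) (xc (lab x)).
  by apply: (@ht_ord (it x) (it y) t) => //; apply: it_lt.
have o2 : ht (it y) (xc (lab x)) <= ht (it z) (xc (lab x)).
  by apply: (@ht_ord (it y) (it z) t) => //; apply: it_lt.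
rewrite ht1 in o1; rewrite {2}exz ht1 -/(lab z) -exz in o2.
have e : ht (it y) (xc (lab x)) = (g (lab x)).2 by apply/eqP; rewrite eq_le o1 o2.
have c : cseg (g (it y).1) (g (it y).2) (g (lab x)).
  have -> : g (lab x) = (xc (lab x), ht (it y) (xc (lab x))) by rewrite e; case: (g (lab x)).
  by apply: on_edge.
case: (E_vtx Ey c) => // e'; exfalso; move: x1; rewrite -/(lab x) e'; slra.
Qed.

(** The label lying further right serves as the squeezing vertex. *)
Lemma lab_noncrossing i j k l : (i < j)%N -> (j < k)%N -> (k < l)%N -> (l < M)%N ->
  lab i = lab k -> lab j = lab l -> lab i = lab j.
Proof.
move=> ij jk kl lM eik ejl.
have kM := ltn_trans kl lM; have jM := ltn_trans jk kM; have iM := ltn_trans ij jM.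
have [le|le] := leP (xc (lab j)) (xc (lab i)); first exact: (lab_between ij jk).
by rewrite eik; apply/esym; apply: (lab_between jk kl) => //; rewrite -eik ltW.
Qed.

Lemma ht0_le i j : (i <= j)%N -> (j < M)%N -> ht (it i) 0 <= ht (it j) 0.
Proof.
move=> ij jM; have iM : (i < M)%N := leq_ltn_trans ij jM.
have [->//|n] := eqVneq i j.
have [Ex x1 x1' x2' x2] := crossesP (it_crosses iM).
have [Ey y1 y1' y2' y2] := crossesP (it_crosses jM).
have lt : ht (it i) t < ht (it j) t by apply: it_lt => //; rewrite ltn_neqAle n.
by apply: (@ht_ord (it i) (it j) t) => //; slra.
Qed.

Lemma ht0_eq e f : crosses e -> crosses f -> ht e 0 = ht f 0 -> e = f \/ (e.2 = f.2 /\ xc e.2 = 0).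
Proof.
move=> /crossesP[Ee e1 e1' e2' e2] /crossesP[Ef f1 f1' f2' f2] h.
have le := lt_trans e1 e2; have lf := lt_trans f1 f2.
have ce : cseg (g e.1) (g e.2) (0, ht e 0) by apply: on_edge; slra.
have cf : cseg (g f.1) (g f.2) (0, ht f 0) by apply: on_edge; slra.
have [e0|e0] := eqVneq (xc e.2) 0.
  right; split=> //; have : cseg (g f.1) (g f.2) (g e.2).
    have -> : g e.2 = (0, ht f 0) by rewrite -h -{2}e0 ht2 //; apply: pairP => /=; rewrite ?e0.
    by [].
  by case/(E_vtx Ef) => // z; exfalso; move: e0; rewrite z; slra.
have [f0|f0] := eqVneq (xc f.2) 0.
  have : cseg (g e.1) (g e.2) (g f.2).
    have -> : g f.2 = (0, ht e 0) by rewrite h -{2}f0 ht2 //; apply: pairP => /=; rewrite ?f0.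
    by [].
  by case/(E_vtx Ee) => z; [exfalso; move: f0; rewrite z; slra|right; rewrite -z].
left; have e20 : 0 < xc e.2 by rewrite lt_def e0.
have oe := on_edge_open le (ltac:(slra) : xc e.1 < 0 < xc e.2).
by rewrite h in oe; apply: same_edge oe cf.
Qed.

Lemma ht0_lt_lab i j : (i < j)%N -> (j < M)%N -> lab i = lab j -> ht (it i) 0 < ht (it j) 0.
Proof.
move=> ij jM el; have iM := ltn_trans ij jM.
rewrite lt_neqAle ht0_le // 1?ltnW // andbT; apply/eqP => h.
have e : it i = it j.
  case: (ht0_eq (it_crosses iM) (it_crosses jM) h) => // -[e2 _].
  by move: el e2; rewrite /lab; case: (it i) (it j) => ? ? [? ?] /= -> ->.
have := it_inj iM jM e; slia.
Qed.

Lemma orient_ht e s (y : F) : xc e.1 < xc e.2 -> orient (g e.1) (g e.2) (s, y) = (xc e.2 - xc e.1) * (y - ht e s).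
Proof. by move=> l; rewrite /orient /ht /=; field; apply/eqP; slra. Qed.

Lemma inside_two (a b c A B z : F * F) : 0 < orient a b c -> oseg a b A -> oseg a c B -> oseg A B z ->
  inside a b c z.
Proof.
move=> D [m [hm ->]] [n [hn ->]] [k [hk ->]].
have P (x y : F) : 0 < x -> 0 < y -> 0 < x * y * orient a b c by move=> ? ?; rewrite !mulr_gt0.
have m0 : 0 < m by slra.
have n0 : 0 < n by slra.
have k0 : 0 < k by slra.
have k1 : 0 < 1 - k by slra.
have m1 : 0 < 1 - m by slra.
have n1 : 0 < 1 - n by slra.
have E1 : orient a b (mix k (mix m a b) (mix n a c)) = k * n * orient a b c by rewrite /orient /mix /=; ring.
have E3 : orient c a (mix k (mix m a b) (mix n a c)) = (1 - k) * m * orient a b c by rewrite /orient /mix /=; ring.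
have E2 : orient b c (mix k (mix m a b) (mix n a c)) = (1 - k) * (1 - m) * orient a b c + k * (1 - n) * orient a b c.
  by rewrite /orient /mix /=; ring.
by split; rewrite ?E1 ?E2 ?E3 ?addr_gt0 ?P.
Qed.

Lemma oseg_vertical (s h1 h2 h : F) : h1 < h < h2 -> oseg (s, h1) (s, h2) (s, h).
Proof.
move=> l; have d : h2 - h1 != 0 by apply/eqP; slra.
exists ((h - h1) / (h2 - h1)); split; first by rewrite divr_gt0 ?ltr_pdivrMr /=; slra.
by apply: pairP; rewrite /mix /=; field.
Qed.

Lemma crosses_t e : E e.1 e.2 -> xc e.1 < t -> t < xc e.2 -> crosses e.
Proof.
move=> Ee h1 h2; rewrite /crosses Ee (lt_trans h1 t0) leNgt /=.
by apply/negP => /left_t; slra.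
Qed.

Hypothesis xt : no_vertex_at.

(** The face above edge [i] has its third corner left or right of the line. The other side of the
    face met by the line is the next crossing edge, since no edge runs inside a face. *)
Lemma it_consecutive i : (i.+1 < M)%N ->
  lab i = lab i.+1 \/ (rgt i = rgt i.+1 /\ E (lab i) (lab i.+1)).
Proof.
move=> i1M; have iM := ltnW i1M.
have ce := it_crosses iM; have cf := it_crosses i1M.
have lt := it_lt (ltnSn i) i1M.
have [Ee e1 e1' e2' e2] := crossesP ce.
have [Ef f1 f1' f2' f2] := crossesP cf.
have le := lt_trans e1 e2; have lf := lt_trans f1 f2.
have of_ := on_edge_open lf (ltac:(slra) : xc (it i.+1).1 < t < xc (it i.+1).2).
have oe := on_edge_open le (ltac:(slra) : xc (it i).1 < t < xc (it i).2).
have [v hv] : exists v, 0 < orient (g (it i).1) (g (it i).2) (g v).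
  have : 0 < orient (g (it i).1) (g (it i).2) (t, ht (it i.+1) t).
    by rewrite orient_ht // mulr_gt0; slra.
  case: of_ => m [hm ->]; rewrite mix_orient => h; apply: contrapT => nx.
  have le0 v : orient (g (it i).1) (g (it i).2) (g v) <= 0 by rewrite leNgt; apply/negP => ?; apply: nx; exists v.
  have h1 : 0 <= (1 - m) * - orient (g (it i).1) (g (it i).2) (g (it i.+1).1).
    by apply: mulr_ge0; [slra|have := le0 (it i.+1).1; slra].
  have h2 : 0 <= m * - orient (g (it i).1) (g (it i).2) (g (it i.+1).2).
    by apply: mulr_ge0; [slra|have := le0 (it i.+1).2; slra].
  slra.
have [w Tw] := tri_exists HP Hsat Ee hv.
have [_ E2 E3 D _] := triP Tw.
have := xt w; case: (ltgtP (xc w) t) => // xw _.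
- pose n : V * V := (w, (it i).2).
  have cn : crosses n by apply: crosses_t => //=; rewrite E_sym.
  have ln : xc n.1 < xc n.2 by rewrite /=; slra.
  have on := on_edge_open ln (ltac:(rewrite /=; slra) : xc n.1 < t < xc n.2).
  have hn : ht (it i) t < ht n t.
    have Dn : 0 < orient (g (it i).1) (g (it i).2) (g w) by [].
    have : 0 < orient (g (it i).1) (g (it i).2) (t, ht n t).
      case: on => m [hm ->]; rewrite mix_orient /= (_ : orient _ _ (g (it i).2) = 0); last by rewrite /orient; ring.
      by rewrite mulr0 addr0 mulr_gt0 //; slra.
    by rewrite orient_ht // pmulr_rgt0; slra.
  have [_ le2] := lt_it iM cn hn.
  have [e|ne] := eqVneq (ht (it i.+1) t) (ht n t).
    right; rewrite /rgt /lab (ht_inj cf cn e) /=; split=> //.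
    by rewrite E_sym.
  have lt2 : ht (it i.+1) t < ht n t by rewrite lt_neqAle ne.
  have zz := oseg_vertical t (ltac:(by rewrite lt lt2) : ht (it i) t < ht (it i.+1) t < ht n t).
  have D2 : 0 < orient (g (it i).2) (g w) (g (it i).1) by rewrite -orient_rot.
  have [i1 i2 i3] := inside_two D2 (oseg_sym on) (oseg_sym oe) (oseg_sym zz).
  by case: (tri_interior HP Tw Ef of_ i3 i1 i2).
- pose n : V * V := ((it i).1, w).
  have cn : crosses n by apply: crosses_t => //=; rewrite E_sym.
  have ln : xc n.1 < xc n.2 by rewrite /=; slra.
  have on := on_edge_open ln (ltac:(rewrite /=; slra) : xc n.1 < t < xc n.2).
  have hn : ht (it i) t < ht n t.
    have : 0 < orient (g (it i).1) (g (it i).2) (t, ht n t).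
      case: on => m [hm ->]; rewrite mix_orient /= (_ : orient _ _ (g (it i).1) = 0); last by rewrite /orient; ring.
      by rewrite mulr0 add0r mulr_gt0 //; slra.
    by rewrite orient_ht // pmulr_rgt0; slra.
  have [_ le2] := lt_it iM cn hn.
  have [e|ne] := eqVneq (ht (it i.+1) t) (ht n t).
    by left; rewrite /lab (ht_inj cf cn e).
  have lt2 : ht (it i.+1) t < ht n t by rewrite lt_neqAle ne.
  have zz := oseg_vertical t (ltac:(by rewrite lt lt2) : ht (it i) t < ht (it i.+1) t < ht n t).
  have [i1 i2 i3] := inside_two D oe on zz.
  by case: (tri_interior HP Tw Ef of_ i1 i2 i3).
Qed.

Hypothesis xo : xc o < 0.
Hypothesis xp : 0 < xc p.
Hypothesis xr : xc r = 0.

Lemma it_ends : (1 < M)%N /\ it 0 = (o, p) /\ it M.-1 = (o, r).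
Proof.
have [D [Eop Epr] Ero inn] := fr.
have all v : 0 <= orient (g o) (g p) (g v) /\ 0 <= orient (g r) (g o) (g v).
  have [iv|] := boolP (inner o p r v); first by have [? ? ?] := inn v iv; split; apply: ltW.
  by rewrite /inner !negb_and !negbK => /or3P[/eqP e|/eqP e|/eqP e]; subst v; split;
    move: D; rewrite /orient; slra.
have cp : crosses (o, p) by rewrite /crosses Eop xo ltW.
have cr : crosses (o, r) by rewrite /crosses E_sym Ero xo xr lexx.
have npr : p <> r by move=> e; rewrite e E_irr in Epr.
have [i iM ei] := it_index cp; have [j jM ej] := it_index cr.
have M1 : (1 < M)%N.
  rewrite ltnNge; apply/negP => h; have ij : i = j by slia.
  by move: ei; rewrite ij ej => -[e]; case: npr.
have hz e : crosses e -> ht (o, p) t <= ht e t /\ ht e t <= ht (o, r) t.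
  move=> ce; have [Ee e1 e1' e2' e2] := crossesP ce.
  have le := lt_trans e1 e2.
  have oe := on_edge_open le (ltac:(slra) : xc e.1 < t < xc e.2).
  have pos a b : (forall v, 0 <= orient (g a) (g b) (g v)) -> 0 <= orient (g a) (g b) (t, ht e t).
    move=> h; case: oe => m [hm ->]; rewrite mix_orient.
    by apply: addr_ge0; apply: mulr_ge0; rewrite ?h //; slra.
  have p1 := pos o p (fun v => (all v).1); have p2 := pos r o (fun v => (all v).2).
  split.
    have lop : xc (o, p).1 < xc (o, p).2 by exact: lt_trans xo xp.
    have dop : 0 < xc p - xc o by rewrite subr_gt0.
    by move: p1; rewrite (orient_ht _ _ lop) /= pmulr_rge0 //; slra.
  have lor : xc (o, r).1 < xc (o, r).2 by rewrite /= xr.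
  have dor : 0 < xc r - xc o by rewrite subr_gt0 xr.
  by move: p2; rewrite orient_swap (orient_ht _ _ lor) /= oppr_ge0 pmulr_rle0 //; slra.
have M0 : (0 < M)%N by slia.
have ML : (M.-1 < M)%N by slia.
split=> //; split; apply: ht_inj => //; try exact: it_crosses; apply/eqP; rewrite eq_le.
- have [-> _] := hz _ (it_crosses M0); rewrite andbT -ei; apply: it_le => //.
- have [_ ->] := hz _ (it_crosses ML); rewrite /= -ej; apply: it_le; slia.
Qed.

End Line.

(** * Combining both sides: the extremal slope cannot be positive *)

Section TwoSides.
Variables (F : realFieldType) (V : finType) (cr : pred (V * V)) (ce : V * V -> F).
Implicit Types (e : V * V) (i j k : nat).

(** One side in combinatorial form: the edges [ed] in their order, their ends [lab] on this side,
    their heights [c]. [cr] marks the edges that truly cross the axis and so occur on both sides;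
    the others end on the axis and may share a height. *)
Record side (M : nat) (lab : nat -> V) (c : nat -> F) (ed : nat -> V * V) (pr : V * V -> V) : Prop := Side {
  s_nc : forall i j k l, (i < j)%N -> (j < k)%N -> (k < l)%N -> (l < M)%N ->
    lab i = lab k -> lab j = lab l -> lab i = lab j;
  s_cle : forall i j, (i <= j)%N -> (j < M)%N -> c i <= c j;
  s_clt : forall i j, (i < j)%N -> (j < M)%N -> lab i = lab j -> c i < c j;
  s_ends : lab 0%N = lab M.-1;
  s_M : (0 < M)%N;
  s_ce : forall i, (i < M)%N -> cr (ed i) -> c i = ce (ed i);
  s_inj : forall i j, (i < M)%N -> (j < M)%N -> ed i = ed j -> i = j;
  s_surj : forall e, cr e -> exists2 i, (i < M)%N & ed i = e;
  s_str : forall i j, (i < j)%N -> (j < M)%N -> cr (ed i) \/ cr (ed j) -> c i < c j;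
  s_lab : forall i, (i < M)%N -> cr (ed i) -> lab i = pr (ed i) }.

Lemma side_sum M lab c ed pr (f : V * V -> F) : side M lab c ed pr -> (forall e, ~~ cr e -> f e = 0) ->
  \sum_e f e = \sum_(i < M) f (ed i).
Proof.
move=> S f0; have inj : injective (fun i : 'I_M => ed i).
  by move=> i j h; apply: val_inj; exact: (s_inj S (ltn_ord i) (ltn_ord j) h).
have <- : \sum_(e in [set ed (i : 'I_M) | i in 'I_M]) f e = \sum_(i < M) f (ed i).
  by rewrite big_imset //=; move=> i j _ _; apply: inj.
rewrite [RHS]big_mkcond; apply: eq_bigr => e _; case: ifP => // h.
apply: f0; apply/negP => ce1; have [i iM ei] := s_surj S ce1.
by move: h; rewrite -ei => /negP; apply; apply/imsetP; exists (Ordinal iM).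
Qed.

Variables (phi psi : V * V -> F).
Hypothesis phi0 : forall e, ~~ cr e -> phi e = 0.
Hypothesis psi_ge0 : forall e, 0 <= psi e.

Let gs_ ed theta := Gs (fun i => phi (ed i)) theta.
Let gc_ c ed eta theta := Gc c (fun i => phi (ed i)) (fun i => psi (ed i)) eta theta.
Let asl_ ed := Asl (fun i => phi (ed i)).

(** The part of an infeasibility certificate that concerns one side; [phi] and [psi] are common to
    both sides. *)
Record dual (M : nat) (lab : nat -> V) (c : nat -> F) (ed : nat -> V * V) (eta theta : nat -> F) : Prop := Dual {
  d_th0 : forall i, 0 <= theta i;
  d_thm : forall i, theta i <> 0 -> (0 < i < M)%N /\ c i.-1 = c i;
  d_etm : forall i, eta i <> 0 -> [/\ (0 < i < M)%N,
    (forall j, (j < M)%N -> lab j = lab i.-1 -> (j < i)%N) & (forall j, (j < M)%N -> lab j = lab i -> (i <= j)%N)];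
  d_bal1 : forall v, \sum_(i < M | lab i == v) (gs_ ed theta i.+1 - gs_ ed theta i) = 0;
  d_bal2 : forall v, \sum_(i < M | lab i == v) (gc_ c ed eta theta i.+1 - gc_ c ed eta theta i) = 0 }.

Section One.
Variables (M : nat) (lab : nat -> V) (c : nat -> F) (ed : nat -> V * V) (pr : V * V -> V) (eta theta : nat -> F).
Hypothesis S : side M lab c ed pr.
Hypothesis D : dual M lab c ed eta theta.

Lemma complete_all : complete M lab 0 M.
Proof. by split=> [|i j iM jM _ _]; slia. Qed.

Lemma theta_out i : ~~ (0 < i < M)%N -> theta i = 0.
Proof. by move=> h; apply/eqP/negPn/negP => /eqP /(d_thm D) [h' _]; rewrite h' in h. Qed.

Lemma eta_out i : ~~ (0 < i < M)%N -> eta i = 0.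
Proof. by move=> h; apply/eqP/negPn/negP => /eqP /(d_etm D) [h' _ _]; rewrite h' in h. Qed.

Lemma Gs0 : gs_ ed theta 0 = 0.
Proof. by rewrite /gs_ /Gs /Asl big_ord0 theta_out // addr0. Qed.

Lemma GsM : gs_ ed theta M = 0.
Proof. by rewrite -(complete_tele (d_bal1 D) complete_all) Gs0. Qed.

Lemma theta_str i : (i <= M)%N -> (i < M)%N /\ cr (ed i) \/ (0 < i)%N /\ cr (ed i.-1) -> theta i = 0.
Proof.
move=> iM h; have [hi|] := boolP (0 < i < M)%N; last exact: theta_out.
apply: (theta_eq0 (d_thm D)) => //; apply: (s_str S); [slia|slia|case: h => -[_ ?]; by [right|left]].
Qed.

(** With bound zero, equality holds along the whole sequence; once all slopes and constants vanish,
    nothing can balance a nonzero [psi] or [theta]. *)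
Lemma zero_case : (forall i, (i <= M)%N -> gs_ ed theta i <= 0) ->
  (forall i, (i < M)%N -> psi (ed i) = 0) /\ forall i, theta i = 0.
Proof.
move=> Gle.
have [_ H] := closure (s_nc S) (s_clt S) (fun i => psi_ge0 (ed i)) (d_thm D) (d_etm D)
  (d_bal1 D) (d_bal2 D) Gle (leqnn _) complete_all Gs0.
have {H} H g : (g <= M)%N -> [/\ gs_ ed theta g = 0, gc_ c ed eta theta g = gc_ c ed eta theta 0 & eta g = 0].
  by move=> gM; apply: H; rewrite ?eta_out ?ltnn ?andbF.
have gc0 : gc_ c ed eta theta 0 = 0.
  by rewrite /gc_ /Gc /Act big_ord0 theta_out // eta_out // mul0r addr0 subr0.
split=> [i iM|].
  have [g1 h1 e1] := H i (ltnW iM); have [g2 h2 e2] := H i.+1 iM.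
  have t : theta i.+1 * (c i - c i.+1) = 0.
    have [->|/eqP n] := eqVneq (theta i.+1) 0; first by rewrite mul0r.
    by have [_ /= ->] := d_thm D n; rewrite subrr mulr0.
  move: g1 g2 h1 h2; rewrite gc0 /gs_ /gc_ /Gs /Gc e1 e2 /Asl /Act !big_ord_recr /=.
  set a := \sum_(j < i) _; set b := \sum_(j < i) _ => g1 g2 h1 h2.
  have e3 : (a + theta i) * c i = 0 by rewrite g1 mul0r.
  have e4 : (a + phi (ed i) + theta i.+1) * c i = 0 by rewrite g2 mul0r.
  lra.
elim=> [|i IH]; first exact: theta_out.
have [iM|iM] := ltnP i M; last by apply: theta_out; slia.
have [ci|nci] := boolP (cr (ed i)); first by apply: theta_str => //; right.
have [g1 _ _] := H i (ltnW iM); have [g2 _ _] := H i.+1 iM.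
move: g1 g2; rewrite /gs_ /Gs IH /Asl !big_ord_recr /= phi0 //; lra.
Qed.

(** The slope accumulated up to a height comes from truly crossing edges only, so it is the same
    function of height on both sides. *)
Definition Bsl y := \sum_(e | cr e && (ce e < y)) phi e.

Lemma Asl_Bsl i : (i < M)%N -> asl_ ed i = Bsl (c i).
Proof.
move=> iM; rewrite /Bsl big_mkcond (side_sum S); last by move=> e /negPf ->.
rewrite /asl_ /Asl -(big_mkord xpredT (fun j => phi (ed j))).
rewrite (@big_nat_widen _ _ _ 0 i M) ?(ltnW iM) // big_mkord big_mkcond; apply: eq_bigr => j _ /=.
have [cj|/phi0 ->] := boolP (cr (ed j)); last by rewrite /= !if_same.
rewrite /= -(s_ce S (ltn_ord j) cj); have [ji|ij] := ltnP j i.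
  by rewrite (s_str S ji iM) //; left.
by rewrite ltNge (s_cle S).
Qed.

Lemma AslM : asl_ ed M = 0.
Proof. by have := GsM; rewrite /gs_ /Gs theta_out ?addr0 // ltnn andbF. Qed.

Lemma AslS i : asl_ ed i.+1 = asl_ ed i + phi (ed i).
Proof. by rewrite /asl_ /Asl big_ord_recr. Qed.

End One.

(** Take a maximal run of gaps with accumulated slope [sg] around a gap between different heights.
    It is bounded by truly crossing edges, since only these change the slope, and [run] gives both
    the same end on the first side. As accumulated slope is a function of height, the same two edges
    bound a run on the second side and share their end there too, so they are one edge. *)
Lemma pos_case M1 lab1 c1 ed1 pr1 eta1 theta1 M2 lab2 c2 ed2 pr2 eta2 theta2 (sg : F) g :
  side M1 lab1 c1 ed1 pr1 -> dual M1 lab1 c1 ed1 eta1 theta1 ->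
  side M2 lab2 c2 ed2 pr2 -> dual M2 lab2 c2 ed2 eta2 theta2 ->
  (forall e e', pr1 e = pr1 e' -> pr2 e = pr2 e' -> e = e') -> 0 < sg ->
  (forall i, (i <= M1)%N -> gs_ ed1 theta1 i <= sg) -> (forall i, (i <= M2)%N -> gs_ ed2 theta2 i <= sg) ->
  (g <= M1)%N -> gs_ ed1 theta1 g = sg -> False.
Proof.
move=> S1 D1 S2 D2 pinj sg0 le1 le2 gM gg.
have gM' : (0 < g < M1)%N.
  have n0 : g <> 0%N by move=> e; move: gg sg0; rewrite e (Gs0 D1) => <-; rewrite ltxx.
  have nM : g <> M1 by move=> e; move: gg sg0; rewrite e (GsM D1) => <-; rewrite ltxx.
  slia.
have [x [xM xc ax]] := nonmicro (s_nc S1) (s_clt S1) (fun i => psi_ge0 (ed1 i)) (d_thm D1)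
  (d_etm D1) (d_bal1 D1) (d_bal2 D1) le1 (s_ends S1) gM' gg.
rewrite -/(asl_ ed1 x) in ax.
have [i1 [i1x a1 m1]] : exists i, [/\ (i < x)%N, asl_ ed1 i <> sg & forall j, (i < j <= x)%N -> asl_ ed1 j = sg].
  have ex : exists i, (i < x)%N && (asl_ ed1 i != sg).
    exists 0%N; apply/andP; split; first by slia.
    by rewrite /asl_ /Asl big_ord0 eq_sym gt_eqF.
  have [|i /andP[ix /eqP ai] mx] := @ex_maxnP (fun i => (i < x)%N && (asl_ ed1 i != sg)) x ex.
    by move=> j /andP[]; slia.
  exists i; split=> // j hj; have [->//|jx] := eqVneq j x.
  apply/eqP/negPn/negP => n; have := mx j; rewrite n andbT; slia.
have [i2 [i2x a2 m2]] : exists i, [/\ (x <= i < M1)%N, asl_ ed1 i.+1 <> sg & forall j, (x <= j <= i)%N -> asl_ ed1 j = sg].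
  have ex : exists i, [&& (x <= i)%N, (i < M1)%N & (asl_ ed1 i.+1 != sg)].
    exists M1.-1; apply/and3P; split; [slia|slia|rewrite prednK; last by slia].
    by rewrite (AslM D1) eq_sym gt_eqF.
  have [i /and3P[xi iM /eqP ai] mn] := ex_minnP ex.
  exists i; split=> // [|j hj]; first by rewrite xi.
  have [->//|jx] := eqVneq j x.
  apply/eqP/negPn/negP => n; have := mn j.-1; rewrite prednK; last by slia.
  by rewrite n andbT; slia.
have i1M : (i1 < M1)%N by slia.
have i2M : (i2 < M1)%N by slia.
have crn ed i : asl_ ed i.+1 <> asl_ ed i -> cr (ed i).
  by rewrite AslS => n; apply/negPn/negP => /phi0 e; apply: n; rewrite e addr0.
have b1 : asl_ ed1 i1.+1 = sg by apply: m1; slia.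
have b2 : asl_ ed1 i2 = sg by apply: m2; slia.
have cr1 : cr (ed1 i1) by apply: crn; rewrite b1 => e; apply: a1.
have cr2 : cr (ed1 i2) by apply: crn; rewrite b2.
have i12 : (i1 < i2)%N by slia.
have mid k : (i1 < k <= i2)%N -> asl_ ed1 k = sg.
  by move=> hk; have [l|l] := leqP k x; [apply: m1|apply: m2]; slia.
have lt1 : gs_ ed1 theta1 i1 < sg.
  rewrite lt_neqAle le1 ?(ltnW i1M) // andbT; apply/eqP.
  by rewrite /gs_ /Gs (theta_str S1 D1) ?(ltnW i1M) // ?addr0 //; left.
have lt2 : gs_ ed1 theta1 i2.+1 < sg.
  rewrite lt_neqAle le1 // andbT; apply/eqP.
  by rewrite /gs_ /Gs (theta_str S1 D1) ?addr0 //; right.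
have L1 := run (s_nc S1) (s_clt S1) (fun i => psi_ge0 (ed1 i)) (d_th0 D1) (d_thm D1)
  (d_etm D1) (d_bal1 D1) (d_bal2 D1) le1 (s_ends S1) i12 i2M lt1 lt2 mid.
have [j1 j1M ej1] := s_surj S2 cr1; have [j2 j2M ej2] := s_surj S2 cr2.
have cj1 : c2 j1 = c1 i1 by rewrite (s_ce S2) // ej1 // (s_ce S1).
have cj2 : c2 j2 = c1 i2 by rewrite (s_ce S2) // ej2 // (s_ce S1).
have c12 : c1 i1 < c1 i2 by apply: (s_str S1) => //; left.
have j12 : (j1 < j2)%N.
  by rewrite ltnNge; apply/negP => h; have := s_cle S2 h j1M; rewrite cj1 cj2; lra.
have A1 : asl_ ed2 j1 = asl_ ed1 i1 by rewrite (Asl_Bsl S2 j1M) cj1 (Asl_Bsl S1 i1M).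
have A2 : asl_ ed2 j2.+1 = asl_ ed1 i2.+1.
  by rewrite !AslS ej2 (Asl_Bsl S2 j2M) cj2 (Asl_Bsl S1 i2M).
have lt1' : gs_ ed2 theta2 j1 < sg.
  rewrite lt_neqAle le2 ?(ltnW j1M) // andbT; apply/eqP.
  have t1 : theta2 j1 = 0 by apply: (theta_str S2 D2); [exact: ltnW|left; rewrite ej1].
  by rewrite /gs_ /Gs t1 addr0 -/(asl_ ed2 j1) A1.
have lt2' : gs_ ed2 theta2 j2.+1 < sg.
  rewrite lt_neqAle le2 // andbT; apply/eqP.
  have t2 : theta2 j2.+1 = 0 by apply: (theta_str S2 D2) => //; right; rewrite /= ej2.
  by rewrite /gs_ /Gs t2 addr0 -/(asl_ ed2 j2.+1) A2.
have mid' k : (j1 < k <= j2)%N -> asl_ ed2 k = sg.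
  case/andP=> k1 k2; have kM : (k < M2)%N := leq_ltn_trans k2 j2M.
  have lo : c1 i1 < c2 k by rewrite -cj1; apply: (s_str S2 k1 kM); left; rewrite ej1.
  have hi : c2 k <= c1 i2 by rewrite -cj2; apply: (s_cle S2 k2 j2M).
  have ex : exists n, (n < M1)%N && (c2 k <= c1 n) by exists i2; rewrite i2M.
  have [n /andP[nM cn] mn] := ex_minnP ex.
  have n2 : (n <= i2)%N by apply: mn; rewrite i2M hi.
  have n1 : (i1 < n)%N.
    by rewrite ltnNge; apply/negP => h; have := s_cle S1 h i1M; lra.
  rewrite (Asl_Bsl S2 kM) -(mid n (introT andP (conj n1 n2))) (Asl_Bsl S1 nM); apply: eq_bigl => e.
  apply: andb_id2l => ee; apply/idP/idP => h; first by apply: lt_le_trans cn.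
  have [m mM em] := s_surj S1 ee.
  have cm : c1 m = ce e by rewrite (s_ce S1) ?em.
  have mn' : (m < n)%N by rewrite ltnNge; apply/negP => h'; have := s_cle S1 h' mM; lra.
  by rewrite -cm ltNge; apply/negP => h'; have := mn m; rewrite mM h' => /(_ isT); rewrite leqNgt mn'.
have L2 := run (s_nc S2) (s_clt S2) (fun i => psi_ge0 (ed2 i)) (d_th0 D2) (d_thm D2)
  (d_etm D2) (d_bal1 D2) (d_bal2 D2) le2 (s_ends S2) j12 j2M lt1' lt2' mid'.
have e12 : ed1 i1 = ed1 i2.
  apply: pinj; first by rewrite -(s_lab S1) // -(s_lab S1).
  rewrite -ej1 -ej2 -(s_lab S2) ?ej1 // -(s_lab S2) ?ej2 //.
by move: i12; rewrite (s_inj S1 i1M i2M e12) ltnn.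
Qed.

End TwoSides.

(** * The linear program for the dual coordinates *)

Section LP.
Variables (F : realFieldType) (V : finType) (cr : pred (V * V)) (ce : V * V -> F).
Variables (M1 M2 : nat) (lab1 lab2 : nat -> V) (c1 c2 : nat -> F) (ed1 ed2 : nat -> V * V).
Implicit Types (e : V * V) (v u : V).
Hypothesis S1 : side cr ce M1 lab1 c1 ed1 fst.
Hypothesis S2 : side cr ce M2 lab2 c2 ed2 snd.
Hypothesis dis : forall i j, (i < M1)%N -> (j < M2)%N -> lab1 i <> lab2 j.

(** The labels on the two sides of such a gap are consecutive classes at one level of nesting; the
    program makes their [X] equal. *)
Definition sib (M : nat) (lab : nat -> V) i := [/\ (0 < i < M)%N, lab i.-1 <> lab i,
  (forall j, (j < M)%N -> lab j = lab i.-1 -> (j < i)%N) & (forall j, (j < M)%N -> lab j = lab i -> (i <= j)%N)].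
(** Arises between edges that end at the same vertex of the axis. No crossing edge orders their
    other ends there, so the program has to impose an inequality. *)
Definition micro (M : nat) (c : nat -> F) i := (0 < i < M)%N && (c i.-1 == c i).

Lemma shift_sum (f th : nat -> F) M : th 0 = 0 -> th M = 0 ->
  \sum_(i < M) f i * th i.+1 = \sum_(i < M) f i.-1 * th i.
Proof.
move=> t0 tM; have h : \sum_(i < M.+1) f i.-1 * th i = \sum_(i < M) f i * th i.+1.
  by rewrite big_ord_recl /= t0 mulr0 add0r; apply: eq_bigr.
by rewrite -h big_ord_recr /= tM mulr0 addr0.
Qed.

(** Abel summation turns the balance at a vertex into increments of the flow at its positions; [th]
    vanishes at both ends, so the shift of the index leaves no boundary terms. *)
Lemma bal_of M lab c ed pr (f : V * V -> F) (th : nat -> F) v : side cr ce M lab c ed pr ->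
  (forall e, ~~ cr e -> f e = 0) -> th 0 = 0 -> th M = 0 ->
  \sum_e f e * (v == pr e)%:R + \sum_(i < M) th i * ((v == lab i.-1)%:R - (v == lab i)%:R) = 0 ->
  \sum_(i < M | lab i == v) (f (ed i) + th i.+1 - th i) = 0.
Proof.
move=> S f0 t0 tM; rewrite (side_sum S); last by move=> e /f0 ->; rewrite mul0r.
move=> h; rewrite big_mkcond -[RHS]h.
have -> : \sum_(i < M) th i * ((v == lab i.-1)%:R - (v == lab i)%:R) =
    \sum_(i < M) (v == lab i)%:R * th i.+1 - \sum_(i < M) (v == lab i)%:R * th i.
  rewrite (shift_sum (fun i => (v == lab i)%:R)) // -sumrB; apply: eq_bigr => i _.
  by rewrite mulrBr mulrC [th i * (v == lab i)%:R]mulrC.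
rewrite -sumrB -big_split /=; apply: eq_bigr => i _.
have -> : f (ed i) * (v == pr (ed i))%:R = f (ed i) * (v == lab i)%:R.
  by have [ci|/f0 ->] := boolP (cr (ed i)); [rewrite (s_lab S)|rewrite !mul0r].
by rewrite eq_sym; case: eqP => _ /=; ring.
Qed.

(** The unknowns: [(v, true)] stands for [Y v] and [(v, false)] for [X v], so [hrow s u] is the row
    of [Y u - s * X u]. *)
Let I := (V * bool)%type.
Let dl v b : I -> F := fun x => (x == (v, b))%:R.
Let lin (a : I -> F) s (b : I -> F) : I -> F := fun x => a x - s * b x.
Let K := (V * V + 'I_M1 + 'I_M2)%type.

Let hrow (s : F) u : I -> F := lin (dl u true) s (dl u false).
Let zero : I -> F := fun=> 0.

Let rowA (x : K) : I -> F := match x with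
  | inl (inl e) => if cr e then lin (hrow (ce e) e.1) 1 (hrow (ce e) e.2) else zero
  | inl (inr i) => if `[< sib M1 lab1 i >] then lin (dl (lab1 i.-1) false) 1 (dl (lab1 i) false) else zero
  | inr i => if `[< sib M2 lab2 i >] then lin (dl (lab2 i) false) 1 (dl (lab2 i.-1) false) else zero end.
Let PB (x : K) : bool := match x with
  | inl (inl e) => cr e | inl (inr i) => micro M1 c1 i | inr i => micro M2 c2 i end.
Let rowB (x : K) : I -> F := match x with
  | inl (inl e) => lin (dl e.2 false) 1 (dl e.1 false)
  | inl (inr i) => lin (hrow (c1 i) (lab1 i.-1)) 1 (hrow (c1 i) (lab1 i))
  | inr i => lin (hrow (c2 i) (lab2 i)) 1 (hrow (c2 i) (lab2 i.-1)) end.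

Let dot_dl v b z : dot (dl v b) z = z (v, b).
Proof. by rewrite /dot (bigD1 (v, b)) //= /dl eqxx mul1r big1 ?addr0 // => x /negPf ->; rewrite mul0r. Qed.

Let dot_lin' a s b z : dot (lin a s b) z = dot a z - s * dot b z.
Proof. exact: dot_linl. Qed.

Let dlE u b v b' : dl u b (v, b') = ((v == u) && (b' == b))%:R.
Proof. by rewrite /dl xpair_eqE. Qed.

Section NoSolution.
Variables (l m : K -> F).
Hypothesis m0 : forall j, 0 <= m j.
Hypothesis mex : exists j, PB j /\ 0 < m j.
Hypothesis mz : forall j, ~~ PB j -> m j = 0.
Hypothesis bal : forall x, \sum_k l k * rowA k x + \sum_j m j * rowB j x = 0.

Let phi e := if cr e then l (inl (inl e)) else 0.
Let psi e := m (inl (inl e)).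
Let etaL i := if insub i is Some j then (if `[< sib M1 lab1 i >] then l (inl (inr j)) else 0) else 0.
Let thetaL i := if insub i is Some j then m (inl (inr j)) else 0.
Let etaR i := if insub i is Some j then (if `[< sib M2 lab2 i >] then l (inr j) else 0) else 0.
Let thetaR i := if insub i is Some j then m (inr j) else 0.
Let D (lab : nat -> V) v i : F := (v == lab i.-1)%:R - (v == lab i)%:R.

Let phi0 e : ~~ cr e -> phi e = 0. Proof. by rewrite /phi => /negPf ->. Qed.
Let psi0 e : ~~ cr e -> psi e = 0. Proof. by move=> h; apply: mz. Qed.
Let psi_ge e : 0 <= psi e. Proof. exact: m0. Qed.

Let balT v : \sum_e phi e * ((v == e.1)%:R - (v == e.2)%:R) + \sum_(i < M1) thetaL i * D lab1 v i
  - \sum_(i < M2) thetaR i * D lab2 v i = 0.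
Proof.
rewrite -[RHS](bal (v, true)) !big_sumType /= [X in _ = _ + X + _ + _]big1; last first.
  by move=> i _; case: ifP => _; rewrite /zero /lin ?dlE ?andbF ?mulr0 //= subrr mulr0.
rewrite [X in _ = _ + X + _]big1; last first.
  by move=> i _; case: ifP => _; rewrite /zero /lin ?dlE ?andbF ?mulr0 //= subrr mulr0.
rewrite [X in _ = _ + (X + _ + _)]big1; last first.
  by move=> i _; rewrite /lin !dlE /= !andbF mulr0 subrr mulr0.
rewrite !addr0 add0r addrA -sumrN; congr (_ + _ + _); apply: eq_bigr => x _.
- by rewrite /phi; case: ifP => _; rewrite ?mul0r /zero ?mulr0 // /hrow /lin !dlE !andbF !andbT /=; ring.
- by rewrite /thetaL valK /hrow /lin !dlE !andbF !andbT /D /=; ring.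
- by rewrite /thetaR valK /hrow /lin !dlE !andbF !andbT /D /=; ring.
Qed.

Let balF v : \sum_e (- (phi e * ce e) - psi e) * ((v == e.1)%:R - (v == e.2)%:R)
  + \sum_(i < M1) (etaL i - thetaL i * c1 i) * D lab1 v i
  - \sum_(i < M2) (etaR i - thetaR i * c2 i) * D lab2 v i = 0.
Proof.
rewrite -[RHS](bal (v, false)) !big_sumType /=.
set a1 := \sum_(i : V * V) _; set a2 := \sum_(i < M1) _; set a3 := \sum_(i < M2) _.
set b1 := \sum_(i : V * V) _; set b2 := \sum_(i < M1) _; set b3 := \sum_(i < M2) _.
set d1 := \sum_(i : V * V) _; set d2 := \sum_(i < M1) _; set d3 := \sum_(i < M2) _.
have e1 : a1 = b1 + d1.
  rewrite -big_split /=; apply: eq_bigr => x _; rewrite /phi /psi.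
  by case: ifP => _; rewrite /zero /hrow /lin !dlE ?andbF ?andbT /=; ring.
have e2 : a2 = b2 + d2.
  rewrite -big_split /=; apply: eq_bigr => x _; rewrite /etaL /thetaL valK.
  by case: ifP => _; rewrite /zero /hrow /lin !dlE ?andbF ?andbT /D /=; ring.
have e3 : - a3 = b3 + d3.
  rewrite -sumrN -big_split /=; apply: eq_bigr => x _; rewrite /etaR /thetaR valK.
  by case: ifP => _; rewrite /zero /hrow /lin !dlE ?andbF ?andbT /D /=; ring.
rewrite e1 e2 e3; ring.
Qed.

Let thm M (c : nat -> F) (f : 'I_M -> F) i : (forall j : 'I_M, ~~ micro M c j -> f j = 0) ->
  (if insub i is Some j then f j else 0) <> 0 -> (0 < i < M)%N /\ c i.-1 = c i.
Proof.
move=> h; case: insubP => // j _ <- n; have [/andP[-> /eqP ->] //|/h e] := boolP (micro M c j).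
by rewrite e in n.
Qed.

Let etm M (lab : nat -> V) (f : 'I_M -> F) i :
  (if insub i is Some j then (if `[< sib M lab i >] then f j else 0) else 0) <> 0 ->
  [/\ (0 < i < M)%N, (forall j, (j < M)%N -> lab j = lab i.-1 -> (j < i)%N) &
    (forall j, (j < M)%N -> lab j = lab i -> (i <= j)%N)].
Proof. by case: insubP => // j _ _; case: asboolP => // -[]. Qed.

Let combine M lab c ed pr (eta theta : nat -> F) : side cr ce M lab c ed pr ->
  (forall i, 0 <= theta i) -> (forall i, theta i <> 0 -> (0 < i < M)%N /\ c i.-1 = c i) ->
  (forall i, eta i <> 0 -> [/\ (0 < i < M)%N,
    (forall j, (j < M)%N -> lab j = lab i.-1 -> (j < i)%N) & (forall j, (j < M)%N -> lab j = lab i -> (i <= j)%N)]) ->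
  (forall v k, (k < M)%N -> v = lab k ->
    \sum_e phi e * (v == pr e)%:R + \sum_(i < M) theta i * D lab v i = 0) ->
  (forall v k, (k < M)%N -> v = lab k ->
    \sum_e (- (phi e * ce e) - psi e) * (v == pr e)%:R + \sum_(i < M) (eta i - theta i * c i) * D lab v i = 0) ->
  dual phi psi M lab c ed eta theta.
Proof.
move=> S h0 h1 h2 hT hF.
have z i : ~~ (0 < i < M)%N -> theta i = 0.
  by move=> n; apply/eqP/negPn/negP => /eqP /h1 [h _]; rewrite h in n.
have z' i : ~~ (0 < i < M)%N -> eta i = 0.
  by move=> n; apply/eqP/negPn/negP => /eqP /h2 [h _ _]; rewrite h in n.
have nM : ~~ (0 < M < M)%N by rewrite ltnn andbF.
split=> // v.
  have [[k [kM ev]]|nx] := pselect (exists k, (k < M)%N /\ v = lab k); last first.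
    by apply: big1 => i /eqP e; case: nx; exists i.
  rewrite -[RHS](bal_of S phi0 (z 0%N isT) (z M nM) (hT v k kM ev)); apply: eq_bigr => i _.
  by rewrite /Gs /Asl big_ord_recr /=; ring.
have [[k [kM ev]]|nx] := pselect (exists k, (k < M)%N /\ v = lab k); last first.
  by apply: big1 => i /eqP e; case: nx; exists i.
rewrite -[RHS](@bal_of M lab c ed pr _ (fun i => eta i - theta i * c i) v S _ _ _ (hF v k kM ev)).
- apply: eq_bigr => i _; rewrite /Gc /Act big_ord_recr /=.
  have -> : phi (ed i) * ce (ed i) = phi (ed i) * c i.
    by have [ci|/phi0 ->] := boolP (cr (ed i)); [rewrite (s_ce S)|rewrite !mul0r].
  ring.
- by move=> e n; rewrite phi0 // psi0 // mul0r oppr0 addr0.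
- by rewrite z // z' // mul0r subr0.
- by rewrite z // z' // mul0r subr0.
Qed.

(** The largest slope over the gaps of both sides is either positive, which the comparison of the
    sides refutes, or not, and then all multipliers of strict inequalities are zero, against
    [mex]. *)
Lemma no_certificate : False.
Proof.
have D1 : dual phi psi M1 lab1 c1 ed1 etaL thetaL.
  apply: (combine S1).
  - by move=> i; rewrite /thetaL; case: insubP.
  - by move=> i; apply: thm => j h; apply: mz.
  - by move=> i; apply: etm.
  - move=> v k kM ev; rewrite -[RHS](balT v) [X in _ = _ - X]big1 ?subr0; last first.
      move=> i _; have [h|/negPf h] := boolP (0 < i)%N.
        rewrite /D; case: eqP => [e|_]; first by case: (@dis k i.-1) => //; [have := ltn_ord i; slia|rewrite -ev].
        by case: eqP => [e|_]; [case: (@dis k i) => //; rewrite -ev|rewrite subrr mulr0].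
      have -> : (i : nat) = 0%N by slia.
      by rewrite /D /= subrr mulr0.
    congr (_ + _); apply: eq_bigr => e _; have [cre|/phi0 ->] := boolP (cr e); last by rewrite !mul0r.
    have [j jM ej] := s_surj S2 cre; have := s_lab S2 jM; rewrite ej => /(_ cre) lj.
    by case: (v =P e.2) => [ev2|_]; [case: (dis kM jM); rewrite -ev ev2|rewrite subr0].
  - move=> v k kM ev; rewrite -[RHS](balF v) [X in _ = _ - X]big1 ?subr0; last first.
      move=> i _; have [h|/negPf h] := boolP (0 < i)%N.
        rewrite /D; case: eqP => [e|_]; first by case: (@dis k i.-1) => //; [have := ltn_ord i; slia|rewrite -ev].
        by case: eqP => [e|_]; [case: (@dis k i) => //; rewrite -ev|rewrite subrr mulr0].
      have -> : (i : nat) = 0%N by slia.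
      by rewrite /D /= subrr mulr0.
    congr (_ + _); apply: eq_bigr => e _; have [cre|n] := boolP (cr e); last by rewrite phi0 // psi0 // !mul0r oppr0 addr0 !mul0r.
    have [j jM ej] := s_surj S2 cre; have := s_lab S2 jM; rewrite ej => /(_ cre) lj.
    by case: (v =P e.2) => [ev2|_]; [case: (dis kM jM); rewrite -ev ev2|rewrite subr0].
have D2 : dual phi psi M2 lab2 c2 ed2 etaR thetaR.
  apply: (combine S2).
  - by move=> i; rewrite /thetaR; case: insubP.
  - by move=> i; apply: thm => j h; apply: mz.
  - by move=> i; apply: etm.
  (* Vertices of the second side enter every row with the opposite sign, so the balance is
     negated. *)
  - move=> v k kM ev; apply: oppr_inj; rewrite oppr0 -[RHS](balT v) [X in _ = _ + X - _]big1 ?addr0; last first.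
      move=> i _; have [h|/negPf h] := boolP (0 < i)%N.
        rewrite /D; case: eqP => [e|_]; first by case: (@dis i.-1 k) => //; [have := ltn_ord i; slia|rewrite -ev].
        by case: eqP => [e|_]; [case: (@dis i k) => //; rewrite -ev|rewrite subrr mulr0].
      have -> : (i : nat) = 0%N by slia.
      by rewrite /D /= subrr mulr0.
    rewrite opprD -sumrN; congr (_ - _); apply: eq_bigr => e _; have [cre|/phi0 ->] := boolP (cr e); last by rewrite !mul0r oppr0.
    have [j jM ej] := s_surj S1 cre; have := s_lab S1 jM; rewrite ej => /(_ cre) lj.
    by case: (v =P e.1) => [ev2|_]; [case: (dis jM kM); rewrite -ev ev2|rewrite sub0r mulrN].
  - move=> v k kM ev; apply: oppr_inj; rewrite oppr0 -[RHS](balF v) [X in _ = _ + X - _]big1 ?addr0; last first.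
      move=> i _; have [h|/negPf h] := boolP (0 < i)%N.
        rewrite /D; case: eqP => [e|_]; first by case: (@dis i.-1 k) => //; [have := ltn_ord i; slia|rewrite -ev].
        by case: eqP => [e|_]; [case: (@dis i k) => //; rewrite -ev|rewrite subrr mulr0].
      have -> : (i : nat) = 0%N by slia.
      by rewrite /D /= subrr mulr0.
    rewrite opprD -sumrN; congr (_ - _); apply: eq_bigr => e _; have [cre|n] := boolP (cr e); last first.
      by rewrite phi0 // psi0 // !mul0r oppr0 addr0 !mul0r oppr0.
    have [j jM ej] := s_surj S1 cre; have := s_lab S1 jM; rewrite ej => /(_ cre) lj.
    by case: (v =P e.1) => [ev2|_]; [case: (dis jM kM); rewrite -ev ev2|rewrite sub0r mulrN].
pose G1 := Gs (fun i => phi (ed1 i)) thetaL; pose G2 := Gs (fun i => phi (ed2 i)) thetaR.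
pose key (x : 'I_M1.+1 + 'I_M2.+1) : F := match x with inl i => G1 i | inr i => G2 i end.
have [x [_ mx]] := @fin_argmin F _ (fun _ : ('I_M1.+1 + 'I_M2.+1)%type => True) (fun x => - key x)
  (ex_intro _ (inl ord0) Logic.I).
have le1 i : (i <= M1)%N -> G1 i <= key x.
  by move=> h; have := mx (inl (Ordinal (h : (i < M1.+1)%N))) Logic.I; rewrite lerN2.
have le2 i : (i <= M2)%N -> G2 i <= key x.
  by move=> h; have := mx (inr (Ordinal (h : (i < M2.+1)%N))) Logic.I; rewrite lerN2.
have [pos|npos] := ltP 0 (key x).
  have pinj e e' : e.1 = e'.1 -> e.2 = e'.2 -> e = e' by case: e e' => ? ? [? ?] /= -> ->.
  case: x @key mx le1 le2 pos => i key mx le1 le2 pos.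
    by apply: (pos_case phi0 psi_ge S1 D1 S2 D2 pinj pos le1 le2 (g := i)) => //; rewrite -ltnS.
  apply: (pos_case phi0 psi_ge S2 D2 S1 D1 _ pos le2 le1 (g := i)) => //; last by rewrite -ltnS.
  by move=> e e' h1 h2; apply: pinj.
have [z1 t1] := zero_case phi0 psi_ge S1 D1 (fun i iM => le_trans (le1 i iM) npos).
have [z2 t2] := zero_case phi0 psi_ge S2 D2 (fun i iM => le_trans (le2 i iM) npos).
case: mex => -[[e|i]|i] /= [h].
- have [i iM ei] := s_surj S1 h; have := z1 i iM; rewrite ei /psi => ->; by rewrite ltxx.
- by have := t1 i; rewrite /thetaL valK => ->; rewrite ltxx.
- by have := t2 i; rewrite /thetaR valK => ->; rewrite ltxx.
Qed.

End NoSolution.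

Theorem lp_solution : exists X Y : V -> F, let h s v := Y v - s * X v in
  [/\ forall e, cr e -> h (ce e) e.1 = h (ce e) e.2 /\ X e.1 < X e.2,
      forall i, sib M1 lab1 i -> X (lab1 i.-1) = X (lab1 i),
      forall i, micro M1 c1 i -> h (c1 i) (lab1 i) < h (c1 i) (lab1 i.-1),
      forall i, sib M2 lab2 i -> X (lab2 i.-1) = X (lab2 i) &
      forall i, micro M2 c2 i -> h (c2 i) (lab2 i.-1) < h (c2 i) (lab2 i)].
Proof.
have [[z [zA zB]]|[l [m [m0 mex mz bal]]]] := motzkin rowA PB rowB; last by case: (no_certificate m0 mex mz bal).
exists (fun v => z (v, false)), (fun v => z (v, true)); split.
- move=> e ce1; have := zA (inl (inl e)); have := zB (inl (inl e)) ce1.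
  by rewrite /= ce1 /hrow !dot_lin' !dot_dl; split; lra.
- move=> i si; have iM : (i < M1)%N by case: si; case/andP.
  have := zA (inl (inr (Ordinal iM))); rewrite /= asboolT // !dot_lin' !dot_dl; lra.
- move=> i mi; have iM : (i < M1)%N by case/andP: mi => /andP[].
  have := zB (inl (inr (Ordinal iM))) mi; rewrite /= /hrow !dot_lin' !dot_dl; lra.
- move=> i si; have iM : (i < M2)%N by case: si; case/andP.
  have := zA (inr (Ordinal iM)); rewrite /= asboolT // !dot_lin' !dot_dl; lra.
- move=> i mi; have iM : (i < M2)%N by case/andP: mi => /andP[].
  have := zB (inr (Ordinal iM)) mi; rewrite /= /hrow !dot_lin' !dot_dl; lra.
Qed.

End LP.

(** * Reflection in the axis *)

Section Mirror.
Variables (F : realFieldType) (V : finType).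
Implicit Types (z : F * F) (a b c d u v : V).

Definition mirror z : F * F := (- z.1, z.2).

Lemma mirrorK : involutive mirror.
Proof. by move=> z; apply: pairP => /=; rewrite ?opprK. Qed.

Lemma mirror_mix s z z' : mirror (mix s z z') = mix s (mirror z) (mirror z').
Proof. by apply: pairP; rewrite /mirror /mix /=; ring. Qed.

Lemma mirror_cseg z z' w : cseg (mirror z) (mirror z') (mirror w) <-> cseg z z' w.
Proof.
split=> -[t [ht e]]; exists t; split=> //; last by rewrite e mirror_mix.
by rewrite -[w]mirrorK e -mirror_mix mirrorK.
Qed.

Lemma mirror_oseg z z' w : oseg (mirror z) (mirror z') (mirror w) <-> oseg z z' w.
Proof.
split=> -[t [ht e]]; exists t; split=> //; last by rewrite e mirror_mix.
by rewrite -[w]mirrorK e -mirror_mix mirrorK.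
Qed.

Lemma mirror_orient z z' w : orient (mirror z) (mirror z') (mirror w) = - orient z z' w.
Proof. by rewrite /orient /mirror /=; ring. Qed.

Variables (g : V -> F * F) (E : rel V).

Lemma mirror_plane : plane_edges g E -> plane_edges (mirror \o g) E.
Proof.
case=> gi Es Ei Ev Ep; split=> //=.
- by move=> u v /(can_inj mirrorK) /gi.
- by move=> a b v Eab /mirror_cseg; apply: Ev.
- move=> a b c d z Eab Ecd; rewrite -[z]mirrorK => /mirror_oseg h /mirror_cseg; exact: Ep h.
Qed.

Lemma mirror_saturated : saturated g E -> saturated (mirror \o g) E.
Proof.
move=> sat a b nab nv ne; apply: sat => // [v h|c d z Ecd h h'].
  by apply: (nv v); apply/mirror_oseg.
by apply: (ne c d (mirror z) Ecd); [apply/mirror_oseg|apply/mirror_cseg].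
Qed.

Lemma mirror_frame o p r : plane_edges g E -> frame g E o p r -> frame (mirror \o g) E p o r.
Proof.
case=> _ Es _ _ _ [D [Eop Epr] Ero inn]; split=> //=.
- by rewrite mirror_orient; move: D; rewrite /orient; lra.
- by split; rewrite Es.
- by rewrite Es.
- move=> v iv; have [|h1 h2 h3] := inn v; first by move: iv; rewrite /inner => /and3P[-> -> ->].
  by rewrite !mirror_orient; move: h1 h2 h3; rewrite /orient => h1 h2 h3; split; lra.
Qed.

End Mirror.

(** * The linear program of a drawing, and what its solutions say about attached vertices *)

Section Attach.
Variables (F : realFieldType) (V : finType) (E : rel V) (cf : F -> F).
Implicit Types (u v w x y : V).
Hypothesis cf_lt : forall s s', s < s' -> cf s < cf s'.

Definition hgt (X Y : V -> F) s v := Y v - s * X v.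
Definition attached (g : V -> F * F) v := exists y, crosses g E (v, y).
Definition chgt (g : V -> F * F) u x := cf (ht g (u, x) 0).

(* Neighbours certifying that [u] lies in the interior of their hull: [p] and [q] precede and
   follow [u] among the vertices attached to the axis, [x] and [x'] are its lowest and highest
   neighbours across the axis. *)
Definition nbr_data (g : V -> F * F) X Y u := exists p q x x',
  [/\ [/\ E u p, E u q, crosses g E (u, x) & crosses g E (u, x')], attached g p /\ attached g q,
    [/\ hgt X Y (chgt g u x) u < hgt X Y (chgt g u x) p, hgt X Y (chgt g u x') q < hgt X Y (chgt g u x') u
      & x = x' \/ chgt g u x < chgt g u x'] &
    [/\ X u <= X p, X u <= X q & X u < X p -> X u < X q -> p = q]].

Lemma cf_le s s' : s <= s' -> cf s <= cf s'.
Proof. by rewrite le_eqVlt => /orP[/eqP -> //|/cf_lt /ltW]. Qed.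

Section OneSide.
Variables (g : V -> F * F) (o p r : V) (t : F).
Local Notation xc v := (g v).1.
Hypothesis HP : plane_edges g E.
Hypothesis Hsat : saturated g E.
Hypothesis fr : frame g E o p r.
Hypothesis t0 : t < 0.
Hypothesis left_t : forall v, xc v < 0 -> xc v < t.
Hypothesis xo : xc o < 0.
Hypothesis xp : 0 < xc p.
Hypothesis xr : xc r = 0.
Hypothesis xt : forall v, xc v != t.

Let Es a b : E a b = E b a. Proof. by case: HP. Qed.
Let M := size (items g E t).
Let itt := it g E o t.
Let la := lab g E o t.
Let c i := cf (ht g (itt i) 0).

Let cle i j : (i <= j)%N -> (j < M)%N -> c i <= c j.
Proof. by move=> ij jM; apply: cf_le; apply: (ht0_le o HP t0 left_t). Qed.

Let clt i j : (i < j)%N -> (j < M)%N -> la i = la j -> c i < c j.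
Proof. by move=> ij jM e; apply: cf_lt; apply: (ht0_lt_lab HP t0 left_t). Qed.

Let nc i j k l : (i < j)%N -> (j < k)%N -> (k < l)%N -> (l < M)%N -> la i = la k -> la j = la l -> la i = la j.
Proof. exact: (lab_noncrossing HP t0 left_t). Qed.

Let ends : la 0 = la M.-1 /\ la 0 = o /\ (1 < M)%N.
Proof.
have [M1 [e0 eM]] := it_ends HP fr t0 left_t xo xp xr.
by rewrite /la /lab e0 /M eM.
Qed.

Let str i j : (i < j)%N -> (j < M)%N -> (0 < xc (itt i).2) \/ (0 < xc (itt j).2) -> c i < c j.
Proof.
move=> ij jM h; have iM := ltn_trans ij jM.
apply: cf_lt; rewrite lt_neqAle (ht0_le o HP t0 left_t) // 1?ltnW // andbT; apply/eqP => e.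
case: (ht0_eq HP t0 left_t (it_crosses o iM) (it_crosses o jM) e) => [e'|[e2 e0]].
  by move: ij; rewrite (it_inj iM jM e') ltnn.
by case: h; rewrite ?/itt -?e2 /itt ?e0 ltxx.
Qed.

Lemma line_side (cr : pred (V * V)) (ce : V * V -> F) (fl : V * V -> V * V) pr :
  involutive fl -> (forall e, cr e -> E (fl e).1 (fl e).2 /\ xc (fl e).1 < 0 < xc (fl e).2) ->
  (forall e, cr e -> ce e = cf (ht g (fl e) 0)) -> (forall e, pr e = (fl e).1) ->
  side cr ce M la c (fun i => fl (itt i)) pr.
Proof.
move=> flK crP ceP prP; have [e1 [e2 M1]] := ends; split=> //.
- by rewrite ltnW.
- by move=> i iM h; rewrite ceP // flK.
- by move=> i j iM jM /(can_inj flK); apply: it_inj.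
- move=> e h; have [Ee /andP[h1 h2]] := crP e h.
  have [i iM ei] := it_index o t (ltac:(by rewrite /crosses Ee h1 (ltW h2)) : crosses g E (fl e)).
  by exists i => //; rewrite /itt ei flK.
- by move=> i j ij jM [/crP[_]|/crP[_]]; rewrite flK => /andP[_ h]; apply: str => //; [left|right].
- by move=> i iM h; rewrite prP flK.
Qed.

Variables (X Y : V -> F).
Hypothesis crX : forall u w, E u w -> xc u < 0 -> 0 < xc w ->
  hgt X Y (chgt g u w) u = hgt X Y (chgt g u w) w /\ X u < X w.
Hypothesis sibX : forall i, sib M la i -> X (la i.-1) = X (la i).
Hypothesis micY : forall i, micro M c i -> hgt X Y (c i) (la i) < hgt X Y (c i) (la i.-1).

(** If the two edges end at a common vertex to the right of the axis, its larger [X] and the height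
    equations of both edges give the inequalities. If they end on the axis, the two heights agree
    and the program imposes it. *)
Let gapY i : (0 < i < M)%N -> la i.-1 <> la i ->
  hgt X Y (c i.-1) (la i) < hgt X Y (c i.-1) (la i.-1) /\ hgt X Y (c i) (la i) < hgt X Y (c i) (la i.-1).
Proof.
case: i => // i /andP[_ iM] /= nl.
have iM' := ltnW iM.
have [//|[er El]] := it_consecutive o HP Hsat t0 left_t xt iM.
have [Ei i1 i1' i2' i2] := crossesP t0 left_t (it_crosses o iM').
have [Ej j1 j1' j2' j2] := crossesP t0 left_t (it_crosses o iM).
have [r0|r0] := eqVneq (xc (itt i).2) 0.
  have ec : c i = c i.+1.
    rewrite /c; congr cf; rewrite -r0 -{1}[(itt i).2]/(rgt g E o t i).
    rewrite (ht2 (e := itt i)) ?(lt_trans i1 i2) //.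
    rewrite -[in RHS]/(rgt g E o t i) er.
    rewrite (ht2 (e := itt i.+1)) ?(lt_trans j1 j2) //.
    by rewrite -[(itt i).2]/(rgt g E o t i) er.
  have mi : micro M c i.+1 by rewrite /micro /= iM -ec eqxx.
  by have := micY mi; rewrite /= ec.
have rp : 0 < xc (itt i).2 by rewrite lt_def r0.
have [e1 l1] := crX Ei i1' rp.
have rp' : 0 < xc (itt i.+1).2.
  by rewrite -[(itt i.+1).2]/(rgt g E o t i.+1) -er.
have [e2 l2] := crX Ej j1' rp'.
have cc : c i < c i.+1 by apply: str => //; left.
have ci : chgt g (itt i).1 (itt i).2 = c i by rewrite /chgt /c; case: (itt i).
have cj : chgt g (itt i.+1).1 (itt i.+1).2 = c i.+1 by rewrite /chgt /c; case: (itt i.+1).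
rewrite ci in e1; rewrite cj in e2.
have er' : (itt i.+1).2 = (itt i).2 by exact/esym.
rewrite er' in e2 l2.
rewrite -[la i]/((itt i).1) -[la i.+1]/((itt i.+1).1); move: e1 e2 l1 l2; rewrite /hgt => e1 e2 l1 l2.
have p1 : 0 < (c i.+1 - c i) * (X (itt i).2 - X (itt i).1) by apply: mulr_gt0; lra.
have p2 : 0 < (c i.+1 - c i) * (X (itt i).2 - X (itt i.+1).1) by apply: mulr_gt0; lra.
split; lra.
Qed.

Let attachedP v : attached g v <-> exists2 i, (i < M)%N & la i = v.
Proof.
split=> [[y /(it_index o t)[i iM ei]]|[i iM <-]]; first by exists i => //; rewrite /la /lab ei.
by exists (rgt g E o t i); have := it_crosses o iM; rewrite /la /lab /rgt; case: (it _ _ _ _ i).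
Qed.

(** For every attached vertex other than [o] some attached vertex has larger [X], so the maximum is
    attained at [o] alone. *)
Lemma attached_nbrs u : attached g u -> u <> o -> nbr_data g X Y u /\ X u < X o.
Proof.
have [e1 [e2 M1]] := ends.
have main v : attached g v -> v <> o -> nbr_data g X Y v /\ exists k, (k < M)%N /\ X v < X (la k).
  move=> /attachedP [i iM ei] no.
  have ni : la i <> la 0 by rewrite ei e2.
  have gX j : (0 < j < M)%N -> la j.-1 <> la j -> (forall k, (k < M)%N -> la k = la j.-1 -> (k < j)%N) ->
      (forall k, (k < M)%N -> la k = la j -> (j <= k)%N) -> X (la j.-1) = X (la j).
    by move=> jM nj h1 h2; apply: sibX.
  have [a [l [al lM ea el [np nq acl [ha hl] [x1 x2 x3 x4]]]]] := side_nbrs nc cle clt gX gapY e1 iM ni.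
  have aM : (a < M)%N by slia.
  have lM' : (l < M)%N by slia.
  rewrite ei in ea el np nq ha hl x1 x2 x3 x4.
  have ita : itt a = (v, (itt a).2) by rewrite -[v]/(v) -(ea : (itt a).1 = v); case: (itt a).
  have itl : itt l = (v, (itt l).2) by rewrite -[v]/(v) -(el : (itt l).1 = v); case: (itt l).
  have ca : chgt g v (itt a).2 = c a by rewrite /chgt /c -ita.
  have cl : chgt g v (itt l).2 = c l by rewrite /chgt /c -itl.
  split; last exact: x4.
  exists (la a.-1), (la l.+1), (itt a).2, (itt l).2; rewrite ca cl; split.
  - split.
    + have a1M : (a.-1.+1 < M)%N by slia.
      have [e|[_]] := it_consecutive o HP Hsat t0 left_t xt a1M.
        by case: np; rewrite -ea /la e prednK //; slia.
      by rewrite prednK; [rewrite -/la ea Es|slia].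
    + have [e|[_]] := it_consecutive o HP Hsat t0 left_t xt lM; first by case: nq; rewrite -el /la e.
      by rewrite -/la el.
    + by rewrite -ita; apply: it_crosses.
    + by rewrite -itl; apply: it_crosses.
  - by split; apply/attachedP; [exists a.-1 => //; slia|exists l.+1].
  - by split=> //; case: acl => [->|]; [left|right].
  - by split.
move=> au no; have [n1 [k [kM lk]]] := main u au no; split=> //.
have [m [am mm]] := @fin_argmin F V (attached g) (fun v => - X v) (ex_intro _ u au).
have [em|nm] := eqVneq m o; last first.
  have [_ [k' [kM' lk']]] := main m am (elimN eqP nm).
  have ak : attached g (la k') by apply/attachedP; exists k'.
  by have := mm _ ak; lra.
have ak : attached g (la k) by apply/attachedP; exists k.
by have := mm _ ak; rewrite em; lra.
Qed.

End OneSide.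
End Attach.

(** * Dual coordinates for both half planes together *)

Section Placement.
Variables (F : realFieldType) (V : finType) (g : V -> F * F) (E : rel V) (cf : F -> F) (o p r : V).
Implicit Types (u v w x y : V) (e : V * V).
Hypothesis cf_lt : forall s s', s < s' -> cf s < cf s'.
Local Notation xc v := (g v).1.
Hypothesis HP : plane_edges g E.
Hypothesis Hsat : saturated g E.
Hypothesis fr : frame g E o p r.
Hypothesis xo : xc o < 0.
Hypothesis xp : 0 < xc p.
Hypothesis xr : xc r = 0.

Let Es a b : E a b = E b a. Proof. by case: HP. Qed.
Local Notation g' := (@mirror F \o g).
Local Notation hgt := (@hgt F V).

(** Half the smallest nonzero distance of a vertex from the axis serves both sides. *)
Lemma axis_gap : exists t, t < 0 /\ forall v,
  [/\ xc v < 0 -> xc v < t, 0 < xc v -> - xc v < t, xc v != t & - xc v != t].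
Proof.
have no : xc o != 0 by rewrite lt_eqF.
have [m [m0 mm]] := @fin_argmin F V (fun v => xc v != 0) (fun v => `|xc v|) (ex_intro (fun v => is_true (xc v != 0)) o no).
have mp : 0 < `|xc m| by rewrite normr_gt0.
exists (- `|xc m| / 2); split; first lra.
move=> v; have [v0|v0] := eqVneq (xc v) 0; first by split; try apply/eqP; move=> *; lra.
have h := mm v v0; have [p1|p1] := leP 0 (xc v).
  rewrite (ger0_norm p1) in h; split; try apply/eqP; move=> *; lra.
rewrite (ltr0_norm p1) in h; split; try apply/eqP; move=> *; lra.
Qed.

Lemma ht_mirror u w : xc u < 0 -> 0 < xc w -> ht g' (w, u) 0 = ht g (u, w) 0.
Proof.
move=> hu hw; rewrite /ht /=; field; repeat (apply/andP; split); apply/eqP; lra.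
Qed.

Lemma nbr_data_shift (X Y X' Y' : V -> F) (m : F) (gg : V -> F * F) u : (forall v, X' v = X v - m) -> (forall v, Y' v = Y v) ->
  nbr_data E cf gg X Y u -> nbr_data E cf gg X' Y' u.
Proof.
move=> eX eY [a [b [x [x' [h1 h2 [h3 h4 h5] [h6 h7 h8]]]]]]; exists a, b, x, x'; split=> //.
  by move: h3 h4; rewrite /hgt !eX !eY => h3 h4; split=> //; lra.
rewrite !eX; split; [lra|lra|move=> k1 k2; apply: h8; lra].
Qed.

Theorem placement : exists X Y : V -> F,
  [/\ forall u w, E u w -> xc u < 0 -> 0 < xc w ->
        hgt X Y (chgt cf g u w) u = hgt X Y (chgt cf g u w) w,
      forall u, attached E g u -> X u < 0 /\ (u <> o -> nbr_data E cf g X Y u) &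
      forall w, attached E g' w -> 0 < X w /\ (w <> p -> nbr_data E cf g' (fun v => - X v) (fun v => - Y v) w)].
Proof.
have [t [t0 Ht]] := axis_gap.
have lt1 v : xc v < 0 -> xc v < t by case: (Ht v).
have lt2 v : (g' v).1 < 0 -> (g' v).1 < t by rewrite /= oppr_lt0; case: (Ht v).
have xt1 v : xc v != t by case: (Ht v).
have xt2 v : (g' v).1 != t by case: (Ht v).
have HP' := mirror_plane HP; have Hsat' := mirror_saturated Hsat; have fr' := mirror_frame HP fr.
have xp' : (g' p).1 < 0 by rewrite /= oppr_lt0.
have xo' : 0 < (g' o).1 by rewrite /= oppr_gt0.
have xr' : (g' r).1 = 0 by rewrite /= xr oppr0.
pose cr e := [&& E e.1 e.2, xc e.1 < 0 & 0 < xc e.2].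
pose ce e := chgt cf g e.1 e.2.
have S1 : side cr ce (size (items g E t)) (lab g E o t) (fun i => cf (ht g (it g E o t i) 0)) (fun i => id (it g E o t i)) fst.
  have h1 e : cr e -> E e.1 e.2 /\ xc e.1 < 0 < xc e.2 by case/and3P=> ? h2 h3; rewrite h2 h3.
  have h2 e : cr e -> ce e = cf (ht g e 0) by case: e.
  exact: (line_side cf_lt HP fr t0 lt1 xo xp xr (fl := id) (pr := fst) (fun _ => erefl) h1 h2 (fun _ => erefl)).
pose sw (e : V * V) := (e.2, e.1).
have swK : involutive sw by case.
have S2 : side cr ce (size (items g' E t)) (lab g' E p t) (fun i => cf (ht g' (it g' E p t i) 0))
    (fun i => sw (it g' E p t i)) snd.
  have h1 e : cr e -> E (sw e).1 (sw e).2 /\ (g' (sw e).1).1 < 0 < (g' (sw e).2).1.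
    by case/and3P=> h1 h2 h3; rewrite /= oppr_lt0 oppr_gt0 h2 h3 Es.
  have h2 e : cr e -> ce e = cf (ht g' (sw e) 0).
    by case: e => u w /and3P[_ h2 h3]; rewrite /ce /chgt ht_mirror.
  exact: (line_side cf_lt HP' fr' t0 lt2 xp' xo' xr' (pr := snd) swK h1 h2 (fun _ => erefl)).
have dis i j : (i < size (items g E t))%N -> (j < size (items g' E t))%N -> lab g E o t i <> lab g' E p t j.
  move=> iM jM e; have /and3P[_ h1 _] := it_crosses o iM; have /and3P[_ h2 _] := it_crosses p jM.
  by move: h1 h2; rewrite -/(lab g E o t i) -/(lab g' E p t j) e /= oppr_lt0; lra.
have [X [Y [c1 c2 c3 c4 c5]]] := lp_solution S1 S2 dis.
have crX u w : E u w -> xc u < 0 -> 0 < xc w -> hgt X Y (chgt cf g u w) u = hgt X Y (chgt cf g u w) w /\ X u < X w.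
  by move=> h1 h2 h3; apply: (c1 (u, w)); rewrite /cr h1 h2.
pose X' v := - X v; pose Y' v := - Y v.
have hN s v : hgt X' Y' s v = - hgt X Y s v by rewrite /hgt /X' /Y'; ring.
have crX' u w : E u w -> (g' u).1 < 0 -> 0 < (g' w).1 -> hgt X' Y' (chgt cf g' u w) u = hgt X' Y' (chgt cf g' u w) w /\ X' u < X' w.
  rewrite /= oppr_lt0 oppr_gt0 Es => h1 h2 h3; have [e l] := crX w u h1 h3 h2.
  by rewrite !hN /chgt ht_mirror // e /X'; split=> //; lra.
have N1 := attached_nbrs cf_lt HP Hsat fr t0 lt1 xo xp xr xt1 crX c2 c3.
have N2 := attached_nbrs cf_lt HP' Hsat' fr' t0 lt2 xp' xo' xr' xt2 crX'
  (fun i h => congr1 -%R (c4 i h)) (fun i h => ltac:(by rewrite !hN ltrN2; exact: c5)).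
have [_ [Eop _] _ _] := fr.
have [_ Xop] := crX o p Eop xo xp.
(* Attached vertices have [X] at most [X o] on the left and at least [X p] on the right; shifting by
   the midpoint separates them by sign, as the reciprocals require. *)
pose m := (X o + X p) / 2.
exists (fun v => X v - m), Y; split.
- by move=> u w h1 h2 h3; have [e _] := crX u w h1 h2 h3; move: e; rewrite /hgt; lra.
- move=> u au; have [->|/eqP no] := eqVneq u o; first by split=> //; rewrite /m; lra.
  have [d l] := N1 u au no; split=> [|_]; first by rewrite /m; lra.
  exact: (nbr_data_shift (m := m) _ _ d).
- move=> w aw; have [->|/eqP no] := eqVneq w p; first by split=> //; rewrite /m; lra.
  have [d l] := N2 w aw no; split=> [|_]; first by move: l; rewrite /X' /m; lra.
  by apply: (nbr_data_shift (m := - m) _ _ d) => v; rewrite /X' // ; ring.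
Qed.

End Placement.

(** * Points strictly inside the hull of three or four others *)

Section Hull.
Variable F : realFieldType.
Implicit Types (a b c d : F * F) (k : F * F).

Lemma comb3 k z a b c : orient z b c * (fn k a - fn k z) + orient z c a * (fn k b - fn k z) +
  orient z a b * (fn k c - fn k z) = 0.
Proof. by rewrite /orient /fn; ring. Qed.

Lemma fn_zero k z a b : orient z a b <> 0 -> fn k a = fn k z -> fn k b = fn k z -> k = (0, 0).
Proof.
move=> n ea eb; have n' : orient z a b != 0 by apply/eqP.
apply: pairP => /=; apply: (mulIf n'); rewrite mul0r.
  rewrite (_ : k.1 * _ = (fn k a - fn k z) * (b.2 - z.2) - (fn k b - fn k z) * (a.2 - z.2)).
    by rewrite ea eb; ring.
  by rewrite /orient /fn; ring.
rewrite (_ : k.2 * _ = (fn k b - fn k z) * (a.1 - z.1) - (fn k a - fn k z) * (b.1 - z.1)).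
  by rewrite ea eb; ring.
by rewrite /orient /fn; ring.
Qed.

(* [z] is strictly inside the hull of [l]. *)
Definition surrounded (l : seq (F * F)) z := forall k, k <> (0, 0) ->
  (exists2 a, a \in l & fn k a < fn k z) /\ (exists2 a, a \in l & fn k z < fn k a).

Lemma signs3 (A B C x y z : F) : 0 < A -> 0 < B -> 0 < C -> A * x + B * y + C * z = 0 -> ~ (x = 0 /\ y = 0) ->
  (x < 0 \/ y < 0 \/ z < 0) /\ (0 < x \/ 0 < y \/ 0 < z).
Proof.
move=> hA hB hC e n; split; apply: contrapT => h.
  have x0 : 0 <= x by rewrite leNgt; apply/negP => l; apply: h; left.
  have y0 : 0 <= y by rewrite leNgt; apply/negP => l; apply: h; right; left.
  have z0 : 0 <= z by rewrite leNgt; apply/negP => l; apply: h; right; right.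
  have h1 := mulr_ge0 (ltW hA) x0; have h2 := mulr_ge0 (ltW hB) y0; have h3 := mulr_ge0 (ltW hC) z0.
  have e1 : A * x = 0 by lra.
  have e2 : B * y = 0 by lra.
  apply: n; move/eqP: e1; move/eqP: e2; rewrite !mulf_eq0 (gt_eqF hA) (gt_eqF hB) /= => /eqP ? /eqP ?; by split.
have x0 : 0 <= - x by rewrite oppr_ge0 leNgt; apply/negP => l; apply: h; left.
have y0 : 0 <= - y by rewrite oppr_ge0 leNgt; apply/negP => l; apply: h; right; left.
have z0 : 0 <= - z by rewrite oppr_ge0 leNgt; apply/negP => l; apply: h; right; right.
have h1 := mulr_ge0 (ltW hA) x0; have h2 := mulr_ge0 (ltW hB) y0; have h3 := mulr_ge0 (ltW hC) z0.
have e1 : A * x = 0 by lra.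
have e2 : B * y = 0 by lra.
apply: n; move/eqP: e1; move/eqP: e2; rewrite !mulf_eq0 (gt_eqF hA) (gt_eqF hB) /= => /eqP ? /eqP ?; by split.
Qed.

Lemma surround3 z a b c : 0 < orient z a b -> 0 < orient z b c -> 0 < orient z c a -> surrounded [:: a; b; c] z.
Proof.
move=> h1 h2 h3 k k0; have := comb3 k z a b c.
move=> e; have [|s1 s2] := signs3 h2 h3 h1 e.
  move=> [e1 e2]; apply: k0; apply: (@fn_zero k z a b); [by apply/eqP; rewrite gt_eqF|lra|lra].
split.
  by case: s1 => [l|[l|l]]; [exists a|exists b|exists c]; rewrite ?inE ?eqxx ?orbT //; lra.
by case: s2 => [l|[l|l]]; [exists a|exists b|exists c]; rewrite ?inE ?eqxx ?orbT //; lra.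
Qed.

Lemma surround_sub l l' z : {subset l <= l'} -> surrounded l z -> surrounded l' z.
Proof. by move=> h s k /s [[a /h al la] [b /h bl lb]]; split; [exists a|exists b]. Qed.

(** If [z] is off the line [ac], three of the points suffice. Otherwise [a] and [c] lie in opposite
    directions from [z], and a functional constant on that line is taken care of by [b] and [d]. *)
Lemma surround4 z a b c d : 0 < orient z a b -> 0 < orient z b c -> 0 < orient z c d -> 0 < orient z d a ->
  surrounded [:: a; b; c; d] z.
Proof.
move=> h1 h2 h3 h4; case: (ltgtP (orient z a c) 0) => ac.
- apply: (surround_sub (l := [:: a; b; c])).
    by move=> x; rewrite !inE => /or3P[] ->; rewrite ?orbT.
  by apply: surround3 => //; move: ac; rewrite /orient; lra.
- apply: (surround_sub (l := [:: a; c; d])).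
    by move=> x; rewrite !inE => /or3P[] ->; rewrite ?orbT.
  exact: surround3.
move=> k k0.
have e1 := comb3 k z a b c; have e2 := comb3 k z a b d.
have ca : orient z c a = 0 by move: ac; rewrite /orient; lra.
rewrite ca mul0r addr0 in e1.
have op (A B x y : F) : 0 < A -> 0 < B -> A * x + B * y = 0 -> x <> 0 -> (x < 0 /\ 0 < y) \/ (0 < x /\ y < 0).
  move=> hA hB e n; case: (ltgtP x 0) => // hx; [left|right]; split=> //.
    have := mulr_gt0 hA (ltac:(lra) : 0 < - x) => h.
    by rewrite -(pmulr_rgt0 _ hB); lra.
  have := mulr_gt0 hA hx => h.
  by rewrite -oppr_gt0 -(pmulr_rgt0 _ hB); lra.
have [fa|fa] := pselect (fn k a - fn k z = 0); last first.
  case: (op _ _ _ _ h2 h1 e1 fa) => -[l1 l2]; split.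
  - by exists a; rewrite ?inE ?eqxx ?orbT //; lra.
  - by exists c; rewrite ?inE ?eqxx ?orbT //; lra.
  - by exists c; rewrite ?inE ?eqxx ?orbT //; lra.
  - by exists a; rewrite ?inE ?eqxx ?orbT //; lra.
rewrite fa mulr0 add0r in e2.
have [fb|fb] := pselect (fn k b - fn k z = 0).
  by case: k0; apply: (@fn_zero k z a b); [apply/eqP; rewrite gt_eqF|lra|lra].
case: (op _ _ _ _ h4 h1 e2 fb) => -[l1 l2]; split.
- by exists b; rewrite ?inE ?eqxx ?orbT //; lra.
- by exists d; rewrite ?inE ?eqxx ?orbT //; lra.
- by exists d; rewrite ?inE ?eqxx ?orbT //; lra.
- by exists b; rewrite ?inE ?eqxx ?orbT //; lra.
Qed.

End Hull.

(** * Continuity from the right at zero *)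

Section Continuity.
Variable F : realFieldType.
Implicit Types (f h : F -> F).

Definition cont0 f := forall e, 0 < e -> ev (fun s => `|f s - f 0| < e).

Lemma cont0_const (a : F) : cont0 (fun=> a).
Proof. by move=> e e0; apply: ev_true => s _; rewrite subrr normr0. Qed.

Lemma cont0_id : cont0 id.
Proof. by move=> e e0; exists (e / 2); split; [lra|move=> s hs; rewrite subr0 gtr0_norm; lra]. Qed.

Lemma cont0_add f h : cont0 f -> cont0 h -> cont0 (fun s => f s + h s).
Proof.
move=> cf ch e e0; have e2 : 0 < e / 2 by lra.
apply: ev_imp (ev_and (cf _ e2) (ch _ e2)) => s _ [h1 h2].
rewrite (_ : _ - _ = (f s - f 0) + (h s - h 0)); last by ring.
by apply: le_lt_trans (ler_normD _ _) _; lra.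
Qed.

Lemma cont0_opp f : cont0 f -> cont0 (fun s => - f s).
Proof.
move=> cf e e0; apply: ev_imp (cf e e0) => s _ h.
by rewrite (_ : _ - _ = - (f s - f 0)) ?normrN //; ring.
Qed.

Lemma cont0_mul f h : cont0 f -> cont0 h -> cont0 (fun s => f s * h s).
Proof.
move=> cf ch e e0.
have N0 := normr_ge0 (h 0); have M0 := normr_ge0 (f 0).
have a0 : 0 < e / (2 * (`|h 0| + 1)) by apply: divr_gt0; lra.
have b0 : 0 < e / (2 * (`|f 0| + 1)) by apply: divr_gt0; lra.
apply: ev_imp (ev_and (cf _ a0) (ev_and (ch _ b0) (ch 1 ltr01))) => s _ [h1 [h2 h3]].
rewrite (_ : _ - _ = (f s - f 0) * h s + f 0 * (h s - h 0)); last by ring.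
apply: le_lt_trans (ler_normD _ _) _; rewrite !normrM.
move: h1 h2; rewrite !ltr_pdivlMr; [|lra|lra] => h1 h2.
have hs : `|h s| <= `|h 0| + 1.
  by have := ler_normD (h s - h 0) (h 0); rewrite subrK; lra.
have p1 := mulr_ge0 (normr_ge0 (f s - f 0)) (ltac:(lra) : 0 <= `|h 0| + 1 - `|h s|).
have p2 := mulr_ge0 (normr_ge0 (h s - h 0)) M0.
have p3 := normr_ge0 (h s - h 0).
lra.
Qed.

Lemma cont0_inv f : cont0 f -> f 0 != 0 -> cont0 (fun s => (f s)^-1).
Proof.
move=> cf n e e0; have N : 0 < `|f 0| by rewrite normr_gt0.
have NN : 0 < `|f 0| * `|f 0| by apply: mulr_gt0.
have a0 : 0 < e * (`|f 0| * `|f 0|) / 2 by apply: divr_gt0; [apply: mulr_gt0|lra].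
apply: ev_imp (ev_and (cf _ a0) (cf _ (ltac:(lra) : 0 < `|f 0| / 2))) => s _ [h1 h2].
have fs : `|f 0| / 2 < `|f s|.
  have := ler_normD (f 0 - f s) (f s); rewrite subrK distrC; lra.
have ns : f s != 0 by rewrite -normr_gt0; lra.
rewrite (_ : _ - _ = - (f s - f 0) / (f s * f 0)); last by field; rewrite n ns.
have fsp : 0 < `|f s| by lra.
rewrite normrM normrN normfV normrM ltr_pdivrMr; last by apply: mulr_gt0.
have := mulr_gt0 (mulr_gt0 e0 N) (ltac:(lra) : 0 < `|f s| - `|f 0| / 2); lra.
Qed.

Lemma cont0_pos f : cont0 f -> 0 < f 0 -> ev (fun s => 0 < f s).
Proof.
move=> cf p; apply: ev_imp (cf _ p) => s _ h.
have := ler_norm (f 0 - f s); rewrite distrC; lra.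
Qed.

Definition cont2 (z : F -> F * F) := cont0 (fun s => (z s).1) /\ cont0 (fun s => (z s).2).

Lemma cont0_orient a b c : cont2 a -> cont2 b -> cont2 c -> cont0 (fun s => orient (a s) (b s) (c s)).
Proof.
move=> [a1 a2] [b1 b2] [c1 c2]; rewrite /orient.
by apply: cont0_add; [|apply: cont0_opp]; apply: cont0_mul; apply: cont0_add => //; apply: cont0_opp.
Qed.

Lemma cont2_mix m a b : cont2 a -> cont2 b -> cont2 (fun s => mix m (a s) (b s)).
Proof.
by move=> [a1 a2] [b1 b2]; split; rewrite /mix /=; apply: cont0_add; apply: cont0_mul => //; apply: cont0_const.
Qed.

Lemma orient_ev a b c : cont2 a -> cont2 b -> cont2 c -> 0 < orient (a 0) (b 0) (c 0) ->
  ev (fun s => 0 < orient (a s) (b s) (c s)).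
Proof. by move=> ha hb hc; apply: cont0_pos; apply: cont0_orient. Qed.

End Continuity.

(** * Positions from dual coordinates, and strict hulls of the neighbours *)

Section Positions.
Variables (F : realFieldType) (V : finType) (E : rel V) (cf : F -> F).
Implicit Types (u v w x y : V) (s : F).

(* [(X, Y)] are dual coordinates of the point [(1 / X, Y / X)]: edges meeting the axis at height
   [c] become vectors of slope [c].  The quadratic term bends the vertical lines [X = const]. *)
Definition pos (g : V -> F * F) (X Y d : V -> F) s v : F * F :=
  if (g v).1 < 0 then ((X v + s * (Y v * Y v))^-1, Y v / (X v + s * (Y v * Y v)))
  else if 0 < (g v).1 then ((X v - s * (Y v * Y v))^-1, Y v / (X v - s * (Y v * Y v)))
  else (s * d v, cf (g v).2).

(** The surrounding points may lie on segments between two neighbours, such as the point where the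
    edge opposite a vertex of the axis crosses it; a functional that is smaller there than at [q u]
    is smaller at one of the two. *)
Definition strict_hull (N : V -> Prop) (q : V -> F * F) u := exists2 l, surrounded l (q u) &
  forall a, a \in l -> exists b c m, [/\ E u b /\ N b, E u c /\ N c, 0 <= m <= 1 & a = mix m (q b) (q c)].

Definition two_sided (N : V -> Prop) (q : V -> F * F) u := forall k, k <> (0, 0) ->
  (exists b, [/\ E u b, N b & fn k (q b) < fn k (q u)]) /\ (exists b, [/\ E u b, N b & fn k (q u) < fn k (q b)]).

Lemma two_sided_mirror N q u : two_sided N (fun v => mirror (q v)) u -> two_sided N q u.
Proof.
move=> h k k0; pose k' : F * F := (- k.1, k.2).
have fk z : fn k' (mirror z) = fn k z by rewrite /fn /k' /mirror /=; ring.
have k'0 : k' <> (0, 0).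
  by move=> [/eqP]; rewrite oppr_eq0 => /eqP e1 e2; apply: k0; apply: pairP.
have [[b [h1 h2 h3]] [c [h4 h5 h6]]] := h k' k'0; rewrite !fk in h3 h6.
by split; [exists b|exists c].
Qed.

Lemma mix_lt (m a b c : F) : 0 <= m <= 1 -> (1 - m) * a + m * b < c -> c <= a -> c <= b -> False.
Proof.
move=> hm l l1 l2; have m0 : 0 <= m by lra.
have m1 : 0 <= 1 - m by lra.
by have := ler_wpM2l m0 l2; have := ler_wpM2l m1 l1; lra.
Qed.

Lemma mix_gt (m a b c : F) : 0 <= m <= 1 -> c < (1 - m) * a + m * b -> a <= c -> b <= c -> False.
Proof.
move=> hm l l1 l2; have m0 : 0 <= m by lra.
have m1 : 0 <= 1 - m by lra.
by have := ler_wpM2l m0 l2; have := ler_wpM2l m1 l1; lra.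
Qed.

Lemma strict_two N q u : strict_hull N q u -> two_sided N q u.
Proof.
move=> [l sur nb] k k0; have [[a al la] [b bl lb]] := sur k k0; split.
  have [x [y [m [[Ex Nx] [Ey Ny] hm e]]]] := nb a al; rewrite e fn_mix in la.
  have [l1|l1] := ltP (fn k (q x)) (fn k (q u)); first by exists x.
  have [l2|l2] := ltP (fn k (q y)) (fn k (q u)); first by exists y.
  by case: (mix_lt hm la l1 l2).
have [x [y [m [[Ex Nx] [Ey Ny] hm e]]]] := nb b bl; rewrite e fn_mix in lb.
have [l1|l1] := ltP (fn k (q u)) (fn k (q x)); first by exists x.
have [l2|l2] := ltP (fn k (q u)) (fn k (q y)); first by exists y.
by case: (mix_gt hm lb l1 l2).
Qed.

Lemma pos_mirror g X Y d s v : pos (@mirror F \o g) (fun v => - X v) (fun v => - Y v) (fun v => - d v) s v =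
  mirror (pos g X Y d s v).
Proof.
rewrite /pos /= oppr_lt0 oppr_gt0; case: (ltgtP (g v).1 0) => h /=; rewrite /mirror /=.
- have -> : - X v - s * (- Y v * - Y v) = - (X v + s * (Y v * Y v)) by ring.
  by rewrite invrN mulrNN.
- have -> : - X v + s * (- Y v * - Y v) = - (X v - s * (Y v * Y v)) by ring.
  by rewrite invrN mulrNN.
- by rewrite mulrN.
Qed.

Section LeftHull.
Variables (g : V -> F * F) (X Y d : V -> F).
Local Notation xc v := (g v).1.
Local Notation hgt := (@hgt F V).
Local Notation P := (pos g X Y d).
Hypothesis XL : forall u, attached E g u -> X u < 0.
Hypothesis XR : forall w, attached E (@mirror F \o g) w -> 0 < X w.
Hypothesis Es : forall a b, E a b = E b a.
Hypothesis XY : forall u w, E u w -> xc u < 0 -> 0 < xc w ->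
  hgt X Y (chgt cf g u w) u = hgt X Y (chgt cf g u w) w.

Lemma crosses_att u x : crosses g E (u, x) -> attached E g u /\ (0 < xc x -> attached E (@mirror F \o g) x).
Proof.
move=> h; split=> [|hx]; first by exists x.
case/and3P: h => /= h1 h2 h3; exists u; rewrite /crosses /= Es h1 oppr_lt0 hx /=; lra.
Qed.

Lemma att_left u : attached E g u -> xc u < 0.
Proof. by case=> x /and3P[]. Qed.

Lemma cont_left u : attached E g u -> cont2 (fun s => P s u).
Proof.
move=> au; have l := att_left au; have n := XL au.
have c : cont0 (fun s => (X u + s * (Y u * Y u))^-1).
  apply: cont0_inv; last by rewrite mul0r addr0 lt_eqF.
  by apply: cont0_add; [apply: cont0_const|apply: cont0_mul; [apply: cont0_id|apply: cont0_const]].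
by split; rewrite /pos l //=; apply: cont0_mul => //; apply: cont0_const.
Qed.

Lemma cont_right w : attached E (@mirror F \o g) w -> cont2 (fun s => P s w).
Proof.
move=> aw; have l : 0 < xc w by case: aw => x /and3P[_]; rewrite /= oppr_lt0.
have n := XR aw.
have c : cont0 (fun s => (X w - s * (Y w * Y w))^-1).
  apply: cont0_inv; last by rewrite mul0r subr0 gt_eqF.
  by apply: cont0_add; [apply: cont0_const|apply: cont0_opp; apply: cont0_mul; [apply: cont0_id|apply: cont0_const]].
by split; rewrite /pos (lt_gtF l) l //=; apply: cont0_mul => //; apply: cont0_const.
Qed.

Lemma cont_axis x : xc x = 0 -> cont2 (fun s => P s x).
Proof.
move=> e; split; rewrite /pos e !ltxx /=; last exact: cont0_const.
by apply: cont0_mul; [apply: cont0_id|apply: cont0_const].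
Qed.

Lemma cont_cross u x : crosses g E (u, x) -> cont2 (fun s => P s x).
Proof.
move=> h; have [_ ax] := crosses_att h; case/and3P: h => /= _ _ h3.
have [e|n] := eqVneq (xc x) 0; first exact: cont_axis.
by apply: cont_right; apply: ax; rewrite lt_def n.
Qed.

Lemma pos0_left u : attached E g u -> P 0 u = ((X u)^-1, Y u / X u).
Proof. by move=> au; rewrite /pos att_left // mul0r addr0. Qed.

Lemma pos0_right w : 0 < xc w -> P 0 w = ((X w)^-1, Y w / X w).
Proof. by move=> l; rewrite /pos (lt_gtF l) l mul0r subr0. Qed.

(** By the height equation the crossing point lies on the ray from [u] to [x], so at parameter 0
    turns towards [x] can be computed with the crossing point. *)
Lemma ray u x : crosses g E (u, x) -> exists2 k, 0 < k &
  forall a, orient (P 0 u) a (P 0 x) = k * orient (P 0 u) a (0, chgt cf g u x).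
Proof.
move=> h; have [au ax] := crosses_att h; have nu := XL au.
case/and3P: (h) => /= Eux xu x0; have [e|n] := eqVneq (xc x) 0.
  exists 1; rewrite ?ltr01 // => a; rewrite mul1r; congr (orient _ _ _).
  rewrite /pos e !ltxx mul0r /chgt; congr (0, cf _).
  by have := @ht2 F V g (u, x) (ltac:(by rewrite /= e)); rewrite /= e.
have xp : 0 < xc x by rewrite lt_def n.
have np := XR (ax xp); have e := XY Eux xu xp.
exists ((X x - X u) / X x); first by apply: divr_gt0; lra.
move=> a; rewrite pos0_left // pos0_right // /orient /=.
have eY : Y x = Y u + chgt cf g u x * (X x - X u) by move: e; rewrite /hgt; lra.
by rewrite eY; field; apply/andP; split; apply/eqP; lra.
Qed.

(** The map from [(X, Y)] to [(1 / X, Y / X)] is projective: it multiplies the determinant of three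
    points by the reciprocal of the product of their [X], up to sign. *)
Lemma orient_dual (a b c y1 y2 y3 : F) : a < 0 -> b < 0 -> c < 0 ->
  (y2 - y1) * (c - a) - (b - a) * (y3 - y1) < 0 -> 0 < orient (a^-1, y1 / a) (b^-1, y2 / b) (c^-1, y3 / c).
Proof.
move=> ha hb hc h.
have abc : 0 < - (a * b * c) by rewrite oppr_gt0 nmulr_llt0 // nmulr_rgt0.
have -> : orient (a^-1, y1 / a) (b^-1, y2 / b) (c^-1, y3 / c) =
   - ((y2 - y1) * (c - a) - (b - a) * (y3 - y1)) / (- (a * b * c)).
  by rewrite /orient /=; field; rewrite !lt_eqF.
by apply: divr_gt0 => //; rewrite oppr_gt0.
Qed.

(** With equal [X] the three points are collinear at parameter 0. Adding [s * Y ^ 2] to [X] bends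
    the line into a parabola, and the determinant becomes [s] times a Vandermonde product, up to
    sign. *)
Lemma turn_back_vertical u p q : attached E g u -> attached E g p -> attached E g q ->
  X p = X u -> X q = X u -> Y u < Y p -> Y q < Y u -> ev (fun s => 0 < orient (P s u) (P s q) (P s p)).
Proof.
move=> au ap aq e e' y1 y2.
have neg y : attached E g y -> ev (fun s => X y + s * (Y y * Y y) < 0).
  move=> /XL ay; apply: ev_imp (@ev_pos_f F (fun s => - (X y + s * (Y y * Y y))) (- X y) (- (Y y * Y y)) 0 _ _).
  - by move=> s _; rewrite oppr_gt0.
  - by move=> s; ring.
  - by lra.
apply: ev_imp (ev_and (neg u au) (ev_and (neg p ap) (neg q aq))) => s s0 [n1 [n2 n3]].
rewrite /pos (att_left au) (att_left ap) (att_left aq); apply: orient_dual => //; rewrite e e'.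
have h1 : 0 < Y u - Y q by rewrite subr_gt0.
have h2 : 0 < Y p - Y u by rewrite subr_gt0.
have h3 : 0 < Y p - Y q by rewrite subr_gt0; apply: lt_trans y1.
rewrite (_ : _ - _ = - (s * ((Y u - Y q) * (Y p - Y u) * (Y p - Y q)))); last by ring.
by rewrite oppr_lt0 !mulr_gt0.
Qed.

(** The turn that closes the fan around [u] on the side away from the axis. *)
Lemma turn_back u p q (c c' : F) : attached E g u -> attached E g p -> attached E g q ->
  X u <= X p -> X u <= X q -> ~ (X u < X p /\ X u < X q) ->
  hgt X Y c u < hgt X Y c p -> hgt X Y c' q < hgt X Y c' u ->
  ev (fun s => 0 < orient (P s u) (P s q) (P s p)).
Proof.
move=> au ap aq lp lq nl hp hq.
have cu := cont_left au; have cp := cont_left ap; have cq := cont_left aq.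
have y1 : X p = X u -> Y u < Y p by move=> e; move: hp; rewrite /hgt e; lra.
have y2 : X q = X u -> Y q < Y u by move=> e; move: hq; rewrite /hgt e; lra.
have [e|np'] := eqVneq (X p) (X u); have [e'|nq'] := eqVneq (X q) (X u).
- by apply: turn_back_vertical; auto.
- apply: orient_ev => //; rewrite !pos0_left //; apply: orient_dual; try exact: XL.
  have l : X u < X q by rewrite lt_def nq'.
  have := mulr_gt0 (ltac:(lra) : 0 < X q - X u) (ltac:(by rewrite subr_gt0; apply: y1) : 0 < Y p - Y u).
  by rewrite e; lra.
- apply: orient_ev => //; rewrite !pos0_left //; apply: orient_dual; try exact: XL.
  have l : X u < X p by rewrite lt_def np'.
  have := mulr_gt0 (ltac:(lra) : 0 < X p - X u) (ltac:(by rewrite subr_gt0; apply: y2) : 0 < Y u - Y q).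
  by rewrite e'; lra.
- by case: nl; rewrite !lt_def np' nq'.
Qed.

Variable N : V -> Prop.
Hypothesis crN : forall u x, crosses g E (u, x) -> N u /\ N x.

(** The fan [p], [x], [x'], [q] winds around [u]: the turns facing the axis are strict already at
    parameter 0, and the last one is [turn_back]. Three points remain if [x] and [x'] coincide or if
    [p] and [q] do. *)
Lemma left_hull u : attached E g u -> nbr_data E cf g X Y u -> ev (fun s => strict_hull N (P s) u).
Proof.
move=> au [p [q [x [x' [[Eup Euq cx cx'] [ap aq] [hp hq hx] [lp lq lpq]]]]]].
have nu := XL au; have np := XL ap; have nq := XL aq.
have cu := cont_left au; have cp := cont_left ap; have cq := cont_left aq.
have ccx := cont_cross cx; have ccx' := cont_cross cx'.
have [k k0 kE] := ray cx; have [k' k0' kE'] := ray cx'.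
have Eux : E u x by case/and3P: cx.
have Eux' : E u x' by case/and3P: cx'.
set c := chgt cf g u x in hp hx kE; set c' := chgt cf g u x' in hq hx kE'.
have up : 0 < X u * X p by rewrite nmulr_rgt0.
have uq : 0 < X u * X q by rewrite nmulr_rgt0.
have o1 : 0 < orient (P 0 u) (P 0 p) (P 0 x).
  rewrite kE mulr_gt0 // !pos0_left //.
  rewrite (_ : orient _ _ _ = (hgt X Y c p - hgt X Y c u) / (X u * X p)); last first.
    by rewrite /orient /hgt /=; field; rewrite !lt_eqF.
  by rewrite divr_gt0 // subr_gt0.
have o2 : 0 < orient (P 0 u) (P 0 x') (P 0 q).
  rewrite (_ : orient (P 0 u) (P 0 x') (P 0 q) = - orient (P 0 u) (P 0 q) (P 0 x')); last by rewrite /orient; ring.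
  rewrite kE' -mulrN mulr_gt0 // !pos0_left //.
  rewrite (_ : - orient _ _ _ = (hgt X Y c' u - hgt X Y c' q) / (X u * X q)); last first.
    by rewrite /orient /hgt /=; field; rewrite !lt_eqF.
  by rewrite divr_gt0 // subr_gt0.
have o3 : c < c' -> 0 < orient (P 0 u) (P 0 x) (P 0 x').
  move=> cc; rewrite kE' mulr_gt0 //.
  rewrite (_ : orient (P 0 u) (P 0 x) (0, c') = - orient (P 0 u) (0, c') (P 0 x)); last by rewrite /orient; ring.
  rewrite kE -mulrN mulr_gt0 // pos0_left //.
  rewrite (_ : - orient _ _ _ = (c' - c) / - X u); last by rewrite /orient /=; field; rewrite lt_eqF.
  by apply: divr_gt0; lra.
have e1 := orient_ev cu cp ccx o1; have e2 := orient_ev cu ccx' cq o2.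
have Nx : N x by case: (crN cx).
have Nx' : N x' by case: (crN cx').
have Np : N p by case: ap => y /crN [].
have Nq : N q by case: aq => y /crN [].
have one (y : V) s : E u y -> N y -> exists b c m, [/\ E u b /\ N b, E u c /\ N c, 0 <= m <= 1 & P s y = mix m (P s b) (P s c)].
  move=> Ey Ny; exists y, y, 0; split=> //; first lra.
  by apply: pairP; rewrite /mix /=; ring.
have [[l1 l2]|nl] := pselect (X u < X p /\ X u < X q).
  have epq := lpq l1 l2; subst q.
  have cc : c < c'.
    case: hx => // e; exfalso; move: hp hq; rewrite /c /c' e; lra.
  apply: ev_imp (ev_and e1 (ev_and e2 (orient_ev cu ccx ccx' (o3 cc)))) => s _ [h1 [h2 h3]].
  exists [:: P s p; P s x; P s x']; first exact: surround3.
  by move=> a; rewrite !inE => /or3P[] /eqP ->; apply: one.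
have e4 := turn_back au ap aq lp lq nl hp hq.
case: hx => [e|cc].
  subst x'; apply: ev_imp (ev_and e1 (ev_and e2 e4)) => s _ [h1 [h2 h3]].
  exists [:: P s p; P s x; P s q]; first exact: surround3.
  by move=> a; rewrite !inE => /or3P[] /eqP ->; apply: one.
apply: ev_imp (ev_and e1 (ev_and e2 (ev_and e4 (orient_ev cu ccx ccx' (o3 cc))))) => s _ [h1 [h2 [h3 h4]]].
exists [:: P s p; P s x; P s x'; P s q]; first exact: surround4.
by move=> a; rewrite !inE => /or4P[] /eqP ->; apply: one.
Qed.

End LeftHull.
End Positions.

(** * Harmonic interpolation of the remaining vertices *)

Section Harmonic.
Variables (F : realFieldType) (V : finType) (g : V -> F * F) (E : rel V) (o p r : V).
Implicit Types (u v w : V).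
Hypothesis HP : plane_edges g E.
Hypothesis Hsat : saturated g E.
Hypothesis fr : frame g E o p r.
Variable N : pred V.
Hypothesis Nout : forall v, ~~ inner o p r v -> N v.

(** The maximum principle: a positive maximum would spread along the edges to the corner [o], where
    the value is zero. *)
Let nonpos (z : V -> F) : (forall v, N v -> z v = 0) ->
  (forall v, ~~ N v -> \sum_(b | E v b) (z b - z v) = 0) -> forall v, z v <= 0.
Proof.
move=> z0 zh v; have [m [_ mm]] := @fin_argmin F V (fun _ => True) (fun v => - z v) (ex_intro _ v I).
have le w : z w <= z m by have := mm w I; rewrite lerN2.
apply: le_trans (le v) _; rewrite leNgt; apply/negP => pos.
pose A w := z w = z m.
have AN w : A w -> ~~ N w by move=> e; apply/negP => /z0; rewrite e; lra.
have step u w : A u -> E u w -> A w.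
  move=> Au Euw; have := zh u (AN u Au); rewrite (bigD1 w) //= => e.
  have : \sum_(b | E u b && (b != w)) (z b - z u) <= 0.
    by apply: sumr_le0 => b _; rewrite Au subr_le0.
  have := le w; rewrite /A -Au => l1 l2; apply/eqP; rewrite eq_le; apply/andP; split=> //; lra.
have im : inner o p r m by apply/negPn/negP => /Nout; apply/negP/AN.
have [u iu [Au Euo]] := climb HP Hsat fr im (erefl : A m) (fun u w _ _ => @step u w).
have := AN o (step u o Au Euo); rewrite Nout // /inner eqxx //.
Qed.

(** The linear system is square, and the maximum principle, applied to a homogeneous solution and
    its negative, makes it injective. *)
Lemma harmonic (f : V -> F) : exists z : V -> F, (forall v, N v -> z v = f v) /\
  forall v, ~~ N v -> \sum_(b | E v b) (z b - z v) = 0.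
Proof.
pose n := #|V|.
pose a v w : F := if N v then (w == v)%:R else (E v w)%:R - (w == v)%:R * (\sum_(b | E v b) 1).
pose A : 'M[F]_n := \matrix_(i, j) a (enum_val j) (enum_val i).
have aE v (z : V -> F) : \sum_w z w * a v w = if N v then z v else \sum_(b | E v b) (z b - z v).
  rewrite /a; case: ifP => _.
    by rewrite (bigD1 v) //= eqxx mulr1 big1 ?addr0 // => w /negPf ->; rewrite mulr0.
  have -> : \sum_w z w * ((E v w)%:R - (w == v)%:R * \sum_(b | E v b) 1) =
     \sum_w z w * (E v w)%:R - \sum_w z w * ((w == v)%:R * \sum_(b | E v b) 1).
    by rewrite -sumrB; apply: eq_bigr => w _; rewrite mulrBr.
  rewrite [X in _ - X](bigD1 v) //= eqxx mul1r [X in _ - (_ + X)]big1 ?addr0; last first.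
    by move=> w /negPf ->; rewrite mul0r mulr0.
  rewrite mulr_sumr sumrB; congr (_ - _).
    by rewrite [RHS]big_mkcond; apply: eq_bigr => w _; case: (E v w); rewrite ?mulr1 ?mulr0.
  by apply: eq_bigr => w _; rewrite mulr1.
have rE (x : 'rV[F]_n) j : (x *m A) 0 j = \sum_w x 0 (enum_rank w) * a (enum_val j) w.
  rewrite mxE (reindex (@enum_rank V)) /=; last exact: onW_bij (enum_rank_bij V).
  by apply: eq_bigr => w _; rewrite mxE enum_rankK.
have free : row_free A.
  apply: inj_row_free => x x0; pose z w := x 0 (enum_rank w).
  have h v : (if N v then z v else \sum_(b | E v b) (z b - z v)) = 0.
    by rewrite -aE; have := rE x (enum_rank v); rewrite x0 mxE enum_rankK.
  have z0 v : N v -> z v = 0 by move=> nv; have := h v; rewrite nv.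
  have zh v : ~~ N v -> \sum_(b | E v b) (z b - z v) = 0 by move=> /negPf nv; have := h v; rewrite nv.
  have le := nonpos z0 zh.
  have ge v : - z v <= 0.
    apply: (nonpos (z := fun v => - z v)) => [w /z0 ->|w /zh e]; first by rewrite oppr0.
    rewrite (eq_bigr (fun b => - (z b - z w))); last by move=> b _; ring.
    by rewrite sumrN e oppr0.
  apply/rowP => j; rewrite !mxE; have := le (enum_val j); have := ge (enum_val j).
  by rewrite /z enum_valK; lra.
have unit : A \in unitmx by rewrite -row_free_unit.
pose b : 'rV[F]_n := \row_j (if N (enum_val j) then f (enum_val j) else 0).
exists (fun w => (b *m invmx A) 0 (enum_rank w)).
have h v : (if N v then (b *m invmx A) 0 (enum_rank v) else
    \sum_(w | E v w) ((b *m invmx A) 0 (enum_rank w) - (b *m invmx A) 0 (enum_rank v))) = if N v then f v else 0.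
  rewrite -(aE v (fun w => (b *m invmx A) 0 (enum_rank w))).
  by have := rE (b *m invmx A) (enum_rank v); rewrite enum_rankK => <-; rewrite mulmxKV // mxE enum_rankK.
by split=> v nv; have := h v; [rewrite nv|rewrite (negPf nv)].
Qed.

End Harmonic.

(** * Freedom of the axis: prescribed heights and scaled offsets *)

Section FreeAxis.
Variables (F : realFieldType) (V : finType) (g : V -> F * F) (E : rel V) (cf : F -> F) (o p r : V).
Implicit Types (u v w x y a b c : V).
Hypothesis cf_lt : forall s s', s < s' -> cf s < cf s'.
Local Notation xc v := (g v).1.
Local Notation yc v := (g v).2.
Hypothesis HP : plane_edges g E.
Hypothesis Hsat : saturated g E.
Hypothesis fr : frame g E o p r.
Hypothesis xo : xc o < 0.
Hypothesis xp : 0 < xc p.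
Hypothesis xr : xc r = 0.
Variable d : V -> F.

Let Es a b : E a b = E b a. Proof. by case: HP. Qed.
Local Notation g' := (@mirror F \o g).
Local Notation hgt := (@hgt F V).

Definition placed v := xc v = 0 \/ attached E g v \/ attached E g' v.

Lemma crosses_mirror2 e : crosses (@mirror F \o g') E e = crosses g E e.
Proof. by rewrite /crosses /= !opprK. Qed.

Lemma crosses_placed u x : crosses g E (u, x) -> placed u /\ placed x.
Proof.
move=> h; have [au ax] := crosses_att Es h; split; first by right; left.
case/and3P: h => /= _ _; rewrite le_eqVlt => /orP[/eqP e|/ax]; [by left|by right; right].
Qed.

Lemma crosses_placed' u x : crosses g' E (u, x) -> placed u /\ placed x.
Proof.
move=> h; split; first by right; right; exists x.
case/and3P: h => /= Eux; rewrite oppr_lt0 oppr_ge0 => xu.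
rewrite le_eqVlt => /orP[/eqP e|xx]; first by left.
by right; left; exists u; rewrite /crosses /= Es Eux xx ltW.
Qed.

Lemma axis_nbr_placed s b : xc s = 0 -> E s b -> placed b.
Proof.
move=> s0 Esb; case: (ltgtP (xc b) 0) => h; [right; left|right; right|by left]; exists s.
  by rewrite /crosses /= Es Esb h s0 lexx.
by rewrite /crosses /= Es Esb oppr_lt0 h s0 oppr0 lexx.
Qed.

Lemma outer_placed v : ~~ inner o p r v -> placed v.
Proof.
have [_ [Eop _] _ _] := fr.
have [h1 h2] := crosses_placed (ltac:(by rewrite /crosses /= Eop xo ltW) : crosses g E (o, p)).
by rewrite /inner !negb_and !negbK => /or3P[] /eqP -> //; left.
Qed.

Section Pos.
Variables (X Y : V -> F).
Local Notation P := (pos cf g X Y d).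
Hypothesis XL : forall u, attached E g u -> X u < 0.
Hypothesis XR : forall w, attached E g' w -> 0 < X w.
Hypothesis XY : forall u w, E u w -> xc u < 0 -> 0 < xc w ->
  hgt X Y (chgt cf g u w) u = hgt X Y (chgt cf g u w) w.

Lemma cont_placed v : placed v -> cont2 (fun s => P s v).
Proof. by case=> [|[]]; [exact: cont_axis|exact: cont_left|exact: cont_right]. Qed.

Lemma pos0_axis v : xc v = 0 -> P 0 v = (0, cf (yc v)).
Proof. by move=> e; rewrite /pos e !ltxx mul0r. Qed.

Lemma axis_cross b c : E b c -> xc b < 0 -> 0 < xc c ->
  exists m, 0 <= m <= 1 /\ mix m (P 0 b) (P 0 c) = (0, chgt cf g b c).
Proof.
move=> Ebc xb xc'; have cb : crosses g E (b, c) by rewrite /crosses /= Ebc xb ltW.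
have [ab ac] := crosses_att Es cb; have nb := XL ab; have nc := XR (ac xc'); have e := XY Ebc xb xc'.
exists (X c / (X c - X b)); split.
  by apply/andP; split; [apply: divr_ge0|rewrite ler_pdivrMr]; lra.
rewrite (pos0_left cf X Y d ab) // (pos0_right cf X Y d) // /mix /=.
have eY : Y c = Y b + chgt cf g b c * (X c - X b) by move: e; rewrite /hgt; lra.
by rewrite eY; congr pair; field; repeat (apply/andP; split); apply/eqP; lra.
Qed.

Lemma ht_above s b c : xc s = 0 -> 0 < xc b -> xc c < 0 -> 0 < orient (g s) (g b) (g c) -> yc s < ht g (c, b) 0.
Proof.
move=> s0 hb hc; rewrite /orient s0 => D.
rewrite -subr_gt0 (_ : ht g (c, b) 0 - yc s = ((xc b - 0) * (yc c - yc s) - (yc b - yc s) * (xc c - 0)) / (xc b - xc c)).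
  by apply: divr_gt0; lra.
by rewrite /ht /=; field; apply/eqP; lra.
Qed.

Lemma ht_below s b c : xc s = 0 -> xc b < 0 -> 0 < xc c -> 0 < orient (g s) (g b) (g c) -> ht g (b, c) 0 < yc s.
Proof.
move=> s0 hb hc; rewrite /orient s0 => D.
rewrite -subr_gt0 (_ : yc s - ht g (b, c) 0 = ((xc b - 0) * (yc c - yc s) - (yc b - yc s) * (xc c - 0)) / (xc c - xc b)).
  by apply: divr_gt0; lra.
by rewrite /ht /=; field; apply/eqP; lra.
Qed.

Lemma axis_sides s : xc s = 0 -> (exists w, E s w /\ 0 < xc w) /\ (exists v, E s v /\ xc v < 0).
Proof.
move=> s0; split.
  have h : 1 * xc s + 0 * yc s < 1 * xc p + 0 * yc p by have := xp; rewrite s0; lra.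
  have [w [Ew lw]] := @nbr_above F V g E HP Hsat 1 0 s p h.
  by exists w; split=> //; move: lw; rewrite s0; lra.
have h : -1 * xc s + 0 * yc s < -1 * xc o + 0 * yc o by have := xo; rewrite s0; lra.
have [w [Ew lw]] := @nbr_above F V g E HP Hsat (-1) 0 s o h.
by exists w; split=> //; move: lw; rewrite s0; lra.
Qed.

(** The face at [s] around the upward direction of the axis has its next corner on the axis or an
    opposite edge that crosses it; either way a point of the axis above [s] is a mixture of
    neighbours. *)
Lemma axis_up s : inner o p r s -> xc s = 0 -> exists b c m h,
  [/\ E s b /\ placed b, E s c /\ placed c, 0 <= m <= 1, mix m (P 0 b) (P 0 c) = (0, h) & cf (yc s) < h].
Proof.
move=> si s0; have [[w [Ew lw]] [v [Ev lv]]] := axis_sides s0.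
have nv : ~ 0 < xc v by lra.
have [b [c [Tb hb hc]]] := @rot_connected F V g E HP Hsat o p r s (fun u => is_true (0 < xc u)) fr si
  (ex_intro _ w (conj Ew lw)) (ex_intro _ v (conj Ev nv)).
have [Eb Ec] := tri_nbr HP Tb; have [_ Ebc _ D _] := triP Tb.
have pb := axis_nbr_placed s0 Eb; have pc := axis_nbr_placed s0 Ec.
have [c0|c0] := eqVneq (xc c) 0.
  exists c, c, 0, (cf (yc c)); split=> //; first lra.
    by rewrite (pos0_axis c0); apply: pairP; rewrite /mix /=; ring.
  apply: cf_lt; move: D; rewrite /orient s0 c0 => D.
  by rewrite -subr_gt0 -(pmulr_rgt0 _ hb); lra.
have cn : xc c < 0 by rewrite lt_neqAle c0 leNgt; apply/negP.
have Ecb : E c b by rewrite Es.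
have [m [hm e]] := axis_cross Ecb cn hb.
exists c, b, m, (chgt cf g c b); split=> //.
by apply: cf_lt; apply: ht_above.
Qed.

Lemma axis_dn s : inner o p r s -> xc s = 0 -> exists b c m h,
  [/\ E s b /\ placed b, E s c /\ placed c, 0 <= m <= 1, mix m (P 0 b) (P 0 c) = (0, h) & h < cf (yc s)].
Proof.
move=> si s0; have [[w [Ew lw]] [v [Ev lv]]] := axis_sides s0.
have nw : ~ xc w < 0 by lra.
have [b [c [Tb hb hc]]] := @rot_connected F V g E HP Hsat o p r s (fun u => is_true (xc u < 0)) fr si
  (ex_intro _ v (conj Ev lv)) (ex_intro _ w (conj Ew nw)).
have [Eb Ec] := tri_nbr HP Tb; have [_ Ebc _ D _] := triP Tb.
have pb := axis_nbr_placed s0 Eb; have pc := axis_nbr_placed s0 Ec.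
have [c0|c0] := eqVneq (xc c) 0.
  exists c, c, 0, (cf (yc c)); split=> //; first lra.
    by rewrite (pos0_axis c0); apply: pairP; rewrite /mix /=; ring.
  apply: cf_lt; move: D; rewrite /orient s0 c0 => D.
  have hb' : 0 < - xc b by lra.
  by rewrite -subr_gt0 -(pmulr_rgt0 _ hb'); lra.
have cn : 0 < xc c by rewrite lt_def c0 leNgt; apply/negP.
have [m [hm e]] := axis_cross Ebc hb cn.
exists b, c, m, (chgt cf g b c); split=> //.
by apply: cf_lt; apply: ht_below.
Qed.

(** A neighbour on the right, the point above, a neighbour on the left and the point below surround
    [s]. *)
Lemma axis_hull s : inner o p r s -> xc s = 0 -> ev (fun t => strict_hull E placed (P t) s).
Proof.
move=> si s0; have [[w [Ew lw]] [v [Ev lv]]] := axis_sides s0.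
have [b [c [m [h [[Eb pb] [Ec pc] hm e lh]]]]] := axis_up si s0.
have [b' [c' [m' [h' [[Eb' pb'] [Ec' pc'] hm' e' lh']]]]] := axis_dn si s0.
have pw := axis_nbr_placed s0 Ew; have pv := axis_nbr_placed s0 Ev.
have av : attached E g v by exists s; rewrite /crosses /= Es Ev lv s0 lexx.
have aw : attached E g' w by exists s; rewrite /crosses /= Es Ew oppr_lt0 lw s0 oppr0 lexx.
have cs := cont_placed (or_introl s0 : placed s).
have cw := cont_placed pw; have cv := cont_placed pv.
have cU := cont2_mix m (cont_placed pb) (cont_placed pc).
have cD := cont2_mix m' (cont_placed pb') (cont_placed pc').
have nw : 0 < (X w)^-1 by rewrite invr_gt0; apply: XR.
have nv : (X v)^-1 < 0 by rewrite invr_lt0; apply: XL.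
have vE : P 0 v = ((X v)^-1, Y v / X v) by apply: (pos0_left cf X Y d av).
have wE : P 0 w = ((X w)^-1, Y w / X w) by apply: (pos0_right cf X Y d lw).
have sE := pos0_axis s0.
have q1 := mulr_gt0 nw (ltac:(lra) : 0 < h - cf (yc s)).
have q2 := mulr_gt0 (ltac:(lra) : 0 < - (X v)^-1) (ltac:(lra) : 0 < h - cf (yc s)).
have q3 := mulr_gt0 (ltac:(lra) : 0 < - (X v)^-1) (ltac:(lra) : 0 < cf (yc s) - h').
have q4 := mulr_gt0 nw (ltac:(lra) : 0 < cf (yc s) - h').
have o1 := orient_ev cs cw cU (ltac:(rewrite /= e sE wE /orient /=; lra)).
have o2 := orient_ev cs cU cv (ltac:(rewrite /= e sE vE /orient /=; lra)).
have o3 := orient_ev cs cv cD (ltac:(rewrite /= e' sE vE /orient /=; lra)).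
have o4 := orient_ev cs cD cw (ltac:(rewrite /= e' sE wE /orient /=; lra)).
apply: ev_imp (ev_and o1 (ev_and o2 (ev_and o3 o4))) => t _ [k1 [k2 [k3 k4]]].
exists [:: P t w; mix m (P t b) (P t c); P t v; mix m' (P t b') (P t c')]; first exact: surround4.
move=> a; rewrite !inE => /or4P[] /eqP ->.
- by exists w, w, 0; split=> //; [lra|apply: pairP; rewrite /mix /=; ring].
- by exists b, c, m.
- by exists v, v, 0; split=> //; [lra|apply: pairP; rewrite /mix /=; ring].
- by exists b', c', m'.
Qed.

Lemma outer_pos : ev (fun t => 0 < orient (P t o) (P t p) (P t r)).
Proof.
have [D [Eop _] _ _] := fr.
have cop : crosses g E (o, p) by rewrite /crosses /= Eop xo ltW.
have [ao ap] := crosses_att Es cop.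
have po : placed o by apply: outer_placed; rewrite /inner eqxx.
have pp : placed p by apply: outer_placed; rewrite /inner eqxx andbF.
have pr : placed r by left.
apply: orient_ev; [exact: cont_placed|exact: cont_placed|exact: cont_placed|].
have [k k0 kE] := @ray F V E cf g X Y d XL XR Es XY o p cop.
rewrite (_ : orient _ _ _ = - orient (P 0 o) (P 0 r) (P 0 p)); last by rewrite /orient; ring.
rewrite kE -mulrN mulr_gt0 // (pos0_axis xr) (pos0_left cf X Y d ao).
have no := XL ao.
have l : chgt cf g o p < cf (yc r).
  apply: cf_lt; have lop : xc (o, p).1 < xc (o, p).2 := lt_trans xo xp.
  have dop : 0 < xc p - xc o by rewrite subr_gt0; exact: lop.
  move: D; have -> : g r = (0, yc r) by rewrite -xr; case: (g r).
  by rewrite (orient_ht _ _ lop) /= pmulr_rgt0; lra.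
rewrite (_ : - orient _ _ _ = (cf (yc r) - chgt cf g o p) / - X o); first by apply: divr_gt0; lra.
by rewrite /orient /=; field; rewrite lt_eqF.
Qed.

End Pos.

Lemma sum0_sides (I : finType) (A : pred I) (f : I -> F) : \sum_(i | A i) f i = 0 ->
  (forall i, A i -> f i = 0) \/ ((exists i, A i /\ f i < 0) /\ (exists i, A i /\ 0 < f i)).
Proof.
move=> h; have [[i [Ai ni]]|nx] := pselect (exists i, A i /\ f i <> 0); last first.
  by left=> i Ai; apply: contrapT => n; apply: nx; exists i.
right; split; apply: contrapT => nx.
  have pos j : A j -> 0 <= f j by move=> Aj; rewrite leNgt; apply/negP => l; apply: nx; exists j.
  by apply: ni; apply/eqP; move/eqP: h; rewrite psumr_eq0 // => /allP /(_ i (mem_index_enum _)); rewrite Ai.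
have pos j : A j -> 0 <= - f j by move=> Aj; rewrite oppr_ge0 leNgt; apply/negP => l; apply: nx; exists j.
have h' : \sum_(j | A j) - f j == 0 by rewrite sumrN h oppr0.
by apply: ni; apply/eqP; move: h'; rewrite psumr_eq0 // => /allP /(_ i (mem_index_enum _)); rewrite Ai oppr_eq0.
Qed.

(** Apart from the corners, vertices on or attached to the axis satisfy the hull condition strictly
    for all small [s]; the others do so weakly, as averages of their neighbours. The offsets and the
    bending of vertical lines share the parameter [s]. Planarity is claimed among inner vertices
    only, since these carry the given graph. *)
Theorem free_axis : exists s (q : V -> F * F), [/\ 0 < s,
  forall v, xc v = 0 -> q v = (s * d v, cf (yc v)),
  forall u v, inner o p r u -> inner o p r v -> q u = q v -> u = v,
  forall a b v, inner o p r a -> inner o p r v -> E a b -> ~ oseg (q a) (q b) (q v) &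
  forall a b c e z, inner o p r a -> inner o p r b -> inner o p r c -> inner o p r e -> E a b -> E c e ->
    oseg (q a) (q b) z -> oseg (q c) (q e) z -> (a = c /\ b = e) \/ (a = e /\ b = c)].
Proof.
have [X [Y [XY HL HR]]] := placement cf_lt HP Hsat fr xo xp xr.
have XL u : attached E g u -> X u < 0 by case/HL.
have XR w : attached E g' w -> 0 < X w by case/HR.
pose P := pos cf g X Y d.
have e1 : ev (fun s => forall u, attached E g u /\ u <> o -> two_sided E placed (P s) u).
  apply: ev_all => u; apply: ev_if => -[au uo]; have [_ /(_ uo) nd] := HL u au.
  by apply: ev_imp (left_hull d XL XR Es XY crosses_placed au nd) => s _; apply: strict_two.
have e2 : ev (fun s => forall u, attached E g' u /\ u <> p -> two_sided E placed (P s) u).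
  apply: ev_all => u; apply: ev_if => -[au up]; have [_ /(_ up) nd] := HR u au.
  have XL' w : attached E g' w -> - X w < 0 by move=> /XR; lra.
  have XR' w : attached E (@mirror F \o g') w -> 0 < - X w.
    by case=> x; rewrite crosses_mirror2 => h; have := XL w (ex_intro _ x h); lra.
  have XY' v w : E v w -> (g' v).1 < 0 -> 0 < (g' w).1 ->
      hgt (fun v => - X v) (fun v => - Y v) (chgt cf g' v w) v = hgt (fun v => - X v) (fun v => - Y v) (chgt cf g' v w) w.
    rewrite /= oppr_lt0 oppr_gt0 Es => h1 h2 h3; have := XY w v h1 h3 h2.
    by rewrite /hgt /chgt ht_mirror //; lra.
  apply: ev_imp (left_hull (fun v => - d v) XL' XR' Es XY' crosses_placed' au nd) => s _ /strict_two h.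
  apply: two_sided_mirror; have -> // : (fun v => mirror (P s v)) = pos cf g' (fun v => - X v) (fun v => - Y v) (fun v => - d v) s.
  by apply/funext => v; rewrite pos_mirror.
have e3 : ev (fun s => forall u, inner o p r u /\ xc u = 0 -> two_sided E placed (P s) u).
  apply: ev_all => u; apply: ev_if => -[iu u0].
  by apply: ev_imp (axis_hull XL XR XY iu u0) => s _; apply: strict_two.
have e4 := outer_pos XL XR XY.
have [s [s0 [t1 [t2 [t3 t4]]]]] := ev_ex (ev_and e1 (ev_and e2 (ev_and e3 e4))).
pose N v : bool := `[< placed v >].
have Nout v : ~~ inner o p r v -> N v by move=> /outer_placed h; apply/asboolP.
have [z1 [z1N z1h]] := harmonic HP Hsat fr Nout (fun v => (P s v).1).
have [z2 [z2N z2h]] := harmonic HP Hsat fr Nout (fun v => (P s v).2).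
pose q v := (z1 v, z2 v).
have qN v : placed v -> q v = P s v.
  by move=> pv; apply: pairP => /=; [apply: z1N|apply: z2N]; apply/asboolP.
have hull : weak_hull E q o p r.
  move=> a k ia; have [->|/eqP k0] := eqVneq k (0, 0).
    by left=> b _; rewrite /fn /= !mul0r.
  have [pa|npa] := pselect (placed a).
    right; have t : two_sided E placed (P s) a.
      have /and3P[/eqP ao /eqP ap _] := ia.
      by case: pa => [a0|[al|ar]]; [apply: t3|apply: t1|apply: t2].
    have [[b [h1 h2 h3]] [c [h4 h5 h6]]] := t k k0.
    by split; [exists b|exists c]; rewrite !qN.
  have na : ~~ N a by apply/asboolP.
  have S : \sum_(b | E a b) (fn k (q b) - fn k (q a)) = 0.
    rewrite (eq_bigr (fun b => k.1 * (z1 b - z1 a) + k.2 * (z2 b - z2 a))); last first.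
      by move=> b _; rewrite /fn /q /=; ring.
    by rewrite big_split /= -!mulr_sumr z1h // z2h // !mulr0 addr0.
  case: (sum0_sides S) => [h|[[b [Eb lb]] [c [Ec lc]]]]; [left|right].
    by move=> b Eb; have := h b Eb; lra.
  by split; [exists b|exists c]; split=> //; lra.
have pl := outer_placed.
have oq : 0 < orient (q o) (q p) (q r).
  by rewrite !qN //; apply: pl; rewrite /inner eqxx ?andbF.
exists s, q; split=> //.
- by move=> v v0; rewrite qN; [rewrite /P /pos v0 !ltxx|left].
- by move=> u v; apply: (q_inj HP Hsat fr hull oq).
- by move=> a b v; apply: (q_vtx HP Hsat fr hull oq).
- by move=> a b c e z; apply: (q_plane HP Hsat fr hull oq).
Qed.

End FreeAxis.

(** * Extension to a maximal plane graph *)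

Section Maximal.
Variables (F : realFieldType) (V : finType) (g : V -> F * F).
Implicit Types (E : rel V) (a b c d v : V) (z : F * F).

Lemma maximal_plane E0 : plane_edges g E0 ->
  exists E, [/\ plane_edges g E, saturated g E & forall a b, E0 a b -> E a b].
Proof.
move=> P0; pose rl (A : {set V * V}) : rel V := fun a b => (a, b) \in A.
pose good A := plane_edges g (rl A) /\ forall a b, E0 a b -> rl A a b.
have ex : exists A, good A.
  exists [set x | E0 x.1 x.2]; have e : rl [set x | E0 x.1 x.2] = E0.
    by apply/funext => a; apply/funext => b; rewrite /rl inE.
  by rewrite /good e.
have [A [[PA sub] mA]] := @fin_argmin F _ good (fun A => - (#|A|%:R)) ex.
exists (rl A); split=> // a b nab nv ne; apply/negPn/negP => nE.
have [gi Es Ei Ev Ep] := PA.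
pose B := (a, b) |: ((b, a) |: A).
have inB x y : rl B x y = [|| (x == a) && (y == b), (x == b) && (y == a) | rl A x y].
  by rewrite /rl /B !inE !xpair_eqE.
have gB : good B.
  split; last by move=> x y /sub h; rewrite inB h !orbT.
  have gab : g a <> g b by move=> /gi.
  have old x y z : rl A x y -> oseg (g x) (g y) z -> cseg (g a) (g b) z -> False.
    move=> Exy oz cz; have nxy : g x <> g y by move=> /gi e; move: Exy; rewrite e Ei.
    have [n1 n2] := oseg_neq nxy oz.
    case: (cseg_oseg cz) => [e|e|oab].
    - by case: (Ev x y a Exy) => [|e'|e']; [rewrite -e; exact: oseg_cseg|apply: n1; rewrite e e'|apply: n2; rewrite e e'].
    - by case: (Ev x y b Exy) => [|e'|e']; [rewrite -e; exact: oseg_cseg|apply: n1; rewrite e e'|apply: n2; rewrite e e'].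
    - exact: (ne x y z Exy oab (oseg_cseg oz)).
  have vab v : cseg (g a) (g b) (g v) -> v = a \/ v = b.
    by move=> /cseg_oseg [/gi ->|/gi ->|/nv //]; [left|right].
  split=> //.
  - by move=> x y; rewrite !inB Es orbCA [(x == b) && _]andbC [(x == a) && _]andbC.
  - move=> x; rewrite inB Ei orbF; apply/negP => /orP[] /andP[/eqP e1 /eqP e2]; apply: nab; congruence.
  - move=> x y v; rewrite inB => /or3P[/andP[/eqP -> /eqP ->]|/andP[/eqP -> /eqP ->]|].
    + exact: vab.
    + by move=> /cseg_sym /vab []; [right|left].
    + exact: Ev.
  - move=> x y c d z; rewrite !inB => /or3P[/andP[/eqP -> /eqP ->]|/andP[/eqP -> /eqP ->]|Exy];
      case/or3P=> [/andP[/eqP -> /eqP ->]|/andP[/eqP -> /eqP ->]|Ecd] oz cz.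
    + by left.
    + by right.
    + by case: (ne c d z Ecd oz cz).
    + by right.
    + by left.
    + by case: (ne c d z Ecd (oseg_sym oz) cz).
    + by case: (old x y z Exy oz cz).
    + by case: (old x y z Exy oz (cseg_sym cz)).
    + exact: Ep Exy Ecd oz cz.
have := mA B gB; rewrite lerN2 ler_nat leqNgt => /negP; apply.
have -> : #|B| = #|A|.+2.
  rewrite /B !cardsU1 !inE xpair_eqE.
  have -> : (a, b) \in A = false by apply/negbTE.
  have -> : (b, a) \in A = false by apply/negbTE; rewrite -[_ \in _]/(rl A b a) Es.
  by have /eqP/negPf -> := nab; rewrite /= !add1n.
by [].
Qed.

End Maximal.

(** * The theorem of Erdos and Szekeres *)

Section ErdosSzekeres.
Variables (F : realFieldType) (T : finType) (y w : T -> F) (S : {set T}).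
Hypothesis y_inj : {in S &, injective y}.
Hypothesis w_inj : {in S &, injective w}.

Definition monotone_on (sg : F) (A : {set T}) := forall u v, u \in A -> v \in A -> y u < y v -> sg * w u < sg * w v.

(** The rank of [v] is the largest size of an increasing set with top [v]. Elements of equal rank
    form a decreasing set, and ranks run from 1 to [m], the size of a largest increasing set. So
    [#|S|] is at most [m] times the size of a largest rank class, and the larger of the two sets
    will do. *)
Lemma erdos_szekeres : exists sg (A : {set T}), [/\ sg = 1 \/ sg = -1, A \subset S, monotone_on sg A & (#|S| <= #|A| ^ 2)%N].
Proof.
pose inc (A : {set T}) := [&& A \subset S & [forall u in A, forall v in A, (y u < y v) ==> (w u < w v)]].
pose top v (A : {set T}) := [&& inc A, v \in A & [forall u in A, y u <= y v]].
pose rk v := (\max_(A : {set T} | top v A) #|A|)%N.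
pose m := (\max_(A : {set T} | inc A) #|A|)%N.
have lem (P : pred {set T}) (A : {set T}) : P A -> (#|A| <= \max_(B : {set T} | P B) #|B|)%N.
  by move=> PA; apply: (leq_bigmax_cond (F := fun A : {set T} => #|A|)).
have inc0 : inc set0 by rewrite /inc sub0set /=; apply/forall_inP => u; rewrite inE.
have [A0 incA0 cA0] : exists2 A, inc A & #|A| = m.
  by rewrite /m; have [|A hA ->] := @eq_bigmax_cond _ inc (fun A => #|A|); [apply/card_gt0P; exists set0|exists A].
have top1 v : v \in S -> top v [set v].
  move=> vS; rewrite /top /inc sub1set vS set11 /=; apply/andP; split.
    by apply/forall_inP => u /set1P ->; apply/forall_inP => x /set1P ->; rewrite ltxx.
  by apply/forall_inP => u /set1P ->.
have topx v : v \in S -> exists2 A, top v A & #|A| = rk v.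
  move=> vS; rewrite /rk; have [|A hA ->] := @eq_bigmax_cond _ (top v) (fun A => #|A|); last by exists A.
  by apply/card_gt0P; exists [set v]; exact: top1.
have rkle v : v \in S -> (rk v < m.+1)%N.
  move=> vS; have [A /and3P[iA _ _] <-] := topx v vS; rewrite ltnS /m.
  exact: lem.
have rkgt v : v \in S -> (0 < rk v)%N.
  move=> vS; apply: leq_trans (lem (top v) [set v] (top1 v vS)).
  by rewrite cards1.
have step u v : u \in S -> v \in S -> y u < y v -> w u < w v -> (rk u < rk v)%N.
  move=> uS vS yl wl; have [A /and3P[/andP[sA /forall_inP iA] uA /forall_inP tA] <-] := topx u uS.
  have vA : v \notin A by apply/negP => /tA; lra.
  have tv : top v (v |: A).
    apply/and3P; split; last first.
    - by apply/forall_inP => x /setU1P[->//|/tA]; lra.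
    - exact: setU11.
    - apply/andP; split; first by rewrite subUset sub1set vS.
      apply/forall_inP => a /setU1P[->|aA]; apply/forall_inP => b /setU1P[->|bA]; apply/implyP => l.
      + by rewrite ltxx in l.
      + by have := tA b bA; lra.
      + have [->//|au] := eqVneq a u.
        have au' : y a < y u.
          rewrite lt_neqAle (tA a aA) andbT; apply/eqP => e; move/eqP: au; apply; apply: y_inj => //.
          exact: (subsetP sA).
        by have := implyP (forall_inP (iA a aA) u uA) au'; lra.
      + exact: (implyP (forall_inP (iA a aA) b bA)).
  have := lem (top v) _ tv.
  by rewrite cardsU1 vA; apply: leq_trans.
pose cl (k : 'I_m.+1) := [set v in S | rk v == k].
have [k mk] : exists k, forall j, (#|cl j| <= #|cl k|)%N.
  by have [k _ h] := @arg_maxnP _ (ord0 : 'I_m.+1) xpredT (fun k => #|cl k|) isT; exists k => j; apply: h.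
have sum : #|S| = (\sum_(j < m.+1) #|cl j|)%N.
  rewrite -sum1_card (partition_big (fun v => inord (rk v) : 'I_m.+1) xpredT) //=.
  apply: eq_bigr => j _; rewrite -sum1_card; apply: eq_bigl => v; rewrite inE.
  have [vS|//] := boolP (v \in S); rewrite /= -(inj_eq val_inj) /= inordK //; exact: rkle.
have cl0 : #|cl ord0| = 0%N.
  apply/eqP; rewrite cards_eq0; apply/eqP/setP => v; rewrite !inE; apply/negP => /andP[vS /eqP e].
  by have := rkgt v vS; rewrite e.
have le : (#|S| <= m * #|cl k|)%N.
  rewrite sum big_ord_recl cl0 add0n -[X in (_ <= X * _)%N](card_ord m) -sum_nat_const; exact: leq_sum.
have [ck|ck] := leqP #|cl k| m.
  exists 1, A0; have /andP[sA /forall_inP iA] := incA0; split=> //; first by left.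
    by move=> u v uA vA l; rewrite !mul1r; exact: (implyP (forall_inP (iA u uA) v vA)).
  by rewrite cA0 (leq_trans le) // -mulnn leq_mul2l ck orbT.
exists (-1), (cl k); split; first by right.
- by apply/subsetP => v; rewrite inE => /andP[].
- move=> u v; rewrite !inE => /andP[uS /eqP eu] /andP[vS /eqP ev] l.
  rewrite !mulN1r ltrN2; case: (ltgtP (w v) (w u)) => // h.
    by have := step u v uS vS l h; rewrite eu ev ltnn.
  by have e := w_inj vS uS h; move: l; rewrite e ltxx.
- by rewrite (leq_trans le) // -mulnn leq_mul2r (ltnW ck) orbT.
Qed.

End ErdosSzekeres.

(** * Increasing interpolation on the axis *)

Section Interpolation.
Variables (F : realFieldType) (T : finType) (y w : T -> F).

(** Induction removing the topmost point: above the next one, [b], the function is replaced by the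
    line through the last two points, whose slope is positive. *)
Lemma monotone_interpolation (A : {set T}) :
  (forall u v, u \in A -> v \in A -> y u < y v -> w u < w v) -> {in A &, injective y} ->
  exists cf : F -> F, (forall s s', s < s' -> cf s < cf s') /\ forall v, v \in A -> cf (y v) = w v.
Proof.
move: {2}#|A| (erefl #|A|) => n; elim: n A => [|n IH] A cA mon inj.
  by exists id; split=> // v; rewrite (cards0_eq cA) inE.
have [a0 a0A] : exists a, a \in A by apply/card_gt0P; rewrite cA.
have [v [vA mv]] := @fin_argmin F T (fun v => v \in A) (fun v => - y v) (ex_intro _ a0 a0A).
pose B := A :\ v.
have BA u : u \in B -> u \in A by rewrite !inE => /andP[].
have [cf [cf_lt cfB]] : exists cf : F -> F, (forall s s', s < s' -> cf s < cf s') /\ forall v, v \in B -> cf (y v) = w v.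
  apply: IH => [|u x /BA uA /BA xA|u x /BA uA /BA xA]; [|exact: mon|exact: inj].
  by have := cardsD1 v A; rewrite vA cA => -[].
have split_ u : u \in A -> u = v \/ u \in B.
  by move=> uA; have [->|n'] := eqVneq u v; [left|right; rewrite !inE n'].
have [[b0 b0B]|nb] := pselect (exists b, b \in B); last first.
  exists (fun s => s - y v + w v); split=> [s s' l|u uA]; first lra.
  by case: (split_ u uA) => [->|h]; [ring|case: nb; exists u].
have [b [bB mb]] := @fin_argmin F T (fun v => v \in B) (fun v => - y v) (ex_intro _ b0 b0B).
have ybv : y b < y v.
  rewrite lt_neqAle; apply/andP; split; last by have := mv b (BA b bB); rewrite lerN2.
  apply/eqP => e; have e' := inj b v (BA b bB) vA e; by move: bB; rewrite e' !inE eqxx.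
have wbv := mon b v (BA b bB) vA ybv.
pose k := (w v - w b) / (y v - y b).
have k0 : 0 < k by apply: divr_gt0; lra.
exists (fun s => if s <= y b then cf s else w b + k * (s - y b)); split=> [s s' l|u uA].
  have [h|h] := leP s (y b); have [h'|h'] := leP s' (y b).
  - exact: cf_lt.
  - have : cf s <= w b by rewrite -(cfB b bB); move: h; rewrite le_eqVlt => /orP[/eqP -> //|/cf_lt /ltW].
    by have := mulr_gt0 k0 (ltac:(lra) : 0 < s' - y b); lra.
  - lra.
  - by have := mulr_gt0 k0 (ltac:(lra) : 0 < s' - s); lra.
case: (split_ u uA) => [->|uB]; last by have := mb u uB; rewrite lerN2 => ->; apply: cfB.
by rewrite leNgt ybv /= /k; field; apply/eqP; lra.
Qed.

End Interpolation.

(** * Normalizing the given drawing and assembling the untangled one *)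

Section Assembly.
Variable F : realFieldType.
Implicit Types (p q z : F * F).

Definition plane_dr (T : finType) (e : rel T) (D : T -> F * F) := injective D /\
  forall a b c d, e a b -> e c d -> ~ ((a = c /\ b = d) \/ (a = d /\ b = c)) ->
  forall x, cseg (D a) (D b) x -> cseg (D c) (D d) x ->
    exists v, (v = a \/ v = b) /\ (v = c \/ v = d) /\ x = D v.

Lemma plane_dr_affine (T : finType) (e : rel T) (D : T -> F * F) (f : F * F -> F * F) : injective f ->
  (forall s p q, f (mix s p q) = mix s (f p) (f q)) -> plane_dr e D -> plane_dr e (fun v => f (D v)).
Proof.
move=> fi fm [Di Dp]; split=> [u v /fi /Di //|a b c d Eab Ecd n x [s [hs ex]] [t [ht ex']]].
rewrite -fm in ex; rewrite -fm in ex'.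
have e' : mix s (D a) (D b) = mix t (D c) (D d) by apply: fi; rewrite -ex.
have [v [h1 [h2 h3]]] := Dp a b c d Eab Ecd n (mix s (D a) (D b)) (ex_intro _ s (conj hs erefl))
  (ex_intro _ t (conj ht e')).
by exists v; do 2 split=> //; rewrite ex h3.
Qed.

Lemma cseg_l p q : cseg p q p.
Proof. by exists 0; split; [slra|apply: pairP; rewrite /mix /=; ring]. Qed.

Lemma norm_bound (T : finType) (g : T -> F * F) : exists2 B, 0 < B &
  forall v, [/\ - B < (g v).1, (g v).1 < B, - B < (g v).2 & (g v).2 < B].
Proof.
exists (1 + \sum_v (`|(g v).1| + `|(g v).2|)).
  have : 0 <= \sum_v (`|(g v).1| + `|(g v).2|) by apply: sumr_ge0 => v _; apply: addr_ge0.
  slra.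
move=> v; rewrite (bigD1 v) //=; set s := \sum_(i | _) _.
have s0 : 0 <= s by apply: sumr_ge0 => u _; apply: addr_ge0.
have a1 := ler_norm (g v).1; have a2 := ler_norm (- (g v).1); have a3 := ler_norm (g v).2; have a4 := ler_norm (- (g v).2).
rewrite !normrN in a2 a4.
have n1 := normr_ge0 (g v).1; have n2 := normr_ge0 (g v).2.
by split; slra.
Qed.

Section Surround.
Variables (T : finType) (e : rel T) (g : T -> F * F) (P : 'I_3 -> F * F) (f : 'I_3 -> F * F -> F) (D : F).
Hypothesis Pe : plane_edges g e.
Hypothesis D0 : 0 < D.
Hypothesis fM : forall k s p q, f k (mix s p q) = (1 - s) * f k p + s * f k q.
Hypothesis fP : forall k j, f k (P j) = (k == j)%:R * D.
Hypothesis fg : forall k v, 0 < f k (g v).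

Definition gplus (v : T + 'I_3) := match v with inl v => g v | inr k => P k end.
Definition eplus : rel (T + 'I_3)%type := fun u v => match u, v with
  | inl a, inl b => e a b | inr i, inr j => i != j | _, _ => false end.

Let inner_seg k a b z : cseg (g a) (g b) z -> 0 < f k z.
Proof.
case=> s [hs ->]; rewrite fM; have h1 := fg k a; have h2 := fg k b.
rewrite ltNge; apply/negP => l; exact: (@mix_lt F s (f k (g a)) (f k (g b)) (Num.min (f k (g a)) (f k (g b))))
  hs (ltac:(by apply: le_lt_trans l _; rewrite lt_min h1)) (ltac:(by rewrite ge_min lexx)) (ltac:(by rewrite ge_min lexx orbT)).
Qed.

Let outer_seg i j k z : cseg (P i) (P j) z -> k != i -> k != j -> f k z = 0.
Proof. by case=> s [_ ->] /negPf ki /negPf kj; rewrite fM !fP ki kj !mul0r !mulr0 addr0. Qed.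

Let third (i j : 'I_3) : exists k, (k != i) && (k != j).
Proof.
by exists (if (i != ord0) && (j != ord0) then ord0 else if (i != inord 1) && (j != inord 1) then inord 1 else inord 2);
  case: i => [[|[|[|//]]]] ?; case: j => [[|[|[|//]]]] ?; rewrite -!(inj_eq val_inj) /= ?inordK.
Qed.

(** [f k] vanishes on the side opposite the corner [P k] and is positive on the whole given drawing,
    so the added sides stay clear of it. *)
Lemma surround_plane : plane_edges gplus eplus.
Proof.
have [gi es ei ev ep] := Pe.
have f1 i : f i (P i) = D by rewrite fP eqxx mul1r.
split.
- case=> [u|i] [v|j] /=.
  + by move=> /gi ->.
  + by move=> h; have [k /andP[kj _]] := third j j; have := fg k u; rewrite h fP (negPf kj) mul0r ltxx.
  + by move=> h; have [k /andP[kj _]] := third i i; have := fg k v; rewrite -h fP (negPf kj) mul0r ltxx.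
  + move=> h; congr inr; apply/eqP; have := f1 i; rewrite h fP; case: (i == j) => //.
    by rewrite mul0r => z; move: D0; rewrite -z ltxx.
- by case=> [u|i] [v|j] //=; rewrite eq_sym.
- by case=> [u|i] /=; rewrite ?eqxx ?ei.
- case=> [a|i] [b|j] [v|k] //= h cz.
  + by case: (ev a b v h cz) => ->; [left|right].
  + have [l /andP[lk _]] := third k k.
    by have := inner_seg l cz; rewrite fP (negPf lk) mul0r ltxx.
  + have [l /andP[li lj]] := third i j.
    by have := fg l v; rewrite (outer_seg cz li lj) ltxx.
  + have [->|ki] := eqVneq k i; first by left.
    have [->|kj] := eqVneq k j; first by right.
    by move: D0; rewrite -(f1 k) (outer_seg cz ki kj) ltxx.
- case=> [a|i] [b|j] [c|k] [d|l] z //= h1 h2 oz cz.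
  + by case: (ep a b c d z h1 h2 oz cz) => -[-> ->]; [left|right].
  + have [m /andP[mk ml]] := third k l.
    by have := inner_seg m (oseg_cseg oz); rewrite (outer_seg cz mk ml) ltxx.
  + have [m /andP[mk ml]] := third i j.
    by have := inner_seg m cz; rewrite (outer_seg (oseg_cseg oz) mk ml) ltxx.
  + case: oz => s [hs ez].
    have fi : f i z <> 0.
      rewrite ez fM !fP eqxx (negPf h1) mul0r mulr0 addr0 mul1r => z0.
      by have := mulr_gt0 (ltac:(lra) : 0 < 1 - s) D0; rewrite z0 ltxx.
    have fj : f j z <> 0.
      rewrite ez fM !fP eqxx (eq_sym j) (negPf h1) mul0r mulr0 add0r mul1r => z0.
      by have := mulr_gt0 (ltac:(lra) : 0 < s) D0; rewrite z0 ltxx.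
    have mem m : f m z <> 0 -> m = k \/ m = l.
      move=> n; have [->|mk] := eqVneq m k; first by left.
      have [->|ml] := eqVneq m l; first by right.
      by case: n; apply: outer_seg cz mk ml.
    case: (mem i fi) => ei'; case: (mem j fj) => ej; subst.
    * by rewrite eqxx in h1.
    * by left.
    * by right.
    * by rewrite eqxx in h1.
Qed.

End Surround.

(** A plane drawing may have an isolated vertex in the interior of an edge. Isolated vertices are
    therefore moved to distinct points of the axis above everything else, which does not take any
    vertex off the axis. *)
Lemma isolate (T : finType) (e : rel T) (g1 : T -> F * F) : (forall x y, e x y = e y x) -> (forall x, e x x = false) ->
  plane_dr e g1 -> exists g2 : T -> F * F, [/\ plane_edges g2 e & forall v, (g1 v).1 = 0 -> (g2 v).1 = 0].
Proof.
move=> es ei [gi gp]; have [H H0 Hb] := norm_bound g1.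
pose iso v := ~~ [exists w, e v w].
pose g2 v : F * F := if iso v then (0, H + (enum_rank v)%:R) else g1 v.
have ge v w : e v w -> g2 v = g1 v.
  by move=> h; rewrite /g2 /iso (_ : [exists w, e v w]) //; apply/existsP; exists w.
have high v : iso v -> H <= (g2 v).2 by move=> h; rewrite /g2 h /= lerDl.
have low v : ~~ iso v -> (g2 v).2 < H by move=> /negPf h; rewrite /g2 h; case: (Hb v).
have seg a b v : e a b -> cseg (g2 a) (g2 b) (g2 v) -> ~~ iso v.
  move=> Eab [s [hs ez]]; apply/negP => /high; rewrite ez /mix /= => l.
  have la : (g2 a).2 < H by rewrite (ge _ _ Eab); case: (Hb a).
  have lb : (g2 b).2 < H by rewrite (ge b a) 1?es //; case: (Hb b).
  have [m [mm [ma mb]]] : exists m, m < H /\ (g2 a).2 <= m /\ (g2 b).2 <= m.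
    exists (Num.max (g2 a).2 (g2 b).2); split; first by rewrite gt_max la.
    by split; rewrite le_max lexx ?orbT.
  exact: (@mix_gt F s _ _ m hs (lt_le_trans mm l) ma mb).
exists g2; split; last first.
  by move=> v h; rewrite /g2; case: ifP.
split=> //.
- move=> u v euv; have [iu|nu] := boolP (iso u); have [iv|nv] := boolP (iso v).
  + move: euv; rewrite /g2 iu iv => -[] /addrI /eqP; rewrite eqr_nat => /eqP h.
    by apply: enum_rank_inj; apply: val_inj.
  + by have := le_lt_trans (high u iu); rewrite euv => /(_ _ (low v nv)); rewrite ltxx.
  + by have := le_lt_trans (high v iv); rewrite -euv => /(_ _ (low u nu)); rewrite ltxx.
  + by move: euv; rewrite /g2 (negPf nu) (negPf nv) => /gi.
- move=> a b v Eab cz; have := seg a b v Eab cz; rewrite negbK => /existsP[w Evw].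
  move: cz; rewrite (ge _ _ Eab) (ge b a) 1?es // (ge _ _ Evw) => cz.
  have [[[-> _]|[-> _]]|n] := pselect ((v = a /\ w = b) \/ (v = b /\ w = a)); [by left|by right|].
  have [u [_ [h /gi ->]]] := gp v w a b Evw Eab n (g1 v) (cseg_l _ _) cz; exact: h.
- move=> a b c d z Eab Ecd; rewrite (ge _ _ Eab) (ge b a) 1?es // (ge _ _ Ecd) (ge d c) 1?es // => oz cz.
  apply: contrapT => n; have [u [h [_ ez]]] := gp a b c d Eab Ecd n z (oseg_cseg oz) cz.
  have nab : g1 a <> g1 b by move=> /gi e'; move: Eab; rewrite e' ei.
  have [n1 n2] := oseg_neq nab oz.
  by case: h => eu; subst u.
Qed.

Lemma separating_functional (T : finType) (D : T -> F * F) : injective D ->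
  exists k, k <> (0, 0) /\ injective (fun v => fn k (D v)).
Proof.
move=> Di; have n01 : ((0, 1) : F * F) <> (0, 0) by case; apply/eqP; exact: oner_neq0.
have [[u [v uv]]|nx] := pselect (exists u v : T, u <> v).
  have [k [_ ki]] := generic_fn Di n01.
  by exists k; split=> // k0; apply: uv; apply: ki; rewrite k0 /fn /= !mul0r.
by exists (0, 1); split=> // u v _; apply: contrapT => n; apply: nx; exists u, v.
Qed.

Theorem untangle (T : finType) (e : rel T) (S : {set T}) (G D : T -> F * F) (a b c : F) :
  (forall x y, e x y = e y x) -> (forall x, e x x = false) -> plane_dr e G ->
  a <> 0 \/ b <> 0 -> (forall v, v \in S -> a * (G v).1 + b * (G v).2 = c) -> injective D ->
  exists (D' : T -> F * F) (A : {set T}),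
    [/\ plane_dr e D', forall v, v \in A -> D' v = D v & (#|S| <= #|A| ^ 2)%N].
Proof.
move=> es ei Gp ab line Di.
have N : 0 < a * a + b * b by apply: (@sq_pos F (a, b)) => -[e1 e2]; case: ab.
(* A similarity that sends the line containing [S] to the vertical axis. *)
pose f1 z : F * F := (a * z.1 + b * z.2 - c, - b * z.1 + a * z.2).
have f1i : injective f1.
  have E1 w : (a * a + b * b) * w.1 = a * (f1 w).1 + a * c - b * (f1 w).2 by rewrite /f1 /=; ring.
  have E2 w : (a * a + b * b) * w.2 = b * (f1 w).1 + b * c + a * (f1 w).2 by rewrite /f1 /=; ring.
  by move=> z z' h; apply: pairP; apply: (mulfI (lt0r_neq0 N)); rewrite ?E1 ?E2 h.
have f1m s p q : f1 (mix s p q) = mix s (f1 p) (f1 q) by apply: pairP; rewrite /f1 /mix /=; ring.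
have [g2 [P2 ax]] := isolate es ei (plane_dr_affine f1i f1m Gp).
have axS v : v \in S -> (g2 v).1 = 0 by move=> /line h; apply: ax; rewrite /f1 /= h subrr.
have [B B0 Bb] := norm_bound g2.
(* A triangle around the square of half side [B], with [o] and [p] on the two sides of the axis and
   [r] on it, as the free axis requires; [64 * (B * B)] is twice its area. *)
pose P (k : 'I_3) : F * F := if k == 0 :> nat then (- 4 * B, - 2 * B) else if k == 1 :> nat then (4 * B, - 2 * B) else (0, 6 * B).
pose i0 : 'I_3 := @Ordinal 3 0 isT; pose i1 : 'I_3 := @Ordinal 3 1 isT; pose i2 : 'I_3 := @Ordinal 3 2 isT.
pose f (k : 'I_3) z := if k == 0 :> nat then orient (P i1) (P i2) z else if k == 1 :> nat then orient (P i2) (P i0) z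
  else orient (P i0) (P i1) z.
have BB : 0 < B * B by apply: mulr_gt0.
have D0 : 0 < 64 * (B * B) by slra.
have fM k s p q : f k (mix s p q) = (1 - s) * f k p + s * f k q.
  by rewrite /f; case: ifP => _; [|case: ifP => _]; rewrite mix_orient.
have fP k j : f k (P j) = (k == j)%:R * (64 * (B * B)).
  by case: k => [[|[|[|//]]]] ?; case: j => [[|[|[|//]]]] ?; rewrite /f /P /orient -(inj_eq val_inj) /=; ring.
have fg k v : 0 < f k (g2 v).
  have [h1 h2 h3 h4] := Bb v.
  have m1 := mulr_gt0 B0 (ltac:(slra) : 0 < B - (g2 v).1).
  have m2 := mulr_gt0 B0 (ltac:(slra) : 0 < (g2 v).1 + B).
  have m3 := mulr_gt0 B0 (ltac:(slra) : 0 < B - (g2 v).2).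
  have m4 := mulr_gt0 B0 (ltac:(slra) : 0 < (g2 v).2 + B).
  by case: k => [[|[|[|//]]]] ?; rewrite /f /P /orient /=; slra.
have [E [HE satE subE]] := maximal_plane (surround_plane P2 D0 fM fP fg).
pose V := (T + 'I_3)%type; pose o : V := inr i0; pose p : V := inr i1; pose r : V := inr i2.
pose g := gplus g2 P.
have inP v : inner o p r v -> exists w, v = inl w.
  by case: v => [w _|[[|[|[|//]]] h]]; [exists w|..].
have inT (w : T) : inner o p r (inl w) by [].
have fr : frame g E o p r.
  split.
  - by rewrite /g /= -[orient _ _ _]/(f i2 (P i2)) fP eqxx mul1r.
  - by split; apply: subE.
  - exact: subE.
  - move=> v /inP [w ->]; split; [exact: (fg i2 w)|exact: (fg i0 w)|exact: (fg i1 w)].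
have [k [k0 ki]] := separating_functional Di.
have K := sq_pos k0.
have [sg [A [sgE AS mono card]]] : exists (sg : F) (A : {set T}), [/\ sg = 1 \/ sg = -1, A \subset S,
    monotone_on (fun v => (g2 v).2) (fun v => fn k (D v)) sg A & (#|S| <= #|A| ^ 2)%N].
  apply: erdos_szekeres; last by move=> u v _ _; apply: ki.
  have [gi _ _ _ _] := P2.
  by move=> u v uS vS h; apply: gi; apply: pairP => //; rewrite !axS.
have sgK : sg * sg = 1 by case: sgE => ->; ring.
have [cf [cf_lt cfA]] : exists cf : F -> F, (forall s s', s < s' -> cf s < cf s') /\
    forall v, v \in A -> cf (g2 v).2 = sg * fn k (D v).
  apply: monotone_interpolation => // u v uA vA h; have [gi _ _ _ _] := P2.
  by apply: gi; apply: pairP => //; rewrite !axS //; apply: (subsetP AS).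
(* The coordinate of [D v] across [k], complementing [fn k]; the offset of the added corners is
   arbitrary. *)
pose d (v : V) : F := match v with inl v => k.2 * (D v).1 - k.1 * (D v).2 | inr _ => 0 end.
have xo : (g o).1 < 0 by rewrite /g /=; slra.
have xp : 0 < (g p).1 by rewrite /g /=; slra.
have xr : (g r).1 = 0 by [].
have [s [q [s0 qax qi qv qp]]] := free_axis cf_lt HE satE fr xo xp xr d.
(* Recovers [D v] from the offset [s * d v] and the height [sg * fn k (D v)]: it undoes the scaling
   by [s], the sign of the monotone set and the change to coordinates along and across [k]. *)
pose M z : F * F := ((k.2 * (z.1 / s) + k.1 * (sg * z.2)) / (k.1 * k.1 + k.2 * k.2),
  (- k.1 * (z.1 / s) + k.2 * (sg * z.2)) / (k.1 * k.1 + k.2 * k.2)).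
have K' := lt0r_neq0 K; have s0' := lt0r_neq0 s0.
have Mm t z z' : M (mix t z z') = mix t (M z) (M z').
  by apply: pairP; rewrite /M /mix /=; field; rewrite s0' K'.
have Mi : injective M.
  have E1 w : w.1 = s * (k.2 * (M w).1 - k.1 * (M w).2) by rewrite /M /=; field; rewrite s0' K'.
  have E2 w : w.2 = sg * (k.1 * (M w).1 + k.2 * (M w).2).
    rewrite (_ : sg * _ = sg * sg * w.2); first by rewrite sgK mul1r.
    by rewrite /M /=; field; rewrite s0' K'.
  by move=> z z' h; apply: pairP; [rewrite E1 (E1 z') h|rewrite E2 (E2 z') h].
exists (fun v => M (q (inl v))), A; split=> //.
- apply: (plane_dr_affine Mi Mm (D := fun v => q (inl v))); split.
    by move=> u v h; have [] := qi (inl u) (inl v) (inT u) (inT v) h.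
  move=> x y x' y' Exy Exy' n z cz cz'.
  have E1 : E (inl x) (inl y) by apply: subE.
  have E2 : E (inl x') (inl y') by apply: subE.
  have qinj u v : q (inl u) = q (inl v) -> u = v by move=> h; have [] := qi (inl u) (inl v) (inT u) (inT v) h.
  case: (cseg_oseg cz) => [e1|e1|oz]; case: (cseg_oseg cz') => [e2|e2|oz'].
  + by exists x; split; [left|split=> //; left; apply: qinj; rewrite -e1].
  + by exists x; split; [left|split=> //; right; apply: qinj; rewrite -e1].
  + by case: (qv (inl x') (inl y') (inl x) (inT _) (inT _) E2); rewrite -e1.
  + by exists y; split; [right|split=> //; left; apply: qinj; rewrite -e1].
  + by exists y; split; [right|split=> //; right; apply: qinj; rewrite -e1].
  + by case: (qv (inl x') (inl y') (inl y) (inT _) (inT _) E2); rewrite -e1.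
  + by case: (qv (inl x) (inl y) (inl x') (inT _) (inT _) E1); rewrite -e2.
  + by case: (qv (inl x) (inl y) (inl y') (inT _) (inT _) E1); rewrite -e2.
  + case: n; case: (qp (inl x) (inl y) (inl x') (inl y') z (inT _) (inT _) (inT _) (inT _) E1 E2 oz oz') => -[[h1] [h2]].
      by left.
    by right.
- move=> v vA; have vS := subsetP AS v vA.
  rewrite (qax (inl v) (axS v vS)) /M /=.
  rewrite cfA // !(mulrA sg sg) sgK mul1r; apply: pairP; rewrite /fn /=; field; rewrite s0' K' //.
Qed.

End Assembly.

(* The theorem over the real numbers *)
From Stdlib Require Import Reals.
Import Rstruct.
Open Scope R_scope.

Lemma on_segmentP (p q x : point) : on_segment p q x <-> @cseg R p q x.
Proof.
split=> [[t [[h1 h2] ->]]|[t [/andP[h1 h2] ->]]]; exists t; split=> //.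
  by apply/andP; split; apply/RleP.
by split; apply/RleP.
Qed.

Lemma plane_drawingP (T : finType) (e : rel T) (D : T -> point) : plane_drawing e D <-> @plane_dr R T e D.
Proof.
split=> -[Di Dp]; split=> // a b c d Eab Ecd n x h1 h2; apply: (Dp a b c d Eab Ecd n x); exact/on_segmentP.
Qed.

Theorem theorem3 :
  exists c : R, 0 < c /\
  forall (T : finType) (e : rel T) (S : {set T}),
    simple_graph e -> planar e -> collinear_set e S ->
    forall D : T -> point, straight_line_drawing D ->
      exists (D' : T -> point) (F : {set T}),
        plane_drawing e D' /\
        (forall v, v \in F -> D' v = D v) /\
        c * sqrt (INR #|S|) <= INR #|F|.
Proof.
(* The bound [#|S| <= #|A| ^ 2] gives the constant 1 after taking square roots. *)
exists 1; split; first exact: Rlt_0_1.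
move=> T e S [es ei] _ [G [Gp [a [b [c [ab line]]]]]] D Di.
have [D' [A [Dp fixA card]]] := @untangle R T e S G D a b c es ei (proj1 (plane_drawingP e G) Gp) ab line Di.
exists D', A; split; first exact/plane_drawingP; split=> //.
rewrite Rmult_1_l -(sqrt_Rsqr (INR #|A|)); last exact: pos_INR.
apply: sqrt_le_1_alt; rewrite /Rsqr -mult_INR; apply: le_INR; apply/ssrnat.leP.
by rewrite multE mulnn.
Qed.
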